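(* Let $\mu\in(0,1)$ and let $\omega_1\in H^1_\mu(\Omega)$ with $\omega_1=0$ on $S_2$. Let $\psi_1$ be a solution to the problem $$-\Delta\psi_1-\frac{2}{r}\psi_{1,r}=\omega_1\ \text{ in }\Omega,\qquad \psi_1=0\ \text{ on }S.$$ Then $$\|\psi_1-\psi_1(0)\|_{L_2(-a,a;H^3_\mu(0,R))}^2+\|\psi_{1,zzz}\|_{L_{2,\mu}(\Omega)}^2+\|\psi_{1,zzr}\|_{L_{2,\mu}(\Omega)}^2+2\mu(2-2\mu)\|\psi_{1,zz}\|_{L_{2,\mu-1}(\Omega)}^2\le c\,\|\omega_1\|_{H^1_\mu(\Omega)}^2,$$ where $\psi_1(0)=\psi_1|_{r=0}$ (a function of $z$) and $c$ is a constant independent of $\psi_1$ and $\omega_1$.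
   Context: Let $a,R>0$. $\Omega=\{x\in\mathbb{R}^3: r<R,\ |z|<a\}$ is a bounded cylinder in cylindrical coordinates $(r,\varphi,z)$, with boundary $S=S_1\cup S_2$, $S_1=\{r=R,\ |z|<a\}$, $S_2=\{r<R,\ z\in\{-a,a\}\}$. All functions are real-valued and axially symmetric, i.e. functions of $(r,z)$ only, so $\Omega$ is identified with $(0,R)\times(-a,a)$ and $dx=r\,dr\,dz$. Subscripts after a comma denote partial derivatives, and $\Delta=\partial_r^2+\frac1r\partial_r+\partial_z^2$. A solution of the boundary value problem is understood in the weak sense: $\psi_1\in H^1(\Omega)$ (i.e. $\psi_1,\psi_{1,r},\psi_{1,z}\in L_2$ with respect to $r\,dr\,dz$), $\psi_1$ has zero trace on $S$, and the equation holds in the sense of distributions in the open rectangle $(0,R)\times(-a,a)$. Weighted spaces: for $\mu\in\mathbb{R}$ and $k\in\{0,1,2,\dots\}$, $$\|u\|_{H^k_\mu(\Omega)}^2=\sum_{|\alpha|\le k}\int_\Omega|\partial_r^{\alpha_1}\partial_z^{\alpha_2}u|^2\,r^{2(\mu+|\alpha|-k)}\,r\,dr\,dz,\qquad L_{2,\mu}(\Omega)=H^0_\mu(\Omega),$$ where $|\alpha|=\alpha_1+\alpha_2$; for functions of $r\in(0,R)$, $$\|v\|_{H^k_\mu(0,R)}^2=\sum_{i=0}^k\int_0^R|\partial_r^i v|^2\,r^{2(\mu-k+i)}\,r\,dr.$$ $L_2(-a,a;X)$ denotes $X$-valued square-integrable functions of $z\in(-a,a)$. *)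

(* Defs.v *)
(* MathComp-Analysis; the reals are an arbitrary R : realType. *)
From HB Require Import structures.
From mathcomp Require Import all_boot all_order all_algebra.
From mathcomp Require Import all_classical all_reals all_analysis.

Set Implicit Arguments.
Unset Strict Implicit.
Unset Printing Implicit Defensive.

Import Order.TTheory GRing.Theory Num.Theory.
Import numFieldNormedType.Exports.

Local Open Scope classical_set_scope.
Local Open Scope ring_scope.

(* An axially symmetric function on the cylinder of radius rho and half-height
   a is a function u : R * R -> R of x = (r, z), r = x.1 and z = x.2. As usual
   the constant factor 2 pi of the angular integration is left out, so that
   the volume element is r dr dz. *)

Notation leb1 := lebesgue_measure.
Notation leb2 := (lebesgue_measure \x lebesgue_measure)%E.

(* The part dl < r of the cylinder; the whole cylinder is dl = 0. *)
Definition cyl {R : realType} (dl rho a : R) : set (R * R) :=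
  `]dl, rho[%classic `*` `](- a), a[%classic.

(* The classical partial derivative d^(i+j) f / dr^i dz^j. *)
Definition pder {R : realType} (i j : nat) (f : R * R -> R) : R * R -> R :=
  iter i (fun g x => 'D_((1, 0) : R * R) g x)
    (iter j (fun g x => 'D_((0, 1) : R * R) g x) f).

(* C^oo: if all these derivatives are (Frechet) differentiable then they are
   continuous, and mixed derivatives do not depend on the order. *)
Definition smooth {R : realType} (f : R * R -> R) : Prop :=
  forall i j x, differentiable (pder i j f) x.

Definition smooth1 {R : realType} (f : R -> R) : Prop :=
  forall n x, derivable (derive1n n f) x 1.

Definition supported_in {R : realType} {V : topologicalType} (D : set V)
    (f : V -> R) : Prop :=
  exists K, [/\ compact K, K `<=` D & forall x, ~ K x -> f x = 0].

Definition locL1 {R : realType} (D : set (R * R)) (u : R * R -> R) : Prop :=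
  measurable_fun D u /\
  forall K, K `<=` D -> compact K ->
    (\int[leb2]_(x in K) `|u x|%:E < +oo)%E.

(* g is a representative of the distributional derivative
   d^(i+j) u / dr^i dz^j on the open set D. *)
Definition weak_der {R : realType} (D : set (R * R)) (i j : nat)
    (u g : R * R -> R) : Prop :=
  [/\ locL1 D u, locL1 D g
    & forall phi, smooth phi -> supported_in D phi ->
        \int[leb2]_(x in D) (u x * pder i j phi x) =
        (-1) ^+ (i + j) * \int[leb2]_(x in D) (g x * phi x)].

Definition weak_der1 {R : realType} (D : set R) (i : nat)
    (v g : R -> R) : Prop :=
  [/\ locally_integrable D v, locally_integrable D g
    & forall phi, smooth1 phi -> supported_in D phi ->
        \int[leb1]_(r in D) (v r * derive1n i phi r) =
        (-1) ^+ i * \int[leb1]_(r in D) (g r * phi r)].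

(* Squared norm of d^(i+j) u / dr^i dz^j in L_{2,nu}(D), weight
   r^(2 nu) r dr dz. All representatives of the derivative agree a.e., so the
   infimum is over at most one value; it is +oo when the distributional
   derivative is not a locally integrable function. *)
Definition der_norm2 {R : realType} (D : set (R * R)) (nu : R) (i j : nat)
    (u : R * R -> R) : \bar R :=
  ereal_inf [set (\int[leb2]_(x in D)
                    ((g x) ^+ 2 * x.1 `^ (2 * nu) * x.1)%:E)%E
            | g in weak_der D i j u].

Definition der1_norm2 {R : realType} (D : set R) (nu : R) (i : nat)
    (v : R -> R) : \bar R :=
  ereal_inf [set (\int[leb1]_(r in D)
                    ((g r) ^+ 2 * r `^ (2 * nu) * r)%:E)%E
            | g in weak_der1 D i v].

(* Squared norm of H^k_mu(D). *)
Definition Hmu_norm2 {R : realType} (D : set (R * R)) (mu : R) (k : nat)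
    (u : R * R -> R) : \bar R :=
  (\sum_(i < k.+1) \sum_(j < k.+1 | (i + j <= k)%N)
     der_norm2 D (mu + (i + j)%:R - k%:R)%R i j u)%E.

(* Squared norm of H^k_mu(0, rho), for functions of r. *)
Definition Hmu1_norm2 {R : realType} (rho mu : R) (k : nat)
    (v : R -> R) : \bar R :=
  (\sum_(i < k.+1)
     der1_norm2 `]0%R, rho[%classic (mu - k%:R + i%:R)%R i v)%E.

(* Squared norm of L_2(-a, a; H^k_mu(0, rho)). *)
Definition L2Hmu1_norm2 {R : realType} (rho a mu : R) (k : nat)
    (u : R * R -> R) : \bar R :=
  (\int[leb1]_(z in `](- a)%R, a[%classic)
     Hmu1_norm2 rho mu k (fun r => u (r, z)))%E.

(* Squared norm of the unweighted space H^1, volume element r dr dz. *)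
Definition H1_norm2 {R : realType} (D : set (R * R)) (u : R * R -> R) : \bar R :=
  (\sum_(i < 2) \sum_(j < 2 | (i + j <= 1)%N) der_norm2 D 0%R i j u)%E.

(* Squared L_2 norms on the lateral surface S_1 and on the part dl < r of the
   two bases S_2, with respect to surface measure. *)
Definition S1_norm2 {R : realType} (rho a : R) (f : R * R -> R) : \bar R :=
  (\int[leb1]_(z in `](- a)%R, a[%classic) ((f (rho, z)) ^+ 2 * rho)%:E)%E.

Definition S2_norm2 {R : realType} (dl rho a : R) (f : R * R -> R) : \bar R :=
  (\int[leb1]_(r in `]dl, rho[%classic)
     (((f (r, - a)) ^+ 2 + (f (r, a)) ^+ 2) * r)%:E)%E.

(* g is the trace of u on the boundary piece whose squared L_2 norm is N: the
   limit of the restrictions of functions smooth up to the boundary that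
   converge to u in H^1(D). *)
Definition has_trace {R : realType} (D : set (R * R))
    (N : (R * R -> R) -> \bar R) (u g : R * R -> R) : Prop :=
  exists f : nat -> R * R -> R,
    [/\ forall n, smooth (f n),
        H1_norm2 D (fun x => f n x - u x) @[n --> \oo] --> 0%E
      & N (fun x => f n x - g x) @[n --> \oo] --> 0%E].

Definition zero_on_S {R : realType} (rho a : R) (u : R * R -> R) : Prop :=
  has_trace (cyl 0 rho a)
    (fun f => S1_norm2 rho a f + S2_norm2 0 rho a f)%E u (fun=> 0).

(* The weights of H^1_mu degenerate only on the axis: a function of H^1_mu is
   in H^1 of each part dl < r, dl > 0, of the cylinder (but not of the whole
   cylinder in general), and its trace on S_2 is taken there. *)
Definition zero_on_S2 {R : realType} (rho a : R) (u : R * R -> R) : Prop :=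
  forall dl, 0 < dl < rho ->
    has_trace (cyl dl rho a) (S2_norm2 dl rho a) u (fun=> 0).

(* - Delta psi - (2/r) psi_r = omega in the sense of distributions in the open
   rectangle, where Delta psi = psi_rr + (1/r) psi_r + psi_zz. *)
Definition distr_eq {R : realType} (D : set (R * R))
    (omega psi : R * R -> R) : Prop :=
  exists2 psi_r, weak_der D 1 0 psi psi_r &
    forall phi, smooth phi -> supported_in D phi ->
      - (\int[leb2]_(x in D) (psi x * pder 2 0 phi x))
      - (\int[leb2]_(x in D) (x.1^-1 * psi_r x * phi x))
      - (\int[leb2]_(x in D) (psi x * pder 0 2 phi x))
      - (\int[leb2]_(x in D) (2 / x.1 * psi_r x * phi x))
      = \int[leb2]_(x in D) (omega x * phi x).

Definition weak_solution {R : realType} (rho a : R)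
    (omega psi : R * R -> R) : Prop :=
  [/\ (H1_norm2 (cyl 0 rho a) psi < +oo)%E,
      zero_on_S rho a psi
    & distr_eq (cyl 0 rho a) omega psi].

(* psi0 is the restriction of psi to the axis r = 0: for a.e. z, psi0 z is the
   essential limit of psi (r, z) as r -> 0+ (psi is only defined up to a null
   set). This determines psi0 a.e. *)
Definition axis_value {R : realType} (a : R) (psi : R * R -> R)
    (psi0 : R -> R) : Prop :=
  measurable_fun `](- a), a[%classic psi0 /\
  {ae leb1, forall z, - a < z < a -> forall e, 0 < e ->
     exists2 d, 0 < d &
       {ae leb1, forall r, 0 < r < d -> `|psi (r, z) - psi0 z| <= e}}.

(* Main.v *)
(* Expand psi_r, psi and omega, for fixed r, in the sines
   sn_n(z) = sin (k_n (z + a)), k_n = freq a n, with coefficients u_n, p_n, w_n.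
   The equation gives r^3 u_n = int_0^r s^3 (k_n^2 p_n - w_n) ds, the solution
   with r^3 u_n -> const <> 0 being excluded by psi_r in L_2, and p_n = - int_r^rho u_n
   by the condition on S_1. A weighted energy estimate for this pair controls
   k_n^2 u_n and k_n^3 p_n by k_n w_n in L_2 (r^(2 mu + 1) dr). Since omega
   vanishes on S_2, the k_n w_n are the cosine coefficients of omega_z, so by
   Bessel's inequality the series of psi_zz, psi_rzz and psi_zzz converge.
   Now r^3 psi_r = - int_0^r s^3 h ds with h = omega + psi_zz on almost every
   line z = const. Hardy's inequality at the axis bounds psi - psi(0) and its
   radial derivatives by h and h_r, and the dual Hardy inequality, applied to
   psi_zz = - int_r^rho psi_rzz ds, bounds psi_zz with the weight of index mu - 1. *)

Require Import Defs.
From HB Require Import structures.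
From mathcomp Require Import all_boot all_order all_algebra.
From mathcomp Require Import all_classical all_reals all_analysis.
From mathcomp Require Import measurable_realfun.
From mathcomp Require Import ring lra.
Set Implicit Arguments.
Unset Strict Implicit.
Unset Printing Implicit Defensive.
Import Order.TTheory GRing.Theory Num.Theory.
Import numFieldNormedType.Exports.
Local Open Scope classical_set_scope.
Local Open Scope ring_scope.

(** * Integration on rectangles *)

(** The operator is r^-3 d_r (r^3 d_r) + d_z^2: r^3 is an integrating factor and r^-2 the singular
    radial solution. The obstacle is that all data are weak. Test functions vanish near the whole
    boundary, axis included, and the boundary conditions are given only by approximating sequences.
    So a sine must be cut off in z before it can be tested with; this costs nothing in the limit,
    because it vanishes linearly where the cutoff is steep. The boundary conditions are converted
    once into identities on almost every line: differentiation in z multiplies the coefficients by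
    k_n, and [psi] is minus the integral of its r-derivative up to r = rho. As [omega] has no
    condition on S_1, it is recovered from its r-derivative only up to a function of z, which
    differentiation in r removes. The range 0 < mu < 1 makes the term left over in the energy
    identity nonnegative; mu < 1 keeps the Hardy exponents at least 3, and mu > 0 makes the dual
    Hardy constant mu^-2 finite. The final constant 1556 + 780 mu^-2 depends on mu alone, and the
    factor 2 mu (2 - 2 mu) enters by its bound 4. *)

Section almost_everywhere_rules.
Context {d} {T : measurableType d} {R : realType} {mu : {measure set T -> \bar R}}.
Implicit Types P Q S : T -> Prop.

Lemma aeW P : (forall x, P x) -> {ae mu, forall x, P x}.
Proof. by move=> h; exact: nearW. Qed.

Lemma ae_imp P Q : (forall x, P x -> Q x) ->
  {ae mu, forall x, P x} -> {ae mu, forall x, Q x}.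
Proof. by move=> PQ; apply: filterS. Qed.

Lemma ae_imp2 P Q S : (forall x, P x -> Q x -> S x) ->
  {ae mu, forall x, P x} -> {ae mu, forall x, Q x} -> {ae mu, forall x, S x}.
Proof. by move=> PQ; apply: filterS2. Qed.

Lemma ae_imp3 P Q S U : (forall x, P x -> Q x -> S x -> U x) ->
  {ae mu, forall x, P x} -> {ae mu, forall x, Q x} -> {ae mu, forall x, S x} ->
  {ae mu, forall x, U x}.
Proof. by move=> PQ; apply: filterS3. Qed.

End almost_everywhere_rules.

Section integral_monotonicity.
Context {d} {T : measurableType d} {R : realType} (mu : {measure set T -> \bar R}).
Local Open Scope ereal_scope.

(** The integral of a nonnegative function is the supremum over the simple functions below it, and
    this family grows with the function, measurable or not. *)
Lemma le_integral_nomeas (D : set T) (f g : T -> \bar R) :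
  (forall x, D x -> 0 <= f x <= g x) ->
  \int[mu]_(x in D) f x <= \int[mu]_(x in D) g x.
Proof.
move=> fg; rewrite integral_mkcond [leRHS]integral_mkcond.
have h x : 0 <= (f \_ D) x <= (g \_ D) x.
  by rewrite !patchE; case: ifPn => [xD|_]; [exact/fg/set_mem|rewrite lexx].
rewrite !ge0_integralTE; last 2 first.
  by move=> x; have /andP[] := h x; exact: le_trans.
  by move=> x; have /andP[] := h x.
apply: ereal_sup_le => _ /= [k kf <-]; exists k => // x.
by apply: le_trans (kf x) _; have /andP[] := h x.
Qed.

(** On a measurable null set [N] containing the exceptional points the larger function is replaced
    by +oo. This changes neither its measurability nor its integral, and the inequality then holds
    everywhere. The smaller function will be the norm of a slice z = const, an infimum over weak
    derivatives whose measurability in z is not established. *)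
Lemma ae_le_integral_nomeas (D : set T) (f g : T -> \bar R) :
  measurable D -> measurable_fun D g ->
  (forall x, D x -> 0 <= f x) -> (forall x, D x -> 0 <= g x) ->
  {ae mu, forall x, D x -> f x <= g x} ->
  \int[mu]_(x in D) f x <= \int[mu]_(x in D) g x.
Proof.
move=> mD mg f0 g0 [N [mN N0 sN]].
pose g' x := if x \in N then +oo else g x.
have mg' : measurable_fun D g'.
  apply: measurable_fun_if => //.
    by apply: (@measurable_fun_bool _ _ _ _ true); rewrite preimage_mem_true; exact: measurableI.
  apply: measurable_funS mg => //.
rewrite (@ge0_ae_eq_integral _ _ _ mu D g g') //.
- apply: le_integral_nomeas => x Dx; rewrite f0//= /g'.
  case: ifPn => [_|/negP xN]; first by rewrite leey.
  apply: contrapT => h; apply: xN; apply/mem_set/sN => /= h2; exact/h/h2.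
- move=> x Dx; rewrite /g'; case: ifP => // _; exact: g0.
- exists N; split => // x /= h; apply: contrapT => xN; apply: h => Dx.
  by rewrite /g' memNset.
Qed.

Lemma cauchy_schwarz_integral (D : set T) (f g : T -> R) :
  measurable D -> measurable_fun D f -> measurable_fun D g ->
  (\int[mu]_(x in D) `|(f x * g x)%:E|) ^+ 2 <=
  (\int[mu]_(x in D) ((f x) ^+ 2)%:E) * (\int[mu]_(x in D) ((g x) ^+ 2)%:E).
Proof.
move=> mD mf mg.
have mf' := (measurable_restrictT f mD).1 mf.
have mg' := (measurable_restrictT g mD).1 mg.
have sqE (x : \bar R) : 0 <= x -> x `^ 2 = x * x.
  move=> x0; rewrite (_ : 2%R = (1 + 1)%R)//.
  by rewrite poweRD ?poweRe1// add_neq0_poweRD_def// pnatr_eq0.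
have N2 (h : T -> R) : ('N[mu]_2%:E[EFin \o (h \_ D)]) `^ 2 = \int[mu]_(x in D) ((h x) ^+ 2)%:E.
  rewrite poweR_Lnorm ?pnatr_eq0// [RHS]integral_mkcond; apply: eq_integral => x _.
  rewrite sqE// !patchE /= patchE; case: ifPn => xD.
    by rewrite -EFinM -normrM ger0_norm -expr2// sqr_ge0.
  by rewrite -[LHS]/(`|0|%:E * `|0|%:E) normr0 mule0.
have := hoelder mu mf' mg' (p:=2) (q:=2).
rewrite !ltr0n => /(_ erefl erefl).
have -> : (2^-1 + 2^-1 = 1 :> R)%R by rewrite [RHS](splitr 1) div1r.
move=> /(_ erefl); rewrite Lnorm1 => h.
have -> : \int[mu]_(x in D) `|(f x * g x)%:E| =
  \int[mu]_x `|(EFin \o (f \_ D \* g \_ D)%R) x|.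
  rewrite [LHS]integral_mkcond; apply: eq_integral => x _.
  by rewrite /= !patchE; case: ifPn; rewrite ?mul0r ?normr0.
rewrite expe2 -N2 -N2 -poweRM ?Lnorm_ge0// -sqE; last exact: integral_ge0.
by apply: gt0_ler_poweR => //; rewrite ?in_itv/= ?leey ?andbT//;
  [exact: integral_ge0|rewrite mule_ge0// Lnorm_ge0].
Qed.

End integral_monotonicity.

Section rectangles.
Context {d1 d2} {T1 : measurableType d1} {T2 : measurableType d2} {R : realType}.
Variables (m1 : {sigma_finite_measure set T1 -> \bar R}).
Variables (m2 : {sigma_finite_measure set T2 -> \bar R}).
Implicit Types (A : set T1) (B : set T2).

Lemma measurable_fun_slice1 d (U : measurableType d) A B (F : T1 * T2 -> U) (x : T1) :
  measurable A -> measurable B -> A x ->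
  measurable_fun (A `*` B) F -> measurable_fun B (fun y => F (x, y)).
Proof.
move=> mA mB Ax mF.
apply: (@measurable_comp _ _ _ _ _ _ (A `*` B) F B (fun y => (x, y))) => //.
- exact: measurableX.
- by move=> _ [y By <-].
- exact/measurable_funTS/pair1_measurable.
Qed.

Lemma measurable_fun_slice2 d (U : measurableType d) A B (F : T1 * T2 -> U) (y : T2) :
  measurable A -> measurable B -> B y ->
  measurable_fun (A `*` B) F -> measurable_fun A (fun x => F (x, y)).
Proof.
move=> mA mB Ay mF.
apply: (@measurable_comp _ _ _ _ _ _ (A `*` B) F A (fun x => (x, y))) => //.
- exact: measurableX.
- by move=> _ [x Bx <-].
- exact/measurable_funTS/pair2_measurable.
Qed.

Local Open Scope ereal_scope.

Lemma patchX A B (F : T1 * T2 -> \bar R) x y :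
  (F \_ (A `*` B)) (x, y) = ((fun x => ((fun y => F (x, y)) \_ B) y) \_ A) x.
Proof.
rewrite !patchE; have [xA|xA] := boolP (x \in A); have [yB|yB] := boolP (y \in B).
- by rewrite mem_set//=; split => /=; exact: set_mem.
- by rewrite memNset// => -[/= _ /mem_set]; apply/negP.
- by rewrite memNset// => -[/= /mem_set + _]; apply/negP.
- by rewrite memNset// => -[/= /mem_set + _]; apply/negP.
Qed.

Lemma fubini_F_rect A B (F : T1 * T2 -> \bar R) :
  fubini_F m2 (F \_ (A `*` B)) = (fun x => \int[m2]_(y in B) F (x, y)) \_ A.
Proof.
apply/funext => x; rewrite /fubini_F patchE; case: ifPn => xA.
  rewrite [RHS]integral_mkcond; apply: eq_integral => y _.
  by rewrite patchX patchE xA.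
by apply: integral0_eq => y _; rewrite patchX patchE (negbTE xA).
Qed.

Lemma fubini_G_rect A B (F : T1 * T2 -> \bar R) :
  fubini_G m1 (F \_ (A `*` B)) = (fun y => \int[m1]_(x in A) F (x, y)) \_ B.
Proof.
apply/funext => y; rewrite /fubini_G patchE; case: ifPn => yB.
  rewrite [RHS]integral_mkcond; apply: eq_integral => x _.
  by rewrite patchX !patchE yB.
by apply: integral0_eq => x _; rewrite patchX !patchE (negbTE yB); case: ifP.
Qed.

Section tonelli.
Variables (A : set T1) (B : set T2) (F : T1 * T2 -> \bar R).
Hypotheses (mA : measurable A) (mB : measurable B).
Hypothesis mF : measurable_fun (A `*` B) F.
Hypothesis F0 : forall x, (A `*` B) x -> 0 <= F x.

Let mAB : measurable (A `*` B). Proof. exact: measurableX. Qed.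
Let mF' : measurable_fun setT (F \_ (A `*` B)).
Proof. exact/(measurable_restrictT _ mAB). Qed.
Let F0' x : 0 <= (F \_ (A `*` B)) x.
Proof. by apply: erestrict_ge0. Qed.

Lemma tonelli_rect1 : \int[(m1 \x m2)]_(x in A `*` B) F x =
  \int[m1]_(x in A) \int[m2]_(y in B) F (x, y).
Proof.
by rewrite integral_mkcond (fubini_tonelli1 _ mF' F0') fubini_F_rect -integral_mkcond.
Qed.

Lemma tonelli_rect2 : \int[(m1 \x m2)]_(x in A `*` B) F x =
  \int[m2]_(y in B) \int[m1]_(x in A) F (x, y).
Proof.
by rewrite integral_mkcond (fubini_tonelli2 _ mF' F0') fubini_G_rect -integral_mkcond.
Qed.

Lemma measurable_tonelli1 :
  measurable_fun A (fun x => \int[m2]_(y in B) F (x, y)).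
Proof.
apply/(measurable_restrictT _ mA); rewrite -fubini_F_rect.
exact: measurable_fun_fubini_tonelli_F.
Qed.

Lemma measurable_tonelli2 :
  measurable_fun B (fun y => \int[m1]_(x in A) F (x, y)).
Proof.
apply/(measurable_restrictT _ mB); rewrite -fubini_G_rect.
exact: measurable_fun_fubini_tonelli_G.
Qed.

End tonelli.

Section fubini.
Variables (A : set T1) (B : set T2) (F : T1 * T2 -> R).
Hypotheses (mA : measurable A) (mB : measurable B).
Hypothesis iF : (m1 \x m2).-integrable (A `*` B) (EFin \o F).

Let mAB : measurable (A `*` B). Proof. exact: measurableX. Qed.
Let iF' : (m1 \x m2).-integrable setT ((EFin \o F) \_ (A `*` B)).
Proof. exact: (integrable_mkcond (EFin \o F) mAB).1 iF. Qed.

Lemma ae_integrable_rect1 :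
  {ae m1, forall x, A x -> m2.-integrable B (fun y => (F (x, y))%:E)}.
Proof.
have := ae_integrable1 iF'; apply: filterS => x /= h Ax.
apply/integrable_mkcond => //; apply: eq_integrable h => // y _.
by rewrite patchX patchE mem_set.
Qed.

Lemma ae_integrable_rect2 :
  {ae m2, forall y, B y -> m1.-integrable A (fun x => (F (x, y))%:E)}.
Proof.
have := ae_integrable2 iF'; apply: filterS => y /= h By.
apply/integrable_mkcond => //; apply: eq_integrable h => // x _.
by rewrite patchX !patchE (mem_set By).
Qed.

Lemma fubini_rect1_fin : {ae m1, forall x, A x ->
  (\int[m2]_(y in B) F (x, y))%R%:E = \int[m2]_(y in B) (F (x, y))%:E}.
Proof.
have := ae_integrable_rect1; apply: filterS => x h Ax.
by rewrite /Rintegral fineK//; apply: integrable_fin_num => //; exact: h.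
Qed.

Lemma fubini_rect2_fin : {ae m2, forall y, B y ->
  (\int[m1]_(x in A) F (x, y))%R%:E = \int[m1]_(x in A) (F (x, y))%:E}.
Proof.
have := ae_integrable_rect2; apply: filterS => x h Ax.
by rewrite /Rintegral fineK//; apply: integrable_fin_num => //; exact: h.
Qed.

Lemma measurable_fubini_rect1 :
  measurable_fun A (fun x => \int[m2]_(y in B) F (x, y))%R.
Proof.
apply: measurableT_comp => //.
have := measurable_fubini_F iF'; rewrite fubini_F_rect.
by move/(measurable_restrictT _ mA).
Qed.

Lemma measurable_fubini_rect2 :
  measurable_fun B (fun y => \int[m1]_(x in A) F (x, y))%R.
Proof.
apply: measurableT_comp => //.
have := measurable_fubini_G iF'; rewrite fubini_G_rect.
by move/(measurable_restrictT _ mB).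
Qed.

Lemma integrable_fubini_rect1 :
  m1.-integrable A (fun x => (\int[m2]_(y in B) F (x, y))%R%:E).
Proof.
apply/integrableP; split; first exact/measurable_EFinP/measurable_fubini_rect1.
have mF : measurable_fun (A `*` B) (fun x => `|(F x)%:E|).
  by apply: measurableT_comp => //; exact: measurable_int iF.
have /integrableP[_] := iF; rewrite tonelli_rect1//.
apply: le_lt_trans; apply: ae_ge0_le_integral => //.
- by apply: measurableT_comp => //; exact/measurable_EFinP/measurable_fubini_rect1.
- by move=> x _; exact: integral_ge0.
- exact: (@measurable_tonelli1 _ _ (fun x => `|(F x)%:E|)).
- apply: filterS2 fubini_rect1_fin ae_integrable_rect1 => x + + Ax => /(_ Ax) -> /(_ Ax) h.
  by apply: le_abse_integral => //; exact: measurable_int h.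
Qed.

Lemma integrable_fubini_rect2 :
  m2.-integrable B (fun y => (\int[m1]_(x in A) F (x, y))%R%:E).
Proof.
apply/integrableP; split; first exact/measurable_EFinP/measurable_fubini_rect2.
have mF : measurable_fun (A `*` B) (fun x => `|(F x)%:E|).
  by apply: measurableT_comp => //; exact: measurable_int iF.
have /integrableP[_] := iF; rewrite tonelli_rect2//.
apply: le_lt_trans; apply: ae_ge0_le_integral => //.
- by apply: measurableT_comp => //; exact/measurable_EFinP/measurable_fubini_rect2.
- by move=> x _; exact: integral_ge0.
- exact: (@measurable_tonelli2 _ _ (fun x => `|(F x)%:E|)).
- apply: filterS2 fubini_rect2_fin ae_integrable_rect2 => x + + Ax => /(_ Ax) -> /(_ Ax) h.
  by apply: le_abse_integral => //; exact: measurable_int h.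
Qed.

Lemma fubini_rect1 : (\int[(m1 \x m2)]_(x in A `*` B) F x =
  \int[m1]_(x in A) \int[m2]_(y in B) F (x, y))%R.
Proof.
rewrite /Rintegral; congr fine; rewrite -[LHS]/(\int[m1 \x m2]_(x in A `*` B) (EFin \o F) x).
etransitivity; first exact: integral_mkcond.
etransitivity; first exact/esym/(integral12_prod_meas1 iF').
rewrite fubini_F_rect -integral_mkcond.
have := measurable_fubini_F iF'; rewrite fubini_F_rect.
move/(measurable_restrictT _ mA) => mG.
apply: ae_eq_integral => //.
  by apply/measurable_EFinP; exact: measurable_fubini_rect1.
by apply: filterS fubini_rect1_fin => x h Ax; rewrite /= -h.
Qed.

Lemma fubini_rect2 : (\int[(m1 \x m2)]_(x in A `*` B) F x =
  \int[m2]_(y in B) \int[m1]_(x in A) F (x, y))%R.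
Proof.
rewrite /Rintegral; congr fine; rewrite -[LHS]/(\int[m1 \x m2]_(x in A `*` B) (EFin \o F) x).
etransitivity; first exact: integral_mkcond.
etransitivity; first exact/esym/(integral21_prod_meas1 iF').
rewrite fubini_G_rect -integral_mkcond.
have := measurable_fubini_G iF'; rewrite fubini_G_rect.
move/(measurable_restrictT _ mB) => mG.
apply: ae_eq_integral => //.
  by apply/measurable_EFinP; exact: measurable_fubini_rect2.
by apply: filterS fubini_rect2_fin => x h Ax; rewrite /= -h.
Qed.

End fubini.
End rectangles.

Section lebesgue_rectangles.
Context {R : realType}.
Notation mu := (@lebesgue_measure R).
Variables A B : set R.
Hypotheses (mA : measurable A) (mB : measurable B).
Local Notation T := (measurableTypeR R).

Section nonneg.
Local Open Scope ereal_scope.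
Variable F : R * R -> \bar R.
Hypothesis mF : measurable_fun (A `*` B) F.
Hypothesis F0 : forall x, (A `*` B) x -> 0 <= F x.

Lemma leb_tonelli1 : \int[leb2]_(x in A `*` B) F x =
  \int[mu]_(x in A) \int[mu]_(y in B) F (x, y).
Proof. exact: (@tonelli_rect1 _ _ T T R mu mu A B F mA mB mF F0). Qed.

Lemma leb_tonelli2 : \int[leb2]_(x in A `*` B) F x =
  \int[mu]_(y in B) \int[mu]_(x in A) F (x, y).
Proof. exact: (@tonelli_rect2 _ _ T T R mu mu A B F mA mB mF F0). Qed.

Lemma leb_measurable_tonelli1 :
  measurable_fun A (fun x => \int[mu]_(y in B) F (x, y)).
Proof. exact: (@measurable_tonelli1 _ _ T T R mu A B F mA mB mF F0). Qed.

Lemma leb_measurable_tonelli2 :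
  measurable_fun B (fun y => \int[mu]_(x in A) F (x, y)).
Proof. exact: (@measurable_tonelli2 _ _ T T R mu A B F mA mB mF F0). Qed.

End nonneg.

Section integrable.
Variable F : R * R -> R.
Hypothesis iF : leb2.-integrable (A `*` B) (EFin \o F).

Lemma leb_ae_integrable1 :
  {ae mu, forall x, A x -> mu.-integrable B (fun y => (F (x, y))%:E)}.
Proof. exact: (@ae_integrable_rect1 _ _ T T R mu mu A B F mA mB iF). Qed.

Lemma leb_ae_integrable2 :
  {ae mu, forall y, B y -> mu.-integrable A (fun x => (F (x, y))%:E)}.
Proof. exact: (@ae_integrable_rect2 _ _ T T R mu mu A B F mA mB iF). Qed.

Lemma leb_integrable_fubini1 :
  mu.-integrable A (fun x => (\int[mu]_(y in B) F (x, y))%:E).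
Proof. exact: (@integrable_fubini_rect1 _ _ T T R mu mu A B F mA mB iF). Qed.

Lemma leb_integrable_fubini2 :
  mu.-integrable B (fun y => (\int[mu]_(x in A) F (x, y))%:E).
Proof. exact: (@integrable_fubini_rect2 _ _ T T R mu mu A B F mA mB iF). Qed.

Lemma leb_fubini1 : \int[leb2]_(x in A `*` B) F x =
  \int[mu]_(x in A) \int[mu]_(y in B) F (x, y).
Proof. exact: (@fubini_rect1 _ _ T T R mu mu A B F mA mB iF). Qed.

Lemma leb_fubini2 : \int[leb2]_(x in A `*` B) F x =
  \int[mu]_(y in B) \int[mu]_(x in A) F (x, y).
Proof. exact: (@fubini_rect2 _ _ T T R mu mu A B F mA mB iF). Qed.

End integrable.
End lebesgue_rectangles.

Section tensor.
Context {d1 d2} {T1 : measurableType d1} {T2 : measurableType d2} {R : realType}.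
Variables (m1 : {sigma_finite_measure set T1 -> \bar R}).
Variables (m2 : {sigma_finite_measure set T2 -> \bar R}).

Lemma measurable_tensor (A : set T1) (B : set T2) (f : T1 -> R) (g : T2 -> R) :
  measurable A -> measurable B -> measurable_fun A f -> measurable_fun B g ->
  measurable_fun (A `*` B) (fun x => f x.1 * g x.2).
Proof.
move=> mA mB mf mg; apply: measurable_funM.
- apply: (@measurable_comp _ _ _ _ _ _ A f _ fst) => //.
    by move=> _ [[x y] [/= Ax _] <-].
  by apply: measurable_funTS; exact: measurable_fst.
- apply: (@measurable_comp _ _ _ _ _ _ B g _ snd) => //.
    by move=> _ [[x y] [/= _ By] <-].
  by apply: measurable_funTS; exact: measurable_snd.
Qed.

Lemma integrable_tensor (A : set T1) (B : set T2) (f : T1 -> R) (g : T2 -> R) :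
  measurable A -> measurable B ->
  m1.-integrable A (EFin \o f) -> m2.-integrable B (EFin \o g) ->
  (m1 \x m2)%E.-integrable (A `*` B) (fun x => (f x.1 * g x.2)%:E).
Proof.
move=> mA mB /integrableP[/measurable_EFinP mf fi] /integrableP[/measurable_EFinP mg gi].
have mfg := measurable_tensor mA mB mf mg.
apply/integrableP; split; first exact/measurable_EFinP.
rewrite tonelli_rect1//; last by do 2 apply: measurableT_comp => //.
under eq_integral => x _ do under eq_integral => y _ do rewrite /= normrM EFinM.
have mg' : measurable_fun B (fun y => `|(g y)%:E|%E).
  by do 2 apply: measurableT_comp => //.
rewrite (eq_integral (fun x => `|(f x)%:E| * \int[m2]_(y in B) `|(g y)%:E|)%E).
  rewrite ge0_integralZr//; last 2 first.
  - by do 2 apply: measurableT_comp => //.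
  - exact: integral_ge0.
  apply: lte_mul_pinfty => //; first exact: integral_ge0.
  by rewrite ge0_fin_numE//; exact: integral_ge0.
by move=> x _; rewrite ge0_integralZl.
Qed.

End tensor.

(** * Rules for integrals of real functions *)

Section real_integrable.
Context {d} {T : measurableType d} {R : realType} {m : {measure set T -> \bar R}}.
Implicit Types (D : set T) (f g : T -> R).

Lemma intZ D c f : m.-integrable D (EFin \o f) -> measurable D ->
  m.-integrable D (EFin \o (fun x => c * f x)).
Proof. by move=> fi mD; exact: (integrableZl mD c fi). Qed.

Lemma intD D f g : m.-integrable D (EFin \o f) -> m.-integrable D (EFin \o g) ->
  measurable D -> m.-integrable D (EFin \o (fun x => f x + g x)).
Proof. by move=> fi gi mD; exact: (integrableD mD fi gi). Qed.

Lemma intB D f g : m.-integrable D (EFin \o f) -> m.-integrable D (EFin \o g) ->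
  measurable D -> m.-integrable D (EFin \o (fun x => f x - g x)).
Proof. by move=> fi gi mD; exact: (integrableB mD fi gi). Qed.

Lemma int_sum D I (s : seq I) (f : I -> T -> R) :
  (forall i, m.-integrable D (EFin \o f i)) -> measurable D ->
  m.-integrable D (EFin \o (fun x => \sum_(i <- s) f i x)).
Proof.
move=> fi mD.
have := @integrable_sum _ _ _ m _ mD I s xpredT (fun i => EFin \o f i) (fun i _ => fi i).
by apply: eq_integrable => // x _ /=; rewrite sumEFin.
Qed.

Lemma int_eq D f g : (forall x, D x -> f x = g x) ->
  m.-integrable D (EFin \o f) -> measurable D -> m.-integrable D (EFin \o g).
Proof.
by move=> fg fi mD; apply: eq_integrable fi => // x /set_mem /fg /= ->.
Qed.

Lemma int_measurable D f : m.-integrable D (EFin \o f) -> measurable_fun D f.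
Proof. by move=> /integrableP[/measurable_EFinP]. Qed.

Lemma int_le D f g : m.-integrable D (EFin \o g) -> measurable D -> measurable_fun D f ->
  (forall x, D x -> `|f x| <= g x) -> m.-integrable D (EFin \o f).
Proof.
move=> gi mD mf fg; apply: le_integrable gi => //; first exact/measurable_EFinP.
by move=> x Dx; rewrite /= lee_fin (le_trans (fg _ Dx))// ler_norm.
Qed.

Lemma RintZ D c f : m.-integrable D (EFin \o f) -> measurable D ->
  \int[m]_(x in D) (c * f x) = c * \int[m]_(x in D) f x.
Proof. by move=> fi mD; rewrite RintegralZl. Qed.

Lemma Rint_sum D I (s : seq I) (f : I -> T -> R) :
  (forall i, m.-integrable D (EFin \o f i)) -> measurable D ->
  \int[m]_(x in D) (\sum_(i <- s) f i x) = \sum_(i <- s) \int[m]_(x in D) f i x.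
Proof.
move=> fi mD; elim: s => [|i s ih].
  rewrite big_nil /Rintegral; under eq_integral do rewrite big_nil.
  by rewrite integral0.
rewrite big_cons -ih -RintegralD//; last exact: int_sum.
by apply: eq_Rintegral => x _; rewrite big_cons.
Qed.

Lemma dct D (F : nat -> T -> R) f g : measurable D ->
  (forall n, measurable_fun D (F n)) -> measurable_fun D f ->
  m.-integrable D (EFin \o g) -> (forall n x, D x -> `|F n x| <= g x) ->
  {ae m, forall x, D x -> F n x @[n --> \oo] --> f x} ->
  \int[m]_(x in D) F n x @[n --> \oo] --> \int[m]_(x in D) f x.
Proof.
move=> mD mF mf gi Fg Ff.
have [] := @dominated_convergence _ _ _ m D mD (fun n => EFin \o F n) (EFin \o f) (EFin \o g).
- by move=> n; exact/measurable_EFinP.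
- exact/measurable_EFinP.
- by apply: filterS Ff => x h /h{}h; apply: cvg_EFin; [exact: nearW|exact: h].
- exact: gi.
- by apply: nearW => x n Dx; rewrite /= lee_fin Fg.
move=> fi _ h; apply: fine_cvg; rewrite fineK//.
exact: integrable_fin_num.
Qed.

End real_integrable.


Section lebesgue_integrable1.
Context {R : realType}.
Notation mu := (@lebesgue_measure R).
Implicit Types (D : set R) (f g : R -> R).
Local Notation T := (measurableTypeR R).

Lemma lint1Z D c f : mu.-integrable D (EFin \o f) -> measurable D ->
  mu.-integrable D (EFin \o (fun x => c * f x)).
Proof. exact: (@intZ _ T R mu D c f). Qed.

Lemma lint1D D f g : mu.-integrable D (EFin \o f) -> mu.-integrable D (EFin \o g) ->
  measurable D -> mu.-integrable D (EFin \o (fun x => f x + g x)).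
Proof. exact: (@intD _ T R mu D f g). Qed.

Lemma lint1B D f g : mu.-integrable D (EFin \o f) -> mu.-integrable D (EFin \o g) ->
  measurable D -> mu.-integrable D (EFin \o (fun x => f x - g x)).
Proof. exact: (@intB _ T R mu D f g). Qed.

Lemma lint1_eq D f g : (forall x, D x -> f x = g x) ->
  mu.-integrable D (EFin \o f) -> measurable D -> mu.-integrable D (EFin \o g).
Proof. exact: (@int_eq _ T R mu D f g). Qed.

Lemma lint1_measurable D f : mu.-integrable D (EFin \o f) -> measurable_fun D f.
Proof. exact: (@int_measurable _ T R mu D f). Qed.

Lemma lint1_le D f g : mu.-integrable D (EFin \o g) -> measurable D -> measurable_fun D f ->
  (forall x, D x -> `|f x| <= g x) -> mu.-integrable D (EFin \o f).
Proof. exact: (@int_le _ T R mu D f g). Qed.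

Lemma lint1_sub D E f : mu.-integrable D (EFin \o f) -> measurable D -> measurable E ->
  E `<=` D -> mu.-integrable E (EFin \o f).
Proof. by move=> fi mD mE ED; exact: (@integrableS _ T R mu D E (EFin \o f)). Qed.

Lemma lint1_norm D f : mu.-integrable D (EFin \o f) ->
  mu.-integrable D (EFin \o (fun x => `|f x|)).
Proof. exact: (@integrable_norm _ T R mu D f). Qed.

Lemma lRint1Z D c f : mu.-integrable D (EFin \o f) -> measurable D ->
  \int[mu]_(x in D) (c * f x) = c * \int[mu]_(x in D) f x.
Proof. exact: (@RintZ _ T R mu D c f). Qed.

Lemma lRint1D D f g : mu.-integrable D (EFin \o f) -> mu.-integrable D (EFin \o g) ->
  measurable D ->
  \int[mu]_(x in D) (f x + g x) = \int[mu]_(x in D) f x + \int[mu]_(x in D) g x.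
Proof. by move=> fi gi mD; exact: (@RintegralD _ T R mu D f g). Qed.

Lemma lRint1B D f g : mu.-integrable D (EFin \o f) -> mu.-integrable D (EFin \o g) ->
  measurable D ->
  \int[mu]_(x in D) (f x - g x) = \int[mu]_(x in D) f x - \int[mu]_(x in D) g x.
Proof. by move=> fi gi mD; exact: (@RintegralB _ T R mu D f g). Qed.

Lemma lRint1_sum D I (s : seq I) (f : I -> R -> R) :
  (forall i, mu.-integrable D (EFin \o f i)) -> measurable D ->
  \int[mu]_(x in D) (\sum_(i <- s) f i x) = \sum_(i <- s) \int[mu]_(x in D) f i x.
Proof. exact: (@Rint_sum _ T R mu D I s f). Qed.

Lemma lRint1_eq D f g : (forall x, D x -> f x = g x) ->
  \int[mu]_(x in D) f x = \int[mu]_(x in D) g x.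
Proof. by move=> fg; apply: eq_Rintegral => x /set_mem /fg. Qed.

Lemma lRint1_le D f g : mu.-integrable D (EFin \o f) -> mu.-integrable D (EFin \o g) ->
  measurable D -> (forall x, D x -> f x <= g x) ->
  \int[mu]_(x in D) f x <= \int[mu]_(x in D) g x.
Proof. by move=> fi gi mD; exact: (@le_Rintegral _ T R mu D f g). Qed.

Lemma lRint1_norm D f : mu.-integrable D (EFin \o f) -> measurable D ->
  `|\int[mu]_(x in D) f x| <= \int[mu]_(x in D) `|f x|.
Proof. by move=> fi mD; exact: (@le_normr_Rintegral _ T R mu D f). Qed.

Lemma lRint1_dct D (F : nat -> R -> R) f g : measurable D ->
  (forall n, measurable_fun D (F n)) -> measurable_fun D f ->
  mu.-integrable D (EFin \o g) -> (forall n x, D x -> `|F n x| <= g x) ->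
  {ae mu, forall x, D x -> F n x @[n --> \oo] --> f x} ->
  \int[mu]_(x in D) F n x @[n --> \oo] --> \int[mu]_(x in D) f x.
Proof. exact: (@dct _ T R mu D F f g). Qed.

End lebesgue_integrable1.

Section lebesgue_integrable2.
Context {R : realType}.
Notation mu := (@lebesgue_measure R \x @lebesgue_measure R)%E.
Implicit Types (D : set (R * R)) (f g : (R * R) -> R).
Local Notation T := (measurableTypeR R * measurableTypeR R)%type.

Lemma lint2Z D c f : mu.-integrable D (EFin \o f) -> measurable D ->
  mu.-integrable D (EFin \o (fun x => c * f x)).
Proof. exact: (@intZ _ T R mu D c f). Qed.

Lemma lint2D D f g : mu.-integrable D (EFin \o f) -> mu.-integrable D (EFin \o g) ->
  measurable D -> mu.-integrable D (EFin \o (fun x => f x + g x)).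
Proof. exact: (@intD _ T R mu D f g). Qed.

Lemma lint2B D f g : mu.-integrable D (EFin \o f) -> mu.-integrable D (EFin \o g) ->
  measurable D -> mu.-integrable D (EFin \o (fun x => f x - g x)).
Proof. exact: (@intB _ T R mu D f g). Qed.

Lemma lint2_eq D f g : (forall x, D x -> f x = g x) ->
  mu.-integrable D (EFin \o f) -> measurable D -> mu.-integrable D (EFin \o g).
Proof. exact: (@int_eq _ T R mu D f g). Qed.

Lemma lint2_measurable D f : mu.-integrable D (EFin \o f) -> measurable_fun D f.
Proof. exact: (@int_measurable _ T R mu D f). Qed.

Lemma lint2_le D f g : mu.-integrable D (EFin \o g) -> measurable D -> measurable_fun D f ->
  (forall x, D x -> `|f x| <= g x) -> mu.-integrable D (EFin \o f).
Proof. exact: (@int_le _ T R mu D f g). Qed.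

Lemma lint2_sub D E f : mu.-integrable D (EFin \o f) -> measurable D -> measurable E ->
  E `<=` D -> mu.-integrable E (EFin \o f).
Proof. by move=> fi mD mE ED; exact: (@integrableS _ T R mu D E (EFin \o f)). Qed.

Lemma lint2_norm D f : mu.-integrable D (EFin \o f) ->
  mu.-integrable D (EFin \o (fun x => `|f x|)).
Proof. exact: (@integrable_norm _ T R mu D f). Qed.

Lemma lRint2Z D c f : mu.-integrable D (EFin \o f) -> measurable D ->
  \int[mu]_(x in D) (c * f x) = c * \int[mu]_(x in D) f x.
Proof. exact: (@RintZ _ T R mu D c f). Qed.

Lemma lRint2D D f g : mu.-integrable D (EFin \o f) -> mu.-integrable D (EFin \o g) ->
  measurable D ->
  \int[mu]_(x in D) (f x + g x) = \int[mu]_(x in D) f x + \int[mu]_(x in D) g x.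
Proof. by move=> fi gi mD; exact: (@RintegralD _ T R mu D f g). Qed.

Lemma lRint2B D f g : mu.-integrable D (EFin \o f) -> mu.-integrable D (EFin \o g) ->
  measurable D ->
  \int[mu]_(x in D) (f x - g x) = \int[mu]_(x in D) f x - \int[mu]_(x in D) g x.
Proof. by move=> fi gi mD; exact: (@RintegralB _ T R mu D f g). Qed.

Lemma lRint2_eq D f g : (forall x, D x -> f x = g x) ->
  \int[mu]_(x in D) f x = \int[mu]_(x in D) g x.
Proof. by move=> fg; apply: eq_Rintegral => x /set_mem /fg. Qed.

Lemma lRint2_le D f g : mu.-integrable D (EFin \o f) -> mu.-integrable D (EFin \o g) ->
  measurable D -> (forall x, D x -> f x <= g x) ->
  \int[mu]_(x in D) f x <= \int[mu]_(x in D) g x.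
Proof. by move=> fi gi mD; exact: (@le_Rintegral _ T R mu D f g). Qed.

Lemma lRint2_norm D f : mu.-integrable D (EFin \o f) -> measurable D ->
  `|\int[mu]_(x in D) f x| <= \int[mu]_(x in D) `|f x|.
Proof. by move=> fi mD; exact: (@le_normr_Rintegral _ T R mu D f). Qed.

Lemma lRint2_dct D (F : nat -> (R * R) -> R) f g : measurable D ->
  (forall n, measurable_fun D (F n)) -> measurable_fun D f ->
  mu.-integrable D (EFin \o g) -> (forall n x, D x -> `|F n x| <= g x) ->
  {ae mu, forall x, D x -> F n x @[n --> \oo] --> f x} ->
  \int[mu]_(x in D) F n x @[n --> \oo] --> \int[mu]_(x in D) f x.
Proof. exact: (@dct _ T R mu D F f g). Qed.

End lebesgue_integrable2.

Lemma continuous_bigsum {R : realType} I (s : seq I) (f : I -> R -> R) :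
  (forall i, continuous (f i)) -> continuous (fun x => \sum_(i <- s) f i x).
Proof.
move=> cf; elim: s => [|i s ih].
  by under eq_fun do rewrite big_nil; move=> x; exact: cvg_cst.
under eq_fun do rewrite big_cons; move=> x.
exact: (cvgD (@cf i x) (@ih x)).
Qed.

(** * Absolutely continuous functions *)

Section absolutely_continuous_calculus.
Context {R : realType}.
Notation mu := (@lebesgue_measure R).
Notation "'I_ x y f" := (\int[mu]_(t in `]x, y[%classic) f t)
  (at level 10, x at level 8, y at level 8, f at level 8).
Implicit Types (p q x y z : R) (f g a b : R -> R).

Lemma itvoo_subset x y p q : p <= x -> y <= q -> `]x, y[%classic `<=` `]p, q[%classic.
Proof. by move=> px yq; apply: subset_itv; rewrite bnd_simp. Qed.

Lemma integrable_sub_itv p q x y f : p <= x -> y <= q ->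
  mu.-integrable `]p, q[ (EFin \o f) -> mu.-integrable `]x, y[ (EFin \o f).
Proof. by move=> px yq; apply: integrableS => //; exact: itvoo_subset. Qed.

Lemma Rintegral_itv_cat f x y z : x <= y -> y <= z ->
  mu.-integrable `]x, z[ (EFin \o f) ->
  \int[mu]_(t in `]x, z[) f t = \int[mu]_(t in `]x, y[) f t + \int[mu]_(t in `]y, z[) f t.
Proof.
move=> xy; rewrite le_eqVlt => /predU1P[<-|yz] fi.
  by rewrite [X in _ + X]/Rintegral set_itvoo0 integral_set0 addr0.
have := @Rintegral_itvB R f (BRight x) (BLeft z) y fi.
rewrite !bnd_simp => /(_ xy yz) <-.
rewrite -Rintegral_itv_bndo_bndc; last by apply: integrable_sub_itv fi => //; exact: ltW.
by rewrite addrC subrK.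
Qed.

(** Absolute continuity encoded by the fundamental theorem of calculus, with the derivative [g] as
    part of the data. The end points belong to the range of validity, so boundary values of [f] can
    be read off. *)
Definition abs_cont p q f g := mu.-integrable `]p, q[ (EFin \o g) /\
  forall x y, p <= x -> x <= y -> y <= q -> f y - f x = \int[mu]_(t in `]x, y[) g t.

Lemma AC_sub p q x y f g : p <= x -> y <= q -> abs_cont p q f g -> abs_cont x y f g.
Proof.
move=> px yq [gi fg]; split; first exact: integrable_sub_itv gi.
by move=> s t xs st ty; apply: fg => //; [exact: le_trans xs|exact: le_trans yq].
Qed.

Lemma AC_ext p q f g f' g' : {in `[p, q], f =1 f'} -> {in `]p, q[, g =1 g'} ->
  abs_cont p q f g -> abs_cont p q f' g'.
Proof.
move=> ff' gg' [gi fg]; split.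
  by apply: eq_integrable gi => // x; rewrite inE => xpq /=; rewrite gg'.
move=> x y px xy yq; rewrite -!ff' ?in_itv/= ?px ?yq ?(le_trans px xy) ?(le_trans xy yq)//.
rewrite fg//; apply: eq_Rintegral => t; rewrite inE/= => txy; apply: gg'.
by have := itvoo_subset px yq txy.
Qed.

Lemma AC_D p q f g f' g' : abs_cont p q f g -> abs_cont p q f' g' ->
  abs_cont p q (fun x => f x + f' x) (fun x => g x + g' x).
Proof.
move=> [gi fg] [gi' fg']; split; first exact: (integrableD _ gi gi').
move=> x y px xy yq; rewrite RintegralD//; [|exact: integrable_sub_itv gi..|exact: integrable_sub_itv gi'].
by rewrite -fg// -fg'//; ring.
Qed.

Lemma AC_Z p q f g (c : R) : abs_cont p q f g -> abs_cont p q (fun x => c * f x) (fun x => c * g x).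
Proof.
move=> [gi fg]; split; first exact: (integrableZl _ c gi).
move=> x y px xy yq; rewrite RintegralZl//; last exact: integrable_sub_itv gi.
by rewrite -fg//; ring.
Qed.

Lemma AC_cst p q (c : R) : abs_cont p q (fun=> c) (fun=> 0).
Proof.
split; first exact: integrable0.
by move=> x y _ _ _; rewrite subrr /Rintegral integral0.
Qed.

Lemma AC_Rintegral p q g : mu.-integrable `]p, q[ (EFin \o g) ->
  abs_cont p q (fun x => \int[mu]_(t in `]p, x[) g t) g.
Proof.
move=> gi; split => // x y px xy yq.
rewrite (@Rintegral_itv_cat g p x y)//; last exact: integrable_sub_itv gi.
by rewrite addrC addKr.
Qed.

Lemma AC_Rintegral_right p q g : mu.-integrable `]p, q[ (EFin \o g) ->
  abs_cont p q (fun x => - \int[mu]_(t in `]x, q[) g t) g.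
Proof.
move=> gi; split => // x y px xy yq.
rewrite (@Rintegral_itv_cat g x y q)//; last exact: integrable_sub_itv gi.
by ring.
Qed.

Lemma AC_continuous p q f g : p <= q -> abs_cont p q f g -> {within `[p, q], continuous f}.
Proof.
move=> pq [gi fg].
have gi' : mu.-integrable `[p, q] (EFin \o g).
  have /integrableP[mg ig] := gi; apply/integrableP; split.
    exact: emeasurable_fun_itv_cc mg.
  rewrite (@integral_itv_bndoo _ _ _ _ true false)//.
  exact: measurableT_comp.
have fE x : p <= x -> x <= q -> f x = f p + parameterized_integral mu p x g.
  move=> px xq; rewrite -[f x](subrK (f p)) fg// addrC; congr (_ + _).
  rewrite /parameterized_integral /Rintegral (@integral_itv_bndoo _ _ _ _ true false)//.
  exact: measurable_int (integrable_sub_itv (lexx _) xq gi).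
have /subspace_continuousP cp := parameterized_integral_continuous pq gi'.
apply/subspace_continuousP => x xpq.
have /andP[px xq] : p <= x <= q by move: xpq; rewrite /= in_itv.
have cpx : parameterized_integral mu p z g @[z --> within `[p, q]%classic (nbhs x)] -->
    parameterized_integral mu p x g by exact: cp.
suff : f z @[z --> within `[p, q]%classic (nbhs x)] --> f x by [].
rewrite (fE x)//; apply: (@cvg_trans _ ((fun z => f p + parameterized_integral mu p z g)
    @ within `[p, q]%classic (nbhs x))); last first.
  by apply: cvgD; [exact: cvg_cst|exact: cpx].
apply: near_eq_cvg; rewrite near_withinE; near=> z => /=.
by rewrite in_itv/= => /andP[pz zq]; rewrite (fE z).
Unshelve. all: by end_near. Qed.

Lemma integrable_continuousM p q f g : {within `[p, q], continuous f} ->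
  mu.-integrable `]p, q[ (EFin \o g) -> mu.-integrable `]p, q[ (fun x => (f x * g x)%:E).
Proof.
move=> cf gi.
have sub : `]p, q[%classic `<=` `[p, q]%classic by exact: subset_itv_oo_cc.
have mf : measurable_fun `]p, q[ f.
  apply: (@measurable_funS _ _ _ _ `[p, q]%classic) => //.
  exact: subspace_continuous_measurable_fun.
have bf : [bounded f x | x in `]p, q[%classic].
  have /compact_bounded[M [Mr hM]] : compact (f @` `[p, q]%classic).
    by apply: continuous_compact => //; exact: segment_compact.
  exists M; split => // N MN x /= xpq; apply: (hM _ MN).
  by exists x => //; exact: sub.
exact: (@integrableMr _ (measurableTypeR R) R mu _ _ f _ mf bf gi).
Qed.

Lemma integrable_continuous p q f : {within `[p, q], continuous f} ->
  mu.-integrable `]p, q[ (EFin \o f).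
Proof.
move=> cf; apply: (@integrableS _ _ _ mu `[p, q]%classic) => //.
  exact: subset_itv_oo_cc.
by apply: continuous_compact_integrable => //; exact: segment_compact.
Qed.

Lemma AC_C1 p q f g : (forall x, p <= x <= q -> is_derive x 1 f (g x)) ->
  {within `[p, q], continuous g} -> abs_cont p q f g.
Proof.
move=> fg cg; split; first exact: integrable_continuous.
move=> x y px; rewrite le_eqVlt => /predU1P[->|xy] yq.
  by rewrite subrr /Rintegral set_itvoo0 integral_set0.
have sub : `[x, y]%classic `<=` `[p, q]%classic by apply: subset_itv; rewrite bnd_simp.
have cg' : {within `[x, y], continuous g} by exact: continuous_subspaceW cg.
have dxy z : z \in `]x, y[ -> is_derive z 1 f (g z).
  rewrite in_itv/= => /andP[xz zy]; apply: fg.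
  by rewrite (le_trans px (ltW xz)) (le_trans (ltW zy) yq).
have cf z : z \in `[x, y] -> {for z, continuous f}.
  rewrite in_itv/= => /andP[xz zy]; apply/differentiable_continuous/derivable1_diffP.
  by have [] := fg z; rewrite // (le_trans px xz) (le_trans zy yq).
have := @continuous_FTC2 R g f x y xy cg'.
rewrite /Rintegral -(@integral_itv_bndoo R x y (EFin \o g) true false); last first.
  apply/measurable_EFinP; apply: (@measurable_funS _ _ _ _ `[x, y]%classic) => //.
    exact: subset_itv_oo_cc.
  exact: subspace_continuous_measurable_fun.
move=> -> //.
- split; first by move=> z /dxy [].
  + by apply: cvg_at_right_filter; apply: cf; rewrite in_itv/= lexx ltW.
  + by apply: cvg_at_left_filter; apply: cf; rewrite in_itv/= lexx ltW.
- by move=> z /dxy h; rewrite derive1E derive_val.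
Qed.

(** Fubini on the triangle x < t < s < y. This symmetry is what makes the double integrals in the
    product rule cancel. *)
Lemma Rintegral_triangle x y a b :
  mu.-integrable `]x, y[ (EFin \o a) -> mu.-integrable `]x, y[ (EFin \o b) ->
  \int[mu]_(s in `]x, y[) (a s * \int[mu]_(t in `]x, s[) b t) =
  \int[mu]_(t in `]x, y[) (b t * \int[mu]_(s in `]t, y[) a s).
Proof.
move=> ai bi.
pose H (u : R * R) := if u.2 < u.1 then a u.1 * b u.2 else 0.
have iH : leb2.-integrable (`]x, y[ `*` `]x, y[) (EFin \o H).
  have iab : leb2.-integrable (`]x, y[ `*` `]x, y[) (fun u : R * R => (a u.1 * b u.2)%:E).
    exact: (integrable_tensor _ _ ai bi).
  have /integrableP[/measurable_EFinP mab _] := iab.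
  apply: le_integrable iab => //; first exact: measurableX.
    apply/measurable_EFinP; apply: measurable_fun_if => //; first exact: measurableX.
    - apply: measurable_fun_ltr => //; first exact: (measurable_funTS measurable_snd).
      exact: (measurable_funTS measurable_fst).
    - by apply: measurable_funS mab => //; exact: measurableX.
  move=> u _; rewrite /H /=; case: ifP => // _.
  by rewrite normr0 lee_fin.
have E1 := leb_fubini1 (measurable_itv _) (measurable_itv _) iH.
have E2 := leb_fubini2 (measurable_itv _) (measurable_itv _) iH.
have {E1 E2} := etrans (esym E2) E1.
have -> : \int[mu]_(s in `]x, y[) \int[mu]_(t in `]x, y[) H (s, t) =
  \int[mu]_(s in `]x, y[) (a s * \int[mu]_(t in `]x, s[) b t).
  apply: eq_Rintegral => s; rewrite inE/= in_itv/= => /andP[xs sy].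
  rewrite -RintegralZl//; last by apply: integrable_sub_itv bi => //; exact: ltW.
  rewrite [RHS]Rintegral_mkcond [LHS]Rintegral_mkcond; apply: eq_Rintegral => t _.
  rewrite !patchE !mem_setE !in_itv/= /H/=.
  case: (ltP x t) => //= xt; case: (ltP t s) => //= ts; first by rewrite (lt_trans ts sy).
  by case: ifP.
move=> <-; apply: eq_Rintegral => t; rewrite inE/= in_itv/= => /andP[xt ty].
rewrite -RintegralZl//; last by apply: integrable_sub_itv ai => //; exact: ltW.
rewrite [RHS]Rintegral_mkcond [LHS]Rintegral_mkcond; apply: eq_Rintegral => s _.
rewrite !patchE !mem_setE !in_itv/= /H/=.
case: (ltP t s) => //= ts; first by rewrite (lt_trans xt ts) mulrC.
by case: ifP.
Qed.

Lemma AC_M p q f g f' g' : p <= q -> abs_cont p q f f' -> abs_cont p q g g' ->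
  abs_cont p q (fun x => f x * g x) (fun x => f' x * g x + f x * g' x).
Proof.
move=> pq acf acg.
have i1 : mu.-integrable `]p, q[ (EFin \o (fun x => f' x * g x)).
  have := integrable_continuousM (AC_continuous pq acg) acf.1.
  by apply: eq_integrable => // x _ /=; rewrite mulrC.
have i2 : mu.-integrable `]p, q[ (EFin \o (fun x => f x * g' x)).
  exact: integrable_continuousM (AC_continuous pq acf) acg.1.
split; first exact: (integrableD _ i1 i2).
move=> x y px xy yq.
have fi := integrable_sub_itv px yq acf.1; have gi := integrable_sub_itv px yq acg.1.
have j1 := integrable_sub_itv px yq i1; have j2 := integrable_sub_itv px yq i2.
rewrite RintegralD//.
(* Write [g s] as [g x] plus the integral of [g'] over []x, s[], and in [E2] write [f s] as [f y]
   minus the integral of [f'] over []s, y[]. Expanding from opposite ends makes the remainders the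
   two sides of [Rintegral_triangle], with opposite signs. *)
have E1 : \int[mu]_(s in `]x, y[) (f' s * g s) =
   g x * (f y - f x) + \int[mu]_(s in `]x, y[) (f' s * \int[mu]_(t in `]x, s[) g' t).
  have -> : \int[mu]_(s in `]x, y[) (f' s * \int[mu]_(t in `]x, s[) g' t) =
    \int[mu]_(s in `]x, y[) (f' s * g s - g x * f' s).
    apply: eq_Rintegral => s; rewrite inE/= in_itv/= => /andP[xs sy].
    by rewrite -(acg.2 x s)//; [ring|exact: ltW|rewrite (le_trans _ yq)// ltW].
  rewrite RintegralB//; last exact: (integrableZl _ (g x) fi).
  by rewrite RintegralZl// -(acf.2 x y)//; ring.
have E2 : \int[mu]_(s in `]x, y[) (f s * g' s) =
   f y * (g y - g x) - \int[mu]_(t in `]x, y[) (g' t * \int[mu]_(s in `]t, y[) f' s).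
  have -> : \int[mu]_(t in `]x, y[) (g' t * \int[mu]_(s in `]t, y[) f' s) =
    \int[mu]_(s in `]x, y[) (f y * g' s - f s * g' s).
    apply: eq_Rintegral => s; rewrite inE/= in_itv/= => /andP[xs sy].
    by rewrite -(acf.2 s y)//; [ring|rewrite (le_trans px)// ltW|exact: ltW].
  rewrite RintegralB//; last exact: (integrableZl _ (f y) gi).
  by rewrite RintegralZl// -(acg.2 x y)//; ring.
by rewrite E1 E2 Rintegral_triangle//; ring.
Qed.

End absolutely_continuous_calculus.

Section integral_misc.
Context {R : realType}.
Notation mu := (@lebesgue_measure R).
Implicit Types (p q x y z : R) (f g : R -> R).

Lemma integrable_of_sqr p q f : measurable_fun `]p, q[ f ->
  mu.-integrable `]p, q[ (fun x => ((f x) ^+ 2)%:E) -> mu.-integrable `]p, q[ (EFin \o f).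
Proof.
move=> mf fi.
have i0 : mu.-integrable `]p, q[ (EFin \o cst (1 : R)).
  by apply: integrable_continuous => x; exact: cst_continuous.
have i1 : mu.-integrable `]p, q[ (EFin \o (fun x => (f x) ^+ 2 + 1)).
  exact: (lint1D (f := fun x : R => f x ^+ 2) (g := cst 1) fi i0).
apply: le_integrable i1 => //; first exact/measurable_EFinP.
move=> x _ /=; rewrite lee_fin [leRHS]ger0_norm ?addr_ge0 ?sqr_ge0//.
rewrite -subr_ge0 -[f x ^+ 2]real_normK ?num_real//.
have := sqr_ge0 (`|f x| - 2^-1); nra.
Qed.

(** Lebesgue differentiation applied to the extension of [f] by zero: its primitive is constant on
    []p, q[], because the part of the integral beyond each point of the interval vanishes. *)
Lemma ae_eq0_of_primitive0 p q f : mu.-integrable `]p, q[ (EFin \o f) ->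
  (forall x, p < x < q -> \int[mu]_(t in `]x, q[) f t = 0) ->
  {ae mu, forall x, p < x < q -> f x = 0}.
Proof.
move=> fi f0.
have [pq|qp] := ltP p q; last first.
  by apply: nearW => x /andP[px xq]; have := lt_trans px xq; rewrite ltNge qp.
pose g := f \_ `]p, q[%classic.
have gi : mu.-integrable setT (EFin \o g).
  rewrite -restrict_EFin.
  exact: ((@integrable_mkcond _ (measurableTypeR R) R mu `]p, q[ (EFin \o f) (measurable_itv _)).1 fi).
have giS (A : set R) : measurable A -> mu.-integrable A (EFin \o g).
  by move=> mA; apply: integrableS gi.
have /= FTC := @FTC1 R g -oo%O (fun y => giS _ (measurable_itv _)) (open_integrable_locally openT gi).
apply: ae_imp FTC => x /(_ (ltNyr _)) [_ gx] /andP[px xq].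
suff : g x = 0 by rewrite /g patchE mem_set//= in_itv/= px xq.
rewrite -gx derive1E.
pose c := \int[mu]_(t in `]p, q[) f t.
have gE y : p < y < q -> \int[mu]_(t in `]-oo, y]) g t = c.
  move=> /andP[py yq].
  rewrite -[RHS](subr0 c) -(f0 y) ?py// /c (@Rintegral_itv_cat _ f p y q) ?ltW// addrK.
  rewrite -Rintegral_itv_bndo_bndc; last exact: giS.
  rewrite [LHS]Rintegral_mkcond [RHS]Rintegral_mkcond; apply: eq_Rintegral => t _.
  rewrite /g !patchE !mem_setE !in_itv/= andbC; case: ltP => ty; rewrite ?andbT ?andbF//.
  by rewrite (lt_trans ty yq).
rewrite (@near_eq_derive _ _ _ _ (cst c) x 1) ?derive_cst//.
have xpq : x \in `]p, q[ by rewrite in_itv/= px.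
near=> y; apply: gE; suff : y \in `]p, q[ by rewrite in_itv.
by near: y; exact: near_in_itvoo.
Unshelve. all: by end_near. Qed.

End integral_misc.

(** * Sine series *)

Section orthogonal_family.
Context {R : realType}.
Notation mu := (@lebesgue_measure R).
Variables (a : R) (e : nat -> R -> R).
Hypotheses (a0 : 0 < a) (ce : forall n, continuous (e n)).
Hypothesis orth : forall m n,
  \int[mu]_(z in `](- a), a[) (e m z * e n z) = a * (m == n)%:R.
Notation J := (`](- a), a[%classic : set R).

Let iee m n : mu.-integrable J (EFin \o (fun z => e m z * e n z)).
Proof. by apply: integrable_continuous => //; apply: continuous_subspaceT => x; apply: cvgM; exact: ce. Qed.

Lemma orth_sum_mul (s : seq nat) (b : nat -> R) m : m \notin s ->
  \int[mu]_(z in J) (e m z * \sum_(n <- s) b n * e n z) = 0.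
Proof.
move=> ms.
under eq_Rintegral do rewrite mulr_sumr.
rewrite lRint1_sum//; last first.
  by move=> n; apply: lint1_eq (lint1Z (b n) (iee m n) _) _ => // z _; ring.
rewrite big_seq big1// => n ns.
rewrite (_ : (fun x => _) = (fun z => b n * (e m z * e n z))); last by apply/funext => z; ring.
rewrite (lRint1Z _ (iee m n))// orth; case: eqP ms => [->|_ _]; first by rewrite ns.
by rewrite !mulr0.
Qed.

Lemma orth_sum_sqr (s : seq nat) (b : nat -> R) : uniq s ->
  \int[mu]_(z in J) ((\sum_(n <- s) b n * e n z) ^+ 2) = a * \sum_(n <- s) b n ^+ 2.
Proof.
elim: s => [_|m s ih /= /andP[ms us]].
  rewrite big_nil mulr0; under eq_Rintegral do rewrite big_nil expr0n.
  by rewrite /Rintegral integral0.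
have cS : continuous (fun z => \sum_(n <- s) b n * e n z).
  by apply: continuous_bigsum => n z; apply: cvgM; [exact: cvg_cst|exact: ce].
rewrite big_cons mulrDr -ih//.
transitivity (\int[mu]_(z in J) ((b m ^+ 2 * (e m z * e m z) +
   2 * b m * (e m z * \sum_(n <- s) b n * e n z)) + (\sum_(n <- s) b n * e n z) ^+ 2)).
  by apply: eq_Rintegral => z _; rewrite big_cons; ring.
have i1 : mu.-integrable J (EFin \o (fun z => e m z * \sum_(n <- s) b n * e n z)).
  by apply: integrable_continuous => //; apply: continuous_subspaceT => x; apply: cvgM; [exact: ce|exact: cS].
rewrite lRint1D//; last 2 first.
  by apply: lint1D => //; [exact: (lint1Z _ (iee m m))|exact: (lint1Z _ i1)].
  by apply: integrable_continuous => //; apply: continuous_subspaceT => x; rewrite /=; apply: cvgM; exact: cS.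
rewrite lRint1D//; [|exact: (lint1Z _ (iee m m))|exact: (lint1Z _ i1)].
by rewrite (lRint1Z _ (iee m m))// (lRint1Z _ i1)// orth_sum_mul// orth eqxx mulr1; ring.
Qed.

(** The mean square of [G - S] is nonnegative for the partial sum [S]; the factors [a] and [a^-1]
    come from the squared norm [a] of each [e n]. *)
Lemma bessel (N : nat) (G : R -> R) : measurable_fun J G ->
  mu.-integrable J (fun z => ((G z) ^+ 2)%:E) ->
  a * \sum_(0 <= n < N) (a^-1 * \int[mu]_(z in J) (G z * e n z)) ^+ 2
    <= \int[mu]_(z in J) ((G z) ^+ 2).
Proof.
move=> mG G2; have Gi := integrable_of_sqr mG G2.
set b := fun n => a^-1 * \int[mu]_(z in J) (G z * e n z).
have Ge n : mu.-integrable J (EFin \o (fun z => G z * e n z)).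
  have := @integrable_continuousM R (- a) a (e n) G (continuous_subspaceT (@ce n)) Gi.
  by apply: eq_integrable => // z _ /=; rewrite mulrC.
pose S z := \sum_(0 <= n < N) b n * e n z.
have cS : continuous S.
  by apply: continuous_bigsum => n z; apply: cvgM; [exact: cvg_cst|exact: ce].
have iS2 : mu.-integrable J (EFin \o (fun z => S z ^+ 2)).
  by apply: integrable_continuous => //; apply: continuous_subspaceT => x; rewrite /=; apply: cvgM; exact: cS.
have iGS : mu.-integrable J (EFin \o (fun z => G z * S z)).
  have := @integrable_continuousM R (- a) a S G (continuous_subspaceT cS) Gi.
  by apply: eq_integrable => // z _ /=; rewrite mulrC.
have GS : \int[mu]_(z in J) (G z * S z) = a * \sum_(0 <= n < N) b n ^+ 2.
  under eq_Rintegral do rewrite mulr_sumr.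
  rewrite lRint1_sum//; last first.
    by move=> n; apply: lint1_eq (lint1Z (b n) (Ge n) _) _ => // z _; ring.
  rewrite mulr_sumr; apply: eq_bigr => n _.
  rewrite (_ : (fun x => _) = (fun z => b n * (G z * e n z))); last by apply/funext => z; ring.
  rewrite (lRint1Z _ (Ge n))// (_ : \int[mu]_(x in J) (G x * e n x) = a * b n); first by ring.
  by rewrite /b mulVKf// gt_eqF.
have SS : \int[mu]_(z in J) (S z ^+ 2) = a * \sum_(0 <= n < N) b n ^+ 2.
  by rewrite orth_sum_sqr// iota_uniq.
have : 0 <= \int[mu]_(z in J) ((G z - S z) ^+ 2).
  by apply: Rintegral_ge0 => z _; exact: sqr_ge0.
rewrite (_ : (fun z => (G z - S z) ^+ 2) = (fun z => (G z ^+ 2 + S z ^+ 2) - 2 * (G z * S z)));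
  last by apply/funext => z; ring.
have iD : mu.-integrable J (EFin \o (fun z => G z ^+ 2 + S z ^+ 2)) by exact: (lint1D G2 iS2).
rewrite lRint1B//; last exact: (lint1Z _ iGS).
rewrite lRint1D// (lRint1Z _ iGS)// GS SS -subr_ge0.
by move: (\int[mu]_(z in J) _) (\sum_(0 <= n < N) _) => A B; lra.
Qed.

End orthogonal_family.

Section trigonometric_system.
Context {R : realType}.
Notation mu := (@lebesgue_measure R).
Variables (a : R).
Hypotheses (a0 : 0 < a).
Notation J := (`](- a), a[%classic : set R).

(** The index is shifted: mode [n] has n + 1 half-waves on []-a, a[]. So [sn] runs through the
    Dirichlet eigenfunctions and [cn] through the non-constant Neumann ones. The absence of the
    constant is harmless, since completeness is used for the sines only. *)
Definition freq (n : nat) : R := n.+1%:R * (pi / (2 * a)).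
Definition sn (n : nat) (z : R) : R := sin (freq n * (z + a)).
Definition cn (n : nat) (z : R) : R := cos (freq n * (z + a)).

Lemma freq_gt0 n : 0 < freq n.
Proof. by rewrite /freq mulr_gt0 ?ltr0n// divr_gt0 ?pi_gt0// mulr_gt0. Qed.

Lemma is_derive_affine (k b x : R) : is_derive x 1 (fun z : R => k * (z + b)) k.
Proof.
have -> : (fun z : R => k * (z + b)) = (k \*: (id + cst b)) by apply/funext.
by apply: is_derive_eq; rewrite addr0 /GRing.scale/= mulr1.
Qed.

Lemma is_derive_sin_affine (k b x : R) :
  is_derive x 1 (fun z : R => sin (k * (z + b))) (k * cos (k * (x + b))).
Proof.
have h := is_derive_affine k b x.
have := @is_derive1_comp R sin (fun z : R => k * (z + b)) x _ _ (is_derive_sin _) h.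
by move=> /is_derive_eq; apply; rewrite mulrC.
Qed.

Lemma is_derive_cos_affine (k b x : R) :
  is_derive x 1 (fun z : R => cos (k * (z + b))) (- k * sin (k * (x + b))).
Proof.
have h := is_derive_affine k b x.
have := @is_derive1_comp R cos (fun z : R => k * (z + b)) x _ _ (is_derive_cos _) h.
by move=> /is_derive_eq; apply; ring.
Qed.

Lemma is_derive_sn n (z : R) : is_derive z 1 (sn n) (freq n * cn n z).
Proof. exact: is_derive_sin_affine. Qed.

Lemma is_derive_cn n (z : R) : is_derive z 1 (cn n) (- freq n * sn n z).
Proof. exact: is_derive_cos_affine. Qed.

Lemma is_derive_continuous (f df : R -> R) :
  (forall x : R, is_derive x 1 f (df x)) -> continuous f.
Proof.
by move=> h x; apply/differentiable_continuous/derivable1_diffP; have [] := h x.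
Qed.

Lemma continuous_sn n : continuous (sn n).
Proof. exact: is_derive_continuous (is_derive_sn n). Qed.

Lemma continuous_cn n : continuous (cn n).
Proof. exact: is_derive_continuous (is_derive_cn n). Qed.

Lemma sin_natpi n : sin (n%:R * pi) = 0 :> R.
Proof.
by elim: n => [|n ih]; rewrite ?mul0r ?sin0// -natr1 mulrDl mul1r sinDpi ih oppr0.
Qed.

Lemma freqa n : freq n * (a + a) = n.+1%:R * pi.
Proof. by rewrite /freq; field; rewrite gt_eqF. Qed.

Lemma snNa n : sn n (- a) = 0. Proof. by rewrite /sn addNr mulr0 sin0. Qed.
Lemma sna n : sn n a = 0. Proof. by rewrite /sn freqa sin_natpi. Qed.

Lemma norm_sn n z : `|sn n z| <= 1. Proof. by rewrite ler_norml sin_geN1 sin_le1. Qed.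
Lemma norm_cn n z : `|cn n z| <= 1. Proof. by rewrite ler_norml cos_geN1 cos_le1. Qed.

Lemma integral_cos_affine (k : R) : k != 0 -> sin (k * (a + a)) = 0 ->
  \int[mu]_(z in J) cos (k * (z + a)) = 0.
Proof.
move=> k0 sk.
have [_ h] : abs_cont (- a) a (fun z => k^-1 * sin (k * (z + a))) (fun z => cos (k * (z + a))).
  apply: AC_C1 => [x _|].
    have := is_deriveZ k^-1 (is_derive_sin_affine k a x).
    by move=> /is_derive_eq; apply; rewrite /GRing.scale/= mulrA mulVf// mul1r.
  by apply: continuous_subspaceT; exact: is_derive_continuous (is_derive_cos_affine k a).
rewrite -h ?lexx//; last by rewrite ge0_cp// ltW.
by rewrite sk addNr !mulr0 sin0 mulr0 subrr.
Qed.

Lemma integral_itv_cst (c : R) : \int[mu]_(z in J) c = c * (2 * a).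
Proof.
rewrite Rintegral_cst//= lebesgue_measure_itv/= lte_fin.
by rewrite (lt_trans _ a0) ?oppr_lt0//=; congr (_ * _); ring.
Qed.

Lemma sin_natB_pi (m n : nat) : sin ((m%:R - n%:R) * pi) = 0 :> R.
Proof. by rewrite mulrBl sinB !sin_natpi; ring. Qed.

Lemma integral_cos_diff (m n : nat) :
  \int[mu]_(z in J) cos ((freq m - freq n) * (z + a)) = 2 * a * (m == n)%:R.
Proof.
have [->|mn] := eqVneq m n.
  under eq_Rintegral do rewrite subrr mul0r cos0.
  by rewrite integral_itv_cst mulr1 mul1r.
rewrite mulr0; apply: integral_cos_affine.
  rewrite /freq -mulrBl mulf_neq0//; first by rewrite subr_eq0 eqr_nat eqSS.
  by rewrite gt_eqF// divr_gt0 ?pi_gt0// mulr_gt0.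
by rewrite mulrBl !freqa -mulrBl sin_natB_pi.
Qed.

Lemma integral_cos_add (m n : nat) :
  \int[mu]_(z in J) cos ((freq m + freq n) * (z + a)) = 0.
Proof.
apply: integral_cos_affine; first by rewrite gt_eqF// addr_gt0// freq_gt0.
by rewrite mulrDl !freqa -mulrDl -natrD sin_natpi.
Qed.

Let icos k : mu.-integrable J (EFin \o (fun z => cos (k * (z + a)))).
Proof.
apply: integrable_continuous; apply: continuous_subspaceT.
exact: is_derive_continuous (is_derive_cos_affine k a).
Qed.

Lemma orth_sn m n : \int[mu]_(z in J) (sn m z * sn n z) = a * (m == n)%:R.
Proof.
transitivity (\int[mu]_(z in J) (2^-1 * cos ((freq m - freq n) * (z + a))
   - 2^-1 * cos ((freq m + freq n) * (z + a)))).
  apply: eq_Rintegral => z _; rewrite /sn !mulrDl mulNr cosB cosD; by field.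
rewrite lRint1B//; [|exact: (lint1Z _ (icos _))..].
rewrite (lRint1Z _ (icos _))// (lRint1Z _ (icos _))// integral_cos_diff integral_cos_add.
by field.
Qed.

Lemma orth_cn m n : \int[mu]_(z in J) (cn m z * cn n z) = a * (m == n)%:R.
Proof.
transitivity (\int[mu]_(z in J) (2^-1 * cos ((freq m - freq n) * (z + a))
   + 2^-1 * cos ((freq m + freq n) * (z + a)))).
  apply: eq_Rintegral => z _; rewrite /cn !mulrDl mulNr cosB cosD; by field.
rewrite lRint1D//; [|exact: (lint1Z _ (icos _))..].
rewrite (lRint1Z _ (icos _))// (lRint1Z _ (icos _))// integral_cos_diff integral_cos_add.
by field.
Qed.

End trigonometric_system.

(** * Completeness of the sine system *)

Section sine_completeness.
Context {R : realType}.
Notation mu := (@lebesgue_measure R).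

Lemma bernoulli_ineq (n : nat) (x : R) : 0 <= x <= 1 -> 1 - n%:R * x <= (1 - x) ^+ n.
Proof.
move=> /andP[x0 x1]; elim: n => [|n ih]; first by rewrite mul0r subr0 expr0.
rewrite exprS; apply: (@le_trans _ _ ((1 - x) * (1 - n%:R * x))); last first.
  by rewrite ler_wpM2l// subr_ge0.
rewrite -natr1 -subr_ge0.
have -> : (1 - x) * (1 - n%:R * x) - (1 - (n%:R + 1) * x) = n%:R * x ^+ 2 by ring.
by rewrite mulr_ge0// sqr_ge0.
Qed.

Lemma bernoulli_ineqD (n : nat) (x : R) : 0 <= x -> 1 + n%:R * x <= (1 + x) ^+ n.
Proof.
move=> x0; elim: n => [|n ih]; first by rewrite mul0r addr0 expr0.
rewrite exprS; apply: (@le_trans _ _ ((1 + x) * (1 + n%:R * x))); last first.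
  by rewrite ler_wpM2l// addr_ge0.
rewrite -natr1 -subr_ge0.
have -> : (1 + x) * (1 + n%:R * x) - (1 + (n%:R + 1) * x) = n%:R * x ^+ 2 by ring.
by rewrite mulr_ge0// sqr_ge0.
Qed.

(* These polynomials tend to the indicator of [0, 1/2): the Weierstrass theorem is
   not needed to approximate indicators of intervals in bounded convergence. *)
Definition kuhn (N : nat) (y : R) : R := (1 - y ^+ N) ^+ (2 ^ N).

Lemma kuhn_ge0 N y : 0 <= y <= 1 -> 0 <= kuhn N y <= 1.
Proof.
move=> /andP[y0 y1]; have h : 0 <= 1 - y ^+ N <= 1.
  by rewrite subr_ge0 exprn_ile1//= gerBl exprn_ge0.
by case/andP: h => h0 h1; rewrite exprn_ge0// exprn_ile1.
Qed.

(** By Bernoulli's inequality [kuhn N y] is at least 1 - (2 y)^N. *)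
Lemma kuhn_cvg1 y : 0 <= y -> y < 2^-1 -> kuhn N y @[N --> \oo] --> (1 : R).
Proof.
move=> y0 y2.
have y1 : y <= 1 by lra.
apply: (@squeeze_cvgr _ _ _ _ (fun N => 1 - (2 * y) ^+ N) (fun=> 1)).
- apply: nearW => N; have /andP[_ ->] : 0 <= kuhn N y <= 1 by apply: kuhn_ge0; rewrite y0.
  rewrite andbT /kuhn; apply: le_trans (bernoulli_ineq _ _); last first.
    by rewrite exprn_ge0//= exprn_ile1.
  by rewrite natrX exprMn.
- rewrite -[X in _ --> X]subr0; apply: cvgB; first exact: cvg_cst.
  by apply: cvg_expr; rewrite ger0_norm; lra.
- exact: cvg_cst.
Qed.

(** Bernoulli's inequality gives (2 y)^N <= (1 + y^N)^(2^N). The product of the right side with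
    [kuhn N y] is a power of 1 - y^(2 N), hence at most 1, so that [kuhn N y] is at most (2
    y)^-N. *)
Lemma kuhn_cvg0 y : 2^-1 < y -> y <= 1 -> kuhn N y @[N --> \oo] --> (0 : R).
Proof.
move=> y2 y1.
have y0 : 0 < y by lra.
have z1 : `|(2 * y)^-1| < 1 by rewrite ger0_norm ?invr_ge0 ?invf_lt1; lra.
apply: (@squeeze_cvgr _ _ _ _ (fun=> 0) (fun N => (2 * y)^-1 ^+ N)).
- apply: nearW => N; have /andP[-> _] : 0 <= kuhn N y <= 1 by apply: kuhn_ge0; rewrite y1 ltW.
  have yN0 : 0 < y ^+ N by rewrite exprn_gt0.
  have yN1 : y ^+ N <= 1 by rewrite exprn_ile1// ltW.
  rewrite /= /kuhn.
  have h : (1 - y ^+ N) ^+ (2 ^ N) * ((2 * y) ^+ N) <= 1.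
    apply: (@le_trans _ _ ((1 - y ^+ N) ^+ (2 ^ N) * (1 + y ^+ N) ^+ (2 ^ N))).
      apply: ler_wpM2l; first by rewrite exprn_ge0// subr_ge0.
      apply: le_trans (bernoulli_ineqD _ (ltW yN0)).
      by rewrite exprMn natrX lerDr.
    rewrite -exprMn -subr_sqr expr1n exprn_ile1// ?subr_ge0 ?gerBl.
      by rewrite exprn_ile1// ltW.
    by rewrite exprn_ge0// ltW.
  by rewrite exprVn -[leRHS]mul1r ler_pdivlMr// exprn_gt0// mulr_gt0.
- exact: cvg_cst.
- exact: cvg_expr.
Qed.


Variables (a : R).
Hypotheses (a0 : 0 < a).
Notation J := (`](- a), a[%classic : set R).
Notation s_ := (sn a).
Notation c_ := (cn a).

Let angle z : z \in `[(- a), a] -> pi / (2 * a) * (z + a) \in `[0, pi].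
Proof.
rewrite !in_itv/= => /andP[az za].
have k0 : 0 < pi / (2 * a) by rewrite divr_gt0 ?pi_gt0// mulr_gt0.
apply/andP; split; first by apply: mulr_ge0; [exact: ltW|lra].
rewrite [leRHS](_ : pi = pi / (2 * a) * (a + a)); last by field; rewrite gt_eqF.
by apply: ler_wpM2l; [exact: ltW|lra].
Qed.

Lemma cn0_decreasing x z : x \in `[(- a), a] -> z \in `[(- a), a] ->
  (c_ 0 x < c_ 0 z) = (z < x).
Proof.
move=> xJ zJ; rewrite /cn /freq mul1r ltr_cos ?angle//.
by rewrite ltr_pM2l ?ltrD2r// divr_gt0 ?pi_gt0// mulr_gt0.
Qed.

Lemma sn0_gt0 z : - a < z < a -> 0 < s_ 0 z.
Proof.
move=> /andP[az za]; rewrite /sn /freq mul1r; apply: sin_gt0_pi.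
have k0 : 0 < pi / (2 * a) by rewrite divr_gt0 ?pi_gt0// mulr_gt0.
apply/andP; split; first by apply: mulr_gt0 => //; lra.
rewrite [ltRHS](_ : pi = pi / (2 * a) * (a + a)); last by field; rewrite gt_eqF.
by rewrite ltr_pM2l//; lra.
Qed.

Variable G : R -> R.
Hypothesis Gi : mu.-integrable J (EFin \o G).
Hypothesis G0 : forall n, \int[mu]_(z in J) (G z * s_ n z) = 0.

Let Gf f : continuous f -> mu.-integrable J (EFin \o (fun z => G z * f z)).
Proof.
move=> cf; have := @integrable_continuousM R (- a) a f G (continuous_subspaceT cf) Gi.
by move=> h; apply: lint1_eq h _ => // z _; rewrite mulrC.
Qed.

Let cX j : continuous (fun z => c_ 0 z ^+ j).
Proof.
elim: j => [|j ih] z; first by under eq_fun do rewrite expr0; exact: cvg_cst.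
under eq_fun do rewrite exprS; apply: cvgM; [exact: continuous_cn|exact: ih].
Qed.

Let csX n j : continuous (fun z => s_ n z * c_ 0 z ^+ j).
Proof. by move=> z; apply: cvgM; [exact: continuous_sn|exact: cX]. Qed.

Let Gsc n j : mu.-integrable J (EFin \o (fun z => G z * (s_ n z * c_ 0 z ^+ j))).
Proof. exact: (@Gf (fun z => s_ n z * c_ 0 z ^+ j) (@csX n j)). Qed.

(** Multiplication by [c_ 0] moves the frequency one unit up and down: with x = z + a, 2 sin (k_n x)
    cos (k_0 x) = sin (k_(n+1) x) + sin (k_(n-1) x). For n = 0 the second sine is zero, whence the
    case distinction. *)
Lemma moment_sin_cosX j n : \int[mu]_(z in J) (G z * (s_ n z * c_ 0 z ^+ j)) = 0.
Proof.
elim: j n => [|j ih] n.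
  by under eq_Rintegral do rewrite expr0 mulr1; exact: G0.
have step z : 2 * (s_ n z * c_ 0 z) =
    s_ n.+1 z + (if n is n'.+1 then s_ n' z else 0).
  have -> : s_ n.+1 z = s_ n z * c_ 0 z + c_ n z * s_ 0 z.
    rewrite /sn /cn -sinD; congr sin.
    by rewrite /freq -(natr1 n.+1); ring.
  case: n => [|n]; first by rewrite /=; ring.
  have -> : s_ n z = s_ n.+1 z * c_ 0 z - c_ n.+1 z * s_ 0 z.
    rewrite /sn /cn -sinB; congr sin.
    by rewrite /freq -(natr1 n.+1); ring.
  by ring.
have E z : G z * (s_ n z * c_ 0 z ^+ j.+1) =
    2^-1 * (G z * (s_ n.+1 z * c_ 0 z ^+ j)) +
    2^-1 * (G z * ((if n is n'.+1 then s_ n' z else 0) * c_ 0 z ^+ j)).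
  transitivity (2^-1 * (G z * (2 * (s_ n z * c_ 0 z) * c_ 0 z ^+ j))).
    by rewrite exprS; field.
  by rewrite step; case: (n) => [|?]; ring.
under eq_Rintegral do rewrite E.
case: n {step E} => [|n].
  under eq_Rintegral do rewrite mul0r !mulr0 addr0.
  by rewrite (lRint1Z _ (Gsc 1 j))// ih mulr0.
rewrite lRint1D//; last 2 first.
- exact: (lint1Z _ (Gsc n.+2 j)).
- exact: (lint1Z _ (Gsc n j)).
by rewrite (lRint1Z _ (Gsc n.+2 j))// (lRint1Z _ (Gsc n j))// !ih !mulr0 addr0.
Qed.

Lemma moment_sin_poly (p : {poly R}) :
  \int[mu]_(z in J) (G z * (s_ 0 z * p.[c_ 0 z])) = 0.
Proof.
transitivity (\int[mu]_(z in J) \sum_(i <- index_enum 'I_(size p))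
    p`_i * (G z * (s_ 0 z * c_ 0 z ^+ i))).
  by apply: eq_Rintegral => z _; rewrite horner_coef !mulr_sumr; apply: eq_bigr => i _; ring.
rewrite lRint1_sum//; last first.
  by move=> i; exact: (lint1Z (p`_i) (Gsc 0 i)).
by rewrite big1// => i _; rewrite (lRint1Z _ (Gsc 0 i))// moment_sin_cosX mulr0.
Qed.

(** [G] times [s_ 0] is orthogonal to every polynomial in [c_ 0], and [c_ 0] is strictly decreasing.
    Polynomials that tend to a step function turn this into the vanishing of the integrals of [G]
    times [s_ 0] over all []t, a[]; division by the positive [s_ 0] remains. *)
Lemma sine_complete : {ae mu, forall z, - a < z < a -> G z = 0}.
Proof.
pose H z := G z * s_ 0 z.
have Hi : mu.-integrable J (EFin \o H) by apply: Gf; exact: continuous_sn.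
suff : {ae mu, forall z, - a < z < a -> H z = 0}.
  apply: ae_imp => z h zJ; have /eqP := h zJ.
  by rewrite mulf_eq0 (gt_eqF (sn0_gt0 zJ)) orbF => /eqP.
apply: (ae_eq0_of_primitive0 Hi) => t /andP[at_ ta].
have tJ : t \in `[(- a), a] by rewrite in_itv/= !ltW.
(* As [c_ 0] takes values in [-1, 1], the factor 1/4 keeps [y] in [0, 1]; in [J] the value is below
   1/2 exactly for z > t, by the monotonicity of [c_ 0]. *)
pose y z := 2^-1 + 4^-1 * (c_ 0 z - c_ 0 t).
have y01 z : 0 <= y z <= 1.
  have := norm_cn a 0 z; have := norm_cn a 0 t; rewrite !ler_norml /y.
  by move: (c_ 0 z) (c_ 0 t) => u v; lra.
pose F (N : nat) z := H z * kuhn N (y z).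
have F0 N : \int[mu]_(z in J) F N z = 0.
  pose q : {poly R} := (1 - ((2^-1 - 4^-1 * c_ 0 t)%:P + 4^-1 *: 'X) ^+ N) ^+ (2 ^ N).
  rewrite -(moment_sin_poly q); apply: eq_Rintegral => z _.
  rewrite /F /H /q /kuhn -mulrA; congr (_ * (_ * _)).
  rewrite !hornerE; congr ((_ - _ ^+ _) ^+ _).
  by rewrite /y; ring.
have cy : continuous y.
  move=> z; apply: cvgD; first exact: cvg_cst.
  apply: cvgM; first exact: cvg_cst.
  by apply: cvgB; [exact: continuous_cn|exact: cvg_cst].
have mH := lint1_measurable Hi.
have cvgF : \int[mu]_(z in J) F n z @[n --> \oo] -->
    \int[mu]_(z in J) ((H \_ `]t, a[%classic) z).
  apply: (@lRint1_dct _ J F (H \_ `]t, a[%classic) (fun z => `|H z|)) => //.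
  - move=> N; apply: measurable_funM => //.
    apply: measurable_funTS; apply: continuous_measurable_fun => z.
    have ck k : continuous (fun u : R => u ^+ k) by move=> u; exact: exprn_continuous.
    apply: (@continuous_comp _ _ _ (fun u => 1 - y u ^+ N) (fun u : R => u ^+ (2 ^ N))); last exact: ck.
    apply: cvgB; first exact: cvg_cst.
    by apply: (@continuous_comp _ _ _ y (fun u : R => u ^+ N)); [exact: cy|exact: ck].
  - apply/(@measurable_restrict _ _ _ _ _ J) => //.
    by apply: measurable_funS mH => //; exact: subIsetr.
  - exact: integrable_norm.
  - move=> n z _; rewrite /F normrM ler_piMr//.
    by have /andP[k0 k1] := kuhn_ge0 n (y01 z); rewrite ger0_norm.
  (* At z = t the argument of [kuhn] is 1/2, the threshold between the two limits; this single point
     is a null set. *)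
  - exists [set t]; split => //; first exact: lebesgue_measure_set1.
    move=> z; apply: contraPP => /= /eqP zt; apply => zJ.
    have zJ' : z \in `[(- a), a] by move: zJ; rewrite !in_itv/= => /andP[? ?]; rewrite !ltW.
    have /andP[y0 y1] := y01 z.
    rewrite /F patchE mem_setE in_itv/=.
    have [zlt|tz|/eqP] := ltgtP z t; last by rewrite (negbTE zt).
    + rewrite -[X in _ --> X](mulr0 (H z)); apply: cvgM; first exact: cvg_cst.
      apply: kuhn_cvg0 => //; rewrite /y ltrDl mulr_gt0// subr_gt0.
      by rewrite cn0_decreasing.
    + have -> : z < a by move: zJ; rewrite in_itv/= => /andP[].
      rewrite -[X in _ --> X](mulr1 (H z)); apply: cvgM; first exact: cvg_cst.
      apply: kuhn_cvg1 => //; rewrite /y gtrDl pmulr_rlt0// subr_lt0.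
      by rewrite cn0_decreasing.
have : \int[mu]_(z in J) ((H \_ `]t, a[%classic) z) = 0.
  have := cvg_lim (@Rhausdorff R) cvgF.
  rewrite (_ : (fun n => _) = fun=> 0); last by apply/funext => n; exact: F0.
  by rewrite lim_cst// => ->.
rewrite -Rintegral_mkcondr (_ : J `&` _ = `]t, a[%classic)//.
by apply/setIidPr; apply: itvoo_subset => //; exact: ltW.
Qed.

End sine_completeness.

(** * Series in weighted L2 spaces *)

Section liminf.
Context {R : realType}.
Local Open Scope ereal_scope.
Implicit Types u : (\bar R)^nat.

Lemma limn_einf_ge0 u : (forall n, 0 <= u n) -> 0 <= limn_einf u.
Proof.
move=> u0; rewrite limn_einf_lim; apply: lime_ge; first exact: is_cvg_einfs.
by apply: nearW => n; apply: le_ereal_inf_tmp => _ [k _ <-].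
Qed.

Lemma limn_einf_le u (c : \bar R) (N : nat) :
  (forall n, (N <= n)%N -> u n <= c) -> limn_einf u <= c.
Proof.
move=> uc; rewrite limn_einf_lim; apply: lime_le; first exact: is_cvg_einfs.
apply: nearW => n; apply: (@le_trans _ _ (u (maxn n N))).
  by apply: ereal_inf_lbound; exists (maxn n N) => //=; exact: leq_maxl.
by apply: uc; exact: leq_maxr.
Qed.

Lemma nneseries_le_of_partial u (c : \bar R) : (forall n, 0 <= u n) ->
  (forall n, \sum_(0 <= i < n) u i <= c) -> \sum_(n <oo) u n <= c.
Proof.
move=> u0 uc; apply: lime_le; first exact: is_cvg_nneseries.
exact: nearW.
Qed.

Lemma measurable_fun_limn_einf d (T : measurableType d) (D : set T) (f : (T -> \bar R)^nat) :
  (forall n, measurable_fun D (f n)) -> measurable_fun D (fun x => limn_einf (f ^~ x)).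
Proof.
move=> mf.
rewrite (_ : (fun x => _) = fun x => - limn_esup (fun n => - f n x)); last first.
  by apply/funext => x; rewrite (limn_esupN (f ^~ x)) oppeK.
apply: measurableT_comp => //; apply: measurable_fun_limn_esup => n.
exact: measurableT_comp.
Qed.

End liminf.

(** * Completeness of L2 with a rate of convergence *)

Section L2_completeness.
Context {d} {T : measurableType d} {R : realType} (mu : {measure set T -> \bar R}).

Lemma cvg_of_geometric_steps (u : nat -> R) (c : R) :
  (forall j, `|u j.+1 - u j| <= c * 2^-1 ^+ j) -> cvgn u.
Proof.
move=> h.
have -> : u = (fun n => u 0%N + series (telescope u) n).
  by apply/funext => n; exact: eq_sum_telescope.
apply: is_cvgD; first exact: is_cvg_cst.
apply: normed_cvg; apply: (@series_le_cvg _ _ (geometric c 2^-1)).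
- by move=> n; exact: normr_ge0.
- by move=> n; rewrite /geometric/= (le_trans (normr_ge0 _) (h n)).
- by move=> n; rewrite /telescope/= /geometric/=; exact: h.
- by apply: is_cvg_geometric_series; rewrite ger0_norm ?invr_ge0//; lra.
Qed.

(** Riesz-Fischer with a prescribed rate: the error bounds [eps] pass to the limit by Fatou's lemma.
    The limit is taken along a subsequence [h] so fast that the sum over j of 4^j (h_(j+1) - h_j)^2
    is integrable; where this sum is finite, the steps decay like 2^-j. *)
Lemma L2_complete (D : set T) (g : nat -> T -> R) (eps : nat -> R) :
  measurable D -> (forall n, measurable_fun D (g n)) ->
  (forall n m, (n <= m)%N -> (\int[mu]_(x in D) ((g m x - g n x) ^+ 2)%:E <= (eps n)%:E)%E) ->
  eps n @[n --> \oo] --> (0 : R) ->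
  exists2 f : T -> R, measurable_fun D f &
    forall n, (\int[mu]_(x in D) ((f x - g n x) ^+ 2)%:E <= (eps n)%:E)%E.
Proof.
move=> mD mg geps eps0.
have mgB n m : measurable_fun D (fun x => ((g m x - g n x) ^+ 2)%:E).
  by apply/measurable_EFinP/measurable_funX; exact: measurable_funB.
have exN j : exists N, forall n, (N <= n)%N -> eps n <= 8^-1 ^+ j.
  have e0 : 0 < 8^-1 ^+ j :> R by rewrite exprn_gt0// invr_gt0.
  have [N _ hN] := (@cvgr0_norm_le _ _ _ _ _ _ eps0 _ e0).
  by exists N => n /hN /=; apply: le_trans; exact: ler_norm.
have [N0 N0P] := choice exN.
(* Summing the thresholds makes the index sequence nondecreasing, the term [j] makes it unbounded,
   and the last summand keeps it beyond the threshold [N0 j]. *)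
pose sg j := (j + \sum_(i < j.+1) N0 i)%N.
have sgN j : (N0 j <= sg j)%N by rewrite /sg big_ord_recr/= addnA leq_addl.
have sgj j : (j <= sg j)%N by rewrite leq_addr.
have sgS j : (sg j <= sg j.+1)%N.
  by rewrite /sg [X in (_ <= _ + X)%N]big_ord_recr/= leq_add// leq_addr.
pose h j := g (sg j).
pose s j x := (4 ^+ j * (h j.+1 x - h j x) ^+ 2)%:E.
have s0 j x : (0 <= s j x)%E by rewrite lee_fin; apply: mulr_ge0; [exact: exprn_ge0|exact: sqr_ge0].
have ms j : measurable_fun D (s j).
  apply/measurable_EFinP; apply: measurable_funM => //.
  by apply: measurable_funX; apply: measurable_funB; exact: mg.
have Is j : (\int[mu]_(x in D) s j x <= (2^-1 ^+ j)%:E)%E.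
  rewrite /s; under eq_integral do rewrite EFinM.
  rewrite ge0_integralZl_EFin//; last 2 first.
  - by move=> x _; rewrite lee_fin sqr_ge0.
  - exact: mgB.
  have -> : (2^-1 ^+ j = 4 ^+ j * 8^-1 ^+ j :> R).
    by rewrite -exprMn; congr (_ ^+ _); field.
  rewrite EFinM lee_wpmul2l ?lee_fin ?exprn_ge0//.
  apply: le_trans (geps _ _ (sgS j)) _.
  by rewrite lee_fin; exact: N0P.
pose S x := (\sum_(j <oo) s j x)%E.
have mS : measurable_fun D S.
  by apply: ge0_emeasurable_sum => // j x Dx _; exact: s0.
have iS : mu.-integrable D S.
  apply/integrableP; split => //.
  under eq_integral => x _ do rewrite gee0_abs ?nneseries_ge0//.
  rewrite integral_nneseries//.
  apply: (@le_lt_trans _ _ 2%:E); last exact: ltry.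
  apply: nneseries_le_of_partial => [n|n]; first exact: integral_ge0.
  apply: (@le_trans _ _ (\sum_(0 <= i < n) 2^-1 ^+ i)%:E).
    by rewrite -sumEFin; apply: lee_sum => i _; exact: Is.
  have -> : (\sum_(0 <= i < n) 2^-1 ^+ i = 2 - 2 * 2^-1 ^+ n :> R).
    elim: n => [|n ih]; first by rewrite big_nil expr0; ring.
    by rewrite big_nat_recr//= ih exprS; field.
  by rewrite lee_fin gerBl mulr_ge0// exprn_ge0// invr_ge0.
have cvgh : {ae mu, forall x, D x -> cvgn (h ^~ x)}.
  apply: filterS (integrable_ae mD iS) => x Sx Dx; have {}Sx := Sx Dx.
  apply: (@cvg_of_geometric_steps _ (Num.sqrt (fine (S x)))) => j.
  have : (s j x <= S x)%E.
    have := @nneseries_lim_ge R (s ^~ x) xpredT 0%N j.+1 (fun _ _ _ => s0 _ _).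
    apply: le_trans; rewrite big_mkord big_ord_recr/= leeDr// sume_ge0//.
  rewrite -(fineK Sx) lee_fin => hj.
  have : `|2 ^+ j * (h j.+1 x - h j x)| <= Num.sqrt (fine (S x)).
    rewrite -sqrtr_sqr ler_wsqrtr// exprMn -exprM mulnC exprM.
    by rewrite (_ : 2 ^+ 2 = 4 :> R)//; ring.
  rewrite normrM ger0_norm ?exprn_ge0// exprVn ler_pdivlMr ?exprn_gt0//.
  by rewrite mulrC.
(* The upper limit is measurable in [x] whether or not the sequence converges; it is the limit
   almost everywhere. *)
pose f x := fine (limn_esup (fun j => (h j x)%:E)).
have mf : measurable_fun D f.
  apply: measurableT_comp => //; apply: measurable_fun_limn_esup => j.
  by apply/measurable_EFinP; exact: mg.
have hf x : cvgn (h ^~ x) -> h j x @[j --> \oo] --> f x.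
  move=> c; rewrite /f.
  have c' : (h j x)%:E @[j --> \oo] --> (limn (h ^~ x))%:E.
    by apply: cvg_EFin; [exact: nearW|exact: c].
  by rewrite (cvg_limn_einf_sup c').2.
exists f => // n.
pose q j x := ((h j x - g n x) ^+ 2)%:E.
have mq j : measurable_fun D (q j) by exact: mgB.
rewrite (@ge0_ae_eq_integral _ _ _ mu D _ (fun x => limn_einf (q ^~ x)))//; first last.
- apply: filterS cvgh => x + Dx => /(_ Dx) /hf hx.
  suff c' : (q j x) @[j --> \oo] --> ((f x - g n x) ^+ 2)%:E by rewrite (cvg_limn_einf_sup c').1.
  apply: cvg_EFin; first exact: nearW.
  apply: (@cvg_comp _ _ _ _ (fun y : R => (y - g n x) ^+ 2) _ _ _ hx).
  by apply: cvgM; apply: cvgB => //; exact: cvg_cst.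
- by move=> x _; apply: limn_einf_ge0 => j; rewrite lee_fin sqr_ge0.
- by move=> x _; rewrite lee_fin sqr_ge0.
- exact: measurable_fun_limn_einf.
- by apply/measurable_EFinP/measurable_funX; apply: measurable_funB => //; exact: mg.
apply: le_trans (fatou _ _ _ _) _ => //; first by move=> j x _; rewrite lee_fin sqr_ge0.
apply: (@limn_einf_le _ _ _ n) => j nj; apply: geps.
exact: leq_trans nj (sgj j).
Qed.

End L2_completeness.

Section weighted_synthesis.
Context {R : realType}.
Notation mu := (@lebesgue_measure R).
Variables (a rho be : R) (e : nat -> R -> R).
Hypotheses (a0 : 0 < a) (rho0 : 0 < rho) (ce : forall n, continuous (e n)).
Hypothesis orth : forall m n,
  \int[mu]_(z in `](- a), a[) (e m z * e n z) = a * (m == n)%:R.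
Notation I := (`]0%R, rho[%classic : set R).
Notation J := (`](- a), a[%classic : set R).

Lemma orth_sum_sqr_ereal (s : seq nat) (b : nat -> R) : uniq s ->
  (\int[mu]_(z in J) ((\sum_(n <- s) b n * e n z) ^+ 2)%:E = (a * \sum_(n <- s) b n ^+ 2)%:E)%E.
Proof.
move=> us; rewrite -(@orth_sum_sqr R a e ce orth s b us) /Rintegral fineK//.
have cS : continuous (fun z => \sum_(n <- s) b n * e n z).
  by apply: continuous_bigsum => n z; apply: cvgM; [exact: cvg_cst|exact: ce].
apply: integrable_fin_num => //; apply: (@integrable_continuous R (- a) a (fun z => (\sum_(n <- s) b n * e n z) ^+ 2)).
by apply: continuous_subspaceT => x; rewrite /=; apply: cvgM; exact: cS.
Qed.

Variable f : nat -> R -> R.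
Hypothesis mf : forall n, measurable_fun I (f n).

(** The Jacobian r is absorbed in the exponent: the squared norm of index nu has be = 2 nu + 1. So 1
    stands for the unweighted L_2, 2 mu - 1 for the index mu - 1 and 2 mu + 1 for the index mu. *)
Definition wsqr (g : R -> R) : \bar R := (\int[mu]_(r in I) ((g r) ^+ 2 * r `^ be)%:E)%E.
Definition wsqr2 (F : R * R -> R) : \bar R :=
  (\int[leb2]_(x in cyl 0%R rho a) ((F x) ^+ 2 * x.1 `^ be)%:E)%E.
Definition partial_series (N : nat) (x : R * R) : R := \sum_(0 <= n < N) f n x.1 * e n x.2.

Lemma measurable_powR_fst (D : set (R * R)) (p : R) :
  measurable_fun D (fun x : R * R => x.1 `^ p).
Proof.
apply: measurable_funTS.
by apply: (measurableT_comp (measurable_powR p)); exact: measurable_fst.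
Qed.

Lemma measurable_wsqr2 (F : R * R -> R) : measurable_fun (cyl 0 rho a) F ->
  measurable_fun (cyl 0 rho a) (fun x => ((F x) ^+ 2 * x.1 `^ be)%:E).
Proof.
move=> mF; apply/measurable_EFinP; apply: measurable_funM.
  exact: measurable_funX.
exact: measurable_powR_fst.
Qed.

Lemma measurable_series_term n : measurable_fun (cyl 0 rho a) (fun x => f n x.1 * e n x.2).
Proof.
apply: (measurable_tensor (A := I) (B := J)) => //.
by apply: measurable_funTS; apply: continuous_measurable_fun; exact: ce.
Qed.

Lemma measurable_partial_series N : measurable_fun (cyl 0 rho a) (partial_series N).
Proof.
by apply: measurable_sum => n; exact: measurable_series_term.
Qed.

(** Tonelli puts the integral in z inside; on each line r = const orthogonality removes the cross
    terms and leaves the factor [a]. *)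
Lemma wsqr2_block N m : (N <= m)%N ->
  wsqr2 (fun x => partial_series m x - partial_series N x) =
  (a%:E * \sum_(N <= n < m) wsqr (f n))%E.
Proof.
move=> Nm.
have mI : measurable I by [].
have mJ : measurable J by [].
rewrite /wsqr2 leb_tonelli1//; last 2 first.
- apply: measurable_wsqr2; apply: measurable_funB; exact: measurable_partial_series.
- by move=> x _; rewrite lee_fin mulr_ge0 ?sqr_ge0 ?powR_ge0.
rewrite [LHS](_ : _ = \int[mu]_(r in I) (\sum_(N <= n < m) (a * ((f n r) ^+ 2 * r `^ be))%:E))%E; last first.
  apply: eq_integral => r _.
  transitivity (\int[mu]_(z in J) ((r `^ be)%:E * ((\sum_(n <- index_iota N m) f n r * e n z) ^+ 2)%:E))%E.
    apply: eq_integral => z _; rewrite -EFinM; congr EFin; rewrite mulrC; congr (_ * _ ^+ 2).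
    by rewrite /partial_series/= (@big_cat_nat _ _ _ N 0 m)//=; ring.
  rewrite ge0_integralZl//; last 3 first.
  - apply/measurable_EFinP; apply: measurable_funX; apply: measurable_sum => n.
    apply: measurable_funM => //; apply: measurable_funTS.
    by apply: continuous_measurable_fun; exact: ce.
  - by move=> z _; rewrite lee_fin sqr_ge0.
  - by rewrite lee_fin powR_ge0.
  rewrite orth_sum_sqr_ereal ?iota_uniq// -EFinM sumEFin; congr EFin.
  by rewrite !mulr_sumr; apply: eq_bigr => n _; ring.
rewrite ge0_integral_sum//; last 2 first.
- move=> n; apply/measurable_EFinP; apply: measurable_funM => //.
  apply: measurable_funM; first by apply: measurable_funX; exact: mf.
  by apply: measurable_funTS; exact: measurable_powR.
- by move=> n r _; rewrite lee_fin mulr_ge0 ?(ltW a0)// mulr_ge0 ?sqr_ge0 ?powR_ge0.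
rewrite ge0_sume_distrr//; last by move=> n _; apply: integral_ge0 => r _; rewrite lee_fin mulr_ge0 ?sqr_ge0 ?powR_ge0.
apply: eq_bigr => n _.
under eq_integral do rewrite EFinM.
rewrite ge0_integralZl_EFin//.
- by move=> r _; rewrite lee_fin mulr_ge0 ?sqr_ge0 ?powR_ge0.
- apply/measurable_EFinP; apply: measurable_funM; first by apply: measurable_funX; exact: mf.
  by apply: measurable_funTS; exact: measurable_powR.
- exact: ltW.
Qed.

(** Multiplication by r^(be/2) makes the weighted space an unweighted one, where completeness
    applies to the partial sums: by orthogonality their squared distances are bounded by tails of a
    convergent series of numbers, which also serve as the rate. *)
Lemma weighted_synthesis (M : R) :
  (forall N, (\sum_(0 <= n < N) wsqr (f n) <= M%:E)%E) ->
  exists F : R * R -> R, exists eps : nat -> R,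
    [/\ measurable_fun (cyl 0 rho a) F, eps n @[n --> \oo] --> (0 : R),
        (wsqr2 F <= (a * M)%:E)%E &
        forall N, (wsqr2 (fun x => F x - partial_series N x)%R <= (eps N)%:E)%E].
Proof.
move=> fM.
have w0 n : (0 <= wsqr (f n))%E.
  by apply: integral_ge0 => r _; rewrite lee_fin mulr_ge0 ?sqr_ge0 ?powR_ge0.
have wfin n : wsqr (f n) \is a fin_num.
  rewrite ge0_fin_numE// (le_lt_trans _ (ltry M))// (le_trans _ (fM n.+1))//.
  by rewrite big_nat_recr//= leeDr// sume_ge0.
pose v n := fine (wsqr (f n)).
have v0 n : 0 <= v n by exact: fine_ge0.
have vE n : (v n)%:E = wsqr (f n) by rewrite fineK.
pose S := series v.
have SM N : S N <= M.
  by rewrite -lee_fin /S /series/= -sumEFin; under eq_bigr do rewrite vE; exact: fM.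
have ndS : nondecreasing_seq S.
  by apply/nondecreasing_seqP => n; rewrite /S /series/= big_nat_recr//= lerDl.
have cS : cvgn S.
  by apply: nondecreasing_is_cvgn => //; exists M => _ [n _ <-].
pose t := limn S.
have St N : S N <= t by exact: nondecreasing_cvgn_le.
have tM : t <= M by apply: limr_le => //; exact: nearW.
have block N m : (N <= m)%N ->
    (wsqr2 (fun x => partial_series m x - partial_series N x)%R <= (a * (t - S N))%:E)%E.
  move=> Nm; rewrite wsqr2_block//; under eq_bigr do rewrite -vE.
  rewrite sumEFin -EFinM lee_fin ler_pM2l// lerBrDl (le_trans _ (St m))//.
  by rewrite /S /series/= (@big_cat_nat _ _ _ N 0 m).
pose h := be / 2.
have hE r : 0 < r -> (r `^ h) ^+ 2 = r `^ be.
  by move=> r0; rewrite expr2 -powRD ?(gt_eqF r0) ?implybT// -splitr.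
pose g n x := partial_series n x * x.1 `^ h.
have mcyl : measurable (cyl 0 rho a : set (R * R)) by exact: measurableX.
have [|||G mG Geps] := @L2_complete _ _ R leb2 (cyl 0 rho a) g (fun N => a * (t - S N)) mcyl.
- move=> n; apply: measurable_funM; first exact: measurable_partial_series.
  exact: measurable_powR_fst.
- move=> N m Nm; apply: le_trans (block _ _ Nm).
  rewrite /wsqr2 (_ : integral _ _ _ = integral leb2 (cyl 0 rho a) (fun x => ((partial_series m x - partial_series N x) ^+ 2 * x.1 `^ be)%:E))//.
  apply: eq_integral => x /set_mem [/=]; rewrite in_itv/= => /andP[x0 _] _.
  by rewrite -hE// /g -mulrBl exprMn.
- rewrite -[X in _ --> X](mulr0 a) -[X in a * X](subrr t).
  by apply: cvgM; [exact: cvg_cst|apply: cvgB; [exact: cvg_cst|exact: cS]].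
have GE N : (wsqr2 (fun x => G x * x.1 `^ (- h) - partial_series N x)%R <= (a * (t - S N))%:E)%E.
  apply: le_trans (Geps N); rewrite /wsqr2.
  rewrite (_ : integral _ _ _ = integral leb2 (cyl 0 rho a) (fun x => ((G x - g N x) ^+ 2)%:E))//.
  apply: eq_integral => x /set_mem [/=]; rewrite in_itv/= => /andP[x0 _] _.
  rewrite -hE// -exprMn; congr ((_ ^+ 2)%:E).
  by rewrite mulrBl powRN mulfVK// gt_eqF// powR_gt0.
exists (fun x => G x * x.1 `^ (- h)), (fun N => a * (t - S N)); split => //.
- by apply: measurable_funM => //; exact: measurable_powR_fst.
- rewrite -[X in _ --> X](mulr0 a) -[X in a * X](subrr t).
  by apply: cvgM; [exact: cvg_cst|apply: cvgB; [exact: cvg_cst|exact: cS]].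
(* The partial sum of no terms is zero, so the error bound at 0 bounds the limit itself. *)
- have := GE 0%N; rewrite (_ : (fun x => _ - partial_series 0 x) = (fun x => G x * x.1 `^ (- h))).
    move=> /le_trans; apply; rewrite lee_fin ler_pM2l// /S /series/= big_geq// subr0.
    exact: tM.
  by apply/funext => x; rewrite /partial_series big_geq// subr0.
Qed.

End weighted_synthesis.

(** * Hardy inequalities *)

Section power_integrals.
Context {R : realType}.
Notation mu := (@lebesgue_measure R).
Implicit Types (p q r s x y rho c : R).

Lemma powRMX r c n : 0 < r -> r `^ c * r ^+ n = r `^ (c + n%:R).
Proof.
by move=> r0; rewrite powRD ?(gt_eqF r0) ?implybT// powR_mulrn// ltW.
Qed.

Lemma powRpred r c : 0 < r -> r `^ (c - 1) * r = r `^ c.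
Proof. by move=> r0; rewrite -{2}(expr1 r) powRMX// subrK. Qed.

Lemma measurable_powR_on (D : set R) c : measurable_fun D (fun r : R => r `^ c).
Proof. by apply: measurable_funTS; exact: measurable_powR. Qed.

Lemma continuous_powR_pos x c : 0 < x -> {for x, continuous (fun r : R => r `^ c)}.
Proof.
move=> x0; apply/differentiable_continuous/derivable1_diffP.
by have [] := is_derive1_powR c x0.
Qed.

Lemma within_continuous_powR x y c : 0 < x -> {within `[x, y], continuous (fun r : R => r `^ c)}.
Proof.
move=> x0; apply: continuous_in_subspaceT => z; rewrite inE/= in_itv/= => /andP[xz _].
by apply: continuous_powR_pos; exact: lt_le_trans xz.
Qed.

Lemma abs_cont_powR x y c : 0 < x ->
  abs_cont x y (fun r => r `^ c) (fun r => c * r `^ (c - 1)).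
Proof.
move=> x0; apply: AC_C1 => [z /andP[xz _]|].
  by apply: is_derive1_powR; exact: lt_le_trans xz.
move=> z; apply: cvgM; first exact: cst_continuous.
exact: within_continuous_powR.
Qed.

Lemma integral_powR x y c : 0 < x -> x <= y -> c != 0 ->
  (\int[mu]_(t in `]x, y[) (t `^ (c - 1))%:E = ((y `^ c - x `^ c) / c)%:E)%E.
Proof.
move=> x0 xy c0.
have ac := AC_Z c^-1 (@abs_cont_powR x y c x0).
have E t : c^-1 * (c * t `^ (c - 1)) = t `^ (c - 1) by rewrite mulKf.
have i1 : mu.-integrable `]x, y[ (EFin \o (fun t => t `^ (c - 1))).
  by apply: lint1_eq ac.1 _ => // t _; rewrite E.
have := ac.2 x y (lexx _) xy (lexx _).
rewrite (lRint1_eq (g := fun t => t `^ (c - 1))); last by move=> t _; rewrite E.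
move=> h; rewrite -[LHS]fineK; last exact: integrable_fin_num.
by congr EFin; rewrite -[LHS]h; field.
Qed.

Lemma le_integral_powR_right x y p : 0 < x -> 0 < p ->
  (\int[mu]_(t in `]x, y[) (t `^ (- p - 1))%:E <= (x `^ (- p) / p)%:E)%E.
Proof.
move=> x0 p0; have [xy|yx] := leP x y; last first.
  rewrite set_itv_ge; last by rewrite bnd_simp -leNgt ltW.
  rewrite integral_set0 lee_fin.
  by rewrite divr_ge0 ?powR_ge0// ltW.
rewrite integral_powR ?oppr_eq0 ?gt_eqF// lee_fin invrN mulrN -mulNr opprB.
by rewrite ler_pM2r ?invr_gt0// gerBl powR_ge0.
Qed.

(** Monotone convergence along the intervals starting at 1/(n+1). Estimates up to the axis are
    thereby reduced to intervals on which all powers of r are regular. *)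
Lemma ge0_integral_le_of_itv rho (f : R -> \bar R) (C : \bar R) :
  measurable_fun `]0%R, rho[ f -> (forall r, (0 < r < rho)%R -> 0 <= f r)%E ->
  (forall d, (0 < d < rho)%R -> \int[mu]_(r in `]d, rho[) f r <= C)%E -> (0 <= C)%E ->
  (\int[mu]_(r in `]0%R, rho[) f r <= C)%E.
Proof.
move=> mf f0 fC C0.
pose F (n : nat) : set R := `](n.+1%:R^-1)%R, rho[%classic.
have FE : `]0%R, rho[%classic = \bigcup_n F n.
  apply/seteqP; split => [x /=|x [n _] /=]; rewrite !in_itv/=.
    move=> /andP[x0 xr]; exists (Num.truncn x^-1) => //; rewrite /F/= in_itv/= xr andbT.
    by rewrite invf_plt ?posrE//; exact: truncnS_gt.
  rewrite /F/= in_itv/= => /andP[nx ->]; rewrite andbT.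
  by apply: lt_trans nx; rewrite invr_gt0.
have sub n : F n `<=` `]0%R, rho[%classic.
  by move=> x nx; rewrite FE; exists n.
have nd : nondecreasing_seq F.
  apply/nondecreasing_seqP => n; apply/subsetPset; apply: subset_itvr; rewrite bnd_simp.
  by rewrite lef_pV2 ?posrE// ler_nat.
rewrite FE; have := @ge0_nondecreasing_set_cvg_integral _ (measurableTypeR R) R F f mu nd.
move=> /(_ (fun _ => measurable_itv _)) h.
have {}h := h (fun i => measurable_funS (measurable_itv _) (@sub i) mf).
have {}h : (\int[mu]_(x in F i) f x)%E @[i --> \oo] --> (\int[mu]_(x in \bigcup_i F i) f x)%E.
  by apply: h => i x /(@sub i) /=; rewrite in_itv/=; exact: f0.
rewrite -(cvg_lim (@ereal_hausdorff R) h); apply: lime_le.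
  by apply/cvg_ex; eexists; exact: h.
apply: nearW => n; have [nr|rn] := ltP (n.+1%:R^-1) rho.
  by apply: fC; rewrite invr_gt0 ltr0n nr.
by rewrite /F set_itv_ge ?bnd_simp -?leNgt// integral_set0.
Qed.

Lemma le_integral_powR_left y p : 0 <= y -> 0 < p ->
  (\int[mu]_(t in `]0%R, y[) (t `^ (p - 1))%:E <= (y `^ p / p)%:E)%E.
Proof.
move=> y0 p0; apply: ge0_integral_le_of_itv.
- by apply/measurable_EFinP; exact: measurable_powR_on.
- by move=> r _; rewrite lee_fin powR_ge0.
- move=> d /andP[d0 dy]; rewrite integral_powR//; [|exact: ltW|by rewrite gt_eqF].
  by rewrite lee_fin ler_pM2r ?invr_gt0// gerBl powR_ge0.
- by rewrite lee_fin divr_ge0 ?powR_ge0// ltW.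
Qed.

Lemma tonelli_triangle rho (k w : R -> \bar R) :
  measurable_fun `]0%R, rho[ k -> measurable_fun `]0%R, rho[ w ->
  (forall r, 0 <= k r)%E -> (forall r, 0 <= w r)%E ->
  (\int[mu]_(r in `]0%R, rho[) (k r * \int[mu]_(s in `]0%R, r[) w s) =
   \int[mu]_(s in `]0%R, rho[) (w s * \int[mu]_(r in `]s, rho[) k r))%E.
Proof.
move=> mk mw k0 w0.
pose H (u : R * R) := (if (u.2 < u.1)%R then k u.1 * w u.2 else 0)%E.
have mH : measurable_fun (`]0%R, rho[ `*` `]0%R, rho[) H.
  apply: measurable_fun_if => //; first exact: measurableX.
  - apply: measurable_fun_ltr => //; first exact: (measurable_funTS measurable_snd).
    exact: (measurable_funTS measurable_fst).
  - apply: (@measurable_funS _ _ _ _ (`]0%R, rho[ `*` `]0%R, rho[)); first exact: measurableX.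
      exact: subIsetl.
    apply: emeasurable_funM.
    + apply: (@measurable_comp _ _ _ _ _ _ `]0%R, rho[%classic k _ fst) => //.
        by move=> _ [[x y] [/= Ax _] <-].
      by apply: measurable_funTS; exact: measurable_fst.
    + apply: (@measurable_comp _ _ _ _ _ _ `]0%R, rho[%classic w _ snd) => //.
        by move=> _ [[x y] [/= _ By] <-].
      by apply: measurable_funTS; exact: measurable_snd.
have H0 (x : R * R) : (0 <= H x)%E by rewrite /H; case: ifP => // _; exact: mule_ge0.
have mI : measurable (`]0%R, rho[%classic : set R) by [].
have E1 := leb_tonelli1 mI mI mH (fun (x : R * R) _ => H0 x).
have E2 := leb_tonelli2 mI mI mH (fun (x : R * R) _ => H0 x).
transitivity (\int[mu]_(r in `]0%R, rho[) \int[mu]_(s in `]0%R, rho[) H (r, s))%E.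
  apply: eq_integral => r; rewrite inE/= in_itv/= => /andP[r0 rr].
  rewrite -ge0_integralZl//; last first.
    by apply: measurable_funS mw => //; apply: itvoo_subset => //; exact: ltW.
  rewrite [RHS]integral_mkcond [LHS]integral_mkcond; apply: eq_integral => s _.
  rewrite !patchE !mem_setE !in_itv/= /H/=.
  by case: (ltP 0 s) => //= s0; case: (ltP s r) => //= sr; [rewrite (lt_trans sr rr)|case: ifP].
rewrite -E1 E2.
apply: eq_integral => s; rewrite inE/= in_itv/= => /andP[s0 sr].
rewrite -ge0_integralZl//; last first.
  by apply: measurable_funS mk => //; apply: itvoo_subset => //; exact: ltW.
rewrite [RHS]integral_mkcond [LHS]integral_mkcond; apply: eq_integral => r _.
rewrite !patchE !mem_setE !in_itv/= /H/=.
case: (ltP s r) => //= ts; first by rewrite (lt_trans s0 ts)/= muleC.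
by case: ifP.
Qed.

Lemma leb_cauchy_schwarz (D : set R) (f g : R -> R) :
  measurable D -> measurable_fun D f -> measurable_fun D g ->
  ((\int[mu]_(x in D) `|(f x * g x)%:E|) ^+ 2 <=
   (\int[mu]_(x in D) ((f x) ^+ 2)%:E) * (\int[mu]_(x in D) ((g x) ^+ 2)%:E))%E.
Proof. exact: (@cauchy_schwarz_integral _ (measurableTypeR R) R mu D f g). Qed.

(** Cauchy-Schwarz for s^(-c/2) and s^(c/2) |g|. The exponent [c] is left free: it is 0 and m + 1 in
    the two Hardy inequalities, and -5 in the bound of the flux. *)
Lemma sqr_integral_le x y c (g : R -> R) : 0 <= x -> measurable_fun `]x, y[ g ->
  ((\int[mu]_(s in `]x, y[) `|g s|%:E) ^+ 2 <=
   (\int[mu]_(s in `]x, y[) (s `^ (- c))%:E) *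
   (\int[mu]_(s in `]x, y[) ((g s) ^+ 2 * s `^ c)%:E))%E.
Proof.
move=> x0 mg; pose h := c / 2.
have hE r : 0 < r -> (r `^ h) ^+ 2 = r `^ c.
  by move=> r0; rewrite expr2 -powRD ?(gt_eqF r0) ?implybT// -splitr.
have hNE r : 0 < r -> (r `^ (- h)) ^+ 2 = r `^ (- c).
  by move=> r0; rewrite !powRN exprVn hE.
have pos s : s \in `]x, y[%classic -> 0 < s.
  by rewrite inE/= in_itv/= => /andP[xs _]; exact: le_lt_trans xs.
have mh : measurable_fun `]x, y[ (fun s => g s * s `^ h).
  by apply: measurable_funM => //; exact: measurable_powR_on.
have mp : measurable_fun `]x, y[ (fun s : R => s `^ (- h)) by exact: measurable_powR_on.
have mI : measurable (`]x, y[%classic : set R) by [].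
have := leb_cauchy_schwarz mI mp mh.
have -> : (\int[mu]_(s in `]x, y[) `|(s `^ (- h) * (g s * s `^ h))%:E| = \int[mu]_(s in `]x, y[) `|g s|%:E)%E.
  apply: eq_integral => s /pos s0; rewrite /= mulrCA -powRD ?(gt_eqF s0) ?implybT// addNr powRr0 mulr1.
  by [].
have -> : (\int[mu]_(s in `]x, y[) ((s `^ (- h)) ^+ 2)%:E = \int[mu]_(s in `]x, y[) (s `^ (- c))%:E)%E.
  by apply: eq_integral => s /pos s0; rewrite hNE.
have -> : (\int[mu]_(s in `]x, y[) ((g s * s `^ h) ^+ 2)%:E = \int[mu]_(s in `]x, y[) ((g s) ^+ 2 * s `^ c)%:E)%E.
  by apply: eq_integral => s /pos s0; rewrite exprMn hE.
by [].
Qed.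

(** Cauchy-Schwarz gives r times the integral of g^2, and exchanging the integrations leaves the
    integral of r^(1-q) over r > s, at most s^(2-q) / (q-2). The constant is at most 1 for q >= 3,
    the case in which it is applied. *)
Lemma hardy_left rho q (g : R -> R) : 2 < q -> measurable_fun `]0%R, rho[ g ->
  (\int[mu]_(r in `]0%R, rho[) ((\int[mu]_(s in `]0%R, r[) `|g s|%:E) ^+ 2 * (r `^ (- q))%:E)
   <= (q - 2)^-1%:E * \int[mu]_(s in `]0%R, rho[) ((g s) ^+ 2 * s `^ (2 - q))%:E)%E.
Proof.
move=> q2 mg.
have mw : measurable_fun `]0%R, rho[ (fun s => ((g s) ^+ 2)%:E).
  by apply/measurable_EFinP; apply: measurable_funX.
have mk : measurable_fun `]0%R, rho[ (fun r => (r `^ (1 - q))%:E).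
  by apply/measurable_EFinP; exact: measurable_powR_on.
apply: (@le_trans _ _ (\int[mu]_(r in `]0%R, rho[)
    ((r `^ (1 - q))%:E * \int[mu]_(s in `]0%R, r[) ((g s) ^+ 2)%:E))%E).
  apply: le_integral_nomeas => r; rewrite /= in_itv/= => /andP[r0 rr].
  have sub : `]0%R, r[%classic `<=` `]0%R, rho[%classic by apply: itvoo_subset => //; exact: ltW.
  apply/andP; split.
    apply: mule_ge0; last by rewrite lee_fin powR_ge0.
    by apply: mule_ge0; apply: integral_ge0.
  have -> : r `^ (1 - q) = r `^ (- q) * r.
    by rewrite -(powRpred (1 - q) r0); congr (_ `^ _ * _); ring.
  suff h : ((\int[mu]_(s in `]0%R, r[) `|g s|%:E) ^+ 2 <= r%:E * \int[mu]_(s in `]0%R, r[) ((g s) ^+ 2)%:E)%E.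
    have aux (A B : \bar R) (k b : R) : 0 <= k -> (A <= b%:E * B -> A * k%:E <= (k * b)%:E * B)%E.
      by move=> k0 AB; rewrite mulrC EFinM muleAC; apply: lee_wpmul2r; rewrite ?lee_fin.
    exact: (aux _ _ _ _ (powR_ge0 _ _) h).
  have := @sqr_integral_le 0 r 0 g (lexx _) (measurable_funS (measurable_itv _) sub mg).
  rewrite oppr0; under [X in (_ <= X * _)%E -> _]eq_integral do rewrite powRr0.
  under [X in (_ <= _ * X)%E -> _]eq_integral do rewrite powRr0 mulr1.
  rewrite integral_cst//= mul1e lebesgue_measure_itv/= lte_fin r0 sube0.
  by [].
rewrite tonelli_triangle//; last 2 first.
- by move=> r; rewrite lee_fin powR_ge0.
- by move=> r; rewrite lee_fin sqr_ge0.
have mR : measurable_fun `]0%R, rho[ (fun s => ((g s) ^+ 2 * s `^ (2 - q))%:E).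
  by apply/measurable_EFinP; apply: measurable_funM; [exact: measurable_funX|exact: measurable_powR_on].
rewrite -ge0_integralZl_EFin//; last 2 first.
- by move=> s _; rewrite lee_fin mulr_ge0 ?sqr_ge0 ?powR_ge0.
- by rewrite invr_ge0 subr_ge0 ltW.
apply: le_integral_nomeas => s; rewrite /= in_itv/= => /andP[s0 sr].
rewrite mule_ge0 ?lee_fin ?sqr_ge0//=; last by apply: integral_ge0 => r _; rewrite lee_fin powR_ge0.
have p0 : 0 < q - 2 by rewrite subr_gt0.
have := @le_integral_powR_right s rho (q - 2) s0 p0.
have e1 : - (q - 2) - 1 = 1 - q by ring.
have e2 : - (q - 2) = 2 - q by ring.
rewrite e1 e2 => h; apply: le_trans (lee_wpmul2l _ h) _; first by rewrite lee_fin sqr_ge0.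
by rewrite -!EFinM lee_fin mulrA mulrC.
Qed.

(** Cauchy-Schwarz with the powers -(m+1)/2 and (m+1)/2 of s yields the factor r^-m / m. After
    exchanging the integrations the remaining r^(m-1) integrates to s^m / m; these are the two
    factors of m^-2. *)
Lemma hardy_right rho m (g : R -> R) : 0 < m -> measurable_fun `]0%R, rho[ g ->
  (\int[mu]_(r in `]0%R, rho[) ((\int[mu]_(s in `]r, rho[) `|g s|%:E) ^+ 2 * (r `^ (2 * m - 1))%:E)
   <= (m ^- 2)%:E * \int[mu]_(s in `]0%R, rho[) ((g s) ^+ 2 * s `^ (2 * m + 1))%:E)%E.
Proof.
move=> m0 mg.
have mw : measurable_fun `]0%R, rho[ (fun s => ((g s) ^+ 2 * s `^ (m + 1))%:E).
  by apply/measurable_EFinP; apply: measurable_funM; [exact: measurable_funX|exact: measurable_powR_on].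
have mk : measurable_fun `]0%R, rho[ (fun r => (r `^ (m - 1))%:E).
  by apply/measurable_EFinP; exact: measurable_powR_on.
have mR : measurable_fun `]0%R, rho[ (fun s => ((g s) ^+ 2 * s `^ (2 * m + 1))%:E).
  by apply/measurable_EFinP; apply: measurable_funM; [exact: measurable_funX|exact: measurable_powR_on].
apply: (@le_trans _ _ (\int[mu]_(r in `]0%R, rho[)
    ((m^-1 * r `^ (m - 1))%:E * \int[mu]_(s in `]r, rho[) ((g s) ^+ 2 * s `^ (m + 1))%:E))%E).
  apply: le_integral_nomeas => r; rewrite /= in_itv/= => /andP[r0 rr].
  have sub : `]r, rho[%classic `<=` `]0%R, rho[%classic by apply: itvoo_subset => //; exact: ltW.
  apply/andP; split.
    apply: mule_ge0; last by rewrite lee_fin powR_ge0.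
    by apply: mule_ge0; apply: integral_ge0.
  have := @sqr_integral_le r rho (m + 1) g (ltW r0) (measurable_funS (measurable_itv _) sub mg).
  rewrite opprD; set K := (\int[mu]_(s in `]r, rho[) ((g s) ^+ 2 * _)%:E)%E => h1.
  have h2 := @le_integral_powR_right r rho m r0 m0.
  have K0 : (0 <= K)%E.
    by apply: integral_ge0 => s _; rewrite lee_fin mulr_ge0 ?sqr_ge0 ?powR_ge0.
  have {}h1 := le_trans h1 (lee_wpmul2r K0 h2).
  apply: (le_trans (lee_wpmul2r _ h1)); first by rewrite lee_fin powR_ge0.
  rewrite muleAC -EFinM lee_wpmul2r// lee_fin.
  rewrite mulrAC mulrC -powRD ?(gt_eqF r0) ?implybT//.
  by rewrite (_ : - m + (2 * m - 1) = m - 1)//; ring.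
rewrite -(@tonelli_triangle rho (fun s => ((g s) ^+ 2 * s `^ (m + 1))%:E) (fun r => (m^-1 * r `^ (m - 1))%:E))//; last 3 first.
- by apply/measurable_EFinP; apply: measurable_funM => //; exact: measurable_powR_on.
- by move=> r; rewrite lee_fin mulr_ge0 ?sqr_ge0 ?powR_ge0.
- by move=> r; rewrite lee_fin mulr_ge0 ?powR_ge0// invr_ge0 ltW.
rewrite -ge0_integralZl_EFin//; last 2 first.
- by move=> s _; rewrite lee_fin mulr_ge0 ?sqr_ge0 ?powR_ge0.
- by rewrite invr_ge0 exprn_ge0// ltW.
apply: le_integral_nomeas => s; rewrite /= in_itv/= => /andP[s0 sr].
have g0 : (0 <= ((g s) ^+ 2 * s `^ (m + 1))%:E)%E by rewrite lee_fin mulr_ge0 ?sqr_ge0 ?powR_ge0.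
apply/andP; split.
  by apply: mule_ge0 => //; apply: integral_ge0 => r _; rewrite lee_fin mulr_ge0 ?powR_ge0// invr_ge0 ltW.
under eq_integral do rewrite EFinM.
rewrite ge0_integralZl_EFin//; last 3 first.
- by move=> r _; rewrite lee_fin powR_ge0.
- by apply/measurable_EFinP; exact: measurable_powR_on.
- by rewrite invr_ge0 ltW.
have h := @le_integral_powR_left s m (ltW s0) m0.
apply: le_trans (lee_wpmul2l g0 (lee_wpmul2l _ h)) _; first by rewrite lee_fin invr_ge0 ltW.
rewrite -!EFinM lee_fin.
rewrite (_ : 2 * m + 1 = m + 1 + m); last by ring.
rewrite [X in _ <= _ * (_ * X)]powRD ?(gt_eqF s0) ?implybT//.
by rewrite le_eqVlt; apply/orP; left; apply/eqP; field; rewrite gt_eqF.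
Qed.

End power_integrals.

(** * The energy estimate for one mode *)

Section energy.
Context {R : realType}.
Notation leb := (@lebesgue_measure R).

Lemma le_addr_small (x y K d0 : R) : 0 < d0 -> 0 <= K ->
  (forall d, 0 < d < d0 -> x <= y + K * d) -> x <= y.
Proof.
move=> d00 K0 h; apply/ler_addgt0Pr => e e0.
pose d := Num.min (d0 / 2) (e / (K + 1)).
have K1 : 0 < K + 1 by rewrite ltr_wpDl.
have d_gt0 : 0 < d by rewrite lt_min !divr_gt0.
have dd0 : d < d0 by rewrite gt_min ltr_pdivrMr// ltr_pMr// ltr1n.
apply: le_trans (h d _) _; first by rewrite d_gt0.
rewrite lerD2l; apply: (@le_trans _ _ ((K + 1) * d)).
  by rewrite ler_wpM2r ?ltW// ltrDl.
by rewrite mulrC -ler_pdivlMr// ge_min lexx orbT.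
Qed.

(** Cauchy-Schwarz on s^3 h = s^(5/2) (s^(1/2) h): the integral of s^5 over []0, r[] is r^6 / 6.
    Thus the primitive is O(r^3), and its quotient by r^3 is bounded up to the axis. *)
Lemma weighted_primitive_bound (rho M : R) (h : R -> R) : measurable_fun `]0, rho[ h ->
  (\int[leb]_(s in `]0%R, rho[) ((h s) ^+ 2 * s)%:E <= M%:E)%E ->
  leb.-integrable `]0, rho[ (EFin \o (fun s => s ^+ 3 * h s)) /\
  forall r : R, 0 < r <= rho ->
    (\int[leb]_(s in `]0, r[) (s ^+ 3 * h s)) ^+ 2 <= M * r ^+ 6.
Proof.
move=> mh hM.
have msh : measurable_fun `]0, rho[ (fun s => s ^+ 3 * h s).
  by apply: measurable_funM => //; apply: measurable_funX.
have key (r : R) : 0 < r -> r <= rho ->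
    ((\int[leb]_(s in `]0%R, r[) `|s ^+ 3 * h s|%:E) ^+ 2 <= (M * r ^+ 6)%:E)%E.
  move=> r0 rr.
  have sub : `]0, r[%classic `<=` `]0, rho[%classic by exact: itvoo_subset.
  have M0 : 0 <= M.
    rewrite -lee_fin; apply: le_trans hM; apply: integral_ge0 => s.
    by rewrite /= in_itv/= => /andP[s0 _]; rewrite lee_fin mulr_ge0 ?sqr_ge0// ltW.
  have := @sqr_integral_le R 0 r (- 5) _ (lexx _) (measurable_funS (measurable_itv _) sub msh).
  rewrite opprK => k1; apply: le_trans k1 _.
  have k2 := @le_integral_powR_left R r 6 (ltW r0) ltac:(by rewrite ltr0n).
  rewrite (_ : 6 - 1 = 5) in k2; last by ring.
  have k3 : (\int[leb]_(s in `]0%R, r[) ((s ^+ 3 * h s) ^+ 2 * s `^ (- 5))%:E <= M%:E)%E.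
    apply: le_trans hM.
    have -> : (\int[leb]_(s in `]0%R, r[) ((s ^+ 3 * h s) ^+ 2 * s `^ (- 5))%:E =
       \int[leb]_(s in `]0%R, r[) ((h s) ^+ 2 * s)%:E)%E.
      apply: eq_integral => s; rewrite inE/= in_itv/= => /andP[s0 _].
      by rewrite powRN powR_mulrn ?ltW//; congr EFin; field; rewrite gt_eqF.
    apply: ge0_subset_integral => //.
      apply/measurable_EFinP; apply: measurable_funM => //; exact: measurable_funX.
    by move=> s; rewrite /= in_itv/= => /andP[s0 _]; rewrite lee_fin mulr_ge0 ?sqr_ge0// ltW.
  apply: (@le_trans _ _ ((r `^ 6 / 6)%:E * M%:E)%E).
    apply: lee_pmul => //.
      by apply: integral_ge0 => s _; rewrite lee_fin powR_ge0.
    by apply: integral_ge0 => s _; rewrite lee_fin mulr_ge0 ?sqr_ge0 ?powR_ge0.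
  rewrite -EFinM lee_fin [leLHS]mulrC; apply: ler_wpM2l => //.
  rewrite powR_mulrn; last exact: ltW.
  rewrite ler_pdivrMr// ler_peMr//; [exact/exprn_ge0/ltW|by rewrite ler1n].
have gi : leb.-integrable `]0, rho[ (EFin \o (fun s => s ^+ 3 * h s)).
  have [r0|r0] := leP rho 0.
    by rewrite set_itv_ge ?bnd_simp -?leNgt//; exact: integrable_set0.
  apply/integrableP; split; first exact/measurable_EFinP.
  have := key rho r0 (lexx _); set K := (\int[_]_(_ in _) _)%E.
  have : (0 <= K)%E by exact: integral_ge0.
  clear; clearbody K; case: K => [r| |] //= _; by rewrite ltry.
split => // r /andP[r0 rr].
have gir := integrable_sub_itv (lexx _) rr gi.
have mI : measurable (`]0, r[%classic : set R) by [].
have := key r r0 rr; rewrite -(@fineK _ (\int[leb]_(s in _) _)%E); last first.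
  by apply: integrable_fin_num => //; exact: (lint1_norm gir).
rewrite -EFin_expe lee_fin; apply: le_trans.
rewrite -(real_normK (num_real (\int[leb]_(s in _) _))) ler_sqr ?nnegrE//.
  exact: (lRint1_norm gir mI).
by apply: fine_ge0; exact: integral_ge0.
Qed.

Section energy_estimate.
Variables (rho mu k M : R) (u psi w : R -> R).
Hypotheses (rho0 : 0 < rho) (mu0 : 0 < mu) (mu1 : mu < 1) (k0 : 0 < k).
Let h s := k ^+ 2 * psi s - w s.
Let V r := \int[leb]_(s in `]0, r[) (s ^+ 3 * h s).
Hypothesis mw : measurable_fun `]0, rho[ w.
Hypothesis mh : measurable_fun `]0, rho[ h.
Hypothesis hM : (\int[leb]_(s in `]0%R, rho[) ((h s) ^+ 2 * s)%:E <= M%:E)%E.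
Hypothesis uE : forall r, 0 < r <= rho -> r ^+ 3 * u r = V r.
Hypothesis psiE : forall r, 0 < r <= rho -> psi r = - \int[leb]_(s in `]r, rho[) u s.

Let shi := (weighted_primitive_bound mh hM).1.

Lemma energy_flux_bound (r : R) : 0 < r <= rho -> `|u r| <= Num.sqrt M.
Proof.
move=> rr; have /andP[r0 _] := rr.
have := (weighted_primitive_bound mh hM).2 r rr; rewrite -/(V r) -uE// exprMn -exprM mulrC.
rewrite ler_pM2r ?exprn_gt0// => h1.
by rewrite -sqrtr_sqr; exact: ler_wsqrtr.
Qed.

Lemma energy_flux_continuous d : 0 < d -> d <= rho -> {within `[d, rho], continuous u}.
Proof.
move=> d0 dr.
have cV : {within `[d, rho], continuous V}.
  by apply: AC_continuous => //; apply: AC_sub (AC_Rintegral shi) => //; exact: ltW.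
have c3 : {within `[d, rho], continuous (fun r => r `^ (- 3))}.
  exact: within_continuous_powR.
apply: (@subspace_eq_continuous _ _ _ (fun r => r `^ (- 3) * V r)).
  move=> r; rewrite inE/= in_itv/= => /andP[dr' rr].
  have r0 := lt_le_trans d0 dr'.
  by rewrite -uE ?r0// powRN powR_mulrn ?ltW// mulKf// expf_neq0// gt_eqF.
by move=> r; apply: cvgM; [exact: c3|exact: cV].
Qed.

Lemma energy_AC_psi d : 0 < d -> d <= rho -> abs_cont d rho psi u.
Proof.
move=> d0 dr; have ui := integrable_continuous (energy_flux_continuous d0 dr).
apply: (AC_ext _ _ (AC_Rintegral_right ui)) => // r; rewrite in_itv/= => /andP[dr' rr].
by rewrite psiE// (lt_le_trans d0 dr').
Qed.

Lemma energy_psi_bound (r : R) : 0 < r <= rho -> `|psi r| <= Num.sqrt M * rho.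
Proof.
move=> /andP[r0 rr].
have ui := integrable_continuous (energy_flux_continuous r0 rr).
have mI : measurable (`]r, rho[%classic : set R) by [].
rewrite psiE ?r0// normrN; apply: le_trans (lRint1_norm ui mI) _.
have ci : leb.-integrable `]r, rho[ (EFin \o (fun _ : R => Num.sqrt M)).
  by apply: integrable_continuous; exact: cst_continuous.
apply: le_trans (lRint1_le (lint1_norm ui) ci mI _) _.
  move=> s; rewrite /= in_itv/= => /andP[rs sr]; apply: energy_flux_bound.
  by rewrite (lt_trans r0 rs) ltW.
rewrite Rintegral_cst//= lebesgue_measure_itv/= lte_fin.
apply: ler_wpM2l; first exact: sqrtr_ge0.
case: ifP => _ /=; last exact: ltW.
by rewrite gerBl ltW.
Qed.

Lemma energy_flux_measurable : measurable_fun `]0, rho[ u.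
Proof.
have cV : {within `[0, rho], continuous V}.
  by apply: AC_continuous (AC_Rintegral shi); exact: ltW.
have mV : measurable_fun `]0, rho[ V.
  apply: (@measurable_funS _ _ _ _ `[0, rho]%classic) => //; first exact: subset_itv_oo_cc.
  exact: subspace_continuous_measurable_fun.
apply: (@eq_measurable_fun _ _ _ _ _ (fun r => r `^ (- 3) * V r)).
  move=> r; rewrite inE/= in_itv/= => /andP[r0 rr].
  by rewrite -uE ?r0 ?ltW// powRN powR_mulrn ?ltW// mulKf// expf_neq0// gt_eqF.
by apply: measurable_funM => //; exact: measurable_powR_on.
Qed.

Lemma energy_psi_measurable : measurable_fun `]0, rho[ psi.
Proof.
apply: (@eq_measurable_fun _ _ _ _ _ (fun r => (k ^+ 2)^-1 * (h r + w r))).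
  by move=> r _; rewrite /h subrK mulKf// expf_neq0// gt_eqF.
by apply: measurable_funM => //; exact: measurable_funD.
Qed.

(** The equation (r^3 u)' = r^3 h is multiplied by r^(2 mu - 2) psi, the power that turns r^3 into
    the weight r^(2 mu + 1). The boundary term at [rho] vanishes with [psi]; the one at d is at most
    O(d), because [u] and [psi] are bounded. *)
Lemma energy_estimate :
  (\int[leb]_(r in `]0%R, rho[) (((u r) ^+ 2 + k ^+ 2 / 2 * (psi r) ^+ 2) * r `^ (2 * mu + 1))%:E
   <= (2 * k ^+ 2)^-1%:E * \int[leb]_(r in `]0%R, rho[) ((w r) ^+ 2 * r `^ (2 * mu + 1))%:E)%E.
Proof.
pose p := 2 * mu.
(* The second summand cancels the cross term (2 mu - 2) r^(2 mu) u psi in the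
   derivative of the first and leaves a nonnegative one. *)
pose Fe (r : R) := r `^ (p - 2) * (V r * psi r) + (1 - mu) * (r `^ p * (psi r * psi r)).
pose Fe' (r : R) := r `^ (p + 1) * (h r * psi r + (u r) ^+ 2) + (1 - mu) * p * (r `^ (p - 1) * (psi r) ^+ 2).
have ac d : 0 < d -> d <= rho -> abs_cont d rho Fe Fe'.
  move=> d0 dr; have acp := energy_AC_psi d0 dr.
  have acV : abs_cont d rho V (fun s => s ^+ 3 * h s).
    by apply: AC_sub (AC_Rintegral shi) => //; exact: ltW.
  have := AC_D (AC_M dr (@abs_cont_powR _ d rho (p - 2) d0) (AC_M dr acV acp))
    (AC_Z (1 - mu) (AC_M dr (@abs_cont_powR _ d rho p d0) (AC_M dr acp acp))).
  apply: AC_ext => // r; rewrite in_itv/= => /andP[dr' rr].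
  have r0 : 0 < r := lt_trans d0 dr'.
  rewrite /Fe' -uE ?r0 ?ltW//.
  have e1 : r `^ (p - 2) = r `^ (p - 2 - 1) * r by rewrite powRpred.
  have e2 : r `^ (p - 1) = r `^ (p - 2) * r by rewrite -(powRpred (p - 1) r0); congr (_ `^ _ * _); ring.
  have e3 : r `^ p = r `^ (p - 1) * r by rewrite powRpred.
  have e4 : r `^ (p + 1) = r `^ p * r by rewrite -(powRpred (p + 1) r0); congr (_ `^ _ * _); ring.
  by rewrite e4 e3 e2 e1 /p; ring.
have := leey (\int[leb]_(r in `]0%R, rho[) ((w r) ^+ 2 * r `^ (2 * mu + 1))%:E)%E.
set Nw := (\int[leb]_(r in _) _)%E; rewrite le_eqVlt => /predU1P[->|Nfin].
  by rewrite gt0_muley ?leey// lte_fin invr_gt0 mulr_gt0// exprn_gt0.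
have Nw0 : (0 <= Nw)%E by apply: integral_ge0 => r _; rewrite lee_fin mulr_ge0 ?sqr_ge0 ?powR_ge0.
have wi : leb.-integrable `]0, rho[ (EFin \o (fun r => (w r) ^+ 2 * r `^ (p + 1))).
  apply/integrableP; split.
    apply/measurable_EFinP; apply: measurable_funM; [exact: measurable_funX|exact: measurable_powR_on].
  apply: le_lt_trans Nfin; apply: le_integral_nomeas => r _ /=.
  by rewrite lee_fin normr_ge0/= ger0_norm// mulr_ge0 ?sqr_ge0 ?powR_ge0.
pose c : R := (2 * k ^+ 2)^-1.
have c0 : 0 < c by rewrite invr_gt0 mulr_gt0// exprn_gt0.
pose G (r : R) := ((u r) ^+ 2 + k ^+ 2 / 2 * (psi r) ^+ 2) * r `^ (p + 1).
have Gc d : 0 < d -> d <= rho -> {within `[d, rho], continuous G}.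
  move=> d0 dr; have cu := energy_flux_continuous d0 dr.
  have cp := AC_continuous dr (energy_AC_psi d0 dr).
  have cr := @within_continuous_powR _ d rho (p + 1) d0.
  move=> r; apply: cvgM; last exact: cr.
  apply: cvgD; first by rewrite expr2; apply: cvgM; exact: cu.
  by apply: cvgM; [exact: cvg_cst|rewrite expr2; apply: cvgM; exact: cp].
have Gi d : 0 < d -> d <= rho -> leb.-integrable `]d, rho[ (EFin \o G).
  by move=> d0 dr; apply: integrable_continuous; exact: Gc.
have G0 r : 0 <= G r.
  by rewrite mulr_ge0 ?powR_ge0// addr_ge0 ?sqr_ge0// mulr_ge0 ?sqr_ge0// divr_ge0 ?sqr_ge0.
pose K := M * rho * rho `^ p.
have M0 : 0 <= M.
  rewrite -lee_fin; apply: le_trans hM; apply: integral_ge0 => s.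
  by rewrite /= in_itv/= => /andP[s0 _]; rewrite lee_fin mulr_ge0 ?sqr_ge0// ltW.
have K0 : 0 <= K by rewrite mulr_ge0 ?powR_ge0// mulr_ge0// ltW.
have main d : 0 < d -> d < rho ->
    \int[leb]_(r in `]d, rho[) G r <= c * fine Nw + K * d.
  move=> d0 dr; have dr' := ltW dr.
  have [acdi acd] := ac d d0 dr'.
  have mI : measurable (`]d, rho[%classic : set R) by [].
  have wid := lint1Z c (integrable_sub_itv (ltW d0) (lexx _) wi) mI.
  apply: (@le_trans _ _ (\int[leb]_(r in `]d, rho[) (c * ((w r) ^+ 2 * r `^ (p + 1)) + Fe' r))).
    apply: (lRint1_le (Gi d d0 dr') (lint1D wid acdi mI) mI) => r.
    rewrite /= in_itv/= => /andP[ddr rr]; have r0 := lt_trans d0 ddr.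
    (* The nonnegative term 2 mu (1 - mu) r^(2 mu - 1) psi^2 is dropped. Multiplied by k^4 and
       summed over the modes it corresponds to half of the fourth term of the estimate, which is
       bounded by the dual Hardy inequality instead. *)
    rewrite /Fe' addrA; apply: ler_wpDr.
      apply: mulr_ge0; last by rewrite mulr_ge0 ?powR_ge0 ?sqr_ge0.
      by apply: mulr_ge0; [rewrite subr_ge0 ltW|rewrite mulr_ge0// ltW].
    rewrite /G mulrA [_ `^ _ * _]mulrC -mulrDl; apply: ler_wpM2r; first exact: powR_ge0.
    have kk : k != 0 by rewrite gt_eqF.
    (* Young's inequality for w psi, with the constant chosen so that half of k^2 psi^2 survives;
       the difference of the two sides is exactly this square. *)
    suff : 0 <= (k * psi r - w r / k) ^+ 2 / 2.
      move=> hh; rewrite -subr_ge0; apply: le_trans hh _; rewrite le_eqVlt; apply/orP; left.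
      by apply/eqP; rewrite /c /h; field.
    by rewrite divr_ge0 ?sqr_ge0.
  rewrite (lRint1D wid acdi mI); apply: lerD.
    rewrite lRint1Z//; last by apply: integrable_sub_itv wi => //; exact: ltW.
    apply: ler_wpM2l; first exact: ltW.
    have Nwf : Nw \is a fin_num by rewrite ge0_fin_numE.
    apply: fine_le => //.
      by apply: integrable_fin_num => //; apply: integrable_sub_itv wi => //; exact: ltW.
    apply: ge0_subset_integral => //.
    - by have /integrableP[] := wi.
    - by move=> r _; rewrite lee_fin mulr_ge0 ?sqr_ge0 ?powR_ge0.
    - by apply: itvoo_subset => //; exact: ltW.
  rewrite -acd//.
  have p0 : psi rho = 0 by rewrite psiE ?rho0 ?lexx// /Rintegral set_itvoo0 integral_set0 oppr0.
  rewrite /Fe p0 !mulr0 addr0 sub0r opprD.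
  have dd : 0 < d <= rho by rewrite d0.
  rewrite -uE//.
  rewrite lerBlDr; apply: ler_wpDr.
    apply: mulr_ge0; first by rewrite subr_ge0 ltW.
    by rewrite mulr_ge0 ?powR_ge0// -expr2 sqr_ge0.
  apply: le_trans (ler_norm _) _; rewrite normrN 3!normrM ger0_norm ?powR_ge0//.
  rewrite (ger0_norm (exprn_ge0 _ (ltW d0))).
  have e : d `^ (p - 2) * d ^+ 3 = d `^ p * d.
    transitivity (d `^ (p + 1)); last by rewrite -(powRpred (p + 1) d0) addrK.
    by rewrite powRMX//; congr (_ `^ _); ring.
  have eb : `|u d| * `|psi d| <= M * rho.
    apply: le_trans (ler_pM _ _ (energy_flux_bound dd) (energy_psi_bound dd)) _ => //.
    by rewrite mulrA -expr2 sqr_sqrtr.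
  rewrite -mulrA mulrA e mulrC /K mulrA; apply: ler_wpM2r; first exact: ltW.
  apply: ler_pM; [by rewrite mulr_ge0|exact: powR_ge0|by []|].
  apply: ge0_ler_powR => //; first by rewrite mulr_ge0// ltW.
  - by rewrite nnegrE ltW.
  - by rewrite nnegrE ltW.
(* The integral over []d, rho[] is bounded by that over the larger []e, rho[], whose error K e is
   arbitrarily small. *)
have fin d : 0 < d -> d < rho -> \int[leb]_(r in `]d, rho[) G r <= c * fine Nw.
  move=> d0 dr; apply: (le_addr_small d0 K0) => e /andP[e0 ed].
  apply: le_trans (main e e0 (lt_trans ed dr)).
  rewrite (Rintegral_itv_cat (ltW ed) (ltW dr)); last by apply: Gi => //; exact: ltW (lt_trans ed dr).
  by rewrite lerDr; apply: Rintegral_ge0 => r _; exact: G0.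
apply: ge0_integral_le_of_itv => //.
- apply/measurable_EFinP; apply: measurable_funM; last exact: measurable_powR_on.
  apply: measurable_funD; first by apply: measurable_funX; exact: energy_flux_measurable.
  by apply: measurable_funM => //; apply: measurable_funX; exact: energy_psi_measurable.
- by move=> r _; rewrite lee_fin; exact: G0.
- move=> d /andP[d0 dr].
  rewrite -[leLHS]fineK; last by apply: integrable_fin_num => //; apply: Gi => //; exact: ltW.
  have Nwf : Nw \is a fin_num by rewrite ge0_fin_numE.
  by rewrite -(fineK Nwf) -EFinM lee_fin; exact: fin.
- by rewrite mule_ge0// lee_fin ltW.
Qed.

End energy_estimate.

End energy.

(** * Test functions *)

Section smooth1_calculus.
Context {R : realType}.
Implicit Types (f g : R -> R) (x c : R).

Lemma is_derive_comp1 f g x (df dg : R) : is_derive x 1 g dg -> is_derive (g x) 1 f df ->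
  is_derive x 1 (fun y => f (g y)) (df * dg).
Proof. by move=> hg hf; exact: (@is_derive1_comp R f g x df dg hf hg). Qed.

Inductive lin_span (S : (R -> R) -> Prop) : (R -> R) -> Prop :=
| Span_gen f : S f -> lin_span S f
| Span_add f g : lin_span S f -> lin_span S g -> lin_span S (fun x => f x + g x)
| Span_scale (k : R) f : lin_span S f -> lin_span S (fun x => k * f x).

Lemma is_derive_derive1 f f' : (forall x, is_derive x 1 f (f' x)) -> f^`()%classic = f'.
Proof. by move=> h; apply/funext => x; rewrite derive1E; have [_ ->] := h x. Qed.

(** If every generator has its derivative in the span, so has every element, and all orders follow
    by induction. Products, affine substitutions and the functions [flat] are treated by choosing a
    family stable under derivation, with no formula for the n-th derivative. *)
Lemma smooth1_span (S : (R -> R) -> Prop) :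
  (forall f, S f -> exists2 f', lin_span S f' & forall x, is_derive x 1 f (f' x)) ->
  forall f, lin_span S f -> smooth1 f.
Proof.
move=> HS.
have HL f : lin_span S f -> exists2 f', lin_span S f' & forall x, is_derive x 1 f (f' x).
  elim=> [g /HS //|g h _ [g' Sg' gg'] _ [h' Sh' hh']|k g _ [g' Sg' gg']].
  - by exists (fun x => g' x + h' x) => [|x]; [exact: Span_add|exact: is_deriveD].
  - exists (fun x => k * g' x) => [|x]; first exact: Span_scale.
    exact: (@is_deriveZ R R R g k x 1 (g' x)).
move=> f Sf n; elim: n f Sf => [|n ih] f /HL[f' Sf' ff'] x.
  by have [] := ff' x.
by rewrite derive1Sn (is_derive_derive1 ff'); exact: ih.
Qed.

Lemma smooth1_is_derive f x : smooth1 f -> is_derive x 1 f (f^`()%classic x).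
Proof. by move=> sf; apply: DeriveDef; [exact: (sf 0 x)|rewrite derive1E]. Qed.

Lemma smooth1_derive f : smooth1 f -> smooth1 f^`()%classic.
Proof. by move=> sf n x; rewrite -derive1Sn; exact: (sf n.+1 x). Qed.

Lemma smooth1_continuous f : smooth1 f -> continuous f.
Proof. by move=> sf; apply: (is_derive_continuous (fun x => smooth1_is_derive x sf)). Qed.

Lemma smooth1_of_derive f f' : (forall x, is_derive x 1 f (f' x)) -> smooth1 f' -> smooth1 f.
Proof.
move=> ff' sf' [|n] x; first by have [] := ff' x.
by rewrite derive1Sn (is_derive_derive1 ff'); exact: sf'.
Qed.

Lemma smooth1M f g : smooth1 f -> smooth1 g -> smooth1 (fun x => f x * g x).
Proof.
move=> sf sg.
pose S h := exists k l, [/\ smooth1 k, smooth1 l & h = (fun x => k x * l x)].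
apply: (@smooth1_span S); last by apply: Span_gen; exists f, g.
move=> _ [k [l [sk sl ->]]].
exists (fun x => k x * l^`()%classic x + k^`()%classic x * l x).
  apply: Span_add; apply: Span_gen.
    by exists k, l^`()%classic; split; [exact: sk|exact: smooth1_derive|].
  by exists k^`()%classic, l; split; [exact: smooth1_derive|exact: sl|].
move=> x; have h := is_deriveM (smooth1_is_derive x sk) (smooth1_is_derive x sl).
by apply: is_derive_eq h _; rewrite /GRing.scale/= [l x * _]mulrC.
Qed.

Lemma smooth1_affine f (k b : R) : smooth1 f -> smooth1 (fun x => f (k * (x + b))).
Proof.
move=> sf.
pose S h := exists2 g, smooth1 g & h = (fun x => g (k * (x + b))).
apply: (@smooth1_span S); last by apply: Span_gen; exists f.
move=> _ [g sg ->]; exists (fun x => k * g^`()%classic (k * (x + b))).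
  by apply/Span_scale/Span_gen; exists g^`()%classic; [exact: smooth1_derive|].
move=> x; have h := is_derive_comp1 (is_derive_affine k b x) (smooth1_is_derive (k * (x + b)) sg).
by apply: is_derive_eq h _; rewrite mulrC.
Qed.

Lemma smooth1_cst c : smooth1 (fun _ : R => c).
Proof.
apply: (@smooth1_span (fun h => exists k, h = fun _ => k)); last by apply: Span_gen; exists c.
by move=> _ [k ->]; exists (fun _ => 0) => [|x]; [apply: Span_gen; exists 0|exact: is_derive_cst].
Qed.

Lemma smooth1_id : smooth1 (fun x : R => x).
Proof. by apply: (@smooth1_of_derive _ (fun _ => 1)); exact: smooth1_cst. Qed.

Lemma smooth1X n : smooth1 (fun x : R => x ^+ n).
Proof.
elim: n => [|n ih]; first exact: smooth1_cst.
have -> : (fun x : R => x ^+ n.+1) = (fun x => x * x ^+ n) by apply/funext => x; rewrite exprS.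
by apply: smooth1M => //; exact: smooth1_id.
Qed.

Lemma smooth1_sin : smooth1 (@sin R).
Proof.
apply: (@smooth1_span (fun h => h = @sin R \/ h = @cos R)); last by apply: Span_gen; left.
move=> _ [->|->].
  by exists (@cos R) => [|x]; [apply: Span_gen; right|exact: is_derive_sin].
exists (fun x => -1 * sin x) => [|x]; first by apply/Span_scale/Span_gen; left.
by apply: is_derive_eq (is_derive_cos x) _; rewrite mulN1r.
Qed.

Lemma smooth1_sn (a : R) n : smooth1 (sn a n).
Proof. exact: smooth1_affine smooth1_sin. Qed.

End smooth1_calculus.

(** * Smooth bump functions *)

Section bumps.
Context {R : realType}.
Implicit Types (x t c p q : R).

(* The powers t^(-N) make the span of these functions stable under derivation. *)
Definition flat c (N : nat) t := if 0 < t then t^-1 ^+ N * expR (- (c * t^-1)) else 0.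

Lemma flat0 c N t : t <= 0 -> flat c N t = 0.
Proof. by move=> t0; rewrite /flat ltNge t0. Qed.

Lemma flat_ge0 c N t : 0 <= flat c N t.
Proof.
rewrite /flat; case: ifP => // t0.
by rewrite mulr_ge0 ?expR_ge0// exprn_ge0// invr_ge0 ltW.
Qed.

Lemma flat0_le1 c t : 0 <= c -> flat c 0 t <= 1.
Proof.
move=> c0; rewrite /flat; case: ifP => // t0.
by rewrite expr0 mul1r expR_le1 oppr_le0 mulr_ge0// invr_ge0 ltW.
Qed.

(** For N > 0 this is the N-th power of c y / N <= exp (c y / N). *)
Lemma pow_le_expR N y c : 0 < c -> 0 <= y -> y ^+ N * expR (- (c * y)) <= (N%:R / c) ^+ N.
Proof.
move=> c0 y0; case: N => [|N].
  by rewrite !expr0 mul1r expR_le1 oppr_le0 mulr_ge0// ltW.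
rewrite expRN ler_pdivrMr ?expR_gt0//.
have e : expR (c * y) = expR (c * y / N.+1%:R) ^+ N.+1.
  by rewrite -expRM_natl; congr expR; field; rewrite gt_eqF.
rewrite e -exprMn; apply: lerXn2r; rewrite ?nnegrE//.
  by rewrite mulr_ge0 ?expR_ge0// divr_ge0// ltW.
have := @expR_ge1Dx R (c * y / N.+1%:R) => h.
apply: (@le_trans _ _ (N.+1%:R / c * (c * y / N.+1%:R))).
  by rewrite le_eqVlt; apply/orP; left; apply/eqP; field; rewrite ?gt_eqF.
apply: ler_wpM2l; first by rewrite divr_ge0// ltW.
by apply: le_trans h; rewrite ler_wpDl.
Qed.

Lemma is_derive0_of_quadratic (f : R -> R) (K : R) :
  (forall x, `|f x| <= K * x ^+ 2) -> is_derive (0 : R) (1 : R) f 0.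
Proof.
move=> fK.
have f0 : f 0 = 0.
  by apply/eqP; rewrite -normr_le0 (le_trans (fK 0))// expr0n/= mulr0.
have K0 : 0 <= K by have := fK 1; rewrite expr1n mulr1; apply: le_trans.
have cv : h^-1 *: ((f \o shift 0) (h *: (1 : R)) - f 0) @[h --> 0^'] --> (0 : R).
  apply/cvgrPdist_le => /= e e0; near=> h.
  rewrite sub0r normrN f0 subr0 addr0 /GRing.scale/= mulr1.
  have hn0 : h != 0 by near: h; exact: nbhs_dnbhs_neq.
  rewrite normrM normfV ler_pdivrMl ?normr_gt0//.
  apply: le_trans (fK h) _.
  rewrite -(real_normK (num_real h)) expr2 mulrA mulrC ler_wpM2l//.
  have : `|h| <= e / (K + 1).
    near: h; apply: dnbhs0_le; rewrite divr_gt0// ltr_wpDl//.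
  rewrite ler_pdivlMr ?ltr_wpDl// => h1.
  apply: le_trans h1; rewrite mulrC; apply: ler_wpM2l => //.
  by rewrite lerDl.
apply: DeriveDef; first by apply/cvg_ex; exists 0.
exact: cvg_lim cv.
Unshelve. all: by end_near. Qed.

Lemma is_derive_flat c N t : 0 < c ->
  is_derive t (1 : R) (flat c N) (c * flat c N.+2 t + - N%:R * flat c N.+1 t).
Proof.
move=> c0; have [t0|t0|->] := ltgtP t 0.
- rewrite !flat0 ?ltW// !mulr0 addr0.
  apply: (@near_eq_is_derive _ _ _ (cst 0) (flat c N)) => //.
  near=> s; rewrite /= flat0//.
  apply: ltW; near: s; exact: lt_nbhsl.
- have ne : t != 0 by rewrite gt_eqF.
  have dV : is_derive t 1 (fun s : R => s^-1) (- t ^- 2).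
    have := @is_deriveV R id t 1 1 ne (is_derive_id _ _).
    by rewrite /GRing.scale/= mulr1.
  have dX : is_derive t 1 (fun s : R => s^-1 ^+ N) (N%:R * t^-1 ^+ N.-1 * (- t ^- 2)).
    have := @is_deriveX R R (fun s => s^-1) N t 1 _ dV.
    have -> : (fun s : R => s^-1) ^+ N = (fun s : R => s^-1 ^+ N) by apply/funext => s; rewrite exprfctE.
    by [].
  have dE : is_derive t 1 (fun s : R => expR (- (c * s^-1))) (expR (- (c * t^-1)) * (c * t ^- 2)).
    have h1 : is_derive t 1 (fun s : R => - (c * s^-1)) (c * t ^- 2).
      have := is_deriveN (@is_deriveZ R R R _ c _ _ _ dV).
      by move=> h; apply: is_derive_eq h _; rewrite /GRing.scale/= mulrN opprK.
    exact: (is_derive_comp1 h1 (is_derive_expR _)).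
  apply: (@near_eq_is_derive _ _ _ (fun s : R => s^-1 ^+ N * expR (- (c * s^-1))) (flat c N)) => //.
    near=> s; rewrite /flat ifT//.
    near: s; exact: lt_nbhsr.
  have h := is_deriveM dX dE; apply: is_derive_eq h _.
  rewrite /flat t0 /GRing.scale/= -!exprVn; case: N {dX} => [|N].
    by rewrite !expr0 !mul0r mulr0 addr0 oppr0 mul0r addr0 !expr2; ring.
  by rewrite /= !exprS; ring.
- rewrite !flat0// !mulr0 addr0.
  (* The exponential absorbs two more powers of x^-1: x^-(N+2) exp (-c/x) is bounded by this
     constant K, so [flat c N] is at most K x^2. *)
  apply: (@is_derive0_of_quadratic _ ((N.+2%:R / c) ^+ N.+2)) => x.
  have K0 : 0 <= (N.+2%:R / c) ^+ N.+2 :> R by rewrite exprn_ge0// divr_ge0// ltW.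
  have [x0|x0] := leP x 0; first by rewrite flat0// normr0 mulr_ge0// sqr_ge0.
  rewrite ger0_norm ?flat_ge0// /flat x0.
  have y0 : 0 <= x^-1 by rewrite invr_ge0 ltW.
  have := pow_le_expR N.+2 c0 y0.
  move=> h; apply: le_trans (ler_wpM2r (sqr_ge0 x) h).
  by rewrite le_eqVlt; apply/orP; left; apply/eqP; rewrite !exprS expr0; set A := x^-1 ^+ N; field; rewrite gt_eqF.
Unshelve. all: by end_near. Qed.

Lemma smooth1_flat c N : 0 < c -> smooth1 (flat c N).
Proof.
move=> c0; apply: (@smooth1_span _ (fun h => exists M, h = flat c M)); last by apply: Span_gen; exists N.
move=> _ [M ->]; exists (fun t => c * flat c M.+2 t + - M%:R * flat c M.+1 t).
  by apply: Span_add; apply/Span_scale/Span_gen; eexists.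
by move=> x; exact: is_derive_flat.
Qed.

(** The parameter [c] has two roles: it keeps the support at distance [c] from [p] and [q], and the
    exponentials exp (-c/t) tend to 1 as it goes to 0. With c = [harmonic m] the functions are
    bounded by 1 and tend to 1 on []p, q[], as dominated convergence requires. *)
Definition bumpf c p q x := flat c 0 (x - (p + c)) * flat c 0 (q - c - x).

Lemma bump_ge0 c p q x : 0 <= bumpf c p q x.
Proof. by rewrite mulr_ge0 ?flat_ge0. Qed.

Lemma bump_le1 c p q x : 0 <= c -> bumpf c p q x <= 1.
Proof. by move=> c0; rewrite mulr_ile1 ?flat_ge0 ?flat0_le1. Qed.

Lemma bump_out c p q x : ~~ (p + c < x < q - c) -> bumpf c p q x = 0.
Proof.
rewrite negb_and -!leNgt => /orP[h|h]; rewrite /bumpf.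
  by rewrite flat0 ?mul0r// subr_le0.
by rewrite [X in _ * X]flat0 ?mulr0// subr_le0.
Qed.

Lemma smooth1_bump c p q : 0 < c -> smooth1 (bumpf c p q).
Proof.
move=> c0; apply: smooth1M.
  have -> : (fun x => flat c 0 (x - (p + c))) = (fun x => flat c 0 (1 * (x + (- (p + c))))).
    by apply/funext => x; rewrite mul1r.
  exact/smooth1_affine/smooth1_flat.
have -> : (fun x => flat c 0 (q - c - x)) = (fun x => flat c 0 (-1 * (x + (- (q - c))))).
  by apply/funext => x; congr flat; ring.
exact/smooth1_affine/smooth1_flat.
Qed.

Definition bumpf' c p q x :=
  c * flat c 2 (x - (p + c)) * flat c 0 (q - c - x) -
  flat c 0 (x - (p + c)) * (c * flat c 2 (q - c - x)).

Lemma is_derive_bump c p q x : 0 < c -> is_derive x 1 (bumpf c p q) (bumpf' c p q x).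
Proof.
move=> c0.
have d1 : is_derive x 1 (fun x => flat c 0 (x - (p + c))) (c * flat c 2 (x - (p + c))).
  have a1 : is_derive x 1 (fun x => x - (p + c)) 1.
    by have := is_derive_affine 1 (- (p + c)) x; congr (is_derive _ _ _ _); apply/funext => y; rewrite mul1r.
  have := is_derive_comp1 a1 (is_derive_flat 0 (x - (p + c)) c0).
  by move=> h; apply: is_derive_eq h _; rewrite oppr0 mul0r addr0 mulr1.
have d2 : is_derive x 1 (fun x => flat c 0 (q - c - x)) (- (c * flat c 2 (q - c - x))).
  have a1 : is_derive x 1 (fun x => q - c - x) (-1).
    have := is_derive_affine (-1) (- (q - c)) x; congr (is_derive _ _ _ _); apply/funext => y; ring.
  have := is_derive_comp1 a1 (is_derive_flat 0 (q - c - x) c0).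
  by move=> h; apply: is_derive_eq h _; rewrite oppr0 mul0r addr0 mulrN1.
have h := is_deriveM d1 d2; apply: is_derive_eq h _.
by rewrite /bumpf' /GRing.scale/=; ring.
Qed.

End bumps.

Section smooth_functions.
Context {R : realType}.
Lemma differentiable_fst (x : R * R) : differentiable (fst : R * R -> R) x.
Proof. apply: (@linear_differentiable R (R * R)%type R fst). move=> y; exact: cvg_fst. Qed.
Lemma differentiable_snd (x : R * R) : differentiable (snd : R * R -> R) x.
Proof. by apply: (@linear_differentiable R (R * R)%type R snd) => y; exact: cvg_snd. Qed.

Lemma continuous_pair_l (r : R) : continuous (fun z : R => (r, z)).
Proof.
move=> z; apply: (@cvg_pair _ _ _ (nbhs z) (nbhs r) (nbhs z) _ _ _ (fun=> r) id); first exact: cvg_cst.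
exact: cvg_id.
Qed.

Lemma continuous_pair_r (z : R) : continuous (fun r : R => (r, z)).
Proof.
move=> r; apply: (@cvg_pair _ _ _ (nbhs r) (nbhs r) (nbhs z) _ _ _ id (fun=> z)); last exact: cvg_cst.
exact: cvg_id.
Qed.

Lemma continuous_slice1 (f : R * R -> R) (r : R) : continuous f -> continuous (fun z => f (r, z)).
Proof.
move=> cf z; apply: (@continuous_comp _ _ _ (fun z => (r, z)) f z); last exact: cf.
exact: continuous_pair_l.
Qed.

Lemma continuous_slice2 (f : R * R -> R) (z : R) : continuous f -> continuous (fun r => f (r, z)).
Proof.
move=> cf r; apply: (@continuous_comp _ _ _ (fun r => (r, z)) f r); last exact: cf.
exact: continuous_pair_r.
Qed.

(** Measurability refers to the product sigma-algebra. Freezing r at the points of a grid of mesh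
    1/(n+1) gives functions whose preimages are countable unions of measurable rectangles and which
    tend to [f] by continuity in r. *)
Lemma measurable_continuous2 (f : R * R -> R) : continuous f -> measurable_fun setT f.
Proof.
move=> cf; pose g (n : nat) (x : R * R) := f ((Num.floor (n.+1%:R * x.1))%:~R / n.+1%:R, x.2).
have cz (r : R) := @continuous_slice1 f r cf.
have mg n : measurable_fun setT (g n).
  move=> _ Y mY; rewrite setTI.
  have -> : g n @^-1` Y = \bigcup_(k in [set: int])
     ([set r : R | (Num.floor (n.+1%:R * r) = k)] `*` ((fun z => f (k%:~R / n.+1%:R, z)) @^-1` Y)).
    apply/seteqP; split => [x /= Yx|x [k _] [/= kE]]; last by rewrite /g kE.
    by exists (Num.floor (n.+1%:R * x.1)).
  apply: countable_bigcupT_measurable => [|k]; first exact: countableP.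
   apply: measurableX.
    have -> : [set r : R | Num.floor (n.+1%:R * r) = k] =
       `[(k%:~R / n.+1%:R)%R, ((k + 1)%:~R / n.+1%:R)%R[%classic.
      apply/seteqP; split => r /=; rewrite in_itv/= ler_pdivrMr// ltr_pdivlMr// ![r * _]mulrC.
        by move=> <-; rewrite floor_le_tmp floorD1_gt.
      by move/floor_def.
    by [].
  rewrite -[X in measurable X]setTI; exact: (continuous_measurable_fun (cz _)).
apply: (@measurable_fun_cvg _ _ _ _ g) => // x _.
rewrite {2}[x]surjective_pairing.
have h := @continuous_slice2 f x.2 cf.
suff h2 : (Num.floor (n.+1%:R * x.1))%:~R / n.+1%:R @[n --> \oo] --> x.1.
  exact: (cvg_comp _ _ h2 (h x.1)).
apply/cvgrPdist_le => /= e e0.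
have [N _ hN] := near_infty_natSinv_lt (PosNum e0).
exists N => // n Nn /=; have := hN n Nn; rewrite /= => ne.
have n0 : 0 < n.+1%:R :> R by [].
rewrite -(ler_pM2l n0) -{1}(gtr0_norm n0) -normrM mulrBr mulrCA divff ?gt_eqF// mulr1.
have := floor_itv (n.+1%:R * x.1); move=> /andP[f1 f2].
rewrite ger0_norm ?subr_ge0//; apply: (@le_trans _ _ 1).
  by rewrite lerBlDl; move: f2; rewrite intrD; exact: ltW.
by rewrite -ler_pdivrMl// mulr1 ltW.
Qed.

Notation e1 := ((1, 0) : R * R).
Notation e2 := ((0, 1) : R * R).
Implicit Types (f g : R * R -> R) (x : R * R) (phi chi : R -> R).

Lemma slice_quotient1 f x :
  (fun h : R => h^-1 *: ((f \o shift x) (h *: e1) - f x)) =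
  (fun h : R => h^-1 *: (((fun r => f (r, x.2)) \o shift x.1) (h *: (1 : R)) - f (x.1, x.2))).
Proof.
apply/funext => h; case: x => r z /=; congr (_ *: (f _ - _)).
have -> : h *: e1 + (r, z) = (h *: (1 : R) + r, h *: (0 : R) + z) by [].
by rewrite scaler0 add0r.
Qed.

Lemma slice_quotient2 f x :
  (fun h : R => h^-1 *: ((f \o shift x) (h *: e2) - f x)) =
  (fun h : R => h^-1 *: (((fun z => f (x.1, z)) \o shift x.2) (h *: (1 : R)) - f (x.1, x.2))).
Proof.
apply/funext => h; case: x => r z /=; congr (_ *: (f _ - _)).
have -> : h *: e2 + (r, z) = (h *: (0 : R) + r, h *: (1 : R) + z) by [].
by rewrite scaler0 add0r.
Qed.

Lemma derive_slice1 f x : 'D_e1 f x = (fun r => f (r, x.2))^`()%classic x.1.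
Proof. by rewrite derive1E /derive slice_quotient1. Qed.

Lemma derive_slice2 f x : 'D_e2 f x = (fun z => f (x.1, z))^`()%classic x.2.
Proof. by rewrite derive1E /derive slice_quotient2. Qed.

Lemma is_derive_slice1 f r z : differentiable f (r, z) ->
  is_derive r 1 (fun s => f (s, z)) ('D_e1 f (r, z)).
Proof.
move=> df; apply: DeriveDef; last by rewrite -derive1E derive_slice1.
have := @diff_derivable R (R * R)%type R f (r, z) e1 df.
by rewrite /derivable (slice_quotient1 f (r, z)).
Qed.

Lemma is_derive_slice2 f r z : differentiable f (r, z) ->
  is_derive z 1 (fun s => f (r, s)) ('D_e2 f (r, z)).
Proof.
move=> df; apply: DeriveDef; last by rewrite -derive1E derive_slice2.
have := @diff_derivable R (R * R)%type R f (r, z) e2 df.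
by rewrite /derivable (slice_quotient2 f (r, z)).
Qed.

Lemma continuous_pder i j f : smooth f -> continuous (pder i j f).
Proof. by move=> sf x; apply: differentiable_continuous; exact: sf. Qed.

Lemma smooth_pder0 j f : smooth f -> smooth (pder 0 j f).
Proof. by move=> sf i k x; have := sf i (k + j)%N x; rewrite /pder iterD. Qed.

Definition tensor phi chi : R * R -> R := fun x => phi x.1 * chi x.2.

Lemma smooth1_derive1n n phi : smooth1 phi -> smooth1 (derive1n n phi).
Proof.
elim: n phi => [//|n ih] phi sphi; rewrite derive1Sn; apply: ih; exact: smooth1_derive.
Qed.

Lemma derive_tensor1 phi chi : smooth1 phi ->
  (fun x => 'D_e1 (tensor phi chi) x) = tensor phi^`()%classic chi.
Proof.
move=> sphi; apply/funext => x; rewrite derive_slice1 /tensor/=.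
have -> : (fun r => phi r * chi x.2) = (fun r => chi x.2 * phi r) by apply/funext => r; rewrite mulrC.
have -> : (fun r => chi x.2 * phi r)^`()%classic = (fun r => chi x.2 * phi^`()%classic r); last by rewrite mulrC.
apply: is_derive_derive1 => r.
exact: (@is_deriveZ R R R phi (chi x.2) r 1 _ (smooth1_is_derive r sphi)).
Qed.

Lemma derive_tensor2 phi chi : smooth1 chi ->
  (fun x => 'D_e2 (tensor phi chi) x) = tensor phi chi^`()%classic.
Proof.
move=> schi; apply/funext => x; rewrite derive_slice2 /tensor/=.
have -> : (fun r => phi x.1 * chi r)^`()%classic = (fun r => phi x.1 * chi^`()%classic r); last by [].
apply: is_derive_derive1 => r.
exact: (@is_deriveZ R R R chi (phi x.1) r 1 _ (smooth1_is_derive r schi)).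
Qed.

Lemma pder_tensor i j phi chi : smooth1 phi -> smooth1 chi ->
  pder i j (tensor phi chi) = tensor (derive1n i phi) (derive1n j chi).
Proof.
move=> sphi schi; rewrite /pder; elim: i => [|i ih].
  elim: j => [//|j ih]; rewrite /= in ih *.
  rewrite ih derive_tensor2; last exact: smooth1_derive1n.
  by rewrite -derive1nS.
rewrite iterS ih derive_tensor1; last exact: smooth1_derive1n.
by rewrite -derive1nS.
Qed.

Lemma smooth_tensor phi chi : smooth1 phi -> smooth1 chi -> smooth (tensor phi chi).
Proof.
move=> sphi schi i j x; rewrite pder_tensor//.
have h1 (r : R) : differentiable (derive1n i phi) r.
  by apply/derivable1_diffP; exact: (sphi i r).
have h2 (r : R) : differentiable (derive1n j chi) r.
  by apply/derivable1_diffP; exact: (schi j r).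
apply: (@differentiableM R (R * R)%type (derive1n i phi \o fst) (derive1n j chi \o snd) x).
  apply: differentiable_comp; first exact: differentiable_fst.
  exact: h1.
apply: differentiable_comp; first exact: differentiable_snd.
exact: h2.
Qed.

End smooth_functions.

Section widening.
Context {d} {T : measurableType d} {R : realType} {m : {measure set T -> \bar R}}.
Variables (D E : set T) (f : T -> R).
Hypotheses (mD : measurable D) (mE : measurable E) (ED : E `<=` D).
Hypothesis f0 : forall x, D x -> ~ E x -> f x = 0.

Lemma restrict_widen : f \_ D = f \_ E.
Proof.
apply/funext => x; rewrite !patchE; case: ifPn => xD; case: ifPn => xE //.
  by rewrite f0//; [exact/set_mem|move=> /mem_set; apply/negP].
by move: xD; rewrite mem_set//; exact/ED/set_mem.
Qed.

Lemma integrable_widen : m.-integrable E (EFin \o f) -> m.-integrable D (EFin \o f).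
Proof.
have e A : (EFin \o f) \_ A = EFin \o (f \_ A).
  by apply/funext => x; rewrite /= !patchE; case: ifP.
move/(integrable_mkcond _ mE).1 => h; apply/(integrable_mkcond _ mD).2.
by rewrite e restrict_widen -e.
Qed.

Lemma Rintegral_widen : \int[m]_(x in D) f x = \int[m]_(x in E) f x.
Proof. by rewrite [LHS]Rintegral_mkcond [RHS]Rintegral_mkcond restrict_widen. Qed.

End widening.

Section lebesgue_widening.
Context {R : realType}.

Lemma lint2_widen (D E : set (R * R)) f : measurable D -> measurable E -> E `<=` D ->
  (forall x, D x -> ~ E x -> f x = 0) ->
  leb2.-integrable E (EFin \o f) -> leb2.-integrable D (EFin \o f).
Proof.
exact: (@integrable_widen _ (measurableTypeR R * measurableTypeR R)%type R
  (lebesgue_measure \x lebesgue_measure)%E D E f).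
Qed.

Lemma lRint2_widen (D E : set (R * R)) f : E `<=` D -> (forall x, D x -> ~ E x -> f x = 0) ->
  \int[leb2]_(x in D) f x = \int[leb2]_(x in E) f x.
Proof.
exact: (@Rintegral_widen _ (measurableTypeR R * measurableTypeR R)%type R
  (lebesgue_measure \x lebesgue_measure)%E D E f).
Qed.

Lemma lRint1_widen (D E : set R) f : E `<=` D -> (forall x, D x -> ~ E x -> f x = 0) ->
  \int[@lebesgue_measure R]_(x in D) f x = \int[@lebesgue_measure R]_(x in E) f x.
Proof. exact: (@Rintegral_widen _ (measurableTypeR R) R lebesgue_measure D E f). Qed.

End lebesgue_widening.

(** * Supports of test functions and closed rectangles *)

Section supports.
Context {R : realType}.
Implicit Types (p q b del rho a r z s t : R) (f : R * R -> R) (phi : R -> R).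

Definition rect p q b : set (R * R) := `[p, q]%classic `*` `[- b, b]%classic.

Lemma compact_rect p q b : compact (rect p q b).
Proof. by apply: compact_setX; exact: segment_compact. Qed.

Lemma rect_sub p q b del rho a : del < p -> q < rho -> b < a ->
  rect p q b `<=` cyl del rho a.
Proof.
move=> dp qr ba [r z] [/=]; rewrite !in_itv/= => /andP[pr rq] /andP[bz zb].
rewrite /cyl/=; split => /=; rewrite in_itv/=.
  by rewrite (lt_le_trans dp pr) (le_lt_trans rq qr).
by rewrite (le_lt_trans zb ba) andbT (lt_le_trans _ bz)// ltrN2.
Qed.

(** The extreme values of both coordinates are attained on [K], hence lie strictly inside; the sides
    of the rectangle are placed halfway between them and the boundary. *)
Lemma compact_sub_rect K del rho a : del < rho -> 0 < a -> compact K -> K `<=` cyl del rho a ->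
  exists p q b, [/\ del < p, p < q, q < rho, 0 < b < a & K `<=` rect p q b].
Proof.
move=> dr a0 cK Ksub.
have [K0|/set0P Kn0] := eqVneq K set0.
  exists (del + (rho - del) / 3), (rho - (rho - del) / 3), (a / 2).
  by rewrite K0; split => //; lra.
have cmax (g : R * R -> R) : continuous g -> exists2 c, K c & forall t : R * R, K t -> g t <= g c.
  move=> cg; have [c cK' hc] := compact_EVT_max Kn0 cK (continuous_subspaceT cg).
  by exists c => [|t Kt]; [exact/set_mem|exact/hc/mem_set].
have c_fst : continuous (fst : R * R -> R) by move=> y; exact: cvg_fst.
have c_snd : continuous (snd : R * R -> R) by move=> y; exact: cvg_snd.
have c_fstN : continuous (fun y : R * R => - y.1) by move=> y; apply: cvgN; exact: c_fst.
have c_sndN : continuous (fun y : R * R => - y.2) by move=> y; apply: cvgN; exact: c_snd.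
have [c1 Kc1 h1] := cmax fst c_fst.
have [c2 Kc2 h2] := cmax (fun x => - x.1) c_fstN.
have [c3 Kc3 h3] := cmax snd c_snd.
have [c4 Kc4 h4] := cmax (fun x => - x.2) c_sndN.
have cylE x : K x -> [/\ del < x.1, x.1 < rho, - a < x.2 & x.2 < a].
  by move=> /Ksub[/=]; rewrite !in_itv/= => /andP[? ?] /andP[? ?].
have [d1 r1 _ _] := cylE _ Kc1; have [d2 r2 _ _] := cylE _ Kc2.
have [_ _ n3 a3] := cylE _ Kc3; have [_ _ n4 a4] := cylE _ Kc4.
have h12 := h2 _ Kc1; have h34 := h4 _ Kc3.
exists ((del + c2.1) / 2), ((c1.1 + rho) / 2), ((Num.max c3.2 (- c4.2) + a) / 2).
have m1 : c3.2 <= Num.max c3.2 (- c4.2) by rewrite le_max lexx.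
have m2 : - c4.2 <= Num.max c3.2 (- c4.2) by rewrite le_max lexx orbT.
have m3 : Num.max c3.2 (- c4.2) < a by rewrite gt_max a3 ltrNl.
split; [lra|lra|lra|apply/andP; split; lra|].
move=> x Kx; have := h1 _ Kx; have := h2 _ Kx; have := h3 _ Kx; have := h4 _ Kx => /=.
move=> k1 k2 k3 k4; split => /=; rewrite in_itv/=; apply/andP; split; lra.
Qed.

Lemma compact_sub_itv (K : set R) del rho : del < rho -> compact K -> K `<=` `]del, rho[%classic ->
  exists p q, [/\ del < p, p < q, q < rho & K `<=` `[p, q]%classic].
Proof.
move=> dr cK Ksub.
have K2 : compact (K `*` `[0 : R, 0]%classic) by apply: compact_setX => //; exact: segment_compact.
have [|p [q [b [dp pq qr _ sub]]]] := compact_sub_rect (a := 1) dr ltr01 K2.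
  move=> [r z] [/= /Ksub Kr]; rewrite in_itv/= => z0; split => //=.
  by rewrite in_itv/=; lra.
exists p, q; split => // r Kr.
by have [] // := sub (r, 0); split => //=; rewrite in_itv/= lexx.
Qed.

(** A support condition with explicit bounds, stable under all derivatives, which the integrations
    by parts can refer to. *)
Definition vanish_off p q b f := forall x, ~ rect p q b x -> f x = 0.

Lemma vanish_off_supported p q b del rho a f : del < p -> q < rho -> b < a ->
  vanish_off p q b f -> supported_in (cyl del rho a) f.
Proof.
by move=> dp qr ba vf; exists (rect p q b); split => //; [exact: compact_rect|exact: rect_sub].
Qed.

Lemma supported_vanish_off del rho a f : del < rho -> 0 < a -> supported_in (cyl del rho a) f ->
  exists p q b, [/\ del < p, p < q, q < rho, 0 < b < a & vanish_off p q b f].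
Proof.
move=> dr a0 [K [cK Ks vK]].
have [p [q [b [dp pq qr ba Kr]]]] := compact_sub_rect dr a0 cK Ks.
by exists p, q, b; split => // x nx; apply: vK => Kx; exact/nx/Kr.
Qed.

(** The complement of the closed interval is open, so [phi] vanishes near each of its points. *)
Lemma derive1_vanish s t phi : (forall x, ~ (s <= x <= t) -> phi x = 0) ->
  forall x, ~ (s <= x <= t) -> phi^`()%classic x = 0.
Proof.
move=> v x /negP; rewrite negb_and -!ltNge derive1E => /orP[xs|tx].
  rewrite (@near_eq_derive _ _ _ _ (cst 0)) ?derive_cst//.
  near=> y; apply: v => /andP[sy _]; have : y < s by near: y; exact: lt_nbhsl.
  by rewrite ltNge sy.
rewrite (@near_eq_derive _ _ _ _ (cst 0)) ?derive_cst//.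
near=> y; apply: v => /andP[_ ty]; have : t < y by near: y; exact: lt_nbhsr.
by rewrite ltNge ty.
Unshelve. all: by end_near. Qed.

Lemma vanish_off_derive1 p q b f : vanish_off p q b f ->
  vanish_off p q b (fun x => 'D_((1, 0) : R * R) f x).
Proof.
move=> vf [r z] nx; rewrite derive_slice1/=.
have [zb|/negP zb] := boolP (- b <= z <= b); last first.
  have -> : (fun s => f (s, z)) = cst 0.
    by apply/funext => s; apply: vf => -[/= _]; rewrite in_itv.
  by rewrite derive1_cst.
apply: (@derive1_vanish p q) => [s ns|pr]; last by apply: nx; split; rewrite /= in_itv.
by apply: vf => -[/=]; rewrite in_itv.
Qed.

Lemma vanish_off_derive2 p q b f : vanish_off p q b f ->
  vanish_off p q b (fun x => 'D_((0, 1) : R * R) f x).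
Proof.
move=> vf [r z] nx; rewrite derive_slice2/=.
have [rp|/negP rp] := boolP (p <= r <= q); last first.
  have -> : (fun s => f (r, s)) = cst 0.
    by apply/funext => s; apply: vf => -[/=]; rewrite in_itv.
  by rewrite derive1_cst.
apply: (@derive1_vanish (- b) b) => [s ns|pr]; last by apply: nx; split; rewrite /= in_itv.
by apply: vf => -[/= _]; rewrite in_itv.
Qed.

Lemma vanish_off_pder i j p q b f : vanish_off p q b f -> vanish_off p q b (pder i j f).
Proof.
move=> vf; rewrite /pder; elim: i => [|i ih]; last exact: vanish_off_derive1.
by elim: j => [//|j ih] /=; exact: vanish_off_derive2.
Qed.

Lemma vanish_off_bounded p q b f : continuous f -> vanish_off p q b f ->
  exists2 M, 0 < M & forall x, `|f x| <= M.
Proof.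
move=> cf vf.
have /compact_bounded[M [_ hM]] : compact (f @` rect p q b).
  by apply: continuous_compact; [exact: continuous_subspaceT|exact: compact_rect].
exists (`|M| + 1); first by rewrite ltr_wpDl.
move=> x; have [xr|xr] := pselect (rect p q b x); last by rewrite vf// normr0 addr_ge0.
by apply: (hM (`|M| + 1)); [rewrite ltr_pwDr// ler_norm|exists x].
Qed.

Lemma measurable_cyl del rho a : measurable (cyl del rho a).
Proof. exact: measurableX. Qed.

Lemma measurable_rect p q b : measurable (rect p q b).
Proof. exact: measurableX. Qed.

Lemma locL1_rect del rho a p q b (u : R * R -> R) : locL1 (cyl del rho a) u ->
  del < p -> q < rho -> b < a -> leb2.-integrable (rect p q b) (EFin \o u).
Proof.
move=> [mu iu] dp qr ba; apply/integrableP; split; last first.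
  by apply: iu; [exact: rect_sub|exact: compact_rect].
apply/measurable_EFinP; apply: measurable_funS mu; first exact: measurable_cyl.
exact: rect_sub.
Qed.

Lemma test_integrable del rho a p q b (u f : R * R -> R) : locL1 (cyl del rho a) u ->
  del < p -> q < rho -> b < a -> continuous f -> vanish_off p q b f ->
  leb2.-integrable (cyl del rho a) (EFin \o (fun x => u x * f x)).
Proof.
move=> lu dp qr ba cf vf.
have [M M0 fM] := vanish_off_bounded cf vf.
have iu := locL1_rect lu dp qr ba.
have mf := measurable_continuous2 cf.
have sub := rect_sub dp qr ba.
have mC := measurable_cyl del rho a; have mr := measurable_rect p q b.
have iuf : leb2.-integrable (rect p q b) (EFin \o (fun x => u x * f x)).
  apply: lint2_le (lint2Z M (lint2_norm iu) mr) mr _ _.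
    by apply: measurable_funM; [exact: lint2_measurable iu|exact: measurable_funTS].
  by move=> x _; rewrite normrM mulrC; exact: ler_wpM2r.
apply: (lint2_widen mC mr sub _ iuf) => x _ nx.
by rewrite vf// mulr0.
Qed.

End supports.

Section slices.
Context {d1 d2} {T1 : measurableType d1} {T2 : measurableType d2} {R : realType}.
Variables (m1 : {sigma_finite_measure set T1 -> \bar R}).
Variables (m2 : {sigma_finite_measure set T2 -> \bar R}).
Variables (A : set T1) (B : set T2) (P : T1 * T2 -> Prop).

(** The product measure of a null set is the integral of the measures of its sections, so almost all
    of them are null. *)
Lemma ae_slices1 : {ae (m1 \x m2)%E, forall x, (A `*` B) x -> P x} ->
  {ae m1, forall x, A x -> {ae m2, forall y, B y -> P (x, y)}}.
Proof.
move=> [N [mN N0 sN]].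
have mx := measurable_fun_xsection m2 mN.
have e : (\int[m1]_x `|(m2 \o xsection N) x| = 0)%E.
  rewrite -N0; apply: eq_integral => x _; rewrite gee0_abs//.
have := (ae_eq_integral_abs m1 measurableT mx).1 e.
apply: ae_imp => x h Ax; exists (xsection N x); split.
- exact: measurable_xsection.
- exact: h.
- move=> y /= ny; rewrite /xsection/=; apply/mem_set/sN => /= hP; apply: ny => By; exact: hP.
Qed.

Lemma ae_slices2 : {ae (m1 \x m2)%E, forall x, (A `*` B) x -> P x} ->
  {ae m2, forall y, B y -> {ae m1, forall x, A x -> P (x, y)}}.
Proof.
move=> [N [mN N0 sN]].
have mx := measurable_fun_ysection m1 mN.
(* Sections in this direction are measured by the product taken in the other order; both products
   agree on rectangles and are therefore equal. *)
have N0' : (m1 \x^ m2)%E N = 0%E.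
  rewrite -N0; apply/esym; apply: product_measure_unique => // X Y mX mY.
  exact: product_measure2E.
have e : (\int[m2]_x `|(m1 \o ysection N) x| = 0)%E.
  rewrite -N0'; apply: eq_integral => x _; rewrite gee0_abs//.
have := (ae_eq_integral_abs m2 measurableT mx).1 e.
apply: ae_imp => x h Ax; exists (ysection N x); split.
- exact: measurable_ysection.
- exact: h.
- move=> y /= ny; rewrite /ysection/=; apply/mem_set/sN => /= hP; apply: ny => By; exact: hP.
Qed.

(** Tonelli for the absolute value of [F]: almost all inner integrals vanish. *)
Lemma ae_eq0_of_slices1 (F : T1 * T2 -> R) : measurable A -> measurable B ->
  measurable_fun (A `*` B) F ->
  {ae m1, forall x, A x -> {ae m2, forall y, B y -> F (x, y) = 0}} ->
  {ae (m1 \x m2)%E, forall x, (A `*` B) x -> F x = 0}.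
Proof.
move=> mA mB mF h.
have mD : measurable (A `*` B) by exact: measurableX.
have mF' : measurable_fun (A `*` B) (EFin \o F) by exact/measurable_EFinP.
have mF'' : measurable_fun (A `*` B) (fun x => `|(EFin \o F) x|%E) by exact: measurableT_comp.
suff e : (\int[(m1 \x m2)]_(x in A `*` B) `|(EFin \o F) x| = 0)%E.
  have := (ae_eq_integral_abs _ mD mF').1 e.
  by apply: ae_imp => x hx Dx; have [] := hx Dx.
rewrite (tonelli_rect1 m1 m2 mA mB mF'')//.
have {}h : {ae m1, forall x, A x -> (\int[m2]_(y in B) `|(EFin \o F) (x, y)| = 0)%E}.
  apply: ae_imp h => x hx Ax.
  have mFx : measurable_fun B (fun y => (EFin \o F) (x, y)).
    exact: (measurable_fun_slice1 mA mB Ax mF').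
  apply: (ae_eq_integral_abs _ mB mFx).2.
  by apply: ae_imp (hx Ax) => y hy By; rewrite /= hy.
have mI := measurable_tonelli1 m2 mA mB mF'' (fun x _ => abse_ge0 _).
rewrite (@ge0_ae_eq_integral _ _ _ m1 A _ (cst 0%E))//; first by rewrite integral0.
by move=> x Ax; exact: integral_ge0.
Qed.

End slices.

Section lebesgue_slices.
Context {R : realType}.
Notation leb := (@lebesgue_measure R).
Local Notation T := (measurableTypeR R).
Variables (A B : set R) (P : R * R -> Prop).

Lemma leb_ae_slices1 : {ae leb2, forall x, (A `*` B) x -> P x} ->
  {ae leb, forall x, A x -> {ae leb, forall y, B y -> P (x, y)}}.
Proof. exact: (@ae_slices1 _ _ T T R leb leb A B P). Qed.

Lemma leb_ae_slices2 : {ae leb2, forall x, (A `*` B) x -> P x} ->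
  {ae leb, forall y, B y -> {ae leb, forall x, A x -> P (x, y)}}.
Proof. exact: (@ae_slices2 _ _ T T R leb leb A B P). Qed.

Lemma leb_ae_eq0_of_slices1 (F : R * R -> R) : measurable A -> measurable B ->
  measurable_fun (A `*` B) F ->
  {ae leb, forall x, A x -> {ae leb, forall y, B y -> F (x, y) = 0}} ->
  {ae leb2, forall x, (A `*` B) x -> F x = 0}.
Proof. exact: (@ae_eq0_of_slices1 _ _ T T R leb leb A B F). Qed.

End lebesgue_slices.

(** * Weak derivatives *)

Section weak_derivative_rules.
Context {R : realType}.
Notation leb := (@lebesgue_measure R).
Notation e1 := ((1, 0) : R * R).
Notation e2 := ((0, 1) : R * R).
Variables (del rho a : R).
Hypotheses (dr : del < rho) (a0 : 0 < a).
Notation D := (cyl del rho a).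
Implicit Types (u g f phi : R * R -> R) (p q b s t r z : R).

Lemma ge0_subset_integral_nomeas d (T : measurableType d) (m : {measure set T -> \bar R})
    (A B : set T) (f : T -> \bar R) : A `<=` B -> (forall x, B x -> 0 <= f x)%E ->
  (\int[m]_(x in A) f x <= \int[m]_(x in B) f x)%E.
Proof.
move=> AB f0; rewrite integral_mkcond [leRHS]integral_mkcond.
apply: le_integral_nomeas => x _; rewrite !patchE.
case: ifPn => [/set_mem xA|_]; case: ifPn => [/set_mem xB|/negP xB] //.
- by rewrite lexx andbT f0.
- by exfalso; apply: xB; apply/mem_set/AB.
- by apply/andP; split; [exact: lexx|exact: f0].
- by apply/andP; split; exact: lexx.
Qed.

Lemma locL1_of_rect u : measurable_fun D u ->
  (forall p q b, del < p -> p < q -> q < rho -> 0 < b < a ->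
     leb2.-integrable (rect p q b) (EFin \o u)) -> locL1 D u.
Proof.
move=> mu iu; split=> // K KD cK.
have [p [q [b [dp pq qr ba KR]]]] := compact_sub_rect dr a0 cK KD.
have /integrableP[_ h] := iu p q b dp pq qr ba.
apply: le_lt_trans h.
exact: (@ge0_subset_integral_nomeas _ (measurableTypeR R * measurableTypeR R)%type
  (lebesgue_measure \x lebesgue_measure)%E K (rect p q b)).
Qed.

Lemma integrable_rect_cst p q b c : leb2.-integrable (rect p q b) (EFin \o (fun _ : R * R => c)).
Proof.
have ic (s t k : R) : leb.-integrable `[s, t] (EFin \o (fun _ : R => k)).
  apply: continuous_compact_integrable; first exact: segment_compact.
  by apply: continuous_subspaceT => x; exact: cst_continuous.
have := integrable_tensor _ _ (ic p q c) (ic (- b) b 1).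
move=> /(_ (measurable_itv _) (measurable_itv _)).
by apply: eq_integrable => // [|x _]; [exact: measurableX|rewrite /= mulr1].
Qed.

Lemma locL1_continuous u : continuous u -> locL1 D u.
Proof.
move=> cu; have mu := measurable_continuous2 cu.
apply: locL1_of_rect; first exact: measurable_funTS.
move=> p q b dp pq qr ba.
have mr := measurable_rect p q b.
have /compact_bounded[M [_ hM]] : compact (u @` rect p q b).
  by apply: continuous_compact; [exact: continuous_subspaceT|exact: compact_rect].
apply: (lint2_le (integrable_rect_cst p q b (`|M| + 1)) mr).
  exact: measurable_funTS.
by move=> x xr; apply: (hM (`|M| + 1)); [rewrite ltr_pwDr// ler_norm|exists x].
Qed.

Lemma locL1B u g : locL1 D u -> locL1 D g -> locL1 D (fun x => u x - g x).
Proof.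
move=> lu lg; apply: locL1_of_rect.
  by apply: measurable_funB; [exact: lu.1|exact: lg.1].
move=> p q b dp pq qr /andP[b0 ba]; have mr := measurable_rect p q b.
by apply: lint2B => //; [exact: (locL1_rect lu)|exact: (locL1_rect lg)].
Qed.

Section integration_by_parts.
Variables (p q b : R).
Hypotheses (dp : del < p) (pq : p < q) (qr : q < rho) (b0 : 0 < b) (ba : b < a).
Variables (u u' phi : R * R -> R).
Hypotheses (lu : locL1 D u) (lu' : locL1 D u').
Hypotheses (dphi : forall x, differentiable phi x) (vphi : vanish_off p q b phi).

Let cphi : continuous phi. Proof. by move=> x; exact: differentiable_continuous. Qed.

(** Fubini and integration by parts on each line z = const. Absolute continuity of [u] is available
    on compact parts of []del, rho[] only, so the integral is first cut to a slightly larger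
    interval []p', q'[], at whose ends [phi] vanishes. *)
Lemma weak_ibp1 : continuous (fun x => 'D_e1 phi x) ->
  (forall z, - a < z < a -> forall s t, del < s -> s <= t -> t < rho ->
     abs_cont s t (fun r => u (r, z)) (fun r => u' (r, z))) ->
  \int[leb2]_(x in D) (u x * 'D_e1 phi x) = - \int[leb2]_(x in D) (u' x * phi x).
Proof.
move=> cdphi acu.
have i1 := test_integrable lu dp qr ba cdphi (vanish_off_derive1 vphi).
have i2 := test_integrable lu' dp qr ba cphi vphi.
have mD := measurable_cyl del rho a.
apply/eqP; rewrite -subr_eq0 opprK addrC -(lRint2D i2 i1 mD).
apply/eqP; rewrite (@leb_fubini2 R `]del, rho[ `](- a), a[ (measurable_itv _) (measurable_itv _) _ (lint2D i2 i1 mD)).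
suff zero (z : R) : - a < z < a ->
    \int[leb]_(r in `]del, rho[) (u' (r, z) * phi (r, z) + u (r, z) * 'D_e1 phi (r, z)) = 0.
  by rewrite /Rintegral integral0_eq//= => z; rewrite in_itv/= => za; congr EFin; exact: zero.
move=> za; have ? := dp; have ? := pq; have ? := qr.
pose p' := (del + p) / 2; pose q' := (q + rho) / 2.
have [h1 h2 h3 h4] : [/\ del < p', p' < p, q < q' & q' < rho] by rewrite /p' /q'; split; lra.
have pq' : p' <= q' by lra.
rewrite (@lRint1_widen R _ `]p', q'[%classic); last 2 first.
- by apply: itvoo_subset; exact: ltW.
- move=> r _ nr; have nR : ~ rect p q b (r, z).
    move=> -[/= + _]; rewrite in_itv/= => /andP[pr rq]; apply: nr; rewrite /= in_itv/=; apply/andP; split; lra.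
  by rewrite vphi// (vanish_off_derive1 vphi)// !mulr0 addr0.
have acp : abs_cont p' q' (fun r => phi (r, z)) (fun r => 'D_e1 phi (r, z)).
  apply: AC_C1 => [r _|]; first exact: is_derive_slice1.
  by apply: continuous_subspaceT; exact: (continuous_slice2 (z := z) cdphi).
have [_ h] := AC_M pq' (acu z za p' q' h1 pq' h4) acp.
rewrite -(h p' q')// !vphi ?mulr0 ?subrr//.
  by move=> -[/= + _]; rewrite in_itv/= => /andP[? ?]; lra.
by move=> -[/= + _]; rewrite in_itv/= => /andP[? ?]; lra.
Qed.

Lemma weak_ibp2 : continuous (fun x => 'D_e2 phi x) ->
  (forall r, del < r < rho -> abs_cont (- a) a (fun z => u (r, z)) (fun z => u' (r, z))) ->
  \int[leb2]_(x in D) (u x * 'D_e2 phi x) = - \int[leb2]_(x in D) (u' x * phi x).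
Proof.
move=> cdphi acu.
have i1 := test_integrable lu dp qr ba cdphi (vanish_off_derive2 vphi).
have i2 := test_integrable lu' dp qr ba cphi vphi.
have mD := measurable_cyl del rho a.
apply/eqP; rewrite -subr_eq0 opprK addrC -(lRint2D i2 i1 mD).
apply/eqP; rewrite (@leb_fubini1 R `]del, rho[ `](- a), a[ (measurable_itv _) (measurable_itv _) _ (lint2D i2 i1 mD)).
suff zero (r : R) : del < r < rho ->
    \int[leb]_(z in `](- a), a[) (u' (r, z) * phi (r, z) + u (r, z) * 'D_e2 phi (r, z)) = 0.
  by rewrite /Rintegral integral0_eq//= => r; rewrite in_itv/= => rdr; congr EFin; exact: zero.
move=> rdr; have ? := a0; have ? := b0; have ? := ba.
have na : - a <= a by lra.
have acp : abs_cont (- a) a (fun z => phi (r, z)) (fun z => 'D_e2 phi (r, z)).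
  apply: AC_C1 => [z _|]; first exact: is_derive_slice2.
  by apply: continuous_subspaceT; exact: (continuous_slice1 (r := r) cdphi).
have [_ h] := AC_M na (acu r rdr) acp.
rewrite -(h (- a) a)// !vphi ?mulr0 ?subrr//.
  by move=> -[/= _]; rewrite in_itv/= => /andP[? ?]; lra.
by move=> -[/= _]; rewrite in_itv/= => /andP[? ?]; lra.
Qed.

End integration_by_parts.

Lemma weak_der_smooth1 f : smooth f -> weak_der D 1 0 f (pder 1 0 f).
Proof.
move=> sf; have cf : continuous f := @continuous_pder R 0 0 f sf.
have cf1 : continuous (fun x => 'D_e1 f x) := @continuous_pder R 1 0 f sf.
split; [exact: locL1_continuous|exact: locL1_continuous|].
move=> phi sphi /(supported_vanish_off dr a0)[p [q [b [dp pq qr /andP[b0 ba] vphi]]]].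
rewrite expr1 mulN1r.
have dphi : forall x, differentiable phi x by exact: (sphi 0%N 0%N).
have cdphi : continuous (fun x => 'D_e1 phi x) := @continuous_pder R 1 0 phi sphi.
have lf : locL1 D f by exact: locL1_continuous.
have lf1 : locL1 D (fun x => 'D_e1 f x) by exact: locL1_continuous.
apply: (weak_ibp1 (p := p) (q := q) (b := b)) => //.
move=> z _ s t _ _ _; apply: AC_C1 => [r _|]; first exact: (is_derive_slice1 (sf 0 0 _)).
by apply: continuous_subspaceT; exact: (continuous_slice2 (z := z) cf1).
Qed.

Lemma weak_der_smooth2 f : smooth f -> weak_der D 0 1 f (pder 0 1 f).
Proof.
move=> sf; have cf : continuous f := @continuous_pder R 0 0 f sf.
have cf1 : continuous (fun x => 'D_e2 f x) := @continuous_pder R 0 1 f sf.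
split; [exact: locL1_continuous|exact: locL1_continuous|].
move=> phi sphi /(supported_vanish_off dr a0)[p [q [b [dp pq qr /andP[b0 ba] vphi]]]].
rewrite expr1 mulN1r.
have dphi : forall x, differentiable phi x by exact: (sphi 0%N 0%N).
have cdphi : continuous (fun x => 'D_e2 phi x) := @continuous_pder R 0 1 phi sphi.
have lf : locL1 D f by exact: locL1_continuous.
have lf1 : locL1 D (fun x => 'D_e2 f x) by exact: locL1_continuous.
apply: (weak_ibp2 (p := p) (q := q) (b := b)) => //.
move=> r _; apply: AC_C1 => [z _|]; first exact: (is_derive_slice2 (sf 0 0 _)).
by apply: continuous_subspaceT; exact: (continuous_slice1 (r := r) cf1).
Qed.

Lemma weak_der_id u : locL1 D u -> weak_der D 0 0 u u.
Proof. by move=> lu; split => // phi _ _; rewrite expr0 mul1r. Qed.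

Lemma weak_der_test_integrable u f i j : locL1 D u -> smooth f -> supported_in D f ->
  leb2.-integrable D (EFin \o (fun x => u x * pder i j f x)).
Proof.
move=> lu sf /(supported_vanish_off dr a0)[p [q [b [dp pq qr /andP[b0 ba] vf]]]].
by apply: (test_integrable lu dp qr ba); [exact: continuous_pder|exact: vanish_off_pder].
Qed.

Lemma weak_derB i j u g u' g' : weak_der D i j u g -> weak_der D i j u' g' ->
  weak_der D i j (fun x => u x - u' x) (fun x => g x - g' x).
Proof.
move=> [lu lg h] [lu' lg' h']; split; [exact: locL1B|exact: locL1B|].
move=> phi sphi supp; have mD := measurable_cyl del rho a.
have t f k l : locL1 D f -> leb2.-integrable D (EFin \o (fun x => f x * pder k l phi x)).
  by move=> lf; exact: weak_der_test_integrable.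
transitivity (\int[leb2]_(x in D) (u x * pder i j phi x) - \int[leb2]_(x in D) (u' x * pder i j phi x)).
  by rewrite -(lRint2B (t _ i j lu) (t _ i j lu') mD); apply: lRint2_eq => x _; rewrite mulrBl.
rewrite h// h'// -mulrBr; congr (_ * _).
by rewrite -(lRint2B (t _ 0 0 lg) (t _ 0 0 lg') mD); apply: lRint2_eq => x _; rewrite mulrBl.
Qed.

Lemma weak_der_sub del' i j u g : del <= del' -> del' < rho ->
  weak_der D i j u g -> weak_der (cyl del' rho a) i j u g.
Proof.
move=> dd dr' [lu lg h].
have sub : cyl del' rho a `<=` D.
  by move=> [r z] [/= rr zz]; split => //=; exact: (itvoo_subset dd (lexx _)).
have ls f : locL1 D f -> locL1 (cyl del' rho a) f.
  move=> [mf hf]; split => [|K KD cK]; last by apply: hf => //; exact: subset_trans sub.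
  by apply: measurable_funS mf => //; exact: measurable_cyl.
split; [exact: ls|exact: ls|] => phi sphi supp.
have [p [q [b [dp pq qr /andP[b0 ba] v]]]] := supported_vanish_off dr' a0 supp.
have nr x : D x -> ~ cyl del' rho a x -> ~ rect p q b x.
  by move=> _ nx /(rect_sub dp qr ba).
have := h phi sphi; rewrite !(@lRint2_widen R D (cyl del' rho a))//.
- by apply; have [K [cK KD vK]] := supp; exists K; split => //; exact: subset_trans sub.
- by move=> x Dx nx; rewrite v ?mulr0//; exact: nr.
- by move=> x Dx nx; rewrite (vanish_off_pder i j v) ?mulr0//; exact: nr.
Qed.

End weak_derivative_rules.

(** * Uniqueness of weak derivatives *)

Section weak_uniqueness.
Context {R : realType}.
Notation leb := (@lebesgue_measure R).
Implicit Types (del rho a p q b : R) (F u g : R * R -> R).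

Lemma cvg_flat0 (t : R) (s : nat -> R) : 0 < t -> s n @[n --> \oo] --> t ->
  flat (harmonic n) 0 (s n) @[n --> \oo] --> (1 : R).
Proof.
move=> t0 st; rewrite -[X in _ --> X](@expR0 R).
have c1 : - (harmonic n * (s n)^-1) @[n --> \oo] --> (0 : R).
  rewrite -oppr0 -(mul0r t^-1); apply: cvgN; apply: cvgM; first exact: cvg_harmonic.
  by apply: cvgV => //; rewrite gt_eqF.
have c2 : expR (- (harmonic n * (s n)^-1)) @[n --> \oo] --> expR (0 : R).
  by apply: (cvg_comp _ _ c1); exact: continuous_expR.
apply: cvg_trans c2; apply: near_eq_cvg.
have sp : \forall n \near \oo, 0 < s n by exact: (cvgr_gt t st).
by near=> n; rewrite /flat ifT ?expr0 ?mul1r//; near: n.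
Unshelve. all: by end_near. Qed.

Lemma cvg_bump p q x : p < x < q -> bumpf (harmonic n) p q x @[n --> \oo] --> (1 : R).
Proof.
move=> /andP[px xq]; rewrite -(mulr1 1); apply: cvgM.
  apply: (@cvg_flat0 (x - p)); first by rewrite subr_gt0.
  rewrite -[X in _ --> X]subr0 -addrA -opprD; apply: cvgB; first exact: cvg_cst.
  by apply: cvgD; [exact: cvg_cst|exact: cvg_harmonic].
apply: (@cvg_flat0 (q - x)); first by rewrite subr_gt0.
rewrite -[X in _ --> X - _]subr0; apply: cvgB; last exact: cvg_cst.
by apply: cvgB; [exact: cvg_cst|exact: cvg_harmonic].
Qed.

(** Products of bumps with the sine are admissible test functions; on the rectangle they tend
    boundedly to the sine. The sine belongs to [b] rather than [a], so that completeness can be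
    applied on []-b, b[]. *)
Lemma weak_zero_moment del rho a p q b n F : locL1 (cyl del rho a) F ->
  (forall phi, smooth phi -> supported_in (cyl del rho a) phi ->
     \int[leb2]_(x in cyl del rho a) (F x * phi x) = 0) ->
  del < p -> q < rho -> b < a ->
  \int[leb2]_(x in `]p, q[ `*` `](- b), b[) (F x * sn b n x.2) = 0.
Proof.
move=> lF Fphi dp qr ba.
pose phi m := tensor (bumpf (harmonic m) p q) (fun z => bumpf (harmonic m) (- b) b z * sn b n z).
have mE : measurable (`]p, q[ `*` `](- b), b[ : set (R * R)) by exact: measurableX.
have iF : leb2.-integrable (`]p, q[ `*` `](- b), b[) (EFin \o F).
  apply: (lint2_sub (locL1_rect lF dp qr ba) (measurable_rect _ _ _) mE).
  by move=> x [/= h1 h2]; split; exact: subset_itv_oo_cc.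
have h0 m : 0 < harmonic m :> R by rewrite /harmonic/= invr_gt0.
have sphi m : smooth (phi m).
  apply: smooth_tensor; first exact: smooth1_bump.
  by apply: smooth1M; [exact: smooth1_bump|exact: smooth1_sn].
have vphi m x : ~ (`]p, q[ `*` `](- b), b[) x -> phi m x = 0.
  move=> nx; rewrite /phi /tensor.
  have [hp|hp] := boolP (p + harmonic m < x.1 < q - harmonic m); last by rewrite bump_out// mul0r.
  have [hb|hb] := boolP (- b + harmonic m < x.2 < b - harmonic m); last first.
    by rewrite (bump_out hb) mul0r mulr0.
  have := h0 m; move: (harmonic m) hp hb => h hp hb hh.
  by exfalso; apply: nx; split; rewrite /= in_itv/=; lra.
have z0 m : \int[leb2]_(x in `]p, q[ `*` `](- b), b[) (F x * phi m x) = 0.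
  rewrite -(Fphi _ (sphi m)); last first.
    apply: (vanish_off_supported dp qr ba) => x nx; apply: vphi => -[h1 h2]; apply: nx.
    by split; exact: subset_itv_oo_cc.
  apply/esym/lRint2_widen => [x [/= h1 h2]|x _ nx]; last by rewrite vphi ?mulr0.
  by apply: (rect_sub dp qr ba); split; exact: subset_itv_oo_cc.
have mF : measurable_fun (`]p, q[ `*` `](- b), b[) F by exact: lint2_measurable iF.
have ms : measurable_fun (`]p, q[ `*` `](- b), b[) (fun x : R * R => sn b n x.2).
  by apply: measurable_funTS; apply: (measurableT_comp (continuous_measurable_fun (@continuous_sn _ _ _)));
    exact: measurable_snd.
have := @lRint2_dct R (`]p, q[ `*` `](- b), b[) (fun m x => F x * phi m x)
  (fun x => F x * sn b n x.2) (fun x => `|F x|) mE.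
move=> h; have {}h : \int[leb2]_(x in `]p, q[ `*` `](- b), b[) (F x * phi m x) @[m --> \oo] -->
    \int[leb2]_(x in `]p, q[ `*` `](- b), b[) (F x * sn b n x.2).
  apply: h.
  - move=> m; apply: measurable_funM => //; apply: measurable_funTS.
    apply: measurable_continuous2; exact: (@continuous_pder _ 0 0 _ (sphi m)).
  - exact: measurable_funM.
  - exact: lint2_norm.
  - move=> m x _; rewrite normrM -[leRHS]mulr1; apply: ler_wpM2l => //.
    have nb (s t y : R) : `|bumpf (harmonic m) s t y| <= 1.
      by rewrite ger0_norm ?bump_ge0//; apply: bump_le1; exact: ltW.
    rewrite /phi /tensor normrM; apply: mulr_ile1 => //.
    by rewrite normrM; apply: mulr_ile1 => //; exact: norm_sn.
  - apply: aeW => x [/= x1 x2]; move: x1 x2; rewrite !in_itv/= => x1 x2.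
    apply: cvgM; first exact: cvg_cst.
    rewrite -[X in _ --> X]mul1r; apply: cvgM; first exact: cvg_bump.
    by rewrite -[X in _ --> X]mul1r; apply: cvgM; [exact: cvg_bump|exact: cvg_cst].
have c0 : \int[leb2]_(x in `]p, q[ `*` `](- b), b[) (F x * phi m x) @[m --> \oo] --> (0 : R).
  by under eq_cvg do rewrite z0; exact: cvg_cst.
exact: (cvg_unique _ h c0).
Qed.

(** The fundamental lemma of the calculus of variations by means of sines: letting the left end vary
    in the moments shows that each sine moment of [F] in z vanishes for almost every r. The moments
    being countable, one null set serves for all of them, and completeness on []-b, b[] applies to
    almost every line. *)
Lemma weak_zero_rect del rho a p q b F : locL1 (cyl del rho a) F ->
  (forall phi, smooth phi -> supported_in (cyl del rho a) phi ->
     \int[leb2]_(x in cyl del rho a) (F x * phi x) = 0) ->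
  del < p -> q < rho -> b < a -> {ae leb2, forall x, cyl p q b x -> F x = 0}.
Proof.
move=> lF Fphi dp qr ba.
have [b0|b0] := leP b 0.
  by apply: aeW => x [_ /=]; rewrite in_itv/= => ?; lra.
have iF : leb2.-integrable (`]p, q[ `*` `](- b), b[) (EFin \o F).
  apply: (lint2_sub (locL1_rect lF dp qr ba) (measurable_rect _ _ _)); first exact: measurableX.
  by move=> x [/= h1 h2]; split; exact: subset_itv_oo_cc.
have mI : measurable (`]p, q[%classic : set R) by [].
have mJ : measurable (`](- b), b[%classic : set R) by [].
apply: leb_ae_eq0_of_slices1 => //; first exact: lint2_measurable iF.
have iFs n : leb2.-integrable (`]p, q[ `*` `](- b), b[) (EFin \o (fun x => F x * sn b n x.2)).
  apply: lint2_le (lint2_norm iF) _ _ _; first exact: measurableX.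
    apply: measurable_funM; first exact: lint2_measurable iF.
    by apply: measurable_funTS; apply: (measurableT_comp (continuous_measurable_fun (@continuous_sn _ _ _)));
      exact: measurable_snd.
  by move=> x _; rewrite normrM -[leRHS]mulr1; apply: ler_wpM2l => //; exact: norm_sn.
have h1 : {ae leb, forall r, forall n, p < r < q ->
    \int[leb]_(z in `](- b), b[) (F (r, z) * sn b n z) = 0}.
  apply: ae_foralln => n; apply: ae_eq0_of_primitive0.
    exact: (leb_integrable_fubini1 mI mJ (iFs n)).
  move=> s /andP[ps sq].
  have iFs' : leb2.-integrable (`]s, q[ `*` `](- b), b[) (EFin \o (fun x => F x * sn b n x.2)).
    apply: (lint2_sub (iFs n)); [exact: measurableX|exact: measurableX|].
    by move=> x [/= k1 k2]; split => //; exact: (itvoo_subset (ltW ps) (lexx _)).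
  rewrite -(leb_fubini1 _ mJ iFs')//.
  by apply: (weak_zero_moment n lF Fphi) => //; exact: lt_trans ps.
apply: ae_imp2 h1 (leb_ae_integrable1 mI mJ iF) => r h1 h2 rpq; move: (rpq); rewrite /= in_itv/= => rpq'.
have := @sine_complete R b b0 (fun z => F (r, z)) (h2 rpq) (fun n => h1 n rpq').
by apply: ae_imp => z hz; rewrite /= in_itv/=; exact: hz.
Qed.

Lemma weak_zero_ae del rho a F : locL1 (cyl del rho a) F ->
  (forall phi, smooth phi -> supported_in (cyl del rho a) phi ->
     \int[leb2]_(x in cyl del rho a) (F x * phi x) = 0) ->
  {ae leb2, forall x, cyl del rho a x -> F x = 0}.
Proof.
move=> lF Fphi.
have h : {ae leb2, forall x, forall m, cyl (del + harmonic m) (rho - harmonic m) (a - harmonic m) x -> F x = 0}.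
  apply: ae_foralln => m; have h0 : 0 < harmonic m :> R by rewrite /harmonic/= invr_gt0.
  by apply: (weak_zero_rect lF Fphi); rewrite ?ltrDl ?gtrBl.
apply: ae_imp h => -[r z] h [/=]; rewrite !in_itv/= => /andP[r1 r2] /andP[z1 z2].
pose e : R := Num.min (Num.min (r - del) (rho - r)) (Num.min (z + a) (a - z)).
have e0 : 0 < e by rewrite !lt_min; apply/andP; split; apply/andP; split; lra.
have [N _ hN] := near_infty_natSinv_lt (PosNum e0).
have {hN} := hN N (leqnn _) => /= hN.
have [m1 m2 m3 m4] : [/\ e <= r - del, e <= rho - r, e <= z + a & e <= a - z].
  by rewrite /e !ge_min !lexx /= ?orbT; split.
have [k [hk hN']] : exists k : R, k = harmonic N /\ k < e by exists (harmonic N).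
by apply: (h N); rewrite -hk; split; rewrite /= in_itv/=; lra.
Qed.

Lemma weak_der_unique del rho a i j u g g' : del < rho -> 0 < a ->
  weak_der (cyl del rho a) i j u g -> weak_der (cyl del rho a) i j u g' ->
  {ae leb2, forall x, cyl del rho a x -> g x = g' x}.
Proof.
move=> dr a0 w w'; have [_ lF h] := weak_derB dr a0 w w'.
have : {ae leb2, forall x, cyl del rho a x -> g x - g' x = 0}.
  apply: (weak_zero_ae lF) => phi sphi supp; have := h phi sphi supp.
  rewrite {1}/Rintegral integral0_eq; last by move=> x _; rewrite subrr mul0r.
  by move/esym/eqP; rewrite mulf_eq0 signr_eq0/= => /eqP.
by apply: ae_imp => x hx Dx; apply/eqP; rewrite -subr_eq0; exact/eqP/hx.
Qed.

(** By uniqueness almost everywhere all members of the set in the infimum are equal, so any weak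
    derivative computes the norm. *)
Lemma der_norm2_eq del rho a nu i j u g : del < rho -> 0 < a ->
  weak_der (cyl del rho a) i j u g ->
  (der_norm2 (cyl del rho a) nu i j u =
   \int[leb2]_(x in cyl del rho a) ((g x) ^+ 2 * x.1 `^ (2 * nu) * x.1)%:E)%E.
Proof.
move=> dr a0 w; apply/eqP; rewrite eq_le; apply/andP; split.
  by apply: ereal_inf_lbound; exists g.
apply: le_ereal_inf_tmp => _ [g' w' <-].
have mw (f : R * R -> R) : weak_der (cyl del rho a) i j u f -> measurable_fun (cyl del rho a)
    (fun x => ((f x) ^+ 2 * x.1 `^ (2 * nu) * x.1)%:E).
  move=> [_ [mf _] _]; apply/measurable_EFinP; apply: measurable_funM.
    by apply: measurable_funM; [exact: measurable_funX|exact: measurable_powR_fst].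
  by apply: measurable_funTS; exact: measurable_fst.
rewrite le_eqVlt; apply/orP; left; apply/eqP.
apply: (@ae_eq_integral _ (measurableTypeR R * measurableTypeR R)%type R
  (lebesgue_measure \x lebesgue_measure)%E) => //.
- exact: measurable_cyl.
- exact: mw.
- exact: mw.
by apply: ae_imp (weak_der_unique dr a0 w w') => x h Dx; rewrite h.
Qed.

(** The infimum over the empty set is +oo. *)
Lemma der_norm2_fin del rho a nu i j u : (der_norm2 (cyl del rho a) nu i j u < +oo)%E ->
  exists g, weak_der (cyl del rho a) i j u g.
Proof.
move=> h; apply: contrapT => ng; move: h; rewrite /der_norm2.
suff -> : weak_der (cyl del rho a) i j u = set0 by rewrite image_set0 ereal_inf0 ltxx.
by apply/seteqP; split => // g w; apply: ng; exists g.
Qed.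

End weak_uniqueness.

(** * Traces *)

Section measurable_parameter_integral.
Context {d1 d2} {T1 : measurableType d1} {T2 : measurableType d2} {R : realType}.
Variables (m : {sigma_finite_measure set T1 -> \bar R}) (A : set T1) (B : set T2).
Hypotheses (mA : measurable A) (mB : measurable B).

(** The Boolean [b] encodes a moving limit of integration: with the condition s > r or s < r it
    gives the joint measurability in (r, z) of primitives in r. Tonelli's theorem is applied to the
    positive and the negative part separately. *)
Lemma measurable_parameter_Rintegral (b : (T1 * T2) * T1 -> bool) (F : T1 * T2 -> R) :
  measurable_fun setT b -> measurable_fun (A `*` B) F ->
  measurable_fun (A `*` B) (fun x => \int[m]_(s in A) (if b (x, s) then F (s, x.2) else 0)).
Proof.
move=> mb mF.
have mAB : measurable (A `*` B) by exact: measurableX.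
have mABA : measurable ((A `*` B) `*` A) by exact: measurableX.
pose H (y : (T1 * T2) * T1) := (if b y then F (y.2, y.1.2) else 0)%:E.
have mH : measurable_fun ((A `*` B) `*` A) H.
  apply/measurable_EFinP; apply: measurable_fun_if => //; first exact: measurable_funTS.
  apply: (@measurable_funS _ _ _ _ ((A `*` B) `*` A)); [by []|exact: subIsetl|].
  apply: (@measurable_comp _ _ _ _ _ _ (A `*` B) F _ (fun y : (T1 * T2) * T1 => (y.2, y.1.2))) => //.
    by move=> _ [[[r z] s] [/= [_ Bz] As] <-].
  apply: measurable_funTS; apply: measurable_fun_pair; first exact: measurable_snd.
  by apply: (measurableT_comp measurable_snd); exact: measurable_fst.
rewrite /Rintegral; apply: (measurableT_comp (fine_measurable measurableT)).
have -> : (fun x => \int[m]_(s in A) (if b (x, s) then F (s, x.2) else 0)%:E)%E =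
  (fun x => (\int[m]_(s in A) H^\+ (x, s))%E - (\int[m]_(s in A) H^\- (x, s))%E)%E.
  by apply/funext => x; rewrite [LHS]integralE; congr (_ - _)%E; apply: eq_integral => s _; rewrite ?funeposE ?funenegE.
apply: emeasurable_funB.
  apply: (measurable_tonelli1 m mAB mA (F := H^\+%E)) => //; exact: measurable_funepos.
apply: (measurable_tonelli1 m mAB mA (F := H^\-%E)) => //; exact: measurable_funeneg.
Qed.

End measurable_parameter_integral.

Section leb_parameter_integral.
Context {R : realType}.
Notation leb := (@lebesgue_measure R).
Local Notation T := (measurableTypeR R).

Lemma leb_measurable_parameter (A B : set R) (b : (R * R) * R -> bool) (F : R * R -> R) :
  measurable A -> measurable B -> measurable_fun setT b -> measurable_fun (A `*` B) F ->
  measurable_fun (A `*` B) (fun x => \int[leb]_(s in A) (if b (x, s) then F (s, x.2) else 0)).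
Proof.
move=> mA mB; exact: (@measurable_parameter_Rintegral _ _ T T R leb A B mA mB b F).
Qed.

Lemma measurable_primitive_right (del sig rho a : R) (F : R * R -> R) : del <= sig ->
  measurable_fun (cyl del rho a) F ->
  measurable_fun (cyl del rho a) (fun x => \int[leb]_(s in `]x.1, rho[) F (s, x.2)) /\
  measurable_fun (cyl del rho a) (fun x => \int[leb]_(s in `]sig, rho[) F (s, x.2)).
Proof.
move=> ds mF; split.
  apply: eq_measurable_fun (@leb_measurable_parameter `]del, rho[ `](- a), a[ (fun y => y.1.1 < y.2) F _ _ _ mF) => //.
    move=> [r z]; rewrite inE => -[/= + _]; rewrite in_itv/= => /andP[dr rr].
    rewrite (@lRint1_widen R `]del, rho[ `]r, rho[)//.
    - by apply: lRint1_eq => s; rewrite /= in_itv/= => /andP[-> _].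
    - by apply: itvoo_subset => //; exact: ltW.
    - move=> s; rewrite /= in_itv/= => /andP[_ sr] ns; rewrite ifF//.
      by apply/negP => rs; apply: ns; rewrite in_itv/= rs.
  apply: measurable_fun_ltr; last exact: measurable_snd.
  by apply: (measurableT_comp measurable_fst); exact: measurable_fst.
apply: eq_measurable_fun (@leb_measurable_parameter `]del, rho[ `](- a), a[ (fun y => sig < y.2) F _ _ _ mF) => //.
  move=> [r z]; rewrite inE => -[/= + _]; rewrite in_itv/= => /andP[dr rr].
  rewrite (@lRint1_widen R `]del, rho[ `]sig, rho[)//.
  - by apply: lRint1_eq => s; rewrite /= in_itv/= => /andP[-> _].
  - exact: itvoo_subset.
  - move=> s; rewrite /= in_itv/= => /andP[_ sr] ns; rewrite ifF//.
    by apply/negP => rs; apply: ns; rewrite in_itv/= rs.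
apply: measurable_fun_ltr; last exact: measurable_snd.
exact: measurable_cst.
Qed.

Lemma measurable_primitive_left (del rho a : R) (F : R * R -> R) :
  measurable_fun (cyl del rho a) F ->
  measurable_fun (cyl del rho a) (fun x => \int[leb]_(s in `]del, x.1[) F (s, x.2)).
Proof.
move=> mF.
apply: eq_measurable_fun (@leb_measurable_parameter `]del, rho[ `](- a), a[ (fun y => y.2 < y.1.1) F _ _ _ mF) => //.
  move=> [r z]; rewrite inE => -[/= + _]; rewrite in_itv/= => /andP[dr rr].
  rewrite (@lRint1_widen R `]del, rho[ `]del, r[)//.
  - by apply: lRint1_eq => s; rewrite /= in_itv/= => /andP[_ ->].
  - by apply: itvoo_subset => //; exact: ltW.
  - move=> s; rewrite /= in_itv/= => /andP[ds _] ns; rewrite ifF//.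
    by apply/negP => rs; apply: ns; rewrite in_itv/= ds.
apply: measurable_fun_ltr; first exact: measurable_snd.
by apply: (measurableT_comp measurable_fst); exact: measurable_fst.
Qed.

End leb_parameter_integral.

Section small_L1.
Context {d} {T : measurableType d} {R : realType} (m : {measure set T -> \bar R}).

(** Pointwise either |g| <= eta or |g| <= g^2 / eta <= g^2 w / (del eta). This is the additive form
    of Cauchy-Schwarz, free of square roots. *)
Lemma L1_le_L2 (D : set T) (g w : T -> R) (del eta C : R) :
  measurable D -> measurable_fun D g -> measurable_fun D w -> 0 < del -> 0 < eta ->
  (forall x, D x -> del <= w x) -> (m D <= C%:E)%E ->
  (\int[m]_(x in D) `|g x|%:E <=
   (eta * C)%:E + (del * eta)^-1%:E * \int[m]_(x in D) ((g x) ^+ 2 * w x)%:E)%E.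
Proof.
move=> mD mg mw d0 e0 dw mC.
have c0 : 0 < (del * eta)^-1 by rewrite invr_gt0 mulr_gt0.
have gw0 x : D x -> 0 <= g x ^+ 2 * w x.
  by move=> Dx; rewrite mulr_ge0 ?sqr_ge0// (le_trans _ (dw x Dx))// ltW.
have mgw : measurable_fun D (fun x => (g x ^+ 2 * w x)%:E).
  by apply/measurable_EFinP; apply: measurable_funM => //; exact: measurable_funX.
apply: (@le_trans _ _ (\int[m]_(x in D) (eta%:E + (del * eta)^-1%:E * (g x ^+ 2 * w x)%:E))%E).
  apply: le_integral_nomeas => x Dx; rewrite lee_fin normr_ge0/= -EFinM -EFinD lee_fin.
  have [h|h] := leP `|g x| eta.
    by apply: (le_trans h); rewrite lerDl mulr_ge0 ?gw0// ltW.
  apply: (@le_trans _ _ ((del * eta)^-1 * (g x ^+ 2 * del))); last first.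
    apply: (@le_trans _ _ ((del * eta)^-1 * (g x ^+ 2 * w x))); last by rewrite lerDr ltW.
    by apply: ler_wpM2l; [exact: ltW|apply: ler_wpM2l; [exact: sqr_ge0|exact: dw]].
  have -> : (del * eta)^-1 * (g x ^+ 2 * del) = `|g x| ^+ 2 / eta.
    by rewrite real_normK ?num_real//; field; rewrite !gt_eqF.
  by rewrite expr2 -mulrA ler_peMr// ler_pdivlMr// mul1r ltW.
rewrite ge0_integralD//; last 3 first.
- by move=> x _; rewrite lee_fin ltW.
- by move=> x Dx; rewrite mule_ge0// lee_fin ?gw0// ltW.
- exact: measurable_funeM.
rewrite integral_cst// ge0_integralZl_EFin//; [|exact: ltW].
by rewrite leeD2r// EFinM; apply: lee_wpmul2l => //; rewrite lee_fin ltW.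
Qed.

(** The parameter [eta] and the threshold [e'] make both terms of [L1_le_L2] at most e / 2; they do
    not depend on [g]. *)
Lemma small_L1 (D : set T) (w : T -> R) (del C e : R) :
  measurable D -> measurable_fun D w -> 0 < del ->
  (forall x, D x -> del <= w x) -> (m D <= C%:E)%E -> 0 < e ->
  exists2 e' : R, 0 < e' & forall g : T -> R, measurable_fun D g ->
    (\int[m]_(x in D) ((g x) ^+ 2 * w x)%:E <= e'%:E)%E -> (\int[m]_(x in D) `|g x|%:E <= e%:E)%E.
Proof.
move=> mD mw d0 dw mC e0.
have C0 : 0 <= C by rewrite -lee_fin; apply: le_trans mC.
have C1 : 0 < 2 * (C + 1) by rewrite mulr_gt0// ltr_wpDl.
pose eta := e / (2 * (C + 1)).
have eta0 : 0 < eta by rewrite divr_gt0.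
exists (e / 2 * (del * eta)); first by apply: mulr_gt0; [exact: divr_gt0|exact: mulr_gt0].
move=> g mg h; apply: le_trans (L1_le_L2 mD mg mw d0 eta0 dw mC) _.
apply: (@le_trans _ _ ((eta * C)%:E + (del * eta)^-1%:E * (e / 2 * (del * eta))%:E)%E).
  by rewrite leeD2l// lee_wpmul2l// lee_fin invr_ge0 mulr_ge0// ltW.
rewrite -EFinM -EFinD lee_fin [X in _ + X]mulrC mulfK; last by rewrite mulf_neq0// gt_eqF.
have : eta * C <= e / 2.
  rewrite /eta invfM mulrA -mulrA ler_piMr//; first by rewrite divr_ge0// ltW.
  by rewrite mulrC ler_pdivrMr ?ltr_wpDl// mul1r lerDl.
by rewrite [X in _ -> _ <= X](splitr e); lra.
Qed.

Lemma ae_eq0_of_small (D : set T) (g : T -> R) (C : R) : measurable D -> measurable_fun D g -> 0 <= C ->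
  (forall e : R, 0 < e -> (\int[m]_(x in D) `|g x|%:E <= (C * e)%:E)%E) ->
  {ae m, forall x, D x -> g x = 0}.
Proof.
move=> mD mg C0 h.
have mg' : measurable_fun D (EFin \o g) by exact/measurable_EFinP.
have z : (\int[m]_(x in D) `|(EFin \o g) x| = 0)%E.
  apply/eqP; rewrite eq_le integral_ge0// andbT.
  apply/lee_addgt0Pr => e e0; rewrite add0e.
  have C1 : 0 < C + 1 by rewrite ltr_wpDl.
  apply: le_trans (h (e / (C + 1)) _) _; first exact: divr_gt0.
  by rewrite lee_fin mulrA ler_pdivrMr// mulrC ler_pM2l// lerDl.
by apply: ae_imp ((ae_eq_integral_abs m mD mg').1 z) => x hx Dx; have [] := hx Dx.
Qed.

End small_L1.

(** * Boundary conditions as integral identities *)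

Section traces.
Context {R : realType}.
Notation leb := (@lebesgue_measure R).
Implicit Types (u ur uz f : R * R -> R) (e r z : R).

Lemma near_le_of_cvg0 (x : nat -> \bar R) : x n @[n --> \oo] --> 0%E ->
  forall e : R, 0 < e -> \forall n \near \oo, (x n <= e%:E)%E.
Proof.
move=> /fine_cvgP[xfin xc] e e0.
have xlt : \forall t \near \oo, (fine \o x) t < e by exact: (cvgr_lt 0 xc).
near=> n; have xf : x n \is a fin_num by near: n.
by rewrite -(fineK xf) lee_fin; apply: ltW; near: n.
Unshelve. all: by end_near. Qed.

Lemma der_norm2_ge0 del rho a nu i j u : 0 <= del ->
  (0 <= der_norm2 (cyl del rho a : set (R * R)) nu i j u)%E.
Proof.
move=> d0; apply: le_ereal_inf_tmp => _ [g _ <-].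
apply: integral_ge0 => x [/= + _]; rewrite in_itv/= => /andP[dx _].
have x0 : 0 <= x.1 := ltW (le_lt_trans d0 dx).
by rewrite lee_fin; apply: mulr_ge0 => //; apply: mulr_ge0; [exact: sqr_ge0|exact: powR_ge0].
Qed.

Lemma H1_norm2E (D : set (R * R)) u :
  (H1_norm2 D u = der_norm2 D 0 0 0 u + der_norm2 D 0 0 1 u + der_norm2 D 0 1 0 u)%E.
Proof.
rewrite /H1_norm2; under eq_bigr do rewrite big_mkcond /=.
have s2 (f : 'I_2 -> \bar R) : (\sum_(i < 2) f i = f ord0 + f (lift ord0 ord0))%E.
  by rewrite big_ord_recl big_ord1.
by rewrite !s2 /= adde0.
Qed.

Section approximation.
Variables (del0 del rho a : R).
Hypotheses (d00 : 0 <= del0) (d01 : del0 <= del) (d0 : 0 < del) (dr : del < rho) (a0 : 0 < a).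
Notation D := (cyl del rho a).
Notation I := (`]del, rho[%classic : set R).
Notation J := (`](- a), a[%classic : set R).

Let mI : measurable I. Proof. by []. Qed.
Let mJ : measurable J. Proof. by []. Qed.
Let mD : measurable D. Proof. exact: measurable_cyl. Qed.

Lemma leb_itvoo (s t : R) : s <= t -> leb `]s, t[%classic = (t - s)%:E.
Proof.
move=> st; rewrite lebesgue_measure_itv/= lte_fin; case: ltgtP st => // -> _.
by rewrite subrr.
Qed.

Lemma leb2_cyl : leb2 D = ((rho - del) * (a + a))%:E.
Proof.
rewrite /cyl (@product_measure1E _ _ (measurableTypeR R) (measurableTypeR R))//.
have := a0; have := dr => dr' a0'.
transitivity (leb I * leb J)%E; first by [].
have na : - a <= a by lra.
by rewrite (leb_itvoo (ltW dr)) (leb_itvoo na) opprK.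
Qed.

(** On r > [del] the weight r is at least [del], so smallness in H^1 gives smallness in L^1. Two
    radii occur because the trace of [psi] is given on the whole cylinder ([del0] is 0) and that of
    [omega] on its parts ([del0] is [del]), while the errors are measured on r > [del] in both
    cases. *)
Lemma smooth_approximation u ur uz N :
  has_trace (cyl del0 rho a) N u (fun=> 0) -> locL1 (cyl del0 rho a) u ->
  weak_der (cyl del0 rho a) 1 0 u ur -> weak_der (cyl del0 rho a) 0 1 u uz ->
  forall e, 0 < e -> exists f, [/\ smooth f,
    (\int[leb2]_(x in D) `|f x - u x|%:E <= e%:E)%E,
    (\int[leb2]_(x in D) `|pder 1 0 f x - ur x|%:E <= e%:E)%E,
    (\int[leb2]_(x in D) `|pder 0 1 f x - uz x|%:E <= e%:E)%E &
    (N f <= e%:E)%E].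
Proof.
move=> [f [sf fu fN]] lu wr wz e e0.
have dr0 : del0 < rho by apply: le_lt_trans dr.
have sub : D `<=` cyl del0 rho a.
  by move=> x [/= x1 x2]; split => //=; exact: (itvoo_subset d01 (lexx _)).
have mw : measurable_fun D (fun x : R * R => x.1) by apply: measurable_funTS; exact: measurable_fst.
have dw (x : R * R) : D x -> del <= x.1.
  by move=> [/= + _]; rewrite in_itv/= => /andP[/ltW].
have mC : (leb2 D <= ((rho - del) * (a + a))%:E)%E by rewrite leb2_cyl.
have [e' e'0 he'] := @small_L1 _ (measurableTypeR R * measurableTypeR R)%type R
  (lebesgue_measure \x lebesgue_measure)%E D (fun x => x.1) del _ e mD mw d0 dw mC e0.
have key n i j g : weak_der (cyl del0 rho a) i j (fun x => f n x - u x) g ->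
    (der_norm2 (cyl del0 rho a) 0 i j (fun x => f n x - u x)%R <= e'%:E)%E ->
    (\int[leb2]_(x in D) `|g x|%:E <= e%:E)%E.
  move=> wg; rewrite (der_norm2_eq 0 dr0 a0 wg) => h; apply: he'.
    by have [_ [mg _] _] := wg; apply: measurable_funS mg => //; exact: measurable_cyl.
  apply: le_trans h.
  apply: (@le_trans _ _ (\int[leb2]_(x in cyl del0 rho a) ((g x) ^+ 2 * x.1)%:E)%E).
    apply: (@ge0_subset_integral_nomeas _ _ (measurableTypeR R * measurableTypeR R)%type
      (lebesgue_measure \x lebesgue_measure)%E D (cyl del0 rho a)) => //.
    move=> x [/= + _]; rewrite in_itv/= => /andP[x1 _].
    by rewrite lee_fin mulr_ge0 ?sqr_ge0//; apply: ltW; exact: le_lt_trans x1.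
  rewrite le_eqVlt; apply/orP; left; apply/eqP; apply: eq_integral => x _.
  by rewrite mulr0 powRr0 mulr1.
have hN := near_le_of_cvg0 fN e0.
have hH := near_le_of_cvg0 fu e'0.
have [n [nN nH]] : exists n, (N (fun x => f n x - 0)%R <= e%:E)%E /\
    (H1_norm2 (cyl del0 rho a) (fun x => f n x - u x)%R <= e'%:E)%E.
  have /filter_ex : \forall n \near \oo, (N (fun x => f n x - 0)%R <= e%:E)%E /\
    (H1_norm2 (cyl del0 rho a) (fun x => f n x - u x)%R <= e'%:E)%E.
    by near=> n; split; near: n.
  by move=> [n hn]; exists n.
have n0 i j : (0 <= der_norm2 (cyl del0 rho a) 0 i j (fun x => f n x - u x)%R)%E.
  exact: der_norm2_ge0.
move: nH; rewrite H1_norm2E => nH.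
exists (f n); split => //.
- apply: (key n 0 0); last first.
    by apply: le_trans nH; rewrite -addeA leeDl// adde_ge0.
  apply: weak_derB => //; last exact: weak_der_id.
  by apply: weak_der_id => //; apply: locL1_continuous => //; exact: (@continuous_pder _ 0 0 _ (sf n)).
- apply: (key n 1 0); last first.
    by apply: le_trans nH; rewrite leeDr// adde_ge0.
  by apply: weak_derB => //; exact: weak_der_smooth1.
- apply: (key n 0 1); last first.
    by apply: le_trans nH; rewrite [X in (X + _)%E]addeC -addeA leeDl// adde_ge0.
  by apply: weak_derB => //; exact: weak_der_smooth2.
- by have -> : f n = (fun x => f n x - 0) by apply/funext => x; rewrite subr0.
Unshelve. all: by end_near. Qed.

(** For smooth [f] this is integration by parts in z up to the boundary values at z = -a and z = a;
    these and the errors of [f] and of its z-derivative are small in mean. Through this lemma the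
    conditions of [psi] and [omega] on S_2 enter. *)
Lemma trace_coefficients u uz n :
  (forall e, 0 < e -> exists f, [/\ smooth f,
    (\int[leb2]_(x in D) `|f x - u x|%:E <= e%:E)%E,
    (\int[leb2]_(x in D) `|pder 0 1 f x - uz x|%:E <= e%:E)%E &
    (\int[leb]_(r in I) (`|f (r, - a)| + `|f (r, a)|)%:E <= e%:E)%E]) ->
  leb2.-integrable D (EFin \o u) -> leb2.-integrable D (EFin \o uz) ->
  {ae leb, forall r, I r ->
     \int[leb]_(z in J) (uz (r, z) * cn a n z) = freq a n * \int[leb]_(z in J) (u (r, z) * sn a n z)}.
Proof.
move=> happ iu iuz; set k := freq a n; have k0 : 0 < k := freq_gt0 a0 n.
have mtrig (t : R -> R) : continuous t -> measurable_fun D (fun x : R * R => t x.2).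
  by move=> ct; apply: measurable_funTS; apply: (measurableT_comp (continuous_measurable_fun ct)); exact: measurable_snd.
have itrig (t : R -> R) (g : R * R -> R) : continuous t -> (forall z, `|t z| <= 1) ->
    leb2.-integrable D (EFin \o g) -> leb2.-integrable D (EFin \o (fun x => g x * t x.2)).
  move=> ct t1 ig; apply: (lint2_le (lint2_norm ig) mD).
    by apply: measurable_funM; [exact: lint2_measurable ig|exact: mtrig].
  by move=> x _; rewrite normrM -[leRHS]mulr1; apply: ler_wpM2l.
have itrig1 (t g : R -> R) : continuous t -> (forall z, `|t z| <= 1) ->
    leb.-integrable J (EFin \o g) -> leb.-integrable J (EFin \o (fun x => g x * t x)).
  move=> ct t1 ig; apply: (lint1_le (lint1_norm ig) mJ).
    apply: measurable_funM; [exact: lint1_measurable ig|].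
    exact: (measurable_funTS (continuous_measurable_fun ct)).
  by move=> x _; rewrite normrM -[leRHS]mulr1; apply: ler_wpM2l.
have cs := @continuous_sn R a n; have cc := @continuous_cn R a n.
have i1 := leb_integrable_fubini1 mI mJ (itrig _ _ cc (norm_cn a n) iuz).
have i2 := leb_integrable_fubini1 mI mJ (itrig _ _ cs (norm_sn a n) iu).
pose g r := \int[leb]_(z in J) (uz (r, z) * cn a n z) - k * \int[leb]_(z in J) (u (r, z) * sn a n z).
have ig : leb.-integrable I (EFin \o g) by exact: (lint1B i1 (lint1Z k i2 mI) mI).
suff : {ae leb, forall r, I r -> g r = 0}.
  by apply: ae_imp => r h Ir; apply/eqP; rewrite -subr_eq0; exact/eqP/h.
(* The total error consists of [e] from the z-derivative, [k * e] from the function and [e] from the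
   boundary values. *)
apply: (@ae_eq0_of_small _ (measurableTypeR R) R leb I g (2 + k)) => //.
- exact: lint1_measurable ig.
- by rewrite addr_ge0// ltW.
move=> e e0; have [f [sf h1 h2 h3]] := happ e e0.
have cf : continuous f := @continuous_pder _ 0 0 _ sf.
have cf2 : continuous (fun x => 'D_((0, 1) : R * R) f x) := @continuous_pder _ 0 1 _ sf.
have mf := measurable_continuous2 cf; have mf2 := measurable_continuous2 cf2.
have mu := lint2_measurable iu; have muz := lint2_measurable iuz.
have ma1 : measurable_fun D (fun x => (`|pder 0 1 f x - uz x|%:E)).
  apply/measurable_EFinP; apply: measurableT_comp => //; apply: measurable_funB => //; exact: measurable_funTS.
have ma2 : measurable_fun D (fun x => (`|f x - u x|%:E)).
  apply/measurable_EFinP; apply: measurableT_comp => //; apply: measurable_funB => //; exact: measurable_funTS.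
have mt1 := leb_measurable_tonelli1 mI mJ ma1 (fun x _ => normr_ge0 _).
have mt2 := leb_measurable_tonelli1 mI mJ ma2 (fun x _ => normr_ge0 _).
have mb : measurable_fun I (fun r => (`|f (r, - a)| + `|f (r, a)|)%:E).
  apply/measurable_EFinP; apply: measurable_funD; apply: measurableT_comp => //;
  apply: measurable_funTS; apply: continuous_measurable_fun; exact: continuous_slice2.
pose B1 r := (\int[leb]_(z in J) `|pder 0 1 f (r, z) - uz (r, z)|%:E)%E.
pose B2 r := (\int[leb]_(z in J) `|f (r, z) - u (r, z)|%:E)%E.
pose B3 r := (`|f (r, - a)| + `|f (r, a)|)%:E.
have B10 r : (0 <= B1 r)%E by exact: integral_ge0.
have B20 r : (0 <= B2 r)%E by exact: integral_ge0.
apply: (@le_trans _ _ (\int[leb]_(r in I) (B1 r + k%:E * B2 r + B3 r))%E).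
  apply: (@ae_le_integral_nomeas _ (measurableTypeR R) R leb) => //.
  - by apply: emeasurable_funD => //; apply: emeasurable_funD => //; exact: measurable_funeM.
  - move=> r _; apply: adde_ge0; last by rewrite lee_fin addr_ge0.
    by apply: adde_ge0 => //; apply: mule_ge0 => //; rewrite lee_fin; exact: ltW.
  apply: ae_imp2 (leb_ae_integrable1 mI mJ iu) (leb_ae_integrable1 mI mJ iuz) => r hu huz Ir.
  have {}hu : leb.-integrable J (EFin \o (fun z => u (r, z))) by exact: hu.
  have {}huz : leb.-integrable J (EFin \o (fun z => uz (r, z))) by exact: huz.
  have cfr := continuous_slice1 (r := r) cf.
  have cf2r := continuous_slice1 (r := r) cf2.
  have ifr : leb.-integrable J (EFin \o (fun z => f (r, z))).
    by apply: integrable_continuous; exact: continuous_subspaceT.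
  have if2r : leb.-integrable J (EFin \o (fun z => 'D_((0, 1) : R * R) f (r, z))).
    by apply: integrable_continuous; exact: continuous_subspaceT.
  have j1 := lint1B if2r huz mJ; have j2 := lint1B ifr hu mJ.
  have t1 := itrig1 _ _ cc (norm_cn a n) j1; have t2 := itrig1 _ _ cs (norm_sn a n) j2.
  have na : - a <= a by have := a0 => ?; lra.
  have acf : abs_cont (- a) a (fun z => f (r, z)) (fun z => 'D_((0, 1) : R * R) f (r, z)).
    apply: AC_C1 => [z _|]; first exact: (is_derive_slice2 (sf 0%N 0%N _)).
    exact: continuous_subspaceT.
  have acc : abs_cont (- a) a (cn a n) (fun z => - freq a n * sn a n z).
    apply: AC_C1 => [z _|]; first exact: is_derive_cn.
    by apply: continuous_subspaceT => z; apply: cvgM; [exact: cvg_cst|exact: cs].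
  have [_ parts] := AC_M na acf acc.
  have {}parts := parts (- a) a (lexx _) na (lexx _).
  have s1 := itrig1 _ _ cc (norm_cn a n) if2r; have s2 := itrig1 _ _ cs (norm_sn a n) ifr.
  have s3 := itrig1 _ _ cc (norm_cn a n) huz; have s4 := itrig1 _ _ cs (norm_sn a n) hu.
  have {}parts : f (r, a) * cn a n a - f (r, - a) * cn a n (- a) =
     \int[leb]_(z in J) ('D_((0, 1) : R * R) f (r, z) * cn a n z) - k * \int[leb]_(z in J) (f (r, z) * sn a n z).
    rewrite parts -(lRint1Z k s2 mJ) -(lRint1B s1 (lint1Z k s2 mJ) mJ).
    by apply: lRint1_eq => z _; rewrite /k; ring.
  have gE : g r = (f (r, a) * cn a n a - f (r, - a) * cn a n (- a))
     - \int[leb]_(z in J) (('D_((0, 1) : R * R) f (r, z) - uz (r, z)) * cn a n z)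
     + k * \int[leb]_(z in J) ((f (r, z) - u (r, z)) * sn a n z).
    rewrite parts /g.
    have -> : \int[leb]_(z in J) (('D_((0, 1) : R * R) f (r, z) - uz (r, z)) * cn a n z) =
      \int[leb]_(z in J) ('D_((0, 1) : R * R) f (r, z) * cn a n z) - \int[leb]_(z in J) (uz (r, z) * cn a n z).
      by rewrite -(lRint1B s1 s3 mJ); apply: lRint1_eq => z _; rewrite mulrBl.
    have -> : \int[leb]_(z in J) ((f (r, z) - u (r, z)) * sn a n z) =
      \int[leb]_(z in J) (f (r, z) * sn a n z) - \int[leb]_(z in J) (u (r, z) * sn a n z).
      by rewrite -(lRint1B s2 s4 mJ); apply: lRint1_eq => z _; rewrite mulrBl.
    by ring.
  have nb (t q : R -> R) : continuous t -> (forall z, `|t z| <= 1) ->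
     leb.-integrable J (EFin \o q) -> (`|\int[leb]_(z in J) (q z * t z)|%:E <= \int[leb]_(z in J) `|q z|%:E)%E.
    move=> ct tle iq; have iqt := itrig1 _ _ ct tle iq.
    rewrite -[leRHS]fineK; last by apply: integrable_fin_num => //; exact: (lint1_norm iq).
    rewrite lee_fin; apply: le_trans (lRint1_norm iqt mJ) _.
    apply: (lRint1_le (lint1_norm iqt) (lint1_norm iq) mJ) => z _.
    by rewrite normrM -[leRHS]mulr1; apply: ler_wpM2l.
  have n1 := nb _ _ cc (norm_cn a n) j1; have n2 := nb _ _ cs (norm_sn a n) j2.
  apply: (@le_trans _ _ (`|\int[leb]_(z in J) (('D_((0, 1) : R * R) f (r, z) - uz (r, z)) * cn a n z)|%:E +
     k%:E * `|\int[leb]_(z in J) ((f (r, z) - u (r, z)) * sn a n z)|%:E + B3 r)%E); last first.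
    by apply: leeD => //; apply: leeD => //; apply: lee_wpmul2l => //; rewrite lee_fin ltW.
  rewrite -EFinM -!EFinD lee_fin gE.
  set X := \int[leb]_(z in J) _; set Y := \int[leb]_(z in J) _.
  apply: le_trans (ler_normD _ _) _; rewrite normrM (gtr0_norm k0).
  rewrite [leRHS]addrAC lerD2r; apply: le_trans (ler_normB _ _) _.
  rewrite [leRHS]addrC lerD2r; apply: le_trans (ler_normB _ _) _; rewrite [leRHS]addrC 2!normrM.
  by apply: lerD; rewrite -[leRHS]mulr1; apply: ler_wpM2l => //; exact: norm_cn.
rewrite ge0_integralD//; last 3 first.
- by move=> r _; rewrite adde_ge0// mule_ge0// lee_fin ltW.
- by apply: emeasurable_funD => //; exact: measurable_funeM.
- by move=> r _; rewrite lee_fin addr_ge0.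
rewrite ge0_integralD//; last 2 first.
- by move=> r _; rewrite mule_ge0// lee_fin ltW.
- exact: measurable_funeM.
rewrite ge0_integralZl_EFin//; last exact: ltW.
rewrite -(leb_tonelli1 mI mJ ma1 (fun x _ => normr_ge0 _)) -(leb_tonelli1 mI mJ ma2 (fun x _ => normr_ge0 _)).
apply: (@le_trans _ _ (e%:E + k%:E * e%:E + e%:E)%E).
  by apply: leeD => //; apply: leeD => //; apply: lee_wpmul2l => //; rewrite lee_fin ltW.
by rewrite -EFinM -!EFinD lee_fin; lra.
Qed.

(** For smooth [f] the value at (rho, z) is f(r, z) plus the integral of f_r over []r, rho[].
    Inserting this leaves only the approximation errors; that of f_r is integrated once more over r,
    which produces the factor rho - del. *)
Lemma trace_radial u ur f e : smooth f -> leb2.-integrable D (EFin \o u) ->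
  leb2.-integrable D (EFin \o ur) ->
  (\int[leb2]_(x in D) `|f x - u x|%:E <= e%:E)%E ->
  (\int[leb2]_(x in D) `|pder 1 0 f x - ur x|%:E <= e%:E)%E ->
  (\int[leb2]_(x in D) `|u x + \int[leb]_(s in `]x.1, rho[) ur (s, x.2) - f (rho, x.2)|%:E
    <= ((1 + (rho - del)) * e)%:E)%E.
Proof.
move=> sf iu iur h1 h2.
have cf : continuous f := @continuous_pder _ 0 0 _ sf.
have cf1 : continuous (fun x => 'D_((1, 0) : R * R) f x) := @continuous_pder _ 1 0 _ sf.
have mf := measurable_continuous2 cf; have mf1 := measurable_continuous2 cf1.
have mu := lint2_measurable iu; have mur := lint2_measurable iur.
have ma1 : measurable_fun D (fun x => (`|f x - u x|%:E)).
  apply/measurable_EFinP; apply: measurableT_comp => //; apply: measurable_funB => //; exact: measurable_funTS.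
have ma2 : measurable_fun D (fun x => (`|pder 1 0 f x - ur x|%:E)).
  apply/measurable_EFinP; apply: measurableT_comp => //; apply: measurable_funB => //; exact: measurable_funTS.
have mfr : measurable_fun D (fun x : R * R => f (rho, x.2)).
  apply: measurable_funTS; apply: (measurableT_comp (continuous_measurable_fun (continuous_slice1 (r := rho) cf))).
  exact: measurable_snd.
have mW := (measurable_primitive_right (lexx del) mur).1.
have ma0 : measurable_fun D (fun x => (`|u x + \int[leb]_(s in `]x.1, rho[) ur (s, x.2) - f (rho, x.2)|%:E)).
  by apply/measurable_EFinP; apply: measurableT_comp => //; apply: measurable_funB => //; exact: measurable_funD.
rewrite (leb_tonelli2 mI mJ ma0)//.
pose B z := (\int[leb]_(r in I) `|pder 1 0 f (r, z) - ur (r, z)|%:E)%E.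
have B0 z : (0 <= B z)%E by exact: integral_ge0.
have mB : measurable_fun J B := leb_measurable_tonelli2 mI mJ ma2 (fun x _ => normr_ge0 _).
have mA : measurable_fun J (fun z => \int[leb]_(r in I) `|f (r, z) - u (r, z)|%:E)%E.
  exact: (leb_measurable_tonelli2 mI mJ ma1 (fun x _ => normr_ge0 _)).
have rd : 0 <= rho - del by rewrite subr_ge0 ltW.
apply: (@le_trans _ _ (\int[leb]_(z in J) ((\int[leb]_(r in I) `|f (r, z) - u (r, z)|%:E) + (rho - del)%:E * B z))%E).
  apply: (@ae_le_integral_nomeas _ (measurableTypeR R) R leb) => //.
  - by apply: emeasurable_funD => //; exact: measurable_funeM.
  - by move=> z _; exact: integral_ge0.
  - by move=> z _; apply: adde_ge0; [exact: integral_ge0|apply: mule_ge0].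
  apply: ae_imp (leb_ae_integrable2 mI mJ iur) => z hur Jz.
  have {}hur : leb.-integrable I (EFin \o (fun r => ur (r, z))) by exact: hur.
  have cfz := continuous_slice2 (z := z) cf.
  have cf1z := continuous_slice2 (z := z) cf1.
  have if1z : leb.-integrable I (EFin \o (fun r => 'D_((1, 0) : R * R) f (r, z))).
    by apply: integrable_continuous; exact: continuous_subspaceT.
  have acf : abs_cont del rho (fun r => f (r, z)) (fun r => 'D_((1, 0) : R * R) f (r, z)).
    apply: AC_C1 => [r _|]; first exact: (is_derive_slice1 (sf 0%N 0%N _)).
    exact: continuous_subspaceT.
  have j := lint1B if1z hur mI.
  apply: (@le_trans _ _ (\int[leb]_(r in I) (`|f (r, z) - u (r, z)|%:E + B z))%E).
    apply: le_integral_nomeas => r; rewrite /= in_itv/= => /andP[r1 r2].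
    rewrite lee_fin normr_ge0/=.
    have sub : `]r, rho[%classic `<=` I by apply: itvoo_subset => //; exact: ltW.
    have mIr : measurable (`]r, rho[%classic : set R) by [].
    have jr := lint1_sub j mI mIr sub.
    have e1 : u (r, z) + \int[leb]_(s in `]r, rho[) ur (s, z) - f (rho, z) =
       - (f (r, z) - u (r, z)) - \int[leb]_(s in `]r, rho[) ('D_((1, 0) : R * R) f (s, z) - ur (s, z)).
      rewrite (lRint1B (lint1_sub if1z mI mIr sub) (lint1_sub hur mI mIr sub) mIr).
      by rewrite -(acf.2 r rho (ltW r1) (ltW r2) (lexx _)); ring.
    rewrite e1; apply: (@le_trans _ _ (`|f (r, z) - u (r, z)|%:E +
        `|\int[leb]_(s in `]r, rho[) ('D_((1, 0) : R * R) f (s, z) - ur (s, z))|%:E)%E).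
      by rewrite -EFinD lee_fin; apply: le_trans (ler_normB _ _) _; rewrite normrN.
    rewrite leeD2l//; apply: (@le_trans _ _ (\int[leb]_(s in `]r, rho[) `|'D_((1, 0) : R * R) f (s, z) - ur (s, z)|)%:E%E).
      by rewrite lee_fin; exact: (lRint1_norm jr mIr).
    rewrite /Rintegral fineK; last by apply: integrable_fin_num => //; exact: (lint1_norm jr).
    exact: (@ge0_subset_integral_nomeas _ _ (measurableTypeR R) leb).
  have mz : measurable_fun I (fun r => `|f (r, z) - u (r, z)|%:E).
    exact: (measurable_fun_slice2 mI mJ Jz ma1).
  rewrite ge0_integralD//.
  by rewrite leeD2l// integral_cst//= (leb_itvoo (ltW dr)) muleC.
rewrite ge0_integralD//; last 3 first.
- by move=> z _; exact: integral_ge0.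
- by move=> z _; apply: mule_ge0.
- exact: measurable_funeM.
rewrite ge0_integralZl_EFin//.
rewrite -(leb_tonelli2 mI mJ ma1 (fun x _ => normr_ge0 _)) -(leb_tonelli2 mI mJ ma2 (fun x _ => normr_ge0 _)).
apply: (@le_trans _ _ (e%:E + (rho - del)%:E * e%:E)%E).
  by apply: leeD => //; apply: lee_wpmul2l => //; rewrite lee_fin.
by rewrite -EFinM -EFinD lee_fin [leRHS]mulrDl mul1r.
Qed.

(** The approximating functions are small on r = rho, which removes the boundary value left over in
    [trace_radial]. *)
Lemma trace_lateral u ur :
  (forall e, 0 < e -> exists f, [/\ smooth f,
    (\int[leb2]_(x in D) `|f x - u x|%:E <= e%:E)%E,
    (\int[leb2]_(x in D) `|pder 1 0 f x - ur x|%:E <= e%:E)%E &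
    (\int[leb]_(z in J) `|f (rho, z)|%:E <= e%:E)%E]) ->
  leb2.-integrable D (EFin \o u) -> leb2.-integrable D (EFin \o ur) ->
  {ae leb2, forall x, D x -> u x + \int[leb]_(s in `]x.1, rho[) ur (s, x.2) = 0}.
Proof.
move=> happ iu iur.
have mu := lint2_measurable iu; have mur := lint2_measurable iur.
have mW : measurable_fun D (fun x => u x + \int[leb]_(s in `]x.1, rho[) ur (s, x.2)).
  by apply: measurable_funD => //; exact: (measurable_primitive_right (lexx del) mur).1.
have rd : 0 <= rho - del by rewrite subr_ge0 ltW.
apply: (@ae_eq0_of_small _ (measurableTypeR R * measurableTypeR R)%type R
  (lebesgue_measure \x lebesgue_measure)%E D _ ((1 + (rho - del)) + (rho - del))) => //.
  by rewrite addr_ge0// addr_ge0.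
move=> e e0; have [f [sf h1 h2 h3]] := happ e e0.
have cf : continuous f := @continuous_pder _ 0 0 _ sf.
have h := trace_radial sf iu iur h1 h2.
have mfr : measurable_fun D (fun x : R * R => f (rho, x.2)).
  apply: measurable_funTS; apply: (measurableT_comp (continuous_measurable_fun (continuous_slice1 (r := rho) cf))).
  exact: measurable_snd.
have mfr' : measurable_fun D (fun x : R * R => `|f (rho, x.2)|%:E).
  by apply/measurable_EFinP; exact: measurableT_comp.
apply: (@le_trans _ _ (\int[leb2]_(x in D) (`|u x + \int[leb]_(s in `]x.1, rho[) ur (s, x.2) - f (rho, x.2)|%:E
   + `|f (rho, x.2)|%:E))%E).
  apply: le_integral_nomeas => x _; rewrite -EFinD !lee_fin normr_ge0/=.
  by apply: le_trans (ler_normD _ _); rewrite subrK.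
rewrite ge0_integralD//; last by apply/measurable_EFinP; apply: measurableT_comp => //; exact: measurable_funB.
rewrite mulrDl EFinD; apply: leeD => //.
rewrite (leb_tonelli1 mI mJ mfr')//=.
rewrite integral_cst//= (leb_itvoo (ltW dr)) muleC EFinM.
by apply: lee_wpmul2l.
Qed.

(** No smallness on r = rho is available here, so f(rho, z) is eliminated: the left side is close to
    it in mean, and so is the average of the left side over []sig, rho[]. The radius [sig] is kept
    apart from [del] so that the average is the same for all [del]. *)
Lemma trace_constant sig u ur : del <= sig -> sig < rho ->
  (forall e, 0 < e -> exists f, [/\ smooth f,
    (\int[leb2]_(x in D) `|f x - u x|%:E <= e%:E)%E &
    (\int[leb2]_(x in D) `|pder 1 0 f x - ur x|%:E <= e%:E)%E]) ->
  leb2.-integrable D (EFin \o u) -> leb2.-integrable D (EFin \o ur) ->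
  {ae leb2, forall x, D x -> u x + \int[leb]_(s in `]x.1, rho[) ur (s, x.2) =
     (rho - sig)^-1 * \int[leb]_(s in `]sig, rho[) (u (s, x.2) + \int[leb]_(t in `]s, rho[) ur (t, x.2))}.
Proof.
move=> ds sr happ iu iur.
have mu := lint2_measurable iu; have mur := lint2_measurable iur.
pose W (x : R * R) := u x + \int[leb]_(s in `]x.1, rho[) ur (s, x.2).
have mW : measurable_fun D W.
  by apply: measurable_funD => //; exact: (measurable_primitive_right (lexx del) mur).1.
pose A (x : R * R) := (rho - sig)^-1 * \int[leb]_(s in `]sig, rho[) W (s, x.2).
have mA : measurable_fun D A.
  by apply: measurable_funM => //; exact: (measurable_primitive_right ds mW).2.
have rd : 0 <= rho - del by rewrite subr_ge0 ltW.
have rs : 0 < rho - sig by rewrite subr_gt0.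
suff : {ae leb2, forall x, D x -> W x - A x = 0}.
  by apply: ae_imp => x h Dx; apply/eqP; rewrite -subr_eq0; apply/eqP; exact: h.
apply: (@ae_eq0_of_small _ (measurableTypeR R * measurableTypeR R)%type R
  (lebesgue_measure \x lebesgue_measure)%E D _ ((1 + (rho - del) / (rho - sig)) * (1 + (rho - del)))) => //.
- by apply: measurable_funB.
- by apply: mulr_ge0; rewrite addr_ge0// divr_ge0// ltW.
move=> e e0; have [f [sf h1 h2]] := happ e e0.
have cf : continuous f := @continuous_pder _ 0 0 _ sf.
have h := trace_radial sf iu iur h1 h2.
have mfr : measurable_fun D (fun x : R * R => f (rho, x.2)).
  apply: measurable_funTS; apply: (measurableT_comp (continuous_measurable_fun (continuous_slice1 (r := rho) cf))).
  exact: measurable_snd.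
have mWf : measurable_fun D (fun x => `|W x - f (rho, x.2)|%:E).
  by apply/measurable_EFinP; apply: measurableT_comp => //; exact: measurable_funB.
have mWA : measurable_fun D (fun x => `|W x - A x|%:E).
  by apply/measurable_EFinP; apply: measurableT_comp => //; exact: measurable_funB.
pose B z := (\int[leb]_(r in I) `|W (r, z) - f (rho, z)|%:E)%E.
have B0 z : (0 <= B z)%E by exact: integral_ge0.
have mB : measurable_fun J B := leb_measurable_tonelli2 mI mJ mWf (fun x _ => normr_ge0 _).
have BD : (\int[leb]_(z in J) B z <= ((1 + (rho - del)) * e)%:E)%E.
  by rewrite -(leb_tonelli2 mI mJ mWf (fun x _ => normr_ge0 _)).
rewrite (leb_tonelli2 mI mJ mWA)//.
apply: (@le_trans _ _ (\int[leb]_(z in J) ((1 + (rho - del) / (rho - sig))%:E * B z))%E); last first.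
  have c0 : 0 <= 1 + (rho - del) / (rho - sig) by rewrite addr_ge0// divr_ge0// ltW.
  rewrite ge0_integralZl_EFin// -mulrA EFinM; exact: lee_wpmul2l.
apply: (@ae_le_integral_nomeas _ (measurableTypeR R) R leb) => //.
- exact: measurable_funeM.
- by move=> z _; exact: integral_ge0.
- by move=> z _; apply: mule_ge0 => //; rewrite lee_fin addr_ge0// divr_ge0// ltW.
apply: ae_imp2 (leb_ae_integrable2 mI mJ iu) (leb_ae_integrable2 mI mJ iur) => z hu hur Jz.
have {}hu : leb.-integrable I (EFin \o (fun r => u (r, z))) by exact: hu.
have {}hur : leb.-integrable I (EFin \o (fun r => ur (r, z))) by exact: hur.
have iW : leb.-integrable I (EFin \o (fun r => W (r, z))).
  apply: (lint1D hu _ mI); apply: (lint1_eq (f := fun r => -1 * - \int[leb]_(s in `]r, rho[) ur (s, z))).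
  - by move=> r _; rewrite mulN1r opprK.
  - apply: lint1Z => //; apply: integrable_continuous.
    exact: (AC_continuous (ltW dr) (AC_Rintegral_right hur)).
  - by [].
have icst : leb.-integrable I (EFin \o (fun _ : R => f (rho, z))).
  by apply: integrable_continuous; exact: cst_continuous.
have iWf := lint1B iW icst mI.
have Bfin : B z = (\int[leb]_(r in I) `|W (r, z) - f (rho, z)|)%:E.
  by rewrite /Rintegral fineK//; apply: integrable_fin_num => //; exact: (lint1_norm iWf).
(* [A] depends on z only; its first argument 0 is a placeholder. *)
have Af : `|f (rho, z) - A (0, z)| <= (rho - sig)^-1 * \int[leb]_(r in I) `|W (r, z) - f (rho, z)|.
  have mS : measurable (`]sig, rho[%classic : set R) by [].
  have subS : `]sig, rho[%classic `<=` I by exact: itvoo_subset.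
  have -> : f (rho, z) - A (0, z) = - ((rho - sig)^-1 * \int[leb]_(r in `]sig, rho[) (W (r, z) - f (rho, z))).
    rewrite (lRint1B (lint1_sub iW mI mS subS) (lint1_sub icst mI mS subS) mS) /A /=.
    rewrite Rintegral_cst//= (leb_itvoo (ltW sr))/=; field; rewrite gt_eqF//.
  rewrite normrN normrM ger0_norm ?invr_ge0//; last exact: ltW.
  apply: ler_wpM2l; first by rewrite invr_ge0 ltW.
  apply: le_trans (lRint1_norm (lint1_sub iWf mI mS subS) mS) _.
  rewrite -lee_fin /Rintegral !fineK; last 2 first.
  - by apply: integrable_fin_num => //; exact: (lint1_norm iWf).
  - by apply: integrable_fin_num => //; exact: (lint1_norm (lint1_sub iWf mI mS subS)).
  exact: (@ge0_subset_integral_nomeas _ _ (measurableTypeR R) leb).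
apply: (@le_trans _ _ (\int[leb]_(r in I) (`|W (r, z) - f (rho, z)|%:E + `|f (rho, z) - A (0, z)|%:E))%E).
  apply: le_integral_nomeas => r _; rewrite -EFinD !lee_fin normr_ge0/=.
  by apply: le_trans (ler_normD _ _); rewrite addrA subrK.
have mz : measurable_fun I (fun r => `|W (r, z) - f (rho, z)|%:E).
  exact: (measurable_fun_slice2 mI mJ Jz mWf).
rewrite ge0_integralD// integral_cst//= (leb_itvoo (ltW dr)).
rewrite -/(B z) Bfin -!EFinM -EFinD lee_fin mulrDl mul1r lerD2l mulrC -mulrA.
by apply: ler_wpM2l.
Qed.

End approximation.

End traces.

(** * The equation of one mode *)

Section cutoff.
Context {R : realType}.
Implicit Types (x : R).

Lemma cvg_flat N (t : R) (s : nat -> R) : 0 < t -> s n @[n --> \oo] --> t ->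
  flat (harmonic n) N (s n) @[n --> \oo] --> t^-1 ^+ N.
Proof.
move=> t0 st; rewrite -[X in _ --> X]mulr1.
have c1 : (s n)^-1 ^+ N * flat (harmonic n) 0 (s n) @[n --> \oo] --> t^-1 ^+ N * 1.
  apply: cvgM; last exact: (cvg_flat0 t0 st).
  have c2 : (s n)^-1 @[n --> \oo] --> t^-1 by apply: cvgV => //; rewrite gt_eqF.
  by apply: (@continuous_cvg _ _ _ _ _ _ (fun y : R => y ^+ N)) => //; exact: exprn_continuous.
apply: cvg_trans c1; apply: near_eq_cvg.
have sp : \forall n \near \oo, 0 < s n by exact: (cvgr_gt t st).
by near=> n; have sn0 : 0 < s n by [near: n]; rewrite /flat sn0 expr0 mul1r.
Unshelve. all: by end_near. Qed.

Variables (p q L L' : R) (g g' : R -> R).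
Hypothesis dg : forall x, is_derive x 1 g (g' x).
Hypothesis gl : forall x, p < x < q -> `|g x| <= L * (x - p).
Hypothesis gr : forall x, p < x < q -> `|g x| <= L * (q - x).
Hypothesis g'b : forall x, p < x < q -> `|g' x| <= L'.

(* If g vanishes linearly at p and q, the derivatives of the cutoffs are bounded
   uniformly in m although those of the bumps are not. *)
Definition cutoff m x := bumpf (harmonic m) p q x * g x.
Definition cutoff' m x := bumpf' (harmonic m) p q x * g x + bumpf (harmonic m) p q x * g' x.

Let h0 m : 0 < harmonic m :> R.
Proof. by rewrite /harmonic/= invr_gt0. Qed.

Lemma is_derive_cutoff m x : is_derive x 1 (cutoff m) (cutoff' m x).
Proof.
have h := is_deriveM (is_derive_bump p q x (h0 m)) (dg x).
by apply: is_derive_eq h _; rewrite /cutoff' /GRing.scale/= [g x * _]mulrC addrC.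
Qed.

Lemma cutoff_out m x : ~~ (p + harmonic m < x < q - harmonic m) -> cutoff m x = 0.
Proof. by move=> h; rewrite /cutoff bump_out// mul0r. Qed.

Lemma bump_le1_norm m x : `|bumpf (harmonic m) p q x| <= 1.
Proof. by rewrite ger0_norm ?bump_ge0//; apply: bump_le1; exact: ltW. Qed.

(* With y = c / t the product is (y + y^2) e^(-y). *)
Lemma flat2_affine_bound (c t : R) : 0 < c -> 0 <= (t + c) * (c * flat c 2 t) <= 5.
Proof.
move=> c0; rewrite /flat; case: ifP => t0; last by rewrite !mulr0 lexx/=.
have y0 : 0 <= c * t^-1 by rewrite mulr_ge0 ?invr_ge0// ltW.
have k1 := @pow_le_expR R 1 (c * t^-1) 1 ltr01 y0.
have k2 := @pow_le_expR R 2 (c * t^-1) 1 ltr01 y0.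
move: k1 k2; rewrite !mul1r !divr1 => k1 k2.
have e0 : 0 <= expR (- (c * t^-1)) by exact: expR_ge0.
have -> : (t + c) * (c * (t^-1 ^+ 2 * expR (- (c * t^-1)))) =
   (c * t^-1) ^+ 1 * expR (- (c * t^-1)) + (c * t^-1) ^+ 2 * expR (- (c * t^-1)).
  by field; rewrite gt_eqF.
apply/andP; split; first by apply: addr_ge0; apply: mulr_ge0 => //; apply: exprn_ge0.
by have := lerD k1 k2; rewrite invr1 expr1n => h; apply: (le_trans h); rewrite expr2; lra.
Qed.

Lemma cutoff'_bound m x : p < x < q -> `|cutoff' m x| <= 10 * L + L'.
Proof.
move=> pxq; have /andP[px xq] := pxq.
have L0 : 0 <= L.
  have := le_trans (normr_ge0 _) (gl pxq).
  by rewrite pmulr_lge0// subr_gt0.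
apply: (le_trans (ler_normD _ _)); apply: lerD; last first.
  by rewrite normrM -[leRHS]mul1r; apply: ler_pM; [exact: normr_ge0|exact: normr_ge0|exact: bump_le1_norm|exact: g'b].
have f1 (y : R) : `|flat (harmonic m) 0 y| <= 1.
  by rewrite ger0_norm ?flat_ge0//; apply: flat0_le1; exact: ltW.
rewrite /bumpf' mulrBl; apply: (le_trans (ler_normB _ _)).
(* Each end contributes 5 L: with t the argument of [flat] there, the distance to the end is t + c,
   so |g| is at most L (t + c), and [flat2_affine_bound] applies. *)
have -> : 10 * L = 5 * L + 5 * L by ring.
set c := harmonic m; have c0 : 0 < c := h0 m.
apply: lerD.
  set t := x - (p + c).
  have /andP[k0 k5] := flat2_affine_bound t c0.
  have -> : c * flat c 2 t * flat c 0 (q - c - x) * g x = flat c 0 (q - c - x) * (c * flat c 2 t * g x) by ring.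
  rewrite normrM -[leRHS]mul1r; apply: ler_pM; [exact: normr_ge0|exact: normr_ge0|exact: f1|].
  have cf0 : 0 <= c * flat c 2 t by rewrite mulr_ge0 ?flat_ge0// ltW.
  rewrite normrM (ger0_norm cf0); apply: (@le_trans _ _ (c * flat c 2 t * (L * (x - p)))).
    by apply: ler_wpM2l => //; exact: gl.
  have -> : c * flat c 2 t * (L * (x - p)) = ((t + c) * (c * flat c 2 t)) * L by rewrite /t; ring.
  exact: ler_wpM2r.
set t := q - c - x.
have /andP[k0 k5] := flat2_affine_bound t c0.
rewrite -mulrA normrM -[leRHS]mul1r; apply: ler_pM; [exact: normr_ge0|exact: normr_ge0|exact: f1|].
have cf0 : 0 <= c * flat c 2 t by rewrite mulr_ge0 ?flat_ge0// ltW.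
rewrite normrM (ger0_norm cf0); apply: (@le_trans _ _ (c * flat c 2 t * (L * (q - x)))).
  by apply: ler_wpM2l => //; exact: gr.
have -> : c * flat c 2 t * (L * (q - x)) = ((t + c) * (c * flat c 2 t)) * L by rewrite /t; ring.
exact: ler_wpM2r.
Qed.

Lemma cvg_cutoff x : p < x < q -> cutoff m x @[m --> \oo] --> g x.
Proof.
move=> pxq; rewrite -[X in _ --> X]mul1r; apply: cvgM; last exact: cvg_cst.
exact: cvg_bump.
Qed.

Lemma cvg_cutoff' x : p < x < q -> cutoff' m x @[m --> \oo] --> g' x.
Proof.
move=> pxq; have /andP[px xq] := pxq.
rewrite -[X in _ --> X]add0r -[X in _ --> X + _](mul0r (g x)) -[X in _ --> _ + X]mul1r.
apply: cvgD; last by apply: cvgM; [exact: cvg_bump|exact: cvg_cst].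
apply: cvgM; last exact: cvg_cst.
have t1 : 0 < x - p by rewrite subr_gt0.
have t2 : 0 < q - x by rewrite subr_gt0.
have s1 : x - (p + harmonic m) @[m --> \oo] --> x - p.
  rewrite -[X in _ --> X]subr0 -addrA -opprD; apply: cvgB; first exact: cvg_cst.
  by apply: cvgD; [exact: cvg_cst|exact: cvg_harmonic].
have s2 : q - harmonic m - x @[m --> \oo] --> q - x.
  rewrite -[X in _ --> X - _]subr0; apply: cvgB; last exact: cvg_cst.
  by apply: cvgB; [exact: cvg_cst|exact: cvg_harmonic].
(* Zero written as the limit of [bumpf'] factor by factor: both of its terms carry the factor
   [harmonic m], while the values of [flat] stay bounded at a fixed interior point. *)
have -> : 0 = 0 * (x - p)^-1 ^+ 2 * (q - x)^-1 ^+ 0 - (x - p)^-1 ^+ 0 * (0 * (q - x)^-1 ^+ 2) :> R by ring.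
have ch := @cvg_harmonic R.
apply: cvgB; apply: cvgM; (try by exact: cvg_flat); by apply: cvgM => //; exact: cvg_flat.
Qed.

Lemma cutoff'_out m x : ~~ (p < x < q) -> cutoff' m x = 0.
Proof.
move=> h; have c0 := h0 m.
have b0 : bumpf (harmonic m) p q x = 0.
  rewrite bump_out//; apply: contra h => /andP[h1 h2]; apply/andP; split.
    by apply: lt_trans h1; rewrite ltrDl.
  by apply: (lt_trans h2); rewrite gtrBl.
have b0' : bumpf' (harmonic m) p q x = 0.
  move: h; rewrite negb_and -!leNgt => /orP[h|h]; rewrite /bumpf'.
    have t0 : x - (p + harmonic m) <= 0 by rewrite subr_le0 (le_trans h)// lerDl ltW.
    by rewrite !(flat0 _ _ t0) mulr0 !mul0r subrr.
  have t0 : q - harmonic m - x <= 0 by rewrite subr_le0 (le_trans _ h)// gerBl ltW.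
  by rewrite !(flat0 _ _ t0) !mulr0 subrr.
by rewrite /cutoff' b0 b0' !mul0r addr0.
Qed.

End cutoff.

(** * The lemma of du Bois-Reymond *)

Section du_bois_reymond.
Context {R : realType}.
Notation leb := (@lebesgue_measure R).
Implicit Types (p q r x : R) (Y : R -> R).

Lemma ae_exists p q (P : R -> Prop) : p < q -> {ae leb, forall r, p < r < q -> P r} ->
  exists r, p < r < q /\ P r.
Proof.
move=> pq [N [mN N0 sN]]; apply: contrapT => nex.
have sub : `]p, q[%classic `<=` N.
  move=> r; rewrite /= in_itv/= => rpq; apply: sN => /= h; apply: nex; exists r; split => //; exact: h.
have mI : measurable (`]p, q[%classic : set R) by [].
have : (leb `]p, q[%classic <= 0)%E by rewrite -N0; apply: le_measure; rewrite ?inE.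
by rewrite (leb_itvoo (ltW pq)) lee_fin leNgt subr_gt0 pq.
Qed.

(* With Phi(x) = int_p^x Y, the hypothesis reads (x - p) Phi(x) = 2 int_p^x Phi, so
   Phi is linear; only test functions vanishing at p and x are involved. *)
Lemma du_bois_reymond_itv p q Y : p < q -> leb.-integrable `]p, q[ (EFin \o Y) ->
  (forall x, p < x <= q -> \int[leb]_(r in `]p, x[) (Y r * (p + x - 2 * r)) = 0) ->
  exists C, {ae leb, forall r, p < r < q -> Y r = C}.
Proof.
move=> pq iY hY; have pq' := ltW pq.
pose Phi x := \int[leb]_(r in `]p, x[) Y r.
have acPhi : abs_cont p q Phi Y := AC_Rintegral iY.
have iPhi : leb.-integrable `]p, q[ (EFin \o Phi).
  by apply: integrable_continuous; exact: AC_continuous acPhi.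
pose Psi x := \int[leb]_(r in `]p, x[) Phi r.
have acPsi : abs_cont p q Psi Phi := AC_Rintegral iPhi.
have Phip : Phi p = 0 by rewrite /Phi /Rintegral set_itvoo0 integral_set0.
have e1 x : p < x -> x <= q -> (x - p) * Phi x = 2 * Psi x.
  move=> px xq; have px' := ltW px.
  have acl : abs_cont p x (fun r => p + x - 2 * r) (fun _ => - 2).
    apply: AC_C1 => [r _|]; last exact: cst_continuous.
    have h := is_derive_affine (-2) (- (p + x) / 2) r.
    have -> : (fun r => p + x - 2 * r) = (fun z => - 2 * (z + - (p + x) / 2)).
      by apply/funext => z; field.
    exact: h.
  have acx := AC_sub (lexx _) xq acPhi.
  have [iM hM] := AC_M px' acx acl.
  have := hM p x (lexx _) px' (lexx _); rewrite Phip mul0r subr0.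
  have iPx := integrable_sub_itv (lexx p) xq iPhi.
  have i1 : leb.-integrable `]p, x[ (EFin \o (fun r => Y r * (p + x - 2 * r))).
    have h := integrable_continuousM (AC_continuous px' acl) (integrable_sub_itv (lexx p) xq iY).
    by apply: lint1_eq h _ => // r _; rewrite /= mulrC.
  have mI : measurable (`]p, x[%classic : set R) by [].
  rewrite (lRint1_eq (g := fun r => Y r * (p + x - 2 * r) + (- 2) * Phi r)); last by move=> r _; ring.
  rewrite (lRint1D i1 (lint1Z _ iPx mI) mI) (lRint1Z _ iPx mI) hY ?px// -/(Psi x).
  move=> h; apply/eqP; rewrite -subr_eq0; apply/eqP.
  by transitivity (- (Phi x * (p + x - 2 * x)) + (- 2 * Psi x)); [ring|rewrite h; ring].
(* The relation (x - p) Phi = 2 Psi says that Psi / (x - p)^2 has derivative zero; away from [p] the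
   factor is smooth. *)
pose t x := ((x - p) ^+ 2)^-1.
have tE x : p < x -> is_derive x 1 t (- 2 * ((x - p) ^+ 3)^-1).
  move=> px; have ne : x - p != 0 by rewrite subr_eq0 gt_eqF.
  have d1 : is_derive x 1 (fun y : R => (y - p) ^+ 2) (2 * (x - p)).
    have h1 : is_derive x 1 (fun y : R => y - p) 1.
      by have := is_derive_affine 1 (- p) x; congr (is_derive _ _ _ _); apply/funext => y; rewrite mul1r.
    have h := @is_deriveX R R (fun y => y - p) 2 x 1 1 h1.
    have -> : (fun y : R => (y - p) ^+ 2) = (fun y => y - p) ^+ 2 by apply/funext => y; rewrite exprfctE.
    by apply: is_derive_eq h _; rewrite /GRing.scale/= mulr1 expr1 mulr_natl.
  have ne2 : (x - p) ^+ 2 != 0 by rewrite expf_neq0.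
  have h := @is_deriveV R (fun y : R => (y - p) ^+ 2) x _ 1 ne2 d1.
  by apply: is_derive_eq h _; rewrite /GRing.scale/=; field.
have const x y : p < x -> x <= y -> y <= q -> Psi x * t x = Psi y * t y.
  move=> px xy yq.
  have act : abs_cont x y t (fun z => - 2 * ((z - p) ^+ 3)^-1).
    apply: AC_C1 => [z /andP[xz zy]|]; first by apply: tE; exact: lt_le_trans xz.
    apply: continuous_in_subspaceT => z; rewrite inE/= in_itv/= => /andP[xz zy].
    have zp : 0 < z - p by rewrite subr_gt0; exact: lt_le_trans xz.
    apply: cvgM; first exact: cvg_cst.
    apply: cvgV; first by rewrite expf_neq0// gt_eqF.
    apply: (@cvg_comp _ _ _ (fun z : R => z - p) (fun y => y ^+ 3)); last exact: exprn_continuous.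
    by apply: cvgB; [exact: cvg_id|exact: cvg_cst].
  have [_ h] := AC_M xy (AC_sub (ltW px) yq acPsi) act.
  have := h x y (lexx _) xy (lexx _).
  rewrite (lRint1_eq (g := fun _ => 0)); last first.
    move=> z; rewrite /= in_itv/= => /andP[xz zy].
    have pz := lt_trans px xz; have zq := le_trans (ltW zy) yq.
    have ne : z - p != 0 by rewrite subr_eq0 gt_eqF.
    have := e1 z pz zq => e; rewrite /t.
    have -> : Phi z = 2 * Psi z / (z - p) by rewrite -e mulrAC mulfV// mul1r.
    by field.
  by rewrite /Rintegral integral0/= => /eqP; rewrite subr_eq0 => /eqP.
pose C := 2 * (Psi q * t q).
have PhiE x : p < x -> x <= q -> Phi x = C * (x - p).
  move=> px xq; have ne : x - p != 0 by rewrite subr_eq0 gt_eqF.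
  have := e1 x px xq => e; rewrite /C -(const x q px xq (lexx _)) /t.
  have -> : Phi x = 2 * Psi x / (x - p) by rewrite -e mulrAC mulfV// mul1r.
  by field.
have ic : leb.-integrable `]p, q[ (EFin \o (fun _ : R => C)).
  by apply: integrable_continuous; exact: cst_continuous.
have mI : measurable (`]p, q[%classic : set R) by [].
exists C; have iYC := lint1B iY ic mI.
suff : {ae leb, forall r, p < r < q -> Y r - C = 0}.
  by apply: ae_imp => r h rpq; apply/eqP; rewrite -subr_eq0; apply/eqP; exact: h.
apply: (ae_eq0_of_primitive0 iYC) => x /andP[px xq].
have mx : measurable (`]x, q[%classic : set R) by [].
have sub : `]x, q[%classic `<=` `]p, q[%classic by apply: itvoo_subset => //; exact: ltW.
rewrite (lRint1B (lint1_sub iY mI mx sub) (lint1_sub ic mI mx sub) mx).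
rewrite -(acPhi.2 x q (ltW px) (ltW xq) (lexx _)) (PhiE q pq (lexx _)) (PhiE x px (ltW xq)).
rewrite Rintegral_cst//= (leb_itvoo (ltW xq))/=; ring.
Qed.

(** Intervals that contain the middle third share its constant, by comparison at one of its points,
    and they exhaust []0, rho[]. *)
Lemma du_bois_reymond (rho : R) Y : 0 < rho ->
  (forall p q, 0 < p -> p < q -> q < rho -> leb.-integrable `]p, q[ (EFin \o Y)) ->
  (forall p q, 0 < p -> p < q -> q < rho -> \int[leb]_(r in `]p, q[) (Y r * (p + q - 2 * r)) = 0) ->
  exists C, {ae leb, forall r, 0 < r < rho -> Y r = C}.
Proof.
move=> rho0 iY hY.
have claim p q : 0 < p -> p < q -> q < rho -> exists C, {ae leb, forall r, p < r < q -> Y r = C}.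
  move=> p0 pq qr; apply: du_bois_reymond_itv => //; first exact: iY.
  by move=> x /andP[px xq]; apply: hY => //; exact: le_lt_trans qr.
have [b1 b2 b3] : [/\ 0 < rho / 3, rho / 3 < 2 * rho / 3 & 2 * rho / 3 < rho] by split; lra.
have [C hC] := claim _ _ b1 b2 b3; exists C.
have claim2 p q : 0 < p -> p <= rho / 3 -> 2 * rho / 3 <= q -> q < rho -> {ae leb, forall r, p < r < q -> Y r = C}.
  move=> p0 p1 q1 qr; have [|C' hC'] := claim p q p0 _ qr; first lra.
  have [|r [_ ->]] // := @ae_exists (rho / 3) (2 * rho / 3) (fun r => C = C') b2 _.
  apply: ae_imp2 hC hC' => r h h' rr; rewrite -h// -h'//.
  by move/andP: rr => [r1 r2]; apply/andP; split; lra.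
have : {ae leb, forall r, forall m : nat, rho / 3 * harmonic m < r < rho - rho / 3 * harmonic m -> Y r = C}.
  apply: ae_foralln => m.
  have [h h0 h1] : exists2 h : R, 0 < h & h = harmonic m /\ h <= 1.
    by exists (harmonic m); [rewrite /harmonic/= invr_gt0|split => //; rewrite /harmonic/= invf_le1// ler1n].
  have [<- h2] := h1.
  have k1 : rho / 3 * h <= rho / 3 by rewrite ger_pMr.
  have k0 : 0 < rho / 3 * h by rewrite mulr_gt0.
  by apply: claim2; lra.
apply: ae_imp => r h /andP[r0 rr].
pose e : R := Num.min r (rho - r) / rho.
have e0 : 0 < e by rewrite divr_gt0// lt_min r0 subr_gt0.
have [N _ hN] := near_infty_natSinv_lt (PosNum e0).
have {hN} := hN N (leqnn _) => /= hN.
have [k [k0 hk]] : exists k : R, k = harmonic N /\ k < e by exists (harmonic N).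
have [m1 m2] : Num.min r (rho - r) <= r /\ Num.min r (rho - r) <= rho - r by rewrite !ge_min !lexx orbT.
have k1 : k * rho < Num.min r (rho - r) by move: hk; rewrite /e ltr_pdivlMr.
have kp : 0 < k by rewrite k0 /harmonic/= invr_gt0.
have kr : 0 < k * rho by rewrite mulr_gt0.
by apply: (h N); rewrite -k0; apply/andP; split; lra.
Qed.

End du_bois_reymond.

Section weighted_fubini.
Context {R : realType}.
Notation leb := (@lebesgue_measure R).

Lemma bounded_mul1 (D : set R) (u g : R -> R) (M : R) : measurable D ->
  leb.-integrable D (EFin \o u) -> measurable_fun D g -> (forall x, D x -> `|g x| <= M) ->
  leb.-integrable D (EFin \o (fun x => g x * u x)).
Proof.
move=> mD iu mg gM; apply: (lint1_le (lint1Z M (lint1_norm iu) mD) mD).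
  by apply: measurable_funM => //; exact: lint1_measurable iu.
by move=> x Dx; rewrite normrM; apply: ler_wpM2r => //; exact: gM.
Qed.

Lemma bounded_mul2 (D : set (R * R)) (u g : R * R -> R) (M : R) : measurable D ->
  leb2.-integrable D (EFin \o u) -> measurable_fun D g -> (forall x, D x -> `|g x| <= M) ->
  leb2.-integrable D (EFin \o (fun x => g x * u x)).
Proof.
move=> mD iu mg gM; apply: (lint2_le (lint2Z M (lint2_norm iu) mD) mD).
  by apply: measurable_funM => //; exact: lint2_measurable iu.
by move=> x Dx; rewrite normrM; apply: ler_wpM2r => //; exact: gM.
Qed.

Lemma lRint1_ae_eq (D : set R) (f g : R -> R) : measurable D ->
  measurable_fun D f -> measurable_fun D g -> {ae leb, forall x, D x -> f x = g x} ->
  \int[leb]_(x in D) f x = \int[leb]_(x in D) g x.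
Proof.
move=> mD mf mg fg; rewrite /Rintegral; congr fine.
apply: (@ae_eq_integral _ (measurableTypeR R) R leb) => //; [exact/measurable_EFinP|exact/measurable_EFinP|].
by apply: ae_imp fg => x h Dx; rewrite h.
Qed.

Lemma weighted_fubini (A B : set R) (H : R * R -> R) (c : R -> R) (M : R) :
  measurable A -> measurable B -> leb2.-integrable (A `*` B) (EFin \o H) ->
  measurable_fun A c -> (forall r, A r -> `|c r| <= M) ->
  leb2.-integrable (A `*` B) (EFin \o (fun x => c x.1 * H x)) /\
  \int[leb2]_(x in A `*` B) (c x.1 * H x) = \int[leb]_(r in A) (c r * \int[leb]_(z in B) H (r, z)).
Proof.
move=> mA mB iH mc cM.
have mAB : measurable (A `*` B) by exact: measurableX.
have mc2 : measurable_fun (A `*` B) (fun x : R * R => c x.1).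
  apply: (@measurable_comp _ _ _ _ _ _ A c _ fst) => //; first by move=> _ [[r z] [/= Ar _] <-].
  by apply: measurable_funTS; exact: measurable_fst.
have icH := bounded_mul2 mAB iH mc2 (fun x Dx => cM x.1 Dx.1).
split => //; rewrite (leb_fubini1 mA mB icH).
apply: lRint1_ae_eq => //.
- exact: lint1_measurable (leb_integrable_fubini1 mA mB icH).
- by apply: measurable_funM => //; exact: lint1_measurable (leb_integrable_fubini1 mA mB iH).
apply: ae_imp (leb_ae_integrable1 mA mB iH) => r h Ar.
exact: (lRint1Z (c r) (h Ar) mB).
Qed.

End weighted_fubini.

(** * The radial equation of a sine coefficient *)

Section ode.
Context {R : realType}.
Notation leb := (@lebesgue_measure R).
Variables (rho a : R) (psi psir psiz omega : R * R -> R) (n : nat).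
Hypotheses (rho0 : 0 < rho) (a0 : 0 < a).
Notation D := (cyl 0 rho a).
Notation J := (`](- a), a[%classic : set R).
Hypothesis wr : weak_der D 1 0 psi psir.
Hypothesis wz : weak_der D 0 1 psi psiz.
Hypothesis deq : forall phi, smooth phi -> supported_in D phi ->
  - (\int[leb2]_(x in D) (psi x * pder 2 0 phi x))
  - (\int[leb2]_(x in D) (x.1^-1 * psir x * phi x))
  - (\int[leb2]_(x in D) (psi x * pder 0 2 phi x))
  - (\int[leb2]_(x in D) (2 / x.1 * psir x * phi x))
  = \int[leb2]_(x in D) (omega x * phi x).
Hypothesis ir : forall d, 0 < d < rho -> leb2.-integrable (cyl d rho a) (EFin \o psir).
Hypothesis iz : forall d, 0 < d < rho -> leb2.-integrable (cyl d rho a) (EFin \o psiz).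
Hypothesis io : forall d, 0 < d < rho -> leb2.-integrable (cyl d rho a) (EFin \o omega).

Let U r := \int[leb]_(z in J) (psir (r, z) * sn a n z).
Let Z r := \int[leb]_(z in J) (psiz (r, z) * cn a n z).
Let W r := \int[leb]_(z in J) (omega (r, z) * sn a n z).
Let k := freq a n.

Lemma itrig2 d (t : R -> R) (g : R * R -> R) : continuous t -> (forall z, `|t z| <= 1) ->
  leb2.-integrable (cyl d rho a) (EFin \o g) ->
  leb2.-integrable (cyl d rho a) (EFin \o (fun x => g x * t x.2)).
Proof.
move=> ct t1 ig; have mD := measurable_cyl d rho a.
apply: (lint2_le (lint2_norm ig) mD).
  apply: measurable_funM; [exact: lint2_measurable ig|].
  by apply: measurable_funTS; apply: (measurableT_comp (continuous_measurable_fun ct)); exact: measurable_snd.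
by move=> x _; rewrite normrM -[leRHS]mulr1; apply: ler_wpM2l.
Qed.

Lemma bounded_of_compact_support (p q : R) (f : R -> R) : continuous f ->
  (forall r, ~ (p <= r <= q) -> f r = 0) -> exists2 M, 0 < M & forall r, `|f r| <= M.
Proof.
move=> cf vf.
have /compact_bounded[M [_ hM]] : compact (f @` `[p, q]%classic).
  by apply: continuous_compact; [exact: continuous_subspaceT|exact: segment_compact].
exists (`|M| + 1); first by rewrite ltr_wpDl.
move=> r; have [xr|xr] := pselect (p <= r <= q); last by rewrite vf// normr0 addr_ge0.
by apply: (hM (`|M| + 1)); [rewrite ltr_pwDr// ler_norm|exists r; rewrite //= in_itv].
Qed.

Section test.
Variables (p q : R) (eta : R -> R).
Hypotheses (p0 : 0 < p) (pq : p < q) (qr : q < rho) (seta : smooth1 eta).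
Hypothesis veta : forall r, ~ (p <= r <= q) -> eta r = 0.

Let E := cyl (p / 2) rho a.
Let IE := (`]p / 2, rho[%classic : set R).
Let eta' := eta^`()%classic.
Let chi m := cutoff (- a) a (sn a n) m.
Let chi' m := cutoff' (- a) a (sn a n) (fun z => k * cn a n z) m.
Let k0 : 0 < k := freq_gt0 a0 n.

Let schi m : smooth1 (chi m).
Proof.
apply: smooth1M; last exact: smooth1_sn.
by apply: smooth1_bump; rewrite /harmonic/= invr_gt0.
Qed.

Let dchi m : (chi m)^`()%classic = chi' m.
Proof. by apply: is_derive_derive1 => z; apply: is_derive_cutoff => y; exact: is_derive_sn. Qed.

Let supp m (f g : R -> R) : (forall r, ~ (p <= r <= q) -> f r = 0) ->
  (forall z, ~ (- a + harmonic m <= z <= a - harmonic m) -> g z = 0) ->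
  supported_in D (tensor f g).
Proof.
move=> vf vg; apply: (@vanish_off_supported R p q (a - harmonic m)) => //.
  by rewrite gtrBl /harmonic/= invr_gt0.
move=> [r z] nx; rewrite /tensor/=.
have [hr|hr] := pselect (p <= r <= q); last by rewrite vf// mul0r.
rewrite vg ?mulr0// => hz; apply: nx; split; rewrite /= in_itv//=.
by rewrite opprB addrC.
Qed.

Let vchi m z : ~ (- a + harmonic m <= z <= a - harmonic m) -> chi m z = 0.
Proof.
move=> h; rewrite /chi cutoff_out//; apply/negP => /andP[h1 h2]; apply: h.
by rewrite !ltW.
Qed.

Let vchi' m z : ~ (- a + harmonic m <= z <= a - harmonic m) -> chi' m z = 0.
Proof. by move=> h; rewrite -dchi; apply: derive1_vanish h => y; exact: vchi. Qed.

Let veta' r : ~ (p <= r <= q) -> eta' r = 0.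
Proof. by move=> h; apply: derive1_vanish h => y; exact: veta. Qed.

Let p2 : 0 < p / 2 < rho.
Proof. by have ? := p0; have ? := pq; have ? := qr; apply/andP; split; lra. Qed.

(** The sine has Lipschitz constant k and vanishes at both ends. These are the hypotheses of
    [cutoff'_bound] with L and L' both equal to k. *)
Lemma sn_cutoff_bounds z : - a < z < a ->
  [/\ `|sn a n z| <= k * (z - - a), `|sn a n z| <= k * (a - z) & `|k * cn a n z| <= k].
Proof.
have lip (x y : R) : `|sn a n x - sn a n y| <= k * `|x - y|.
  wlog xy : x y / y <= x => [hw|].
    have [|/ltW xy] := leP y x; first exact: hw.
    by rewrite distrC [X in _ <= _ * X]distrC; exact: hw.
  have ac : abs_cont y x (sn a n) (fun z => k * cn a n z).
    apply: AC_C1 => [t _|]; first exact: is_derive_sn.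
    by apply: continuous_subspaceT => t; apply: cvgM; [exact: cvg_cst|exact: continuous_cn].
  rewrite (ac.2 y x (lexx _) xy (lexx _)).
  have mI : measurable (`]y, x[%classic : set R) by [].
  apply: le_trans (lRint1_norm ac.1 mI) _.
  have ic : leb.-integrable `]y, x[ (EFin \o (fun _ : R => k)).
    by apply: integrable_continuous; exact: cst_continuous.
  apply: le_trans (lRint1_le (lint1_norm ac.1) ic mI _) _.
    by move=> t _; rewrite normrM gtr0_norm// -[leRHS]mulr1; apply: ler_wpM2l; [exact: ltW|exact: norm_cn].
  by rewrite Rintegral_cst//= (leb_itvoo xy)/= ger0_norm// subr_ge0.
move=> /andP[az za]; split.
- by have h1 : 0 <= z - - a by [rewrite subr_ge0 ltW]; have := lip z (- a); rewrite snNa subr0 (ger0_norm h1).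
- by have h1 : 0 <= a - z by [rewrite subr_ge0 ltW]; have := lip z a; rewrite (sna a0 n) subr0 distrC (ger0_norm h1).
- by rewrite normrM gtr0_norm// -[leRHS]mulr1; apply: ler_wpM2l; [exact: ltW|exact: norm_cn].
Qed.

(** The test function is [eta] in r times the cut-off sine in z. Moving one derivative onto [psi] in
    each variable leaves psi_r and psi_z only, and dominated convergence removes the cutoff. The
    coefficient 3 / r collects 1 / r of the Laplacian and 2 / r of the equation. *)
Lemma ode_test : [/\
  leb.-integrable IE (EFin \o (fun r => eta' r * U r)),
  leb.-integrable IE (EFin \o (fun r => 3 * r `^ (- 1) * eta r * U r)),
  leb.-integrable IE (EFin \o (fun r => k * eta r * Z r)),
  leb.-integrable IE (EFin \o (fun r => eta r * W r)) &
  \int[leb]_(r in IE) (eta' r * U r) - \int[leb]_(r in IE) (3 * r `^ (- 1) * eta r * U r)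
  + \int[leb]_(r in IE) (k * eta r * Z r) - \int[leb]_(r in IE) (eta r * W r) = 0].
Proof.
have mE : measurable E := measurable_cyl _ _ _.
have mI : measurable IE by exact: measurable_itv.
have mJ : measurable J by [].
have iR := ir p2; have iZ := iz p2; have iO := io p2.
have ceta := smooth1_continuous seta.
have ceta' := smooth1_continuous (smooth1_derive seta).
have [M1 M10 hM1] := bounded_of_compact_support ceta veta.
have [M2 M20 hM2] := bounded_of_compact_support ceta' veta'.
have meta : measurable_fun IE eta by apply: measurable_funTS; exact: continuous_measurable_fun.
have meta' : measurable_fun IE eta' by apply: measurable_funTS; exact: continuous_measurable_fun.
pose c1 := eta'; pose c2 r := 3 * r `^ (- 1) * eta r; pose c3 r := eta r.
have mc2 : measurable_fun IE c2.
  by apply: measurable_funM => //; apply: measurable_funM => //; exact: measurable_powR_on.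
have rinv r : IE r -> 0 <= r `^ (- 1) <= 2 / p.
  rewrite /IE/= in_itv/= => /andP[h1 h2]; rewrite powR_ge0/=.
  have r0 : 0 < r by apply: lt_trans h1; rewrite divr_gt0.
  rewrite powR_inv1; last exact: ltW.
  by rewrite -[leRHS]invrK invf_div lef_pV2 ?posrE// ?divr_gt0// ltW.
have hc2 r : IE r -> `|c2 r| <= 3 * (2 / p) * M1.
  move=> Ir; have /andP[k1 k2] := rinv r Ir.
  rewrite /c2 normrM normrM ger0_norm// (ger0_norm k1).
  by apply: ler_pM => //; [rewrite mulr_ge0|apply: ler_wpM2l].
pose sn2 x := sn a n x.2 : R; pose cn2 x := cn a n x.2 : R.
have iRs := itrig2 (@continuous_sn R a n) (norm_sn a n) iR.
have iZc := itrig2 (@continuous_cn R a n) (norm_cn a n) iZ.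
have iOs := itrig2 (@continuous_sn R a n) (norm_sn a n) iO.
have [j1 f1] := weighted_fubini mI mJ iRs meta' (fun r _ => hM2 r).
have [j2 f2] := weighted_fubini mI mJ iRs mc2 hc2.
have [j3 f3] := weighted_fubini mI mJ iZc meta (fun r _ => hM1 r).
have [j4 f4] := weighted_fubini mI mJ iOs meta (fun r _ => hM1 r).
have g1 := bounded_mul1 mI (leb_integrable_fubini1 mI mJ iRs) meta' (fun r _ => hM2 r).
have g2 := bounded_mul1 mI (leb_integrable_fubini1 mI mJ iRs) mc2 hc2.
have g3 := bounded_mul1 mI (leb_integrable_fubini1 mI mJ iZc) meta (fun r _ => hM1 r).
have g4 := bounded_mul1 mI (leb_integrable_fubini1 mI mJ iOs) meta (fun r _ => hM1 r).
have ec3 r : k * (eta r * Z r) = k * eta r * Z r by rewrite mulrA.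
split => //.
  by apply: lint1_eq (lint1Z k g3 mI) mI => r _; exact: ec3.
have -> : \int[leb]_(r in IE) (k * eta r * Z r) = k * \int[leb]_(r in IE) (eta r * Z r).
  by rewrite -(lRint1Z k g3 mI); apply: lRint1_eq => r _; rewrite mulrA.
rewrite -f1 -f2 -f3 -f4.
pose G x := c1 x.1 * (psir x * sn a n x.2) - c2 x.1 * (psir x * sn a n x.2)
  + k * (eta x.1 * (psiz x * cn a n x.2)) - eta x.1 * (omega x * sn a n x.2).
pose F m x := c1 x.1 * (psir x * chi m x.2) - c2 x.1 * (psir x * chi m x.2)
  + eta x.1 * (psiz x * chi' m x.2) - eta x.1 * (omega x * chi m x.2).
have -> : \int[leb2]_(x in E) (eta' x.1 * (psir x * sn a n x.2)) - \int[leb2]_(x in E) (c2 x.1 * (psir x * sn a n x.2))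
   + k * \int[leb2]_(x in E) (eta x.1 * (psiz x * cn a n x.2)) - \int[leb2]_(x in E) (eta x.1 * (omega x * sn a n x.2))
   = \int[leb2]_(x in E) G x.
  rewrite -(lRint2Z k j3 mE) -(lRint2B j1 j2 mE) -(lRint2D (lint2B j1 j2 mE) (lint2Z k j3 mE) mE).
  by rewrite -(lRint2B (lint2D (lint2B j1 j2 mE) (lint2Z k j3 mE) mE) j4 mE).
have na z : J z -> - a < z < a by rewrite /= in_itv.
have chib m z : J z -> `|chi m z| <= 1.
  move=> Jz; rewrite /chi /cutoff normrM; apply: mulr_ile1 => //; first exact: bump_le1_norm.
  exact: norm_sn.
(* The derivative of the bump accounts for 10 k, that of the sine for k. *)
have chi'b m z : J z -> `|chi' m z| <= 11 * k.
  move=> /na Jz; have := @cutoff'_bound R (- a) a k k (sn a n) (fun z => k * cn a n z).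
  have -> : 11 * k = 10 * k + k by ring.
  by apply => // y hy; have [] := sn_cutoff_bounds hy.
have msn (f : R -> R) : continuous f -> measurable_fun E (fun x : R * R => f x.2).
  by move=> cf; apply: measurable_funTS; apply: (measurableT_comp (continuous_measurable_fun cf)); exact: measurable_snd.
have mfs (f : R -> R) : measurable_fun IE f -> measurable_fun E (fun x : R * R => f x.1).
  move=> mf; apply: (@measurable_comp _ _ _ _ _ _ IE f _ fst) => //; first by move=> _ [[r z] [/= Ar _] <-].
  by apply: measurable_funTS; exact: measurable_fst.
have cchi m : continuous (chi m) by exact: (smooth1_continuous (@schi m)).
have cchi' m : continuous (chi' m).
  by rewrite -dchi; exact: (smooth1_continuous (smooth1_derive (@schi m))).
have mR := lint2_measurable iR; have mZ := lint2_measurable iZ; have mO := lint2_measurable iO.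
have tm (u : R * R -> R) (c t : R -> R) : measurable_fun E u -> measurable_fun IE c -> continuous t ->
    measurable_fun E (fun x => c x.1 * (u x * t x.2)).
  by move=> m1 m2 m3; apply: measurable_funM; [exact: mfs|apply: measurable_funM => //; exact: msn].
pose C := M2 + 3 * (2 / p) * M1.
pose dom (x : R * R) := C * `|psir x| + (11 * k * M1) * `|psiz x| + M1 * `|omega x|.
have idom : leb2.-integrable E (EFin \o dom).
  apply: (lint2D _ (lint2Z _ (lint2_norm iO) mE) mE).
  exact: (lint2D (lint2Z _ (lint2_norm iR) mE) (lint2Z _ (lint2_norm iZ) mE) mE).
have mF m : measurable_fun E (F m).
  by apply: measurable_funB; [apply: measurable_funD; [apply: measurable_funB|]|]; exact: tm.
have mG : measurable_fun E G.
  apply: measurable_funB; last by apply: tm => //; exact: continuous_sn.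
  apply: measurable_funD; first by apply: measurable_funB; apply: tm => //; exact: continuous_sn.
  by apply: measurable_funM => //; apply: tm => //; exact: continuous_cn.
have hF m x : E x -> `|F m x| <= dom x.
  move=> -[Ir Jz]; have b1 := chib m _ Jz; have b2 := chi'b m _ Jz.
  rewrite /F /dom; apply: (le_trans (ler_normB _ _)); apply: lerD; last first.
    rewrite normrM; apply: ler_pM => //; rewrite normrM -[leRHS]mulr1; exact: ler_wpM2l.
  apply: (le_trans (ler_normD _ _)); apply: lerD; last first.
    rewrite 2!normrM; have -> : 11 * k * M1 * `|psiz x| = M1 * (`|psiz x| * (11 * k)) by ring.
    by apply: ler_pM; [exact: normr_ge0|by rewrite mulr_ge0|exact: hM1|exact: ler_wpM2l].
  rewrite -mulrBl normrM; apply: ler_pM => //.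
    apply: (le_trans (ler_normB _ _)); apply: lerD; [exact: hM2|exact: hc2].
  by rewrite normrM -[leRHS]mulr1; exact: ler_wpM2l.
have lim : \int[leb2]_(x in E) F m x @[m --> \oo] --> \int[leb2]_(x in E) G x.
  apply: (lRint2_dct mE mF mG idom hF); apply: aeW => -[r z] [/= Ir Jz].
  have zJ := na _ Jz.
  have l1 : chi m z @[m --> \oo] --> sn a n z by exact: cvg_cutoff.
  have l2 : chi' m z @[m --> \oo] --> k * cn a n z by exact: cvg_cutoff'.
  have cc (c : R) (s : nat -> R) l : s m @[m --> \oo] --> l -> c * s m @[m --> \oo] --> c * l.
    by move=> h; apply: cvgM => //; exact: cvg_cst.
  apply: cvgB; last by apply: (cc _ _ _ (cc _ _ _ l1)).
  apply: cvgD; first by apply: cvgB; apply: (cc _ _ _ (cc _ _ _ l1)).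
  have -> : k * (eta r * (psiz (r, z) * cn a n z)) = eta r * (psiz (r, z) * (k * cn a n z)) by ring.
  by apply: (cc _ _ _ (cc _ _ _ l2)).
suff zero m : \int[leb2]_(x in E) F m x = 0.
  have c0 : \int[leb2]_(x in E) F m x @[m --> \oo] --> (0 : R).
    by under eq_cvg do rewrite zero; exact: cvg_cst.
  exact: (cvg_unique _ lim c0).
have bt (u : R * R -> R) (c t : R -> R) (Mc Mt : R) : leb2.-integrable E (EFin \o u) -> measurable_fun IE c ->
    continuous t -> (forall r, IE r -> `|c r| <= Mc) -> (forall z, J z -> `|t z| <= Mt) ->
    leb2.-integrable E (EFin \o (fun x => c x.1 * (u x * t x.2))).
  move=> iu mc ct hc ht; apply: (lint2_eq (f := fun x => (c x.1 * t x.2) * u x)) => //; first by move=> x _; ring.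
  apply: (bounded_mul2 (M := Mc * Mt)) => //.
    by apply: measurable_funM; [exact: mfs|exact: msn].
  by move=> x [Ir Jz]; rewrite normrM; apply: ler_pM => //; [exact: hc|exact: ht].
have i1 := bt _ _ _ _ _ iR meta' (cchi m) (fun r _ => hM2 r) (chib m).
have i2 := bt _ _ _ _ _ iR mc2 (cchi m) hc2 (chib m).
have i3 := bt _ _ _ _ _ iZ meta (cchi' m) (fun r _ => hM1 r) (chi'b m).
have i4 := bt _ _ _ _ _ iO meta (cchi m) (fun r _ => hM1 r) (chib m).
rewrite /F (lRint2B (lint2D (lint2B i1 i2 mE) i3 mE) i4 mE) (lRint2D (lint2B i1 i2 mE) i3 mE) (lRint2B i1 i2 mE).
have seta' := smooth1_derive seta; have schi' : smooth1 (chi' m) by rewrite -dchi; exact: (smooth1_derive (@schi m)).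
have s1 := supp veta' (@vchi m); have s2 := supp veta (@vchi' m); have s3 := supp veta (@vchi m).
have [_ _ wr'] := wr; have [_ _ wz'] := wz.
have e1 := wr' _ (smooth_tensor seta' (@schi m)) s1.
have e2 := wz' _ (smooth_tensor seta schi') s2.
have e3 := deq (smooth_tensor seta (@schi m)) s3.
have sub : E `<=` D.
  move=> [r z] [/= h1 h2]; split => //=; apply: (itvoo_subset _ (lexx rho)) h1.
  by move/andP: p2 => [/ltW].
have off (f : R -> R) x : (forall r, ~ (p <= r <= q) -> f r = 0) -> D x -> ~ E x -> f x.1 = 0.
  move=> vf [/= + Jz] nE; rewrite in_itv/= => /andP[r0 rr]; apply: vf => /andP[pr rq].
  apply: nE; split => //=; rewrite in_itv/= rr andbT.
  by apply: lt_le_trans pr; rewrite ltr_pdivrMr// ltr_pMr// ltr1n.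
have wid (u : R * R -> R) (f g : R -> R) : (forall r, ~ (p <= r <= q) -> f r = 0) ->
    \int[leb2]_(x in D) (u x * tensor f g x) = \int[leb2]_(x in E) (f x.1 * (u x * g x.2)).
  move=> vf; rewrite (@lRint2_widen R D E)//.
    by apply: lRint2_eq => x _; rewrite /tensor; ring.
  by move=> x Dx nE; rewrite /tensor off// mul0r mulr0.
(* One derivative is made part of a new test function, so that the first-order weak derivatives of
   [psi] suffice; [q2] does the same in z. *)
have q1 : pder 2 0 (tensor eta (chi m)) = pder 1 0 (tensor eta' (chi m)).
  by rewrite (pder_tensor 2 0 seta (@schi m)) (pder_tensor 1 0 seta' (@schi m)).
have q2 : pder 0 2 (tensor eta (chi m)) = pder 0 1 (tensor eta (chi' m)).
  by rewrite (pder_tensor 0 2 seta (@schi m)) (pder_tensor 0 1 seta schi') -dchi.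
move: e3; rewrite q1 q2 e1 e2 !wid//.
set I1 := \int[leb2]_(x in E) (eta' x.1 * _); set I3 := \int[leb2]_(x in E) (eta x.1 * (psiz x * _)).
set I4 := \int[leb2]_(x in E) (eta x.1 * (omega x * _)).
set I2 := \int[leb2]_(x in E) (c2 x.1 * _).
have r1 x : E x -> x.1 `^ (- 1) = x.1^-1.
  move=> [/= + _]; rewrite in_itv/= => /andP[h1 h2]; rewrite powR_inv1//.
  by apply: ltW; apply: lt_trans h1; rewrite divr_gt0.
(* [c2] contains the factor 3 / r, of which the Laplacian contributes one third and the term (2/r)
   psi_r two thirds. *)
have -> : \int[leb2]_(x in E) (eta x.1 * (x.1^-1 * psir x * chi m x.2)) = 3^-1 * I2.
  rewrite /I2 -(lRint2Z _ i2 mE); apply: lRint2_eq => x Ex; rewrite /c2 r1//; field.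
  by have [/= + _] := Ex; rewrite in_itv/= => /andP[h1 h2]; rewrite gt_eqF//; apply: lt_trans h1; rewrite divr_gt0.
have -> : \int[leb2]_(x in E) (eta x.1 * (2 / x.1 * psir x * chi m x.2)) = 2 / 3 * I2.
  rewrite /I2 -(lRint2Z _ i2 mE); apply: lRint2_eq => x Ex; rewrite /c2 r1//; field.
  by have [/= + _] := Ex; rewrite in_itv/= => /andP[h1 h2]; rewrite gt_eqF//; apply: lt_trans h1; rewrite divr_gt0.
rewrite /= !expr1 !mulN1r => h.
have -> : I1 - I2 + I3 - I4 = (- (- I1) - 3^-1 * I2 - - I3 - 2 / 3 * I2) - I4 by field.
by rewrite h subrr.
Qed.

End test.

Variables (Psi : R -> R) (M K : R).
Let h r := k ^+ 2 * Psi r - W r.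
Hypothesis ZPsi : {ae leb, forall r, 0 < r < rho -> Z r = k * Psi r}.
Hypothesis mU : measurable_fun `]0, rho[ U.
Hypothesis mPsi : measurable_fun `]0, rho[ Psi.
Hypothesis mW : measurable_fun `]0, rho[ W.
Hypothesis hM : (\int[leb]_(s in `]0%R, rho[) ((h s) ^+ 2 * s)%:E <= M%:E)%E.
Hypothesis UK : (\int[leb]_(s in `]0%R, rho[) ((U s) ^+ 2 * s)%:E <= K%:E)%E.

Let mh : measurable_fun `]0, rho[ h.
Proof. by apply: measurable_funB => //; apply: measurable_funM. Qed.

(** With eta = r^3 th the tested equation says that r^3 U th' + r^3 h th has integral zero;
    integration by parts of the second term replaces it by - V th'. Taking cutoffs of (r - p)(q - r)
    for th gives the hypothesis of [du_bois_reymond] for r^3 U - V, and the constant found is then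
    excluded at the axis. *)
Lemma ode_integrated :
  {ae leb, forall r, 0 < r < rho -> r ^+ 3 * U r = \int[leb]_(s in `]0, r[) (s ^+ 3 * h s)}.
Proof.
have [ish bV] := weighted_primitive_bound mh hM.
have [isU bU] := weighted_primitive_bound mU UK.
pose V r := \int[leb]_(s in `]0, r[) (s ^+ 3 * h s).
have acV : abs_cont 0 rho V (fun s => s ^+ 3 * h s) := AC_Rintegral ish.
have cV := AC_continuous (ltW rho0) acV.
have iV : leb.-integrable `]0, rho[ (EFin \o V) by exact: integrable_continuous.
pose Y r := r ^+ 3 * U r - V r.
have mI0 : measurable (`]0, rho[%classic : set R) by [].
have iY : leb.-integrable `]0, rho[ (EFin \o Y) := lint1B isU iV mI0.
have [C hC] : exists C, {ae leb, forall r, 0 < r < rho -> Y r = C}.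
  apply: du_bois_reymond => // p q p0 pq qr.
    by apply: integrable_sub_itv iY; exact: ltW.
  pose g (r : R) : R := (r - p) * (q - r); pose g' (r : R) : R := p + q - 2 * r.
  have dg (x : R) : is_derive x 1 g (g' x).
    have d1 : is_derive x 1 (fun r : R => r - p) 1.
      by have := is_derive_affine 1 (- p) x; congr (is_derive _ _ _ _); apply/funext => y; rewrite mul1r.
    have d2 : is_derive x 1 (fun r : R => q - r) (- 1).
      by have := is_derive_affine (- 1) (- q) x; congr (is_derive _ _ _ _); apply/funext => y; ring.
    by have := is_deriveM d1 d2 => d; apply: is_derive_eq d _; rewrite /g' /GRing.scale/=; ring.
  have qp : 0 < q - p by rewrite subr_gt0.
  have gl (x : R) : p < x < q -> `|g x| <= (q - p) * (x - p).
    move=> /andP[px xq]; have h1 : 0 < x - p by rewrite subr_gt0.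
    have h2 : 0 < q - x by rewrite subr_gt0.
    rewrite /g normrM !gtr0_norm// mulrC; apply: ler_wpM2r; first exact: ltW.
    by apply: lerB => //; exact: ltW.
  have gr (x : R) : p < x < q -> `|g x| <= (q - p) * (q - x).
    move=> /andP[px xq]; have h1 : 0 < x - p by rewrite subr_gt0.
    have h2 : 0 < q - x by rewrite subr_gt0.
    rewrite /g normrM !gtr0_norm//; apply: ler_wpM2r; first exact: ltW.
    by apply: lerB => //; exact: ltW.
  have g'b (x : R) : p < x < q -> `|g' x| <= 2 * (q - p).
    by move=> /andP[px xq]; rewrite ler_norml /g'; apply/andP; split; lra.
  pose th m := cutoff p q g m; pose th' m := cutoff' p q g g' m.
  have hm m : 0 < harmonic m :> R by rewrite /harmonic/= invr_gt0.
  have sg : smooth1 g.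
    apply: smooth1M; [have := @smooth1_affine R _ 1 (- p) (@smooth1_id R)|have := @smooth1_affine R _ (- 1) (- q) (@smooth1_id R)];
    by congr smooth1; apply/funext => y; ring.
  have sth m : smooth1 (th m) := smooth1M (@smooth1_bump R _ p q (hm m)) sg.
  have dth m : (th m)^`()%classic = th' m.
    by apply: is_derive_derive1 => z; apply: is_derive_cutoff => y; exact: dg.
  have oth m r : ~ (p <= r <= q) -> th m r = 0.
    move=> nr; rewrite /th cutoff_out//; apply/negP => /andP[h1 h2]; apply: nr.
    have := hm m => hmm; apply/andP; split; lra.
  have oth' m r : ~ (p < r < q) -> th' m r = 0 by move=> /negP nr; exact: cutoff'_out.
  pose IE := (`]p / 2, rho[%classic : set R).
  have mIE : measurable IE by exact: measurable_itv.
  have p2 : 0 < p / 2 by rewrite divr_gt0.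
  have p2r : p / 2 <= rho by lra.
  have subIE : IE `<=` `]0, rho[%classic by apply: itvoo_subset => //; exact: ltW.
  have zero m : \int[leb]_(r in `]p, q[) (Y r * th' m r) = 0.
    pose eta r := r ^+ 3 * th m r.
    have seta : smooth1 eta := smooth1M (@smooth1X R 3%N) (sth m).
    have veta r : ~ (p <= r <= q) -> eta r = 0 by move=> nr; rewrite /eta oth// mulr0.
    have [g1 g2 g3 g4 hsum] := ode_test p0 pq qr seta veta.
    have etaE r : eta^`()%classic r = 3 * r ^+ 2 * th m r + r ^+ 3 * th' m r.
      rewrite -dth.
      have -> : eta^`()%classic = (fun r => 3 * r ^+ 2 * th m r + r ^+ 3 * (th m)^`()%classic r); last by [].
      apply: is_derive_derive1.
      move=> y; have d0' : is_derive y 1 (fun x : R => x ^+ 3) (3 * y ^+ 2).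
        have -> : (fun x : R => x ^+ 3) = id ^+ 3 by apply/funext => w; rewrite exprfctE.
        by apply: is_derive_eq; rewrite /GRing.scale/= mulr1 mulr_natl.
      have := is_deriveM d0' (smooth1_is_derive y (sth m)) => d'.
      by apply: is_derive_eq d' _; rewrite /GRing.scale/=; ring.
    have acth : abs_cont (p / 2) rho (th m) (th' m).
      apply: AC_C1 => [r _|]; first by apply: is_derive_cutoff => y; exact: dg.
      by apply: continuous_subspaceT; rewrite -dth; exact: (smooth1_continuous (smooth1_derive (sth m))).
    have [iVt hVt] := AC_M p2r (AC_sub (ltW p2) (lexx _) acV) acth.
    have cth := AC_continuous p2r acth.
    have cth' : {within `[p / 2, rho], continuous (th' m)}.
      by apply: continuous_subspaceT; rewrite -dth; exact: (smooth1_continuous (smooth1_derive (sth m))).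
    have ivt : leb.-integrable IE (EFin \o (fun r => r ^+ 3 * h r * th m r)).
      have := integrable_continuousM cth (lint1_sub ish mI0 mIE subIE).
      by move=> hh; apply: lint1_eq hh mIE => r _; rewrite mulrC.
    have iVt' : leb.-integrable IE (EFin \o (fun r => V r * th' m r)).
      have := integrable_continuousM cth' (lint1_sub iV mI0 mIE subIE).
      by move=> hh; apply: lint1_eq hh mIE => r _; rewrite mulrC.
    have parts : \int[leb]_(r in IE) (r ^+ 3 * h r * th m r) + \int[leb]_(r in IE) (V r * th' m r) = 0.
      rewrite -(lRint1D ivt iVt' mIE) -(hVt (p / 2) rho (lexx _) p2r (lexx _)).
      rewrite !oth ?mulr0 ?subrr//; apply/negP; rewrite negb_and -!ltNge.
        by apply/orP; left; rewrite ltr_pdivrMr// ltr_pMr// ltr1n.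
      by apply/orP; right.
    have iUt : leb.-integrable IE (EFin \o (fun r => r ^+ 3 * U r * th' m r)).
      have := integrable_continuousM cth' (lint1_sub isU mI0 mIE subIE).
      by move=> hh; apply: lint1_eq hh mIE => r _; rewrite mulrC.
    have eqn : \int[leb]_(r in IE) (r ^+ 3 * U r * th' m r) + \int[leb]_(r in IE) (r ^+ 3 * h r * th m r) = 0.
      rewrite -hsum -(lRint1B g1 g2 mIE) -(lRint1D (lint1B g1 g2 mIE) g3 mIE)
        -(lRint1B (lint1D (lint1B g1 g2 mIE) g3 mIE) g4 mIE) -(lRint1D iUt ivt mIE).
      apply: lRint1_ae_eq => //.
      - exact: lint1_measurable (lint1D iUt ivt mIE).
      - exact: lint1_measurable (lint1B (lint1D (lint1B g1 g2 mIE) g3 mIE) g4 mIE).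
      apply: ae_imp ZPsi => r hZ Ir; move: (subIE _ Ir); rewrite /= in_itv/= => rr.
      have /andP[r0 _] := rr.
      rewrite -/(U r) -/(Z r) -/(W r) -/k hZ// etaE powR_inv1; last exact: ltW.
      by rewrite /eta /h; field; rewrite gt_eqF.
    have tot : \int[leb]_(r in IE) (Y r * th' m r) = 0.
      have -> : \int[leb]_(r in IE) (Y r * th' m r) =
        \int[leb]_(r in IE) (r ^+ 3 * U r * th' m r) - \int[leb]_(r in IE) (V r * th' m r).
        by rewrite -(lRint1B iUt iVt' mIE); apply: lRint1_eq => r _; rewrite /Y; ring.
      by move/eqP: parts; rewrite addrC addr_eq0 => /eqP ->; rewrite opprK.
    rewrite -tot; apply/esym; apply: lRint1_widen.
      by apply: itvoo_subset; [rewrite ler_pdivrMr// ler_pMr// ler1n|exact: ltW].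
    by move=> r _; rewrite /= in_itv/= => nr; rewrite oth'// mulr0.
  have mpq : measurable (`]p, q[%classic : set R) by [].
  have iYpq : leb.-integrable `]p, q[ (EFin \o Y) by apply: integrable_sub_itv iY; exact: ltW.
  have mY := lint1_measurable iYpq.
  have lim : \int[leb]_(r in `]p, q[) (Y r * th' m r) @[m --> \oo] --> \int[leb]_(r in `]p, q[) (Y r * g' r).
    apply: (lRint1_dct (g := fun r => (10 * (q - p) + 2 * (q - p)) * `|Y r|)) => //.
    - move=> m; apply: measurable_funM => //; apply: measurable_funTS; apply: continuous_measurable_fun.
      by rewrite -dth; exact: (smooth1_continuous (smooth1_derive (sth m))).
    - apply: measurable_funM => //; apply: measurable_funTS; apply: continuous_measurable_fun => x.
      by apply: cvgB; [exact: cvg_cst|apply: cvgM; [exact: cvg_cst|exact: cvg_id]].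
    - by apply: lint1Z => //; exact: lint1_norm.
    - move=> m r; rewrite /= in_itv/= => rpq; rewrite normrM mulrC; apply: ler_wpM2r => //.
      exact: (cutoff'_bound gl gr g'b).
    - apply: aeW => r; rewrite /= in_itv/= => rpq; apply: cvgM; first exact: cvg_cst.
      exact: cvg_cutoff'.
  have c0 : \int[leb]_(r in `]p, q[) (Y r * th' m r) @[m --> \oo] --> (0 : R).
    by under eq_cvg do rewrite zero; exact: cvg_cst.
  exact: (cvg_unique _ lim c0).
(* r^3 U - V = C is in L_1 near 0 with mean O(d) over ]0, d[, because U and h are
   square integrable with respect to s ds. *)
suff C0 : C = 0.
  by apply: ae_imp hC => r hr rr; have := hr rr; rewrite C0 => /eqP; rewrite subr_eq0 => /eqP.
apply/eqP; rewrite -normr_le0.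
have M0 : 0 <= M.
  rewrite -lee_fin; apply: le_trans hM; apply: integral_ge0 => s.
  by rewrite /= in_itv/= => /andP[s0 _]; rewrite lee_fin mulr_ge0 ?sqr_ge0// ltW.
have K0 : 0 <= K.
  rewrite -lee_fin; apply: le_trans UK; apply: integral_ge0 => s.
  by rewrite /= in_itv/= => /andP[s0 _]; rewrite lee_fin mulr_ge0 ?sqr_ge0// ltW.
(* For d <= 1 one has d^3 <= d^2 and r^3 <= d for r < d, so both integrals on the right are O(d^2),
   against C d on the left. *)
pose m1 : R := Num.min rho 1.
have m10 : 0 < m1 by rewrite lt_min rho0/=.
apply: (@le_addr_small R `|C| 0 (Num.sqrt K + Num.sqrt M) m1) => //.
move=> d /andP[d0]; rewrite lt_min => /andP[dr d1]; rewrite add0r.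
have mId : measurable (`]0, d[%classic : set R) by [].
have subd : `]0, d[%classic `<=` `]0, rho[%classic by apply: itvoo_subset => //; exact: ltW.
have iUd := lint1_sub isU mI0 mId subd; have iVd := lint1_sub iV mI0 mId subd.
have eC : C * d = \int[leb]_(r in `]0, d[) (r ^+ 3 * U r) - \int[leb]_(r in `]0, d[) V r.
  rewrite -(lRint1B iUd iVd mId).
  transitivity (\int[leb]_(r in `]0, d[) C).
    by rewrite Rintegral_cst//= (leb_itvoo (ltW d0))/= subr0.
  apply: lRint1_ae_eq => //; first exact: lint1_measurable (lint1B iUd iVd mId).
  by apply: ae_imp hC => r hr Ir; rewrite -hr//; have := subd _ Ir; rewrite /= in_itv.
have dle : 0 < d <= rho by rewrite d0 ltW.
have d2 : d ^+ 3 <= d ^+ 2 by rewrite exprS ger_pMl ?exprn_gt0// ltW.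
have b1 : `|\int[leb]_(r in `]0, d[) (r ^+ 3 * U r)| <= Num.sqrt K * d ^+ 2.
  apply: (@le_trans _ _ (Num.sqrt K * d ^+ 3)); last by apply: ler_wpM2l => //; exact: sqrtr_ge0.
  rewrite -sqrtr_sqr -[X in _ <= _ * X]ger0_norm; last by rewrite exprn_ge0// ltW.
  rewrite -[X in _ <= _ * X]sqrtr_sqr -sqrtrM//; apply: ler_wsqrtr.
  by rewrite -exprM; exact: bU.
have bVr r : 0 < r < d -> `|V r| <= Num.sqrt M * d.
  move=> /andP[r0 rd]; apply: (@le_trans _ _ (Num.sqrt M * r ^+ 3)).
    rewrite -sqrtr_sqr -[X in _ <= _ * X]ger0_norm; last by rewrite exprn_ge0// ltW.
    rewrite -[X in _ <= _ * X]sqrtr_sqr -sqrtrM//; apply: ler_wsqrtr.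
    by rewrite -exprM; apply: bV; rewrite r0 ltW// (lt_trans rd).
  apply: ler_wpM2l; first exact: sqrtr_ge0.
  have r1 : r <= 1 by apply: ltW; apply: lt_trans d1.
  apply: (@le_trans _ _ r); last exact: ltW.
  by rewrite exprS ger_pMr// exprn_ile1// ltW.
have b2 : `|\int[leb]_(r in `]0, d[) V r| <= Num.sqrt M * d ^+ 2.
  apply: le_trans (lRint1_norm iVd mId) _.
  have ic : leb.-integrable `]0, d[ (EFin \o (fun _ : R => Num.sqrt M * d)).
    by apply: integrable_continuous; exact: cst_continuous.
  apply: le_trans (lRint1_le (lint1_norm iVd) ic mId _) _.
    by move=> r; rewrite /= in_itv/= => rd; exact: bVr.
  by rewrite Rintegral_cst//= (leb_itvoo (ltW d0))/= subr0 -mulrA expr2.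
rewrite -(ler_pM2r d0) -{1}(gtr0_norm d0) -normrM eC.
apply: (le_trans (ler_normB _ _)); apply: (le_trans (lerD b1 b2)).
by rewrite -mulrDl -mulrA expr2.
Qed.

End ode.

(** * Synthesis of the modes *)

Section slices_and_weights.
Context {R : realType}.
Notation leb := (@lebesgue_measure R).

(** Countably many parameters rho / (n + 2) suffice, since each point of [B] lies in [A d] for all
    small d. *)
Lemma ae_of_exhaustion d (T : measurableType d) (m : {measure set T -> \bar R}) (rho : R)
    (A : R -> set T) (B : set T) (P : T -> Prop) : 0 < rho ->
  (forall x, B x -> exists2 e : R, 0 < e & forall d, 0 < d -> d < e -> A d x) ->
  (forall d, 0 < d < rho -> {ae m, forall x, A d x -> P x}) -> {ae m, forall x, B x -> P x}.
Proof.
move=> rho0 AB h.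
have h' n : {ae m, forall x, A (rho * harmonic n.+1) x -> P x}.
  apply: h; rewrite mulr_gt0 ?harmonic_gt0//= -[ltRHS]mulr1 ltr_pM2l// /harmonic/=.
  by rewrite invf_lt1// ltr1n.
apply: ae_imp (ae_foralln h') => x hx Bx; have [e e0 he] := AB x Bx.
have := @cvg_harmonic R => /cvgr_lt/(_ (e / rho)) []; first by rewrite divr_gt0.
move=> N _ hN; apply: (hx N); apply: he; first by rewrite mulr_gt0// harmonic_gt0.
by rewrite mulrC -ltr_pdivlMr//; apply: hN => /=.
Qed.

Lemma ae_of_subitv (rho : R) (P : R -> Prop) : 0 < rho ->
  (forall d : R, 0 < d < rho -> {ae leb, forall r, d < r < rho -> P r}) ->
  {ae leb, forall r, 0 < r < rho -> P r}.
Proof.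
move=> rho0; apply: (@ae_of_exhaustion _ (measurableTypeR R) leb rho (fun d r => d < r < rho) (fun r => 0 < r < rho)) => //.
by move=> r /andP[r0 rr]; exists r => // d _ dr; rewrite /= dr.
Qed.

Lemma ae_of_subcyl (rho a : R) (P : R * R -> Prop) : 0 < rho ->
  (forall d : R, 0 < d < rho -> {ae leb2, forall x, cyl d rho a x -> P x}) ->
  {ae leb2, forall x, cyl 0 rho a x -> P x}.
Proof.
move=> rho0; apply: (@ae_of_exhaustion _ (measurableTypeR R * measurableTypeR R)%type (lebesgue_measure \x lebesgue_measure)%E rho (fun d => cyl d rho a)) => //.
move=> [r z] [/= + Jz]; rewrite in_itv/= => /andP[r0 rr]; exists r => // d _ dr; split => //=.
by rewrite in_itv/= dr.
Qed.

Lemma measurable_Rintegral1 d1 d2 (T1 : measurableType d1) (T2 : measurableType d2)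
    (m2 : {sigma_finite_measure set T2 -> \bar R}) (A : set T1) (B : set T2) (F : T1 * T2 -> R) :
  measurable A -> measurable B -> measurable_fun (A `*` B) F ->
  measurable_fun A (fun x => \int[m2]_(y in B) F (x, y)).
Proof.
move=> mA mB mF.
have mF' : measurable_fun (A `*` B) (EFin \o F) by exact/measurable_EFinP.
rewrite /Rintegral; apply: (measurableT_comp (fine_measurable measurableT)).
have -> : (fun x => \int[m2]_(y in B) (F (x, y))%:E)%E =
  (fun x => (\int[m2]_(y in B) (EFin \o F)^\+ (x, y))%E - (\int[m2]_(y in B) (EFin \o F)^\- (x, y))%E)%E.
  by apply/funext => x; rewrite [LHS]integralE; congr (_ - _)%E; apply: eq_integral => s _; rewrite ?funeposE ?funenegE.
apply: emeasurable_funB.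
  apply: (measurable_tonelli1 m2 mA mB (F := (EFin \o F)^\+%E)) => //; exact: measurable_funepos.
apply: (measurable_tonelli1 m2 mA mB (F := (EFin \o F)^\-%E)) => //; exact: measurable_funeneg.
Qed.

Lemma leb_measurable_Rintegral1 (A B : set R) (F : R * R -> R) :
  measurable A -> measurable B -> measurable_fun (A `*` B) F ->
  measurable_fun A (fun x => \int[leb]_(y in B) F (x, y)).
Proof.
exact: (@measurable_Rintegral1 _ _ (measurableTypeR R) (measurableTypeR R) (@lebesgue_measure R)).
Qed.

Lemma ae_fin_of_integral (A : set R) (f : R -> \bar R) : measurable A -> measurable_fun A f ->
  (forall x, A x -> 0 <= f x)%E -> (\int[leb]_(x in A) f x < +oo)%E ->
  {ae leb, forall x, A x -> (f x < +oo)%E}.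
Proof.
move=> mA mf f0 fi.
have i : leb.-integrable A f.
  apply/integrableP; split => //; apply: le_lt_trans fi.
  by apply: le_integral_nomeas => x Ax; rewrite abse_ge0 gee0_abs ?f0/=.
have := @integrable_ae _ (measurableTypeR R) R _ A mA f i.
by apply: ae_imp => x h Ax; rewrite ltey_eq (h Ax).
Qed.

(** Away from the axis every weight is bounded below; one summand of [C] serves for be <= 0, the
    other for be > 0. *)
Lemma powR_bounded_below (d rho be : R) : 0 < d -> exists2 C, 0 < C &
  forall r, d < r < rho -> 1 <= C * r `^ be.
Proof.
move=> d0; pose C := d `^ (- be) + rho `^ (- be).
exists C; first by rewrite /C ltr_wpDr ?powR_ge0// powR_gt0.
move=> r /andP[dr rr]; have r0 := lt_trans d0 dr; have rho0 := lt_trans r0 rr.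
rewrite -(@mulVf _ (r `^ be)); last by rewrite gt_eqF// powR_gt0.
apply: ler_wpM2r; first exact: powR_ge0.
rewrite -powRN /C; have [b|b] := leP be 0.
  apply: (@le_trans _ _ (rho `^ (- be))); last by rewrite lerDr powR_ge0.
  by apply: ge0_ler_powR; rewrite ?nnegrE ?oppr_ge0// ltW.
apply: (@le_trans _ _ (d `^ (- be))); last by rewrite lerDl powR_ge0.
rewrite !powRN lef_pV2 ?posrE ?powR_gt0//.
by apply: ge0_ler_powR; rewrite ?nnegrE// ltW.
Qed.

(* AM-GM: [2 |c f| <= f^2 w + c^2 / w]. *)
Lemma norm_mul_le_weighted (c f w C : R) : 0 < w -> c ^+ 2 <= C * w -> `|c * f| <= f ^+ 2 * w + C.
Proof.
move=> w0 hc; rewrite normrM -(ler_pM2r w0) -[f ^+ 2](real_normK (num_real f)).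
rewrite -[c ^+ 2](real_normK (num_real c)) in hc.
have := normr_ge0 c; have := normr_ge0 f; move: (`|f|) (`|c|) hc => x y hc x0 y0.
have := sqr_ge0 (x * w - y); rewrite sqrrB => h.
have : 0 <= y * x * w by rewrite !mulr_ge0// ltW.
move: h; rewrite exprMn (mulrDl (x ^+ 2 * w)) in hc *.
by nra.
Qed.

Section weighted.
Variables (rho a be : R).
Hypotheses (rho0 : 0 < rho) (a0 : 0 < a).
Notation I := (`]0%R, rho[%classic : set R).
Notation J := (`](- a), a[%classic : set R).
Notation D := (cyl 0 rho a).

Let mI : measurable I. Proof. by []. Qed.
Let mJ : measurable J. Proof. by []. Qed.
Let mD : measurable D. Proof. exact: measurable_cyl. Qed.

Lemma subcyl d : 0 <= d -> cyl d rho a `<=` D.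
Proof. by move=> d0 [r z] [/= h1 h2]; split => //=; apply: (itvoo_subset d0 (lexx rho)) h1. Qed.

Lemma integrable_wsqr2 F : measurable_fun D F -> (wsqr2 a rho be F < +oo)%E ->
  leb2.-integrable D (EFin \o (fun x => (F x) ^+ 2 * x.1 `^ be)).
Proof.
move=> mF fF; apply/integrableP; split; first exact: measurable_wsqr2.
apply: le_lt_trans fF; apply: le_integral_nomeas => x _.
by rewrite abse_ge0/= ger0_norm// mulr_ge0 ?sqr_ge0 ?powR_ge0.
Qed.

(** The AM-GM inequality with the weight. It is applied with c = 1 away from the axis and with c =
    r^3 up to it. *)
Lemma integrable_of_wsqr2 d C (c : R -> R) F : 0 <= d -> measurable_fun D F ->
  (wsqr2 a rho be F < +oo)%E -> measurable_fun `]d, rho[ c ->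
  (forall r, d < r < rho -> (c r) ^+ 2 <= C * r `^ be) ->
  leb2.-integrable (cyl d rho a) (EFin \o (fun x => c x.1 * F x)).
Proof.
move=> d0 mF fF mc hc; have mE := measurable_cyl d rho a.
have sE := subcyl d0.
have ic : leb2.-integrable (cyl d rho a) (EFin \o (fun _ : R * R => C)).
  apply: (lint2_sub (@integrable_rect_cst R d rho a C)) => //; first exact: measurable_rect.
  by move=> [r z] [/= + +]; rewrite !in_itv/= => /andP[? ?] /andP[? ?]; split; rewrite /= in_itv/=; apply/andP; split; apply: ltW.
apply: (lint2_le (lint2D (lint2_sub (integrable_wsqr2 mF fF) mD mE sE) ic mE) mE).
  apply: measurable_funM; last exact: measurable_funS sE mF.
  apply: (@measurable_comp _ _ _ _ _ _ `]d, rho[%classic c _ fst) => //; first by move=> _ [[r z] [/= Ar _] <-].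
  by apply: measurable_funTS; exact: measurable_fst.
move=> [r z] [/= + _]; rewrite in_itv/= => rr; have /andP[dr _] := rr.
have w0 : 0 < r `^ be by rewrite powR_gt0// (le_lt_trans d0).
exact: norm_mul_le_weighted w0 (hc r rr).
Qed.

Lemma integrable_subcyl_of_wsqr2 d F : 0 < d -> measurable_fun D F -> (wsqr2 a rho be F < +oo)%E ->
  leb2.-integrable (cyl d rho a) (EFin \o F).
Proof.
move=> d0 mF fF; have [C _ hC] := powR_bounded_below rho be d0.
have := @integrable_of_wsqr2 d C (fun=> 1) F (ltW d0) mF fF => /(_ (measurable_cst _)).
move=> h; apply: lint2_eq (h _) (measurable_cyl _ _ _) => [x _|r rr]; first by rewrite mul1r.
by rewrite expr1n; exact: hC.
Qed.

Lemma locL1_of_wsqr2 F : measurable_fun D F -> (wsqr2 a rho be F < +oo)%E -> locL1 D F.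
Proof.
move=> mF fF; apply: (locL1_of_rect rho0 a0 mF) => p q b p0 pq qr /andP[b0 ba].
have p2 : 0 < p / 2 by rewrite divr_gt0.
apply: (lint2_sub (integrable_subcyl_of_wsqr2 p2 mF fF)); [exact: measurable_cyl|exact: measurable_rect|].
move=> [r z] [/= + +]; rewrite !in_itv/= => /andP[h1 h2] /andP[h3 h4]; split; rewrite /= in_itv/=; apply/andP; split.
- by apply: lt_le_trans h1; rewrite ltr_pdivrMr// ltr_pMr// ltr1n.
- exact: le_lt_trans qr.
- by apply: lt_le_trans h3; rewrite ltrN2.
- exact: le_lt_trans ba.
Qed.

Lemma ae_wsqr_slices2 F : measurable_fun D F -> (wsqr2 a rho be F < +oo)%E ->
  {ae leb, forall z, J z -> (wsqr rho be (fun r => F (r, z)) < +oo)%E}.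
Proof.
move=> mF fF; have mw := @measurable_wsqr2 R a rho be F mF.
have w0 x : (I `*` J) x -> (0 <= ((F x) ^+ 2 * x.1 `^ be)%:E)%E.
  by move=> _; rewrite lee_fin mulr_ge0 ?sqr_ge0 ?powR_ge0.
move: fF; rewrite /wsqr2 (leb_tonelli2 mI mJ mw w0) => fF.
apply: (ae_fin_of_integral mJ (leb_measurable_tonelli2 mI mJ mw w0) _ fF).
by move=> z Jz; apply: integral_ge0 => r Ir; exact: (w0 (r, z)).
Qed.

Lemma ae_sqr_slices1 F : measurable_fun D F -> (wsqr2 a rho be F < +oo)%E ->
  {ae leb, forall r, I r -> leb.-integrable J (fun z => ((F (r, z)) ^+ 2)%:E)}.
Proof.
move=> mF fF; have iw := integrable_wsqr2 mF fF.
apply: ae_imp (leb_ae_integrable1 mI mJ iw) => r h Ir; have := h Ir.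
have r0 : 0 < r by move: Ir; rewrite /= in_itv/= => /andP[].
move=> /(lint1Z (r `^ be)^-1) /(_ mJ) h'; apply: lint1_eq h' mJ => z _ /=.
by field; rewrite gt_eqF// powR_gt0.
Qed.

(** The support of [phi] keeps away from the axis, so the weight is bounded below there and
    convergence in the weighted L_2 norm implies convergence in L^1. *)
Lemma pairing_cvg (F : R * R -> R) (Fn : nat -> R * R -> R) (eps : nat -> R) p q b (phi : R * R -> R) :
  locL1 D F -> (forall N, locL1 D (Fn N)) ->
  (forall N, (wsqr2 a rho be (fun x => F x - Fn N x)%R <= (eps N)%:E)%E) ->
  eps N @[N --> \oo] --> (0 : R) -> 0 < p -> p < q -> q < rho -> 0 < b < a -> continuous phi -> vanish_off p q b phi ->
  \int[leb2]_(x in D) (Fn N x * phi x) @[N --> \oo] --> \int[leb2]_(x in D) (F x * phi x).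
Proof.
move=> lF lFn hF eps0 p0 pq qr /andP[b0 ba] cphi vphi.
have [C C0 hC] := powR_bounded_below rho be (divr_gt0 p0 (ltr0n R 2)).
pose E := cyl (p / 2) rho a; have mE : measurable E by exact: measurable_cyl.
have p2 : 0 < p / 2 by rewrite divr_gt0.
have sE : E `<=` D by apply: subcyl; exact: ltW.
have [M M0 hM] := vanish_off_bounded cphi vphi.
apply/cvgrPdist_le => e e0.
have mw : measurable_fun E (fun x : R * R => x.1 `^ be) := @measurable_powR_fst R E be.
have wC x : E x -> C^-1 <= x.1 `^ be.
  move=> [/= + _]; rewrite in_itv/= => rr; have := hC x.1 rr.
  by rewrite -ler_pdivrMl// mulr1.
have p2r : p / 2 < rho by apply: lt_trans (lt_trans pq qr); rewrite ltr_pdivrMr// ltr_pMr// ltr1n.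
have fE : (leb2 E <= ((rho - p / 2) * (a + a))%:E)%E by rewrite leb2_cyl.
have C10 : 0 < C^-1 by rewrite invr_gt0.
have eM0 : 0 < e / M by rewrite divr_gt0.
have [e' e'0 small] := @small_L1 _ (measurableTypeR R * measurableTypeR R)%type R (lebesgue_measure \x lebesgue_measure)%E
  E _ _ _ _ mE mw C10 wC fE eM0.
have := eps0 => /cvgr_lt/(_ e' e'0); apply: filterS => N epsN.
pose g x := F x - Fn N x.
have mg : measurable_fun D g by apply: measurable_funB; [exact: lF.1|exact: (lFn N).1].
have fg : (wsqr2 a rho be g < +oo)%E by apply: le_lt_trans (hF N) _; rewrite ltry.
have ig := integrable_subcyl_of_wsqr2 p2 mg fg.
have sg : (\int[leb2]_(x in E) `|g x|%:E <= (e / M)%:E)%E.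
  apply: small; first exact: measurable_funS sE mg.
  apply: (@le_trans _ _ (wsqr2 a rho be g)); last by apply: le_trans (hF N) _; rewrite lee_fin ltW.
  by apply: ge0_subset_integral_nomeas => // x _; rewrite lee_fin mulr_ge0 ?sqr_ge0 ?powR_ge0.
have i1 := test_integrable lF p0 qr ba cphi vphi.
have i2 := test_integrable (lFn N) p0 qr ba cphi vphi.
rewrite -(lRint2B i1 i2 mD).
have -> : \int[leb2]_(x in D) (F x * phi x - Fn N x * phi x) = \int[leb2]_(x in E) (g x * phi x).
  rewrite (@lRint2_widen R D E)//; first by apply: lRint2_eq => x _; rewrite /g; ring.
  move=> [r z] [_ Jz] nE; rewrite -mulrBl vphi ?mulr0// => -[/= + _]; rewrite in_itv/= => /andP[pr rq].
  apply: nE; split => //=; rewrite in_itv/= (le_lt_trans rq)// andbT.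
  by apply: lt_le_trans pr; rewrite ltr_pdivrMr// ltr_pMr// ltr1n.
have mphi := measurable_continuous2 cphi.
have igp : leb2.-integrable E (EFin \o (fun x => g x * phi x)).
  apply: lint2_eq (bounded_mul2 mE ig (measurable_funTS mphi) (fun x _ => hM x)) mE => x _.
  by rewrite mulrC.
apply: le_trans (lRint2_norm igp mE) _.
apply: le_trans (lRint2_le (lint2_norm igp) (lint2Z M (lint2_norm ig) mE) mE _) _.
  by move=> x _; rewrite normrM mulrC; apply: ler_wpM2r.
rewrite (lRint2Z M (lint2_norm ig) mE) mulrC -ler_pdivlMr//.
have fin : (\int[leb2]_(x in E) `|g x|%:E)%E \is a fin_num by apply: integrable_fin_num => //; exact: lint2_norm.
by rewrite -lee_fin fineK.
Qed.

End weighted.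
End slices_and_weights.

(** * Sine and cosine coefficients as functions of r *)

Section coefficients.
Context {R : realType}.
Notation leb := (@lebesgue_measure R).

Definition coef (a : R) (t : R -> R) (F : R * R -> R) (r : R) : R :=
  \int[leb]_(z in `](- a), a[%classic) (F (r, z) * t z).

Variables (rho a be : R) (e : nat -> R -> R).
Hypotheses (rho0 : 0 < rho) (a0 : 0 < a) (ce : forall n, continuous (e n)).
Hypothesis orth : forall m n,
  \int[leb]_(z in `](- a), a[) (e m z * e n z) = a * (m == n)%:R.
Notation I := (`]0%R, rho[%classic : set R).
Notation J := (`](- a), a[%classic : set R).
Notation D := (cyl 0 rho a).

Let mI : measurable I. Proof. by []. Qed.
Let mJ : measurable J. Proof. by []. Qed.
Let mD : measurable D. Proof. exact: measurable_cyl. Qed.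

Lemma measurable_coef d t F : continuous t -> measurable_fun (cyl d rho a) F ->
  measurable_fun `]d, rho[ (coef a t F).
Proof.
move=> ct mF; have mId : measurable (`]d, rho[%classic : set R) by [].
apply: (leb_measurable_Rintegral1 (F := fun x => F x * t x.2) mId mJ).
apply: measurable_funM => //; apply: measurable_funTS.
by apply: (measurableT_comp (continuous_measurable_fun ct)); exact: measurable_snd.
Qed.

Lemma bessel_ereal N (G : R -> R) : measurable_fun J G ->
  ((a * \sum_(0 <= n < N) (a^-1 * \int[leb]_(z in J) (G z * e n z)) ^+ 2)%:E
    <= \int[leb]_(z in J) ((G z) ^+ 2)%:E)%E.
Proof.
move=> mG; have G0 : (0 <= \int[leb]_(z in J) ((G z) ^+ 2)%:E)%E by apply: integral_ge0 => z _; rewrite lee_fin sqr_ge0.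
have [fi|] := ltP (\int[leb]_(z in J) ((G z) ^+ 2)%:E)%E +oo%E; last by rewrite leye_eq => /eqP ->; rewrite leey.
have iG : leb.-integrable J (fun z => ((G z) ^+ 2)%:E).
  apply/integrableP; split; first by apply/measurable_EFinP; exact: measurable_funX.
  by apply: le_lt_trans fi; apply: le_integral_nomeas => z _; rewrite abse_ge0/= ger0_norm// sqr_ge0.
have := bessel a0 ce orth N mG iG; rewrite -lee_fin => h; apply: le_trans h _.
by rewrite /Rintegral fineK// ge0_fin_numE.
Qed.

Lemma sqr_coef_le m (G : R -> R) : measurable_fun J G ->
  (((\int[leb]_(z in J) (G z * e m z)) ^+ 2)%:E <= a%:E * \int[leb]_(z in J) ((G z) ^+ 2)%:E)%E.
Proof.
move=> mG; set c := \int[leb]_(z in J) (G z * e m z).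
have -> : c ^+ 2 = a * (a * (a^-1 * c) ^+ 2) by field; rewrite gt_eqF.
rewrite EFinM; apply: lee_wpmul2l; first by rewrite lee_fin ltW.
apply: le_trans (bessel_ereal m.+1 mG); rewrite lee_fin; apply: ler_wpM2l; first exact: ltW.
by rewrite big_nat_recr//= lerDr sumr_ge0// => i _; exact: sqr_ge0.
Qed.

Lemma wsqr2E F : measurable_fun D F ->
  (wsqr2 a rho be F = \int[leb]_(r in I) (\int[leb]_(z in J) ((F (r, z)) ^+ 2)%:E * (r `^ be)%:E))%E.
Proof.
move=> mF; have mw := @measurable_wsqr2 R a rho be F mF.
have w0 x : (I `*` J) x -> (0 <= ((F x) ^+ 2 * x.1 `^ be)%:E)%E.
  by move=> _; rewrite lee_fin mulr_ge0 ?sqr_ge0 ?powR_ge0.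
rewrite /wsqr2 (leb_tonelli1 mI mJ mw w0); apply: eq_integral => r; rewrite inE => Ir.
transitivity (\int[leb]_(z in J) (((F (r, z)) ^+ 2)%:E * (r `^ be)%:E))%E.
  by apply: eq_integral => z _; rewrite EFinM.
apply: ge0_integralZr => //; last by rewrite lee_fin powR_ge0.
  apply/measurable_EFinP; apply: measurable_funX.
  exact: (@measurable_fun_slice1 _ _ (measurableTypeR R) (measurableTypeR R) _ _ I J F r mI mJ Ir mF).
by move=> z _; rewrite lee_fin sqr_ge0.
Qed.

Lemma measurable_wsqr (g : R -> R) : measurable_fun I g ->
  measurable_fun I (fun r => ((g r) ^+ 2 * r `^ be)%:E).
Proof.
move=> mg; apply/measurable_EFinP; apply: measurable_funM; [exact: measurable_funX|exact: measurable_powR_on].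
Qed.

(** Bessel's inequality on each line r = const, integrated against the weight. *)
Lemma bessel_wsqr N F : measurable_fun D F ->
  (\sum_(0 <= n < N) a%:E * wsqr rho be (fun r => a^-1 * coef a (e n) F r)%R <= wsqr2 a rho be F)%E.
Proof.
move=> mF; rewrite (wsqr2E mF).
have mc n : measurable_fun I (fun r => a^-1 * coef a (e n) F r).
  by apply: measurable_funM => //; exact: measurable_coef.
have mt n : measurable_fun I (fun r => (a * ((a^-1 * coef a (e n) F r) ^+ 2 * r `^ be))%:E).
  by apply/measurable_EFinP; apply: measurable_funM => //; apply/measurable_EFinP; exact: (measurable_wsqr (mc n)).
have -> : (\sum_(0 <= n < N) a%:E * wsqr rho be (fun r => a^-1 * coef a (e n) F r)%R =
  \int[leb]_(r in I) (\sum_(0 <= n < N) (a * ((a^-1 * coef a (e n) F r) ^+ 2 * r `^ be))%:E))%E.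
  rewrite ge0_integral_sum//; last first.
    by move=> n r _; rewrite lee_fin mulr_ge0 ?(ltW a0)// mulr_ge0 ?sqr_ge0 ?powR_ge0.
  apply: eq_bigr => n _; rewrite /wsqr.
  transitivity (\int[leb]_(r in I) (a%:E * ((a^-1 * coef a (e n) F r) ^+ 2 * r `^ be)%:E))%E; last first.
    by apply: eq_integral => r _; rewrite EFinM.
  apply/esym; apply: ge0_integralZl => //; first exact: (measurable_wsqr (mc n)).
    by move=> r _; rewrite lee_fin mulr_ge0 ?sqr_ge0 ?powR_ge0.
  by rewrite lee_fin ltW.
apply: le_integral_nomeas => r Ir; apply/andP; split.
  by apply: sume_ge0 => n _; rewrite lee_fin mulr_ge0 ?(ltW a0)// mulr_ge0 ?sqr_ge0 ?powR_ge0.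
have mFr := @measurable_fun_slice1 _ _ (measurableTypeR R) (measurableTypeR R) _ _ I J F r mI mJ Ir mF.
rewrite sumEFin; under eq_bigr do rewrite mulrA; rewrite -mulr_suml -mulr_sumr EFinM.
by apply: lee_wpmul2r; [rewrite lee_fin powR_ge0|exact: (bessel_ereal N mFr)].
Qed.

Lemma ae_eq0_of_wsqr (g : R -> R) : measurable_fun I g -> wsqr rho be g = 0%E ->
  {ae leb, forall r, I r -> g r = 0}.
Proof.
move=> mg g0.
have h : {ae leb, forall r, I r -> ((g r) ^+ 2 * r `^ be)%:E = 0%E}.
  apply/(@ae_eq_integral_abs _ (measurableTypeR R) R leb I mI _ (measurable_wsqr mg)).
  rewrite -g0 /wsqr; apply: eq_integral => r _; rewrite gee0_abs// lee_fin.
  by rewrite mulr_ge0 ?sqr_ge0 ?powR_ge0.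
apply: ae_imp h => r h Ir; have r0 : 0 < r by move: Ir; rewrite /= in_itv/= => /andP[].
by have /eqP := h Ir; rewrite eqe mulf_eq0 sqrf_eq0 => /orP[/eqP//|]; rewrite gt_eqF// powR_gt0.
Qed.

Lemma coef_partial_series (f : nat -> R -> R) N m r : (m < N)%N ->
  coef a (e m) (partial_series e f N) r = a * f m r.
Proof.
move=> mN; rewrite /coef /partial_series.
have ie n : leb.-integrable J (EFin \o (fun z => f n r * (e n z * e m z))).
  apply: lint1Z => //; apply: integrable_continuous; apply: continuous_subspaceT => z.
  by apply: cvgM; exact: ce.
transitivity (\int[leb]_(z in J) (\sum_(0 <= n < N) f n r * (e n z * e m z))).
  by apply: lRint1_eq => z _; rewrite mulr_suml; apply: eq_bigr => n _; rewrite /= mulrA.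
rewrite (lRint1_sum _ ie mJ).
have ie' n : leb.-integrable J (EFin \o (fun z => e n z * e m z)).
  by apply: integrable_continuous; apply: continuous_subspaceT => z; apply: cvgM; exact: ce.
under eq_bigr do rewrite (lRint1Z _ (ie' _) mJ) orth.
rewrite (bigD1_seq m) ?mem_index_iota ?iota_uniq//= eqxx mulr1 big1 ?addr0 1?mulrC// => n nm.
by rewrite (negbTE nm) mulr0 mulr0.
Qed.

(** For N > m the coefficient of the partial sum is exactly [a * f m], and by Bessel's inequality
    the coefficient of the remainder has squared weighted norm at most [a * eps N]. *)
Lemma synthesis_coef (f : nat -> R -> R) F (eps : nat -> R) m :
  (forall n, measurable_fun I (f n)) -> measurable_fun D F -> (wsqr2 a rho be F < +oo)%E ->
  eps n @[n --> \oo] --> (0 : R) ->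
  (forall N, (wsqr2 a rho be (fun x => F x - partial_series e f N x)%R <= (eps N)%:E)%E) ->
  {ae leb, forall r, I r -> coef a (e m) F r = a * f m r}.
Proof.
move=> mf mF fF eps0 hN.
have mg : measurable_fun I (fun r => coef a (e m) F r - a * f m r).
  by apply: measurable_funB; [exact: measurable_coef|apply: measurable_funM].
suff : wsqr rho be (fun r => coef a (e m) F r - a * f m r) = 0%E.
  by move=> /(ae_eq0_of_wsqr mg); apply: ae_imp => r h Ir; apply/eqP; rewrite -subr_eq0 h.
apply/eqP; rewrite eq_le; apply/andP; split; last first.
  by apply: integral_ge0 => r _; rewrite lee_fin mulr_ge0 ?sqr_ge0 ?powR_ge0.
have key N : (m < N)%N -> (wsqr rho be (fun r => coef a (e m) F r - a * f m r)%R <= (a * eps N)%:E)%E.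
  move=> mN; pose G x := F x - partial_series e f N x.
  have mG : measurable_fun D G by apply: measurable_funB => //; exact: measurable_partial_series.
  have mGr r : I r -> measurable_fun J (fun z => G (r, z)).
    by move=> Ir; exact: (@measurable_fun_slice1 _ _ (measurableTypeR R) (measurableTypeR R) _ _ I J G r mI mJ Ir mG).
  have mGi : measurable_fun I (fun r => (\int[leb]_(z in J) ((G (r, z)) ^+ 2)%:E)%E).
    apply: (leb_measurable_tonelli1 mI mJ (F := fun x => ((G x) ^+ 2)%:E)).
      by apply/measurable_EFinP; exact: measurable_funX.
    by move=> x _; rewrite lee_fin sqr_ge0.
  apply: (@le_trans _ _ (a%:E * wsqr2 a rho be G)%E); last first.
    by rewrite EFinM; apply: lee_wpmul2l; [rewrite lee_fin ltW|exact: hN].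
  rewrite (wsqr2E mG) /wsqr.
  have <- : (\int[leb]_(r in I) (a%:E * (\int[leb]_(z in J) ((G (r, z)) ^+ 2)%:E * (r `^ be)%:E)) =
      a%:E * \int[leb]_(r in I) (\int[leb]_(z in J) ((G (r, z)) ^+ 2)%:E * (r `^ be)%:E))%E.
    apply: ge0_integralZl => //.
    - by apply: emeasurable_funM => //; apply/measurable_EFinP; exact: measurable_powR_on.
    - by move=> r _; apply: mule_ge0; [apply: integral_ge0 => z _; rewrite lee_fin sqr_ge0|rewrite lee_fin powR_ge0].
    - by rewrite lee_fin ltW.
  apply: ae_le_integral_nomeas => //.
  - apply: emeasurable_funM => //; apply: emeasurable_funM => //.
    by apply/measurable_EFinP; exact: measurable_powR_on.
  - by move=> r _; rewrite lee_fin mulr_ge0 ?sqr_ge0 ?powR_ge0.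
  - move=> r _; apply: mule_ge0; first by rewrite lee_fin ltW.
    by apply: mule_ge0; [apply: integral_ge0 => z _; rewrite lee_fin sqr_ge0|rewrite lee_fin powR_ge0].
  have iF := ae_sqr_slices1 mF fF.
  apply: ae_imp iF => r iFr Ir.
  have iFm : leb.-integrable J (EFin \o (fun z => F (r, z) * e m z)).
    have iFz : leb.-integrable J (EFin \o (fun z => F (r, z))).
      apply: integrable_of_sqr; last exact: iFr.
      exact: (@measurable_fun_slice1 _ _ (measurableTypeR R) (measurableTypeR R) _ _ I J F r mI mJ Ir mF).
    have cm : {within `[- a, a], continuous (e m)} by apply: continuous_subspaceT; exact: ce.
    have := integrable_continuousM cm iFz => h.
    by apply: lint1_eq h mJ => z _; rewrite mulrC.
  have iSm : leb.-integrable J (EFin \o (fun z => partial_series e f N (r, z) * e m z)).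
    apply: integrable_continuous; apply: continuous_subspaceT => z; apply: cvgM; last exact: ce.
    have : continuous (fun z => \sum_(0 <= n < N) f n r * e n z); last by apply.
    by apply: continuous_bigsum => n y; apply: cvgM; [exact: cvg_cst|exact: ce].
  have <- : coef a (e m) G r = coef a (e m) F r - a * f m r.
    rewrite -(coef_partial_series f r mN) /coef -(lRint1B iFm iSm mJ).
    by apply: lRint1_eq => z _; rewrite /G mulrBl.
  rewrite EFinM muleA; apply: lee_wpmul2r; first by rewrite lee_fin powR_ge0.
  exact: (sqr_coef_le m (mGr _ Ir)).
apply/lee_addgt0Pr => d d0; rewrite add0e.
have := eps0 => /cvgr_lt/(_ (d / a)) []; first by rewrite divr_gt0.
move=> N _ hN'; pose K := maxn N m.+1; have mK : (m < K)%N by rewrite leq_max leqnn orbT.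
apply: le_trans (key K mK) _; rewrite lee_fin mulrC -ler_pdivlMr//; apply: ltW.
by apply: hN' => /=; rewrite leq_max leqnn.
Qed.

End coefficients.

(** * Weak derivatives of sine and cosine series *)

Section weak_series.
Context {R : realType}.
Notation leb := (@lebesgue_measure R).
Variables (rho a be : R).
Hypotheses (rho0 : 0 < rho) (a0 : 0 < a).
Notation I := (`]0%R, rho[%classic : set R).
Notation J := (`](- a), a[%classic : set R).
Notation D := (cyl 0 rho a).
Notation k_ := (freq a).

Let mI : measurable I. Proof. by []. Qed.
Let mJ : measurable J. Proof. by []. Qed.
Let mD : measurable D. Proof. exact: measurable_cyl. Qed.

(** Completeness of the sines on almost every line r = const; since there are countably many modes,
    one null set serves for all. *)
Lemma ae_eq_of_coef (F G : R * R -> R) : measurable_fun D F -> measurable_fun D G ->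
  {ae leb, forall r, I r -> leb.-integrable J (EFin \o (fun z => F (r, z)))} ->
  {ae leb, forall r, I r -> leb.-integrable J (EFin \o (fun z => G (r, z)))} ->
  (forall m, {ae leb, forall r, I r -> coef a (sn a m) F r = coef a (sn a m) G r}) ->
  {ae leb2, forall x, D x -> F x = G x}.
Proof.
move=> mF mG iF iG hc.
have mFG : measurable_fun (I `*` J) (fun x => F x - G x) by exact: measurable_funB.
suff : {ae leb2, forall x, (I `*` J) x -> F x - G x = 0}.
  by apply: ae_imp => x h Dx; apply/eqP; rewrite -subr_eq0; apply/eqP; exact: h.
apply: (leb_ae_eq0_of_slices1 mI mJ mFG).
apply: ae_imp3 iF iG (ae_foralln hc) => r h1 h2 h3 Ir.
have i1 := h1 Ir; have i2 := h2 Ir.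
have iB := lint1B i1 i2 mJ.
apply: ae_imp (sine_complete a0 iB _) => [z h|m]; first by rewrite /= in_itv.
have it (g : R -> R) : leb.-integrable J (EFin \o g) -> leb.-integrable J (EFin \o (fun z => g z * sn a m z)).
  move=> ig; have cm : {within `[- a, a], continuous (sn a m)} by apply: continuous_subspaceT; exact: continuous_sn.
  by apply: lint1_eq (integrable_continuousM cm ig) mJ => z _; rewrite mulrC.
transitivity (\int[leb]_(z in J) (F (r, z) * sn a m z - G (r, z) * sn a m z)).
  by apply: lRint1_eq => z _; rewrite mulrBl.
rewrite (lRint1B (it _ i1) (it _ i2) mJ); apply/eqP; rewrite subr_eq0; apply/eqP.
exact: h3.
Qed.

Lemma weak_der_limit i j (F G : R * R -> R) (Fn Gn : nat -> R * R -> R) (eps eps' : nat -> R) :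
  locL1 D F -> locL1 D G -> (forall N, weak_der D i j (Fn N) (Gn N)) ->
  (forall N, (wsqr2 a rho be (fun x => F x - Fn N x)%R <= (eps N)%:E)%E) -> eps N @[N --> \oo] --> (0 : R) ->
  (forall N, (wsqr2 a rho be (fun x => G x - Gn N x)%R <= (eps' N)%:E)%E) -> eps' N @[N --> \oo] --> (0 : R) ->
  weak_der D i j F G.
Proof.
move=> lF lG wN hF e0 hG e0'; split => // phi sphi supp.
have lFn N : locL1 D (Fn N) by have [] := wN N.
have lGn N : locL1 D (Gn N) by have [] := wN N.
have [p [q [b [p0 pq qr ba vphi]]]] := supported_vanish_off rho0 a0 supp.
have c1 := pairing_cvg a0 lF lFn hF e0 p0 pq qr ba (@continuous_pder R i j phi sphi) (vanish_off_pder i j vphi).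
have c2 := pairing_cvg a0 lG lGn hG e0' p0 pq qr ba (@continuous_pder R 0 0 phi sphi) vphi.
have c3 : (-1) ^+ (i + j) * \int[leb2]_(x in D) (Gn N x * phi x) @[N --> \oo] -->
   ((-1) ^+ (i + j) * \int[leb2]_(x in D) (G x * phi x) : R) by apply: cvgM => //; exact: cvg_cst.
have e N : (-1) ^+ (i + j) * \int[leb2]_(x in D) (Gn N x * phi x) = \int[leb2]_(x in D) (Fn N x * pder i j phi x).
  by have [_ _ h] := wN N; rewrite h.
move: c3; under eq_cvg do rewrite e.
by move=> c3; exact: (cvg_unique _ c1 c3).
Qed.

(** The z-derivative of a test function is again a test function, to which the first weak derivative
    applies. *)
Lemma weak_der_0S j (u v w : R * R -> R) :
  weak_der D 0 j u v -> weak_der D 0 1 v w -> weak_der D 0 j.+1 u w.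
Proof.
move=> [lu lv h1] [_ lw h2]; split => // phi sphi supp.
have [p [q [b [p0 pq qr /andP[b0 ba] vphi]]]] := supported_vanish_off rho0 a0 supp.
have s1 : smooth (pder 0 1 phi) by exact: smooth_pder0.
have supp1 : supported_in D (pder 0 1 phi).
  exact: vanish_off_supported p0 qr ba (vanish_off_pder 0 1 vphi).
have -> : pder 0 j.+1 phi = pder 0 j (pder 0 1 phi) by rewrite /pder/= -iterSr.
by rewrite h1// h2// !add0n mulrA -exprD addn1.
Qed.

Lemma weak_der_1j j (u v w : R * R -> R) :
  weak_der D 1 0 u v -> weak_der D 0 j v w -> weak_der D 1 j u w.
Proof.
move=> [lu lv h1] [_ lw h2]; split => // phi sphi supp.
have [p [q [b [p0 pq qr /andP[b0 ba] vphi]]]] := supported_vanish_off rho0 a0 supp.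
have s1 : smooth (pder 0 j phi) by exact: smooth_pder0.
have supp1 : supported_in D (pder 0 j phi).
  exact: vanish_off_supported p0 qr ba (vanish_off_pder 0 j vphi).
have -> : pder 1 j phi = pder 1 0 (pder 0 j phi) by [].
by rewrite h1// h2// mulrA -exprD.
Qed.

Lemma weak_der_ae_eq i j (u v w : R * R -> R) : locL1 D u ->
  {ae leb2, forall x, D x -> u x = v x} -> weak_der D i j v w -> weak_der D i j u w.
Proof.
move=> lu uv [lv lw h]; split => // phi sphi supp; rewrite -h// /Rintegral; congr fine.
have [p [q [b [p0 pq qr /andP[b0 ba] vphi]]]] := supported_vanish_off rho0 a0 supp.
have mp : measurable_fun D (pder i j phi).
  by apply: measurable_funTS; apply: measurable_continuous2; exact: (@continuous_pder R i j phi sphi).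
apply: (@ae_eq_integral _ (measurableTypeR R * measurableTypeR R)%type R (lebesgue_measure \x lebesgue_measure)%E) => //.
- by apply/measurable_EFinP; apply: measurable_funM => //; exact: lu.1.
- by apply/measurable_EFinP; apply: measurable_funM => //; exact: lv.1.
- by apply: ae_imp uv => x e Dx; rewrite e.
Qed.

Lemma locL1_bounded (F : R * R -> R) M : measurable_fun D F -> (forall x, D x -> `|F x| <= M) -> locL1 D F.
Proof.
move=> mF hM; apply: (locL1_of_rect rho0 a0 mF) => p q b p0 pq qr /andP[b0 ba].
have mr := measurable_rect p q b.
have sub := rect_sub p0 qr ba.
apply: (lint2_le (@integrable_rect_cst R p q b M) mr); first exact: measurable_funS sub mF.
by move=> x rx; apply: hM; exact: sub.
Qed.

Lemma measurable_mode (f e : R -> R) : measurable_fun I f -> continuous e ->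
  measurable_fun D (fun x : R * R => f x.1 * e x.2).
Proof.
move=> mf ce; apply: (@measurable_tensor _ _ (measurableTypeR R) (measurableTypeR R) R I J) => //.
by apply: measurable_funTS; exact: continuous_measurable_fun.
Qed.

(** Differentiation is in z alone: the factor in r is a constant on each line of integration and has
    only to be measurable and bounded. *)
Lemma weak_der_mode (f g e e' : R -> R) M k : 
  measurable_fun I f -> (forall r, I r -> `|f r| <= M) -> (forall r, g r = k * f r) ->
  (forall z, `|e z| <= 1) -> (forall z, `|e' z| <= 1) -> continuous e -> continuous e' ->
  (forall z : R, is_derive z 1 e (k * e' z)) ->
  weak_der D 0 1 (fun x => f x.1 * e x.2) (fun x => g x.1 * e' x.2).
Proof.
move=> mf fM gE e1 e1' ce ce' de.
have mg : measurable_fun I g.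
  by have -> : g = (fun r => k * f r); [exact/funext|exact: measurable_funM].
have le : locL1 D (fun x => f x.1 * e x.2).
  apply: (@locL1_bounded _ M); first exact: measurable_mode.
  by move=> x [Ix _]; rewrite normrM -[leRHS]mulr1; apply: ler_pM => //; exact: fM.
have le' : locL1 D (fun x => g x.1 * e' x.2).
  apply: (@locL1_bounded _ (`|k| * M)); first exact: measurable_mode.
  move=> x [Ix _]; rewrite gE !normrM -[leRHS]mulr1; apply: ler_pM => //.
  by apply: ler_wpM2l => //; exact: fM.
split => // phi sphi supp.
have [p [q [b [p0 pq qr /andP[b0 ba] vphi]]]] := supported_vanish_off rho0 a0 supp.
rewrite expr1 mulN1r; apply: (weak_ibp2 a0 (p := p) (q := q) (b := b)) => //.
- by move=> x; exact: (sphi 0%N 0%N x).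
- exact: (@continuous_pder R 0 1 phi sphi).
move=> r _ /=; have ac : abs_cont (- a) a e (fun z => k * e' z).
  apply: AC_C1; apply: continuous_subspaceT => t.
  by apply: cvgM; [exact: cvg_cst|exact: ce'].
apply: AC_ext (AC_Z (f r) ac) => z _ //=; by rewrite gE; ring.
Qed.

Section series.
Variables (f : nat -> R -> R) (M : nat -> R).
Hypotheses (mf : forall n, measurable_fun I (f n)) (fM : forall n r, I r -> `|f n r| <= M n).

Lemma weak_der_series (e e' : nat -> R -> R) (k : nat -> R) N :
  (forall n z, `|e n z| <= 1) -> (forall n z, `|e' n z| <= 1) ->
  (forall n, continuous (e n)) -> (forall n, continuous (e' n)) ->
  (forall n (z : R), is_derive z 1 (e n) (k n * e' n z)) ->
  weak_der D 0 1 (partial_series e f N) (partial_series e' (fun n r => k n * f n r) N).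
Proof.
move=> e1 e1' ce ce' de; elim: N => [|N ih].
  have -> : partial_series e f 0 = (fun=> 0) by apply/funext => x; rewrite /partial_series big_geq.
  have -> : partial_series e' (fun n r => k n * f n r) 0 = (fun=> 0) by apply/funext => x; rewrite /partial_series big_geq.
  have l0 : locL1 D (fun=> 0) by apply: (@locL1_bounded _ 0) => [//|x _]; rewrite normr0.
  split => // phi _ _; under [X in X = _]lRint2_eq do rewrite mul0r.
  under [X in _ = _ * X]lRint2_eq do rewrite mul0r.
  by rewrite /Rintegral integral0 mulr0.
(* The rule [weak_derB] is about differences, so the next mode is added by subtracting its
   negative. *)
have w := @weak_der_mode (fun r => - f N r) (fun r => - (k N * f N r)) (e N) (e' N) (M N) (k N).
have := weak_derB rho0 a0 ih (w _ _ _ (e1 N) (e1' N) (@ce N) (@ce' N) (de N)).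
have -> : (fun x => partial_series e f N x - - f N x.1 * e N x.2) = partial_series e f N.+1.
  by apply/funext => x; rewrite /partial_series big_nat_recr//= mulNr opprK.
have -> : (fun x => partial_series e' (fun n r => k n * f n r) N x - - (k N * f N x.1) * e' N x.2) =
  partial_series e' (fun n r => k n * f n r) N.+1.
  by apply/funext => x; rewrite /partial_series big_nat_recr//= mulNr opprK.
apply; first exact: (measurableT_comp (@oppr_measurable R _) (mf N)).
  by move=> r Ir; rewrite normrN; exact: fM.
by move=> r; rewrite mulrN.
Qed.

Lemma weak_der_series_sn N :
  weak_der D 0 1 (partial_series (sn a) f N) (partial_series (cn a) (fun n r => k_ n * f n r) N).
Proof.
apply: weak_der_series => //.
- exact: norm_sn.
- exact: norm_cn.
- exact: continuous_sn.
- exact: continuous_cn.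
- by move=> n z; exact: is_derive_sn.
Qed.

Lemma weak_der_series_cn N :
  weak_der D 0 1 (partial_series (cn a) f N) (partial_series (sn a) (fun n r => - k_ n * f n r) N).
Proof.
apply: weak_der_series => //.
- exact: norm_cn.
- exact: norm_sn.
- exact: continuous_cn.
- exact: continuous_sn.
- by move=> n z; exact: is_derive_cn.
Qed.

End series.

Lemma weak_der_series2_sn (f : nat -> R -> R) (M : nat -> R) N :
  (forall n, measurable_fun I (f n)) -> (forall n r, I r -> `|f n r| <= M n) ->
  weak_der D 0 2 (partial_series (sn a) f N) (partial_series (sn a) (fun n r => - k_ n * (k_ n * f n r)) N).
Proof.
move=> mf fM; apply: weak_der_0S (weak_der_series_sn mf fM N) _.
apply: (@weak_der_series_cn _ (fun n => k_ n * M n)) => [n|n r Ir]; first exact: measurable_funM.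
by rewrite normrM gtr0_norm ?freq_gt0//; apply: ler_wpM2l; [exact/ltW/freq_gt0|exact: fM].
Qed.

End weak_series.

Section weighted_calculus.
Context {R : realType}.
Notation leb := (@lebesgue_measure R).

Lemma le_sqr_integral_comb d (T : measurableType d) (m : {measure set T -> \bar R}) (D : set T)
    (w f g1 g2 : T -> R) (c1 c2 : R) : measurable D -> measurable_fun D w ->
  measurable_fun D g1 -> measurable_fun D g2 -> (forall x, D x -> 0 <= w x) -> 0 <= c1 -> 0 <= c2 ->
  {ae m, forall x, D x -> (f x) ^+ 2 <= c1 * (g1 x) ^+ 2 + c2 * (g2 x) ^+ 2} ->
  (\int[m]_(x in D) ((f x) ^+ 2 * w x)%:E <=
   c1%:E * \int[m]_(x in D) ((g1 x) ^+ 2 * w x)%:E + c2%:E * \int[m]_(x in D) ((g2 x) ^+ 2 * w x)%:E)%E.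
Proof.
move=> mD mw m1 m2 w0 c10 c20 h.
have mg (g : T -> R) : measurable_fun D g -> measurable_fun D (fun x => ((g x) ^+ 2 * w x)%:E).
  by move=> mg; apply/measurable_EFinP; apply: measurable_funM => //; exact: measurable_funX.
have g0 (g : T -> R) x : D x -> (0 <= ((g x) ^+ 2 * w x)%:E)%E.
  by move=> Dx; rewrite lee_fin mulr_ge0 ?sqr_ge0 ?w0.
have mcg c (g : T -> R) : measurable_fun D g -> measurable_fun D (fun x => (c%:E * ((g x) ^+ 2 * w x)%:E)%E).
  by move=> mg'; apply: emeasurable_funM => //; exact: mg.
have cg0 c (g : T -> R) x : 0 <= c -> D x -> (0 <= c%:E * ((g x) ^+ 2 * w x)%:E)%E.
  by move=> c0 Dx; apply: mule_ge0; [rewrite lee_fin|exact: g0].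
have Z c (g : T -> R) : 0 <= c -> measurable_fun D g ->
    (\int[m]_(x in D) (c%:E * ((g x) ^+ 2 * w x)%:E) = c%:E * \int[m]_(x in D) ((g x) ^+ 2 * w x)%:E)%E.
  by move=> c0 mg'; apply: ge0_integralZl => //; [exact: mg|move=> x; exact: g0].
rewrite -!Z//.
have -> : (\int[m]_(x in D) (c1%:E * ((g1 x) ^+ 2 * w x)%:E) + \int[m]_(x in D) (c2%:E * ((g2 x) ^+ 2 * w x)%:E) =
   \int[m]_(x in D) (c1%:E * ((g1 x) ^+ 2 * w x)%:E + c2%:E * ((g2 x) ^+ 2 * w x)%:E))%E.
  by apply/esym; apply: ge0_integralD => //; [move=> x; exact: cg0|exact: mcg|move=> x; exact: cg0|exact: mcg].
apply: ae_le_integral_nomeas => //.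
- by apply: emeasurable_funD; exact: mcg.
- by move=> x; exact: g0.
- by move=> x Dx; apply: adde_ge0; exact: cg0.
apply: ae_imp h => x hx Dx; rewrite -!EFinM -EFinD lee_fin.
have -> : c1 * ((g1 x) ^+ 2 * w x) + c2 * ((g2 x) ^+ 2 * w x) = (c1 * (g1 x) ^+ 2 + c2 * (g2 x) ^+ 2) * w x by ring.
by apply: ler_wpM2r; [exact: w0|exact: hx].
Qed.

Variables (rho a : R).
Hypotheses (rho0 : 0 < rho) (a0 : 0 < a).
Notation I := (`]0%R, rho[%classic : set R).
Notation J := (`](- a), a[%classic : set R).
Notation D := (cyl 0 rho a).

Let mI : measurable I. Proof. by []. Qed.
Let mJ : measurable J. Proof. by []. Qed.
Let mD : measurable D. Proof. exact: measurable_cyl. Qed.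

Lemma wsqr_comb be (f g1 g2 : R -> R) (c1 c2 : R) : measurable_fun I g1 -> measurable_fun I g2 ->
  0 <= c1 -> 0 <= c2 ->
  {ae leb, forall r, I r -> (f r) ^+ 2 <= c1 * (g1 r) ^+ 2 + c2 * (g2 r) ^+ 2} ->
  (wsqr rho be f <= c1%:E * wsqr rho be g1 + c2%:E * wsqr rho be g2)%E.
Proof.
move=> m1 m2 c10 c20 h.
apply: (@le_sqr_integral_comb _ (measurableTypeR R) leb) => //; first exact: measurable_powR_on.
by move=> x _; exact: powR_ge0.
Qed.

Lemma wsqr2_comb be (f g1 g2 : R * R -> R) (c1 c2 : R) : measurable_fun D g1 -> measurable_fun D g2 ->
  0 <= c1 -> 0 <= c2 ->
  {ae leb2, forall x, D x -> (f x) ^+ 2 <= c1 * (g1 x) ^+ 2 + c2 * (g2 x) ^+ 2} ->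
  (wsqr2 a rho be f <= c1%:E * wsqr2 a rho be g1 + c2%:E * wsqr2 a rho be g2)%E.
Proof.
move=> m1 m2 c10 c20 h.
apply: (@le_sqr_integral_comb _ (measurableTypeR R * measurableTypeR R)%type
  (lebesgue_measure \x lebesgue_measure)%E) => //; first exact: measurable_powR_fst.
by move=> x _; exact: powR_ge0.
Qed.

Lemma wsqr_ge0 be (f : R -> R) : (0 <= wsqr rho be f)%E.
Proof. by apply: integral_ge0 => r _; rewrite lee_fin mulr_ge0 ?sqr_ge0 ?powR_ge0. Qed.

Lemma wsqr2_ge0 be (f : R * R -> R) : (0 <= wsqr2 a rho be f)%E.
Proof. by apply: integral_ge0 => r _; rewrite lee_fin mulr_ge0 ?sqr_ge0 ?powR_ge0. Qed.

Lemma wsqr_le be (f g : R -> R) (c : R) : measurable_fun I g -> 0 <= c ->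
  {ae leb, forall r, I r -> (f r) ^+ 2 <= c * (g r) ^+ 2} ->
  (wsqr rho be f <= c%:E * wsqr rho be g)%E.
Proof.
move=> mg c0 h; have := @wsqr_comb be f g g c 0 mg mg c0 (lexx _); rewrite mul0e adde0; apply.
by apply: ae_imp h => r h Ir; rewrite mul0r addr0; exact: h.
Qed.

Lemma wsqr_ae_eq be (f g : R -> R) : measurable_fun I f -> measurable_fun I g ->
  {ae leb, forall r, I r -> f r = g r} -> wsqr rho be f = wsqr rho be g.
Proof.
move=> mf mg h; apply/eqP; rewrite eq_le; apply/andP; split.
  rewrite -[leRHS]mul1e; apply: wsqr_le => //; apply: ae_imp h => r h Ir.
  by rewrite mul1r h.
rewrite -[leRHS]mul1e; apply: wsqr_le => //; apply: ae_imp h => r h Ir.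
by rewrite mul1r h.
Qed.

Lemma wsqr1E (f : R -> R) : wsqr rho 1 f = (\int[leb]_(r in I) ((f r) ^+ 2 * r)%:E)%E.
Proof.
apply: eq_integral => r; rewrite inE/= in_itv/= => /andP[r0 _]; rewrite powRr1//; exact: ltW.
Qed.

(** On the bounded interval r^(be' - be) is at most its value at [rho]; a larger exponent gives a
    weaker norm at the axis. *)
Lemma wsqr2_weight_le be be' (F : R * R -> R) : measurable_fun D F -> be <= be' ->
  (wsqr2 a rho be' F <= (rho `^ (be' - be))%:E * wsqr2 a rho be F)%E.
Proof.
move=> mF bb; have mw := @measurable_wsqr2 R a rho be F mF.
rewrite /wsqr2.
have <- : (\int[leb2]_(x in D) ((rho `^ (be' - be))%:E * ((F x) ^+ 2 * x.1 `^ be)%:E) =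
   (rho `^ (be' - be))%:E * \int[leb2]_(x in D) ((F x) ^+ 2 * x.1 `^ be)%:E)%E.
  apply: (@ge0_integralZl _ (measurableTypeR R * measurableTypeR R)%type R (lebesgue_measure \x lebesgue_measure)%E) => //.
    by move=> x _; rewrite lee_fin mulr_ge0 ?sqr_ge0 ?powR_ge0.
  by rewrite lee_fin powR_ge0.
apply: le_integral_nomeas => -[r z] [/= + _]; rewrite in_itv/= => /andP[r0 rr].
rewrite lee_fin mulr_ge0 ?sqr_ge0 ?powR_ge0//= -EFinM lee_fin [leRHS]mulrCA.
apply: ler_wpM2l; first exact: sqr_ge0.
have -> : r `^ be' = r `^ (be' - be) * r `^ be.
  by rewrite -powRD ?subrK//; apply/implyP => _; rewrite gt_eqF.
apply: ler_wpM2r; first exact: powR_ge0.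
by apply: ge0_ler_powR; rewrite ?subr_ge0 ?nnegrE//; apply: ltW.
Qed.

Lemma coef_wsqr_le be (e : nat -> R -> R) m F : (forall n, continuous (e n)) ->
  (forall m n, \int[leb]_(z in `](- a), a[) (e m z * e n z) = a * (m == n)%:R) ->
  measurable_fun D F -> (wsqr rho be (coef a (e m) F) <= a%:E * wsqr2 a rho be F)%E.
Proof.
move=> ce orth mF; have mc := measurable_coef (@ce m) mF.
apply: (@le_trans _ _ (a%:E * (a%:E * wsqr rho be (fun r => a^-1 * coef a (e m) F r)%R))%E).
  rewrite muleA -EFinM; apply: wsqr_le; first exact: measurable_funM.
    by apply: mulr_ge0; apply: ltW.
  apply: aeW => r _; have <- : coef a (e m) F r ^+ 2 = a * a * (a^-1 * coef a (e m) F r) ^+ 2; last by [].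
  by field; rewrite gt_eqF.
apply: lee_wpmul2l; first by rewrite lee_fin ltW.
apply: le_trans (bessel_wsqr be a0 ce orth m.+1 mF); rewrite big_nat_recr//=.
rewrite -[leLHS]add0e; apply: leeD => //; apply: sume_ge0 => n _; apply: mule_ge0; [by rewrite lee_fin ltW|exact: wsqr_ge0].
Qed.

(** Fubini. The function obtained by integration over [X] no longer depends on r, so its coefficient
    is evaluated at the placeholder 0. *)
Lemma coef_primitive (X : set R) (t : R -> R) (F : R * R -> R) : measurable X -> continuous t ->
  (forall z, `|t z| <= 1) -> leb2.-integrable (X `*` J) (EFin \o F) ->
  coef a t (fun x => \int[leb]_(s in X) F (s, x.2)) 0 = \int[leb]_(s in X) coef a t F s.
Proof.
move=> mX ct t1 iF; have mXJ : measurable (X `*` J) by exact: measurableX.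
have iFt : leb2.-integrable (X `*` J) (EFin \o (fun x => F x * t x.2)).
  apply: (lint2_le (lint2_norm iF) mXJ).
    apply: measurable_funM; [exact: lint2_measurable iF|].
    by apply: measurable_funTS; apply: (measurableT_comp (continuous_measurable_fun ct)); exact: measurable_snd.
  by move=> x _; rewrite normrM -[leRHS]mulr1; apply: ler_wpM2l.
rewrite /coef -(leb_fubini1 mX mJ iFt) (leb_fubini2 mX mJ iFt) /=.
have mt : measurable_fun J t by apply: measurable_funTS; exact: continuous_measurable_fun.
apply: lRint1_ae_eq => //.
- by apply: measurable_funM => //; exact: lint1_measurable (leb_integrable_fubini2 mX mJ iF).
- exact: lint1_measurable (leb_integrable_fubini2 mX mJ iFt).
apply: ae_imp (leb_ae_integrable2 mX mJ iF) => z h Jz; rewrite mulrC -(lRint1Z (t z) (h Jz) mX).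
by apply: lRint1_eq => s _; rewrite mulrC.
Qed.

End weighted_calculus.

(** * Bounds for a single mode *)

Section modes.
Context {R : realType}.
Notation leb := (@lebesgue_measure R).
Variables (rho a mu : R) (psi psir psiz omega : R * R -> R).
Hypotheses (rho0 : 0 < rho) (a0 : 0 < a) (mu0 : 0 < mu) (mu1 : mu < 1).
Notation I := (`]0%R, rho[%classic : set R).
Notation J := (`](- a), a[%classic : set R).
Notation D := (cyl 0 rho a).
Hypothesis wr : weak_der D 1 0 psi psir.
Hypothesis wz : weak_der D 0 1 psi psiz.
Hypothesis deq : forall phi, smooth phi -> supported_in D phi ->
  - (\int[leb2]_(x in D) (psi x * pder 2 0 phi x))
  - (\int[leb2]_(x in D) (x.1^-1 * psir x * phi x))
  - (\int[leb2]_(x in D) (psi x * pder 0 2 phi x))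
  - (\int[leb2]_(x in D) (2 / x.1 * psir x * phi x))
  = \int[leb2]_(x in D) (omega x * phi x).
Hypothesis mo : measurable_fun D omega.
Hypothesis fp : (wsqr2 a rho 1 psi < +oo)%E.
Hypothesis fr : (wsqr2 a rho 1 psir < +oo)%E.
Hypothesis fz : (wsqr2 a rho 1 psiz < +oo)%E.
Hypothesis fo : (wsqr2 a rho (2 * mu - 1) omega < +oo)%E.
Hypothesis lateral : {ae leb2, forall x, D x -> psi x + \int[leb]_(s in `]x.1, rho[) psir (s, x.2) = 0}.
Hypothesis coef_z : forall n,
  {ae leb, forall r, 0 < r < rho -> coef a (cn a n) psiz r = freq a n * coef a (sn a n) psi r}.

Let mI : measurable I. Proof. by []. Qed.
Let mJ : measurable J. Proof. by []. Qed.
Let mD : measurable D. Proof. exact: measurable_cyl. Qed.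
Let be : R := 2 * mu + 1.

(** The coefficients satisfy their equations only almost everywhere. [U] is redefined as r^-3 times
    the primitive given by the equation and [P] as minus the integral of [U]; these representatives
    satisfy the identities at every r and are bounded, as the energy estimate and the
    differentiation of the series require. The factor k^-4 is (2 / k^2) (2 k^2)^-1. *)
Lemma mode n : exists U P : R -> R, exists M : R,
  let k := freq a n in let W := coef a (sn a n) omega in
  [/\ measurable_fun I U, measurable_fun I P, (forall r, I r -> `|U r| <= M /\ `|P r| <= M),
      {ae leb, forall r, I r -> coef a (sn a n) psir r = U r /\ coef a (sn a n) psi r = P r} &
  [/\ (wsqr rho be U <= (2 * k ^+ 2)^-1%:E * wsqr rho be W)%E,
      (wsqr rho be P <= (k ^- 4)%:E * wsqr rho be W)%E,
      (forall r, I r -> P r = - \int[leb]_(s in `]r, rho[) U s) &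
      (forall r, I r -> r ^+ 3 * U r = \int[leb]_(s in `]0, r[) (s ^+ 3 * (k ^+ 2 * P s - W s)))]].
Proof.
set k := freq a n; have k0 : 0 < k := freq_gt0 a0 n.
have [lp lr _] := wr; have [_ lz _] := wz.
have mp := lp.1; have mr := lr.1; have mz := lz.1.
pose e := sn a; have ce m : continuous (e m) by exact: continuous_sn.
have oe i j : \int[leb]_(z in `](- a), a[) (e i z * e j z) = a * (i == j)%:R by exact: orth_sn.
pose Uc := coef a (e n) psir; pose Pc := coef a (e n) psi; pose W := coef a (e n) omega.
have mUc : measurable_fun I Uc by exact: measurable_coef.
have mPc : measurable_fun I Pc by exact: measurable_coef.
have mW : measurable_fun I W by exact: measurable_coef.
pose h s := k ^+ 2 * Pc s - W s.
have mh : measurable_fun I h by apply: measurable_funB => //; apply: measurable_funM.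
have fin1 F : measurable_fun D F -> (wsqr2 a rho 1 F < +oo)%E -> (wsqr rho 1 (coef a (e n) F) < +oo)%E.
  move=> mF fF; apply: le_lt_trans (coef_wsqr_le a0 1 n ce oe mF) _.
  by rewrite lte_mul_pinfty ?lee_fin ?(ltW a0).
(* The bound of the flux at the axis uses the weight s ds; since 2 mu - 1 <= 1, the norm of [omega]
   of index mu - 1 controls it. *)
have fo1 : (wsqr2 a rho 1 omega < +oo)%E.
  have b1 : 2 * mu - 1 <= 1 by have ? := mu1; lra.
  apply: le_lt_trans (wsqr2_weight_le rho0 mo b1) _.
  by rewrite lte_mul_pinfty ?lee_fin ?powR_ge0.
have fh : (wsqr rho 1 h < +oo)%E.
  have := @wsqr_comb R rho 1 h Pc W (2 * k ^+ 4) 2 mPc mW.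
  move=> /(_ _ _ _)/le_lt_trans; apply.
  - by rewrite mulr_ge0// exprn_ge0// ltW.
  - by [].
  - apply: aeW => r _; rewrite /h; have := sqr_ge0 (k ^+ 2 * Pc r + W r).
    move: (Pc r) (W r) => x y hh.
    have : (k ^+ 2 * x - y) ^+ 2 + (k ^+ 2 * x + y) ^+ 2 = 2 * k ^+ 4 * x ^+ 2 + 2 * y ^+ 2 by ring.
    by move=> <-; rewrite lerDl.
  - have k4 : 0 <= 2 * k ^+ 4 by rewrite mulr_ge0// exprn_ge0// ltW.
    by apply: lte_add_pinfty; rewrite lte_mul_pinfty ?lee_fin ?fin1.
pose M := fine (wsqr rho 1 h).
have hM : (\int[leb]_(s in `]0%R, rho[) ((h s) ^+ 2 * s)%:E <= M%:E)%E.
  by rewrite -(wsqr1E rho h) /M fineK// ge0_fin_numE// wsqr_ge0.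
have UK : (\int[leb]_(s in `]0%R, rho[) ((Uc s) ^+ 2 * s)%:E <= (fine (wsqr rho 1 Uc))%:E)%E.
  by rewrite -(wsqr1E rho Uc) fineK// ge0_fin_numE ?wsqr_ge0// fin1.
have isub F : measurable_fun D F -> (wsqr2 a rho 1 F < +oo)%E -> forall d : R, 0 < d < rho ->
    leb2.-integrable (cyl d rho a) (EFin \o F).
  by move=> mF fF d /andP[d0 _]; exact: integrable_subcyl_of_wsqr2 d0 mF fF.
have ode := ode_integrated rho0 a0 wr wz deq (isub _ mr fr) (isub _ mz fz) (isub _ mo fo1)
  (coef_z n) mUc mPc mW hM UK.
have [ish bV] := weighted_primitive_bound mh hM.
pose V r := \int[leb]_(s in `]0, r[) (s ^+ 3 * h s).
pose U r := (r ^+ 3)^-1 * V r.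
pose P r := - \int[leb]_(s in `]r, rho[) U s.
have uE r : 0 < r <= rho -> r ^+ 3 * U r = V r.
  by move=> /andP[r0 _]; rewrite /U mulVKf// expf_neq0// gt_eqF.
have mU : measurable_fun I U := energy_flux_measurable rho0 mh hM uE.
have bU r : 0 < r <= rho -> `|U r| <= Num.sqrt M by exact: (energy_flux_bound mh hM uE).
have UcE : {ae leb, forall r, I r -> Uc r = U r}.
  apply: ae_imp ode => r hr; rewrite /= in_itv/= => rr; have /andP[r0 rr'] := rr.
  apply: (@mulfI _ (r ^+ 3)); first by rewrite expf_neq0// gt_eqF.
  by rewrite (hr rr) uE// r0 ltW.
have iU : leb.-integrable I (EFin \o U).
  apply: (lint1_le (g := fun=> Num.sqrt M)) => //.
    by apply: integrable_continuous; exact: cst_continuous.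
  by move=> r; rewrite /= in_itv/= => /andP[r0 rr]; apply: bU; rewrite r0 ltW.
have acP : abs_cont 0 rho P U := AC_Rintegral_right iU.
have mP : measurable_fun I P.
  apply: (@measurable_funS _ _ _ _ `[0, rho]%classic) => //; first exact: subset_itv_oo_cc.
  apply: subspace_continuous_measurable_fun => //; exact: AC_continuous (ltW rho0) acP.
have bP r : I r -> `|P r| <= Num.sqrt M * rho.
  rewrite /= in_itv/= => /andP[r0 rr]; rewrite normrN.
  have mIr : measurable (`]r, rho[%classic : set R) by [].
  have iUr : leb.-integrable `]r, rho[ (EFin \o U) by apply: integrable_sub_itv iU => //; exact: ltW.
  apply: le_trans (lRint1_norm iUr mIr) _.
  have ci : leb.-integrable `]r, rho[ (EFin \o (fun _ : R => Num.sqrt M)).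
    by apply: integrable_continuous; exact: cst_continuous.
  apply: le_trans (lRint1_le (lint1_norm iUr) ci mIr _) _.
    by move=> s; rewrite /= in_itv/= => /andP[rs sr]; apply: bU; rewrite (lt_trans r0 rs) ltW.
  rewrite Rintegral_cst//= (leb_itvoo (ltW rr))/=; apply: ler_wpM2l; first exact: sqrtr_ge0.
  by rewrite gerBl ltW.
(* The condition on S_1, multiplied by the sine and integrated over z. *)
have PcE : {ae leb, forall r, I r -> Pc r = P r}.
  apply: ae_imp (leb_ae_slices1 lateral) => r hr Ir; have := Ir; rewrite /= in_itv/= => /andP[r0 rr].
  have mIr : measurable (`]r, rho[%classic : set R) by [].
  have iFr : leb2.-integrable (`]r, rho[ `*` J) (EFin \o psir) by apply: isub => //; rewrite r0.
  have c1 := coef_primitive mIr (ce n) (norm_sn a n) iFr.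
  have subr : `]r, rho[%classic `<=` I by apply: itvoo_subset => //; exact: ltW.
  have -> : P r = - \int[leb]_(s in `]r, rho[) Uc s.
    rewrite /P; congr (- _); apply: lRint1_ae_eq => //; [exact: measurable_funS subr mU|exact: measurable_funS subr mUc|].
    by apply: ae_imp UcE => s hs Is; rewrite hs//; exact: subr.
  rewrite -c1 /Pc /coef -[RHS]mulN1r.
  have mprim : measurable_fun J (fun z => \int[leb]_(s in `]r, rho[) psir (s, z)).
    exact: lint1_measurable (leb_integrable_fubini2 mIr mJ iFr).
  have iprim : leb.-integrable J (EFin \o (fun z => (\int[leb]_(s in `]r, rho[) psir (s, z)) * e n z)).
    have cm : {within `[- a, a], continuous (e n)} by apply: continuous_subspaceT; exact: ce.
    by apply: lint1_eq (integrable_continuousM cm (leb_integrable_fubini2 mIr mJ iFr)) mJ => z _; rewrite mulrC.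
  rewrite -(lRint1Z (-1) iprim mJ).
  have me : measurable_fun J (e n) by apply: measurable_funTS; exact: continuous_measurable_fun.
  apply: lRint1_ae_eq => //.
  - apply: measurable_funM => //.
    exact: (@measurable_fun_slice1 _ _ (measurableTypeR R) (measurableTypeR R) _ _ I J psi r mI mJ Ir mp).
  - by apply: measurable_funM => //; apply: measurable_funM.
  - apply: ae_imp (hr Ir) => z hz Jz; have /eqP := hz Jz; rewrite addr_eq0 => /eqP -> /=.
    by rewrite mulNr mulN1r.
(* [h] was built from the coefficient [Pc]; the energy estimate is applied with the representative
   [P] in its place, which agrees with it almost everywhere. *)
pose h' s := k ^+ 2 * P s - W s.
have mh' : measurable_fun I h' by apply: measurable_funB => //; apply: measurable_funM.
have hh' : {ae leb, forall r, I r -> h r = h' r} by apply: ae_imp PcE => r hr Ir; rewrite /h /h' hr.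
have hM' : (\int[leb]_(s in `]0%R, rho[) ((h' s) ^+ 2 * s)%:E <= M%:E)%E.
  by rewrite -(wsqr1E rho h') -(wsqr_ae_eq 1 mh mh' hh') (wsqr1E rho h).
have uE' r : 0 < r <= rho -> r ^+ 3 * U r = \int[leb]_(s in `]0, r[) (s ^+ 3 * h' s).
  move=> rr; have /andP[r0 rr'] := rr; rewrite uE//.
  have subr : `]0, r[%classic `<=` I by exact: itvoo_subset.
  have mIr : measurable (`]0, r[%classic : set R) by [].
  have mx (g : R -> R) : measurable_fun I g -> measurable_fun `]0, r[ (fun s => s ^+ 3 * g s).
    by move=> mg; apply: measurable_funM; [exact: measurable_funX|exact: measurable_funS subr mg].
  apply: lRint1_ae_eq => //; [exact: mx|exact: mx|].
  by apply: ae_imp hh' => s hs Is; rewrite hs//; exact: subr.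
have est := energy_estimate rho0 mu0 mu1 k0 mW mh' hM' uE' (fun r _ => erefl).
have m1 : measurable_fun I (fun r => (((U r) ^+ 2 + k ^+ 2 / 2 * (P r) ^+ 2) * r `^ be)%:E).
  apply/measurable_EFinP; apply: measurable_funM; last exact: measurable_powR_on.
  by apply: measurable_funD; [exact: measurable_funX|apply: measurable_funM => //; exact: measurable_funX].
have Wf : (\int[leb]_(r in `]0%R, rho[) ((W r) ^+ 2 * r `^ be)%:E = wsqr rho be W)%E by [].
exists U, P, (Num.sqrt M * (1 + rho)); split => //.
- move=> r Ir; split.
    apply: (@le_trans _ _ (Num.sqrt M)).
      by apply: bU; move: Ir; rewrite /= in_itv/= => /andP[-> /ltW].
    by rewrite ler_peMr ?sqrtr_ge0// lerDl ltW.
  by apply: le_trans (bP _ Ir) _; apply: ler_wpM2l; rewrite ?sqrtr_ge0// lerDr.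
- by apply: ae_imp2 UcE PcE => r h1 h2 Ir; rewrite -h1// -h2.
split => //.
- apply: le_trans est; apply: le_integral_nomeas => r _; rewrite lee_fin mulr_ge0 ?sqr_ge0 ?powR_ge0//= lee_fin.
  by apply: ler_wpM2r; [exact: powR_ge0|rewrite lerDl mulr_ge0 ?sqr_ge0// divr_ge0// sqr_ge0].
- apply: (@le_trans _ _ ((2 / k ^+ 2)%:E * ((2 * k ^+ 2)^-1%:E * wsqr rho be W))%E); last first.
    rewrite muleA -EFinM; apply: lee_wpmul2r; first exact: wsqr_ge0.
    by rewrite lee_fin; rewrite le_eqVlt; apply/orP; left; apply/eqP; field; rewrite gt_eqF.
  apply: le_trans (lee_wpmul2l _ est); last by rewrite lee_fin divr_ge0// sqr_ge0.
  have <- : (\int[leb]_(r in I) ((2 / k ^+ 2)%:E * (((U r) ^+ 2 + k ^+ 2 / 2 * (P r) ^+ 2) * r `^ be)%:E) =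
     (2 / k ^+ 2)%:E * \int[leb]_(r in I) (((U r) ^+ 2 + k ^+ 2 / 2 * (P r) ^+ 2) * r `^ be)%:E)%E.
    apply: ge0_integralZl => //; last by rewrite lee_fin divr_ge0// sqr_ge0.
    by move=> r _; rewrite lee_fin mulr_ge0 ?powR_ge0// addr_ge0 ?sqr_ge0// mulr_ge0 ?sqr_ge0// divr_ge0// sqr_ge0.
  apply: le_integral_nomeas => r _; rewrite lee_fin mulr_ge0 ?sqr_ge0 ?powR_ge0//= lee_fin.
  rewrite mulrA; apply: ler_wpM2r; first exact: powR_ge0.
  have -> : 2 / k ^+ 2 * (U r ^+ 2 + k ^+ 2 / 2 * P r ^+ 2) = P r ^+ 2 + 2 / k ^+ 2 * U r ^+ 2.
    by field; rewrite gt_eqF.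
  by rewrite lerDl mulr_ge0 ?sqr_ge0// divr_ge0// sqr_ge0.
- by move=> r; rewrite /= in_itv/= => /andP[r0 rr]; apply: uE'; rewrite r0 ltW.
Qed.

End modes.

(** * Summation of the modes *)

Section mode_synthesis.
Context {R : realType}.
Notation leb := (@lebesgue_measure R).
Variables (rho a mu : R) (psi psir psiz omega omegaz : R * R -> R).
Hypotheses (rho0 : 0 < rho) (a0 : 0 < a) (mu0 : 0 < mu) (mu1 : mu < 1).
Notation I := (`]0%R, rho[%classic : set R).
Notation J := (`](- a), a[%classic : set R).
Notation D := (cyl 0 rho a).
Notation be := (2 * mu + 1).
Hypothesis wr : weak_der D 1 0 psi psir.
Hypothesis wz : weak_der D 0 1 psi psiz.
Hypothesis deq : forall phi, smooth phi -> supported_in D phi ->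
  - (\int[leb2]_(x in D) (psi x * pder 2 0 phi x))
  - (\int[leb2]_(x in D) (x.1^-1 * psir x * phi x))
  - (\int[leb2]_(x in D) (psi x * pder 0 2 phi x))
  - (\int[leb2]_(x in D) (2 / x.1 * psir x * phi x))
  = \int[leb2]_(x in D) (omega x * phi x).
Hypothesis mo : measurable_fun D omega.
Hypothesis moz : measurable_fun D omegaz.
Hypothesis fp : (wsqr2 a rho 1 psi < +oo)%E.
Hypothesis fr : (wsqr2 a rho 1 psir < +oo)%E.
Hypothesis fz : (wsqr2 a rho 1 psiz < +oo)%E.
Hypothesis fo : (wsqr2 a rho (2 * mu - 1) omega < +oo)%E.
Hypothesis foz : (wsqr2 a rho be omegaz < +oo)%E.
Hypothesis lateral : {ae leb2, forall x, D x -> psi x + \int[leb]_(s in `]x.1, rho[) psir (s, x.2) = 0}.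
Hypothesis coef_z : forall n,
  {ae leb, forall r, 0 < r < rho -> coef a (cn a n) psiz r = freq a n * coef a (sn a n) psi r}.
Hypothesis coef_oz : forall n,
  {ae leb, forall r, 0 < r < rho -> coef a (cn a n) omegaz r = freq a n * coef a (sn a n) omega r}.

Let mI : measurable I. Proof. by []. Qed.
Let mJ : measurable J. Proof. by []. Qed.
Let mD : measurable D. Proof. exact: measurable_cyl. Qed.
Let k n := freq a n.
Let k0 n : 0 < k n. Proof. exact: freq_gt0. Qed.
Let W n := coef a (sn a n) omega.
Let w n r := a^-1 * (k n * W n r).

Let mW n : measurable_fun I (W n).
Proof. by apply: measurable_coef => //; exact: continuous_sn. Qed.

Let mw n : measurable_fun I (w n).
Proof. by apply: measurable_funM => //; exact: measurable_funM. Qed.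

Lemma mule_lty (x : R) (y : \bar R) : 0 <= x -> (0 <= y)%E -> (y < +oo)%E -> (x%:E * y < +oo)%E.
Proof. by move=> x0 y0 y1; rewrite lte_mul_pinfty. Qed.

(** The vanishing of [omega] on S_2, in the form [coef_oz], makes [w n] equal to a^-1 times the
    cosine coefficient of [omegaz], for which Bessel's inequality is available. *)
Lemma bessel_omega N :
  (\sum_(0 <= n < N) wsqr rho be (w n) <= (a^-1 * fine (wsqr2 a rho be omegaz))%:E)%E.
Proof.
have mc n : measurable_fun I (fun r => a^-1 * coef a (cn a n) omegaz r).
  by apply: measurable_funM => //; apply: measurable_coef => //; exact: continuous_cn.
have wE n : wsqr rho be (w n) = wsqr rho be (fun r => a^-1 * coef a (cn a n) omegaz r).
  apply: wsqr_ae_eq => //; apply: ae_imp (coef_oz n) => r h; rewrite /= in_itv/= => /h e.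
  by rewrite /w e.
have := bessel_wsqr be a0 (@continuous_cn R a) (orth_cn a0) N moz.
rewrite -ge0_sume_distrr; last by move=> n _; exact: wsqr_ge0.
under eq_bigr do rewrite -wE.
rewrite -(@fineK _ (wsqr2 a rho be omegaz)); last by rewrite ge0_fin_numE ?wsqr2_ge0.
move=> h; rewrite EFinM -[leLHS]mul1e -(_ : (a^-1)%:E * a%:E = 1)%E; last by rewrite -EFinM mulVf// gt_eqF.
by rewrite -muleA; apply: lee_wpmul2l => //; rewrite lee_fin invr_ge0 ltW.
Qed.

(** The squared norms of the [w n] are summable by [bessel_omega], so a bound of each mode by [w n]
    with a common constant suffices, and this constant passes to the sum. *)
Lemma mode_sum_synthesis (e : nat -> R -> R) (f : nat -> R -> R) (c : R) :
  (forall n, continuous (e n)) ->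
  (forall m n, \int[leb]_(z in `](- a), a[) (e m z * e n z) = a * (m == n)%:R) ->
  (forall n, measurable_fun I (f n)) -> 0 <= c ->
  (forall n, (wsqr rho be (f n) <= c%:E * wsqr rho be (w n))%E) ->
  exists F : R * R -> R, exists eps : nat -> R,
    [/\ measurable_fun D F, eps n @[n --> \oo] --> (0 : R),
        (wsqr2 a rho be F <= c%:E * wsqr2 a rho be omegaz)%E &
        forall N, (wsqr2 a rho be (fun x => F x - partial_series e f N x)%R <= (eps N)%:E)%E].
Proof.
move=> ce oe mf c0 hf.
have fin : wsqr2 a rho be omegaz \is a fin_num by rewrite ge0_fin_numE ?wsqr2_ge0.
have hM N : (\sum_(0 <= n < N) wsqr rho be (f n) <= (c * (a^-1 * fine (wsqr2 a rho be omegaz)))%:E)%E.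
  apply: (@le_trans _ _ (c%:E * \sum_(0 <= n < N) wsqr rho be (w n))%E).
    rewrite ge0_sume_distrr; last by move=> n _; exact: wsqr_ge0.
    by apply: lee_sum => n _; exact: hf.
  by rewrite EFinM; apply: lee_wpmul2l; [rewrite lee_fin|exact: bessel_omega].
have [F [eps [h1 h2 h3 h4]]] := weighted_synthesis a0 ce oe mf hM.
exists F, eps; split => //; apply: le_trans h3 _; rewrite -[in leRHS](fineK fin) -EFinM lee_fin.
by rewrite le_eqVlt; apply/orP; left; apply/eqP; field; rewrite gt_eqF.
Qed.

Lemma freq0_le n : k 0 <= k n.
Proof. by rewrite /k /freq ler_wpM2r ?divr_ge0 ?pi_ge0// ?mulr_ge0 ?(ltW a0)// ler_nat. Qed.

Lemma ae_integrable_slices1 be' (F : R * R -> R) : measurable_fun D F -> (wsqr2 a rho be' F < +oo)%E ->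
  {ae leb, forall r, I r -> leb.-integrable J (EFin \o (fun z => F (r, z)))}.
Proof.
move=> mF fF; apply: ae_imp (ae_sqr_slices1 mF fF) => r h Ir.
apply: integrable_of_sqr; last exact: h.
exact: (@measurable_fun_slice1 _ _ (measurableTypeR R) (measurableTypeR R) _ _ I J F r mI mJ Ir mF).
Qed.

(** The square s^6 is at most a constant times the weight s^(2 mu + 1), because 5 - 2 mu >= 0. *)
Lemma integrable_cubic F r : measurable_fun D F -> (wsqr2 a rho be F < +oo)%E -> 0 < r < rho ->
  leb2.-integrable (`]0, r[ `*` J) (EFin \o (fun x => x.1 ^+ 3 * F x)).
Proof.
move=> mF fF /andP[r0 rr].
have b5 : 0 <= 5 - 2 * mu by have ? := mu1; lra.
have i0 := @integrable_of_wsqr2 R rho a be 0 (rho `^ (5 - 2 * mu)) (fun s => s ^+ 3) F (lexx _) mF fF.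
have mJr : measurable (`]0, r[%classic `*` J) by apply: measurableX.
have m3 : measurable_fun I (fun s : R => s ^+ 3) by exact: measurable_funX.
have bnd s : 0 < s < rho -> (s ^+ 3) ^+ 2 <= rho `^ (5 - 2 * mu) * s `^ be.
  move=> /andP[s0 sr]; rewrite -exprM.
  have -> : s ^+ (3 * 2) = s `^ (5 - 2 * mu) * s `^ be.
    rewrite -powRD; last by apply/implyP => _; rewrite gt_eqF.
    by rewrite (_ : 5 - 2 * mu + be = 6) ?powR_mulrn//; [exact: ltW|ring].
  by apply: ler_wpM2r; [exact: powR_ge0|apply: ge0_ler_powR; rewrite ?nnegrE//; exact: ltW].
apply: (lint2_sub (i0 m3 bnd) mD mJr).
by move=> [s z] [/= h1 h2]; split => //=; apply: itvoo_subset h1 => //; exact: ltW.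
Qed.

(** The series of [psi], of [psir] and of their z-derivatives are summed separately. Completeness
    identifies the first two sums with [psi] and [psir], and weak derivatives pass to the limit from
    the partial sums. The two integral identities are then verified coefficient by coefficient. *)
Lemma second_derivatives : exists A B C : R * R -> R,
  [/\ [/\ measurable_fun D A, measurable_fun D B & measurable_fun D C],
      [/\ weak_der D 0 2 psi A, weak_der D 1 2 psi B & weak_der D 0 3 psi C],
      [/\ (wsqr2 a rho be A < +oo)%E, (wsqr2 a rho be B <= (2^-1)%:E * wsqr2 a rho be omegaz)%E &
          (wsqr2 a rho be C <= wsqr2 a rho be omegaz)%E],
      {ae leb2, forall x, D x -> A x = - \int[leb]_(s in `]x.1, rho[) B (s, x.2)} &
      {ae leb2, forall x, D x -> x.1 ^+ 3 * psir x =
         - \int[leb]_(s in `]0, x.1[) (s ^+ 3 * (omega (s, x.2) + A (s, x.2)))}].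
Proof.
have [lp lr _] := wr; have mp := lp.1; have mr := lr.1.
have modeE n : exists X : (R -> R) * (R -> R) * R,
  [/\ measurable_fun I X.1.1, measurable_fun I X.1.2, (forall r, I r -> `|X.1.1 r| <= X.2 /\ `|X.1.2 r| <= X.2),
      {ae leb, forall r, I r -> coef a (sn a n) psir r = X.1.1 r /\ coef a (sn a n) psi r = X.1.2 r} &
  [/\ (wsqr rho be X.1.1 <= (2 * k n ^+ 2)^-1%:E * wsqr rho be (W n))%E,
      (wsqr rho be X.1.2 <= (k n ^- 4)%:E * wsqr rho be (W n))%E,
      (forall r, I r -> X.1.2 r = - \int[leb]_(s in `]r, rho[) X.1.1 s) &
      (forall r, I r -> r ^+ 3 * X.1.1 r = \int[leb]_(s in `]0, r[) (s ^+ 3 * (k n ^+ 2 * X.1.2 s - W n s)))]].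
  by have [U [P [M h]]] := mode rho0 a0 mu0 mu1 wr wz deq mo fp fr fz fo lateral coef_z n; exists (U, P, M).
have [X hX] := choice modeE.
pose U n := (X n).1.1; pose P n := (X n).1.2; pose M n := (X n).2.
have mU n : measurable_fun I (U n) by have [] := hX n.
have mP n : measurable_fun I (P n) by have [] := hX n.
have bU n r : I r -> `|U n r| <= M n by have [_ _ h _ _] := hX n; case/h.
have bP n r : I r -> `|P n r| <= M n by have [_ _ h _ _] := hX n; case/h.
have coefU n : {ae leb, forall r, I r -> coef a (sn a n) psir r = U n r}.
  by have [_ _ _ h _] := hX n; apply: ae_imp h => r h /h[].
have coefP n : {ae leb, forall r, I r -> coef a (sn a n) psi r = P n r}.
  by have [_ _ _ h _] := hX n; apply: ae_imp h => r h /h[].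
have eU n : (wsqr rho be (U n) <= (2 * k n ^+ 2)^-1%:E * wsqr rho be (W n))%E by have [_ _ _ _ []] := hX n.
have eP n : (wsqr rho be (P n) <= (k n ^- 4)%:E * wsqr rho be (W n))%E by have [_ _ _ _ []] := hX n.
have PE n r : I r -> P n r = - \int[leb]_(s in `]r, rho[) U n s by have [_ _ _ _ [_ _ h _]] := hX n; exact: h.
have UE n r : I r -> r ^+ 3 * U n r = \int[leb]_(s in `]0, r[) (s ^+ 3 * (k n ^+ 2 * P n s - W n s)).
  by have [_ _ _ _ [_ _ _ h]] := hX n; exact: h.
have kn0 n : k n != 0 by rewrite gt_eqF.
have an0 : a != 0 by rewrite gt_eqF.
have WE n : (wsqr rho be (W n) <= ((a / k n) ^+ 2)%:E * wsqr rho be (w n))%E.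
  apply: wsqr_le => //; first exact: sqr_ge0.
  apply: aeW => r _; rewrite /w le_eqVlt; apply/orP; left; apply/eqP; field.
  by rewrite an0 kn0.
have scaled (g : nat -> R -> R) n (c d C : R) : measurable_fun I (g n) -> 0 <= d ->
    (wsqr rho be (g n) <= d%:E * wsqr rho be (W n))%E -> c ^+ 2 * (d * (a / k n) ^+ 2) <= C ->
    (wsqr rho be (fun r => c * g n r)%R <= C%:E * wsqr rho be (w n))%E.
  move=> mg d0 hg hC; apply: (@le_trans _ _ ((c ^+ 2)%:E * wsqr rho be (g n))%E).
    by apply: wsqr_le => //; [exact: sqr_ge0|apply: aeW => r _; rewrite exprMn].
  apply: (@le_trans _ _ ((c ^+ 2)%:E * (d%:E * (((a / k n) ^+ 2)%:E * wsqr rho be (w n))))%E).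
    apply: lee_wpmul2l; first by rewrite lee_fin sqr_ge0.
    by apply: (le_trans hg); apply: lee_wpmul2l; [rewrite lee_fin|exact: WE].
  by rewrite !muleA -!EFinM; apply: lee_wpmul2r; [exact: wsqr_ge0|rewrite lee_fin -mulrA].
have kinv n m : (k n ^+ m)^-1 <= (k 0 ^+ m)^-1.
  by rewrite lef_pV2 ?posrE ?exprn_gt0//; apply: lerXn2r; rewrite ?nnegrE ?(ltW (k0 _))//; exact: freq0_le.
(* [f0] and [f1] are the Fourier coefficients of [psi] and [psir]; [fA] and [fB] belong to psi_zz
   and psi_rzz in sines, [fC] to psi_zzz in cosines. In units of the squared norm of [w n] the
   bounds for [f0], [f1], [fA], [fB], [fC] are k^-6, k^-4 / 2, k^-2, 1/2 and 1. The last two do not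
   depend on n and are the constants for [B] and [C]; the others are bounded through the lowest
   frequency. *)
pose f0 n r := a^-1 * P n r; pose f1 n r := a^-1 * U n r.
pose fA n r := - k n * (k n * f0 n r); pose fB n r := - k n * (k n * f1 n r).
pose fC n r := k n * fA n r.
have mf0 n : measurable_fun I (f0 n) by exact: measurable_funM.
have mf1 n : measurable_fun I (f1 n) by exact: measurable_funM.
have mfA n : measurable_fun I (fA n) by do 2 apply: measurable_funM => //.
have mfB n : measurable_fun I (fB n) by do 2 apply: measurable_funM => //.
have mfC n : measurable_fun I (fC n) by exact: measurable_funM.
have dU n : 0 <= (2 * k n ^+ 2)^-1 by rewrite invr_ge0 mulr_ge0// sqr_ge0.
have dP n : 0 <= k n ^- 4 by rewrite invr_ge0 exprn_ge0// ltW.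
have ki0 m : 0 <= (k 0 ^+ m)^-1 by rewrite invr_ge0 exprn_ge0// ltW.
have cs := @continuous_sn R a; have cc := @continuous_cn R a.
have os := @orth_sn R a a0; have oc := @orth_cn R a a0.
have [S0 [eps0 [mS0 e0 fS0 hS0]]] : exists F : R * R -> R, exists eps : nat -> R,
    [/\ measurable_fun D F, eps n @[n --> \oo] --> (0 : R),
        (wsqr2 a rho be F <= ((k 0 ^+ 6)^-1)%:E * wsqr2 a rho be omegaz)%E &
        forall N, (wsqr2 a rho be (fun x => F x - partial_series (sn a) f0 N x)%R <= (eps N)%:E)%E].
  apply: mode_sum_synthesis => // n; apply: (scaled P n _ _ _ (mP n) (dP n) (eP n)).
  apply: le_trans (kinv n 6%N); rewrite le_eqVlt; apply/orP; left; apply/eqP; field.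
  by rewrite an0 kn0.
have [S1 [eps1 [mS1 e1 fS1 hS1]]] : exists F : R * R -> R, exists eps : nat -> R,
    [/\ measurable_fun D F, eps n @[n --> \oo] --> (0 : R),
        (wsqr2 a rho be F <= (2^-1 * (k 0 ^+ 4)^-1)%:E * wsqr2 a rho be omegaz)%E &
        forall N, (wsqr2 a rho be (fun x => F x - partial_series (sn a) f1 N x)%R <= (eps N)%:E)%E].
  apply: mode_sum_synthesis => // [|n]; first exact: mulr_ge0.
  apply: (scaled U n _ _ _ (mU n) (dU n) (eU n)).
  apply: (@le_trans _ _ (2^-1 * (k n ^+ 4)^-1)); last exact: ler_wpM2l.
  rewrite le_eqVlt; apply/orP; left; apply/eqP; field; by rewrite an0 kn0.
have [A [epsA [mA eA fA' hA]]] : exists F : R * R -> R, exists eps : nat -> R,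
    [/\ measurable_fun D F, eps n @[n --> \oo] --> (0 : R),
        (wsqr2 a rho be F <= ((k 0 ^+ 2)^-1)%:E * wsqr2 a rho be omegaz)%E &
        forall N, (wsqr2 a rho be (fun x => F x - partial_series (sn a) fA N x)%R <= (eps N)%:E)%E].
  apply: mode_sum_synthesis => // n.
  have -> : fA n = (fun r => (- k n * (k n * a^-1)) * P n r) by apply/funext => r; rewrite /fA /f0; ring.
  apply: (scaled P n _ _ _ (mP n) (dP n) (eP n)).
  apply: le_trans (kinv n 2%N); rewrite le_eqVlt; apply/orP; left; apply/eqP; field.
  by rewrite an0 kn0.
have [B [epsB [mB eB fB' hB]]] : exists F : R * R -> R, exists eps : nat -> R,
    [/\ measurable_fun D F, eps n @[n --> \oo] --> (0 : R),
        (wsqr2 a rho be F <= (2^-1)%:E * wsqr2 a rho be omegaz)%E &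
        forall N, (wsqr2 a rho be (fun x => F x - partial_series (sn a) fB N x)%R <= (eps N)%:E)%E].
  apply: mode_sum_synthesis => // n.
  have -> : fB n = (fun r => (- k n * (k n * a^-1)) * U n r) by apply/funext => r; rewrite /fB /f1; ring.
  apply: (scaled U n _ _ _ (mU n) (dU n) (eU n)).
  rewrite le_eqVlt; apply/orP; left; apply/eqP; field; by rewrite an0 kn0.
have [C [epsC [mC eC fC' hC]]] : exists F : R * R -> R, exists eps : nat -> R,
    [/\ measurable_fun D F, eps n @[n --> \oo] --> (0 : R),
        (wsqr2 a rho be F <= 1%:E * wsqr2 a rho be omegaz)%E &
        forall N, (wsqr2 a rho be (fun x => F x - partial_series (cn a) fC N x)%R <= (eps N)%:E)%E].
  apply: mode_sum_synthesis => // n.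
  have -> : fC n = (fun r => (k n * (- k n * (k n * a^-1))) * P n r) by apply/funext => r; rewrite /fC /fA /f0; ring.
  apply: (scaled P n _ _ _ (mP n) (dP n) (eP n)).
  rewrite le_eqVlt; apply/orP; left; apply/eqP; field; by rewrite an0 kn0.
have fin F c : (wsqr2 a rho be F <= c%:E * wsqr2 a rho be omegaz)%E -> (wsqr2 a rho be F < +oo)%E.
  move=> h; apply: (le_lt_trans h); rewrite -(@fineK _ (wsqr2 a rho be omegaz)); last by rewrite ge0_fin_numE ?wsqr2_ge0.
  by rewrite -EFinM ltry.
have fS0i := fin _ _ fS0; have fS1i := fin _ _ fS1; have fAi := fin _ _ fA'; have fBi := fin _ _ fB'.
have fCi := fin _ _ fC'.
have lS0 := locL1_of_wsqr2 rho0 a0 mS0 fS0i; have lS1 := locL1_of_wsqr2 rho0 a0 mS1 fS1i.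
have lA := locL1_of_wsqr2 rho0 a0 mA fAi; have lB := locL1_of_wsqr2 rho0 a0 mB fBi.
have lC := locL1_of_wsqr2 rho0 a0 mC fCi.
have cS0 m := synthesis_coef a0 cs os m mf0 mS0 fS0i e0 hS0.
have cS1 m := synthesis_coef a0 cs os m mf1 mS1 fS1i e1 hS1.
have cA m := synthesis_coef a0 cs os m mfA mA fAi eA hA.
have cB m := synthesis_coef a0 cs os m mfB mB fBi eB hB.
have psiS0 : {ae leb2, forall x, D x -> psi x = S0 x}.
  apply: (ae_eq_of_coef a0 mp mS0 (ae_integrable_slices1 mp fp) (ae_integrable_slices1 mS0 fS0i)) => m.
  by apply: ae_imp2 (coefP m) (cS0 m) => r h1 h2 Ir; rewrite h1// h2// /f0 mulVKf.
have psirS1 : {ae leb2, forall x, D x -> psir x = S1 x}.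
  apply: (ae_eq_of_coef a0 mr mS1 (ae_integrable_slices1 mr fr) (ae_integrable_slices1 mS1 fS1i)) => m.
  by apply: ae_imp2 (coefU m) (cS1 m) => r h1 h2 Ir; rewrite h1// h2// /f1 mulVKf.
have bound (g : nat -> R -> R) c n : (forall r, I r -> `|g n r| <= M n) -> forall r, I r -> `|c * g n r| <= `|c| * M n.
  by move=> hg r Ir; rewrite normrM; apply: ler_wpM2l => //; exact: hg.
have w02 : weak_der D 0 2 psi A.
  apply: (weak_der_ae_eq rho0 a0 lp psiS0).
  apply: (weak_der_limit rho0 a0 lS0 lA _ hS0 e0 hA eA) => N.
  exact: (weak_der_series2_sn rho0 a0 N mf0 (fun n => bound P a^-1 n (bP n))).
have wr2 : weak_der D 0 2 psir B.
  apply: (weak_der_ae_eq rho0 a0 lr psirS1).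
  apply: (weak_der_limit rho0 a0 lS1 lB _ hS1 e1 hB eB) => N.
  exact: (weak_der_series2_sn rho0 a0 N mf1 (fun n => bound U a^-1 n (bU n))).
have wAC : weak_der D 0 1 A C.
  apply: (weak_der_limit rho0 a0 lA lC _ hA eA hC eC) => N.
  apply: (weak_der_series_sn rho0 a0 mfA (M := fun n => `|- k n * (k n * a^-1)| * M n)) => n r Ir.
  by have := bound P (- k n * (k n * a^-1)) n (bP n) r Ir; rewrite /fA /f0 !mulrA.
exists A, B, C; split => //.
- by split => //; [exact: weak_der_1j wr wr2|exact: weak_der_0S w02 wAC].
- by split => //; rewrite -[leRHS]mul1e.
(* For each mode this is the identity [PE] multiplied by -k^2. *)
- have mprim := (measurable_primitive_right (lexx 0) mB).1.
  have iB r : I r -> leb2.-integrable (`]r, rho[ `*` J) (EFin \o B).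
    by rewrite /= in_itv/= => /andP[r0 rr]; exact: integrable_subcyl_of_wsqr2 r0 mB fBi.
  apply: (ae_eq_of_coef a0 mA _ (ae_integrable_slices1 mA fAi)).
  + exact: (measurableT_comp (@oppr_measurable R _) mprim).
  + apply: aeW => r Ir; have mIr : measurable (`]r, rho[%classic : set R) by [].
    have := lint1Z (-1) (leb_integrable_fubini2 mIr mJ (iB r Ir)) mJ => h.
    by apply: lint1_eq h mJ => z _; rewrite mulN1r.
  move=> m; apply: ae_imp (cA m) => r h Ir; rewrite h//.
  have mIr : measurable (`]r, rho[%classic : set R) by [].
  have subr : `]r, rho[%classic `<=` I.
    by move: Ir; rewrite /= in_itv/= => /andP[r0 _]; apply: itvoo_subset => //; exact: ltW.
  have c1 := coef_primitive mIr (@cs m) (norm_sn a m) (iB r Ir).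
  have iprim : leb.-integrable J (EFin \o (fun z => (\int[leb]_(s in `]r, rho[) B (s, z)) * sn a m z)).
    have cm : {within `[- a, a], continuous (sn a m)} by apply: continuous_subspaceT; exact: cs.
    by apply: lint1_eq (integrable_continuousM cm (leb_integrable_fubini2 mIr mJ (iB r Ir))) mJ => z _; rewrite mulrC.
  transitivity (- 1 * coef a (sn a m) (fun x => \int[leb]_(s in `]r, rho[) B (s, x.2)) 0); last first.
    rewrite /coef -(lRint1Z (-1) iprim mJ); apply: lRint1_eq => z _ /=.
    by rewrite mulN1r mulNr.
  rewrite c1.
  have -> : \int[leb]_(s in `]r, rho[) coef a (sn a m) B s = \int[leb]_(s in `]r, rho[) ((- k m * k m) * U m s).
    apply: lRint1_ae_eq => //.
    - by apply: (measurable_funS _ subr) => //; apply: measurable_coef => //; exact: cs.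
    - by apply: measurable_funM => //; exact: measurable_funS subr (mU m).
    - apply: ae_imp (cB m) => s hs Is; rewrite hs; last exact: subr.
      by rewrite /fB /f1; field.
  have iU : leb.-integrable `]r, rho[ (EFin \o U m).
    apply: (lint1_le (g := fun=> M m)) => //.
    - by apply: integrable_continuous; exact: cst_continuous.
    - exact: measurable_funS subr (mU m).
    - by move=> s Is; apply: bU; exact: subr.
  by rewrite (lRint1Z _ iU mIr) /fA /f0 PE//; field.
(* The coefficient of [A] is -k^2 P, so that of [H] is W - k^2 P; the identity [UE] of the modes has
   the opposite sign under the integral, whence the minus. *)
- pose H x := omega x + A x.
  have mH : measurable_fun D H by exact: measurable_funD.
  have fo' : (wsqr2 a rho be omega < +oo)%E.
    have b1 : 2 * mu - 1 <= be by lra.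
    by apply: le_lt_trans (wsqr2_weight_le rho0 mo b1) _; apply: mule_lty; [exact: powR_ge0|exact: wsqr2_ge0|exact: fo].
  have fH : (wsqr2 a rho be H < +oo)%E.
    have := @wsqr2_comb R rho a be H omega A 2 2 mo mA.
    move=> /(_ (ler0n _ _) (ler0n _ _) _)/le_lt_trans; apply.
      apply: aeW => x _; rewrite /H; move: (omega x) (A x) => p q.
      rewrite -subr_ge0 (_ : _ - _ = (p - q) ^+ 2) ?sqr_ge0//; ring.
    by apply: lte_add_pinfty; rewrite lte_mul_pinfty ?lee_fin.
  have mG : measurable_fun D (fun x => x.1 ^+ 3 * H x).
    by apply: measurable_funM => //; apply: measurable_funTS; apply: measurable_funX; exact: measurable_fst.
  have mprim := measurable_primitive_left mG.
  have iG r : I r -> leb2.-integrable (`]0, r[ `*` J) (EFin \o (fun x => x.1 ^+ 3 * H x)).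
    by rewrite /= in_itv/= => rr; exact: integrable_cubic.
  have mL : measurable_fun D (fun x => x.1 ^+ 3 * psir x).
    by apply: measurable_funM => //; apply: measurable_funTS; apply: measurable_funX; exact: measurable_fst.
  apply: (ae_eq_of_coef a0 mL).
  + exact: (measurableT_comp (@oppr_measurable R _) mprim).
  + by apply: ae_imp (ae_integrable_slices1 mr fr) => r h Ir; exact: (lint1Z (r ^+ 3) (h Ir) mJ).
  + apply: aeW => r Ir; have mIr : measurable (`]0, r[%classic : set R) by [].
    have := lint1Z (-1) (leb_integrable_fubini2 mIr mJ (iG r Ir)) mJ => h.
    by apply: lint1_eq h mJ => z _; rewrite mulN1r.
  move=> m; apply: ae_imp2 (coefU m) (ae_integrable_slices1 mr fr) => r h1 h2 Ir.
  have mIr : measurable (`]0, r[%classic : set R) by [].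
  have subr : `]0, r[%classic `<=` I.
    by move: Ir; rewrite /= in_itv/= => /andP[_ rr]; apply: itvoo_subset => //; exact: ltW.
  have it (g : R -> R) : leb.-integrable J (EFin \o g) -> leb.-integrable J (EFin \o (fun z => g z * sn a m z)).
    move=> ig; have cm : {within `[- a, a], continuous (sn a m)} by apply: continuous_subspaceT; exact: cs.
    by apply: lint1_eq (integrable_continuousM cm ig) mJ => z _; rewrite mulrC.
  have -> : coef a (sn a m) (fun x => x.1 ^+ 3 * psir x) r = r ^+ 3 * U m r.
    rewrite -h1// /coef -(lRint1Z (r ^+ 3) (it _ (h2 Ir)) mJ).
    by apply: lRint1_eq => z _ /=; rewrite mulrA.
  have c1 := coef_primitive mIr (@cs m) (norm_sn a m) (iG r Ir).
  have iprim := it _ (leb_integrable_fubini2 mIr mJ (iG r Ir)).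
  transitivity (- 1 * coef a (sn a m) (fun x => \int[leb]_(s in `]0, r[) (s ^+ 3 * H (s, x.2))) 0); last first.
    rewrite /coef -(lRint1Z (-1) iprim mJ); apply: lRint1_eq => z _ /=.
    by rewrite mulN1r mulNr.
  rewrite c1 UE//.
  have mPr : measurable_fun `]0, r[ (P m) := measurable_funS mI subr (mP m).
  have mWr : measurable_fun `]0, r[ (W m) := measurable_funS mI subr (mW m).
  have mcr : measurable_fun `]0, r[ (coef a (sn a m) (fun x => x.1 ^+ 3 * H x)).
    by apply: (measurable_funS mI subr); apply: measurable_coef mG; exact: cs.
  have icr : leb.-integrable `]0, r[ (EFin \o coef a (sn a m) (fun x => x.1 ^+ 3 * H x)).
    have := itrig2 (@cs m) (norm_sn a m) (iG r Ir) => /(leb_integrable_fubini1 mIr mJ) h.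
    by apply: lint1_eq h mIr => s _.
  rewrite -(lRint1Z (-1) icr mIr); apply: lRint1_ae_eq => //.
  - apply: measurable_funM; first exact: measurable_funX.
    by apply: measurable_funB => //; apply: measurable_funM.
  - by apply: measurable_funM.
  apply: ae_imp3 (cA m) (ae_integrable_slices1 mo fo) (ae_integrable_slices1 mA fAi) => s k1 k2 k3 Is.
  have Is' := subr _ Is.
  have -> : coef a (sn a m) (fun x => x.1 ^+ 3 * H x) s = s ^+ 3 * (W m s + a * fA m s).
    rewrite -k1// /W /coef -(lRint1D (it _ (k2 Is')) (it _ (k3 Is')) mJ).
    rewrite -(lRint1Z (s ^+ 3) (lint1D (it _ (k2 Is')) (it _ (k3 Is')) mJ) mJ).
    by apply: lRint1_eq => z _ /=; rewrite /H; ring.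
  by rewrite /fA /f0; field.
Qed.

End mode_synthesis.

(** * Regularity on lines parallel to the radius *)

Section radial_slice.
Context {R : realType}.
Notation leb := (@lebesgue_measure R).
Variables (rho : R).
Hypothesis rho0 : 0 < rho.
Notation I := (`]0%R, rho[%classic : set R).

Let mI : measurable I. Proof. by []. Qed.

Let subI p : 0 < p -> `]p, rho[%classic `<=` I.
Proof. by move=> p0; apply: itvoo_subset => //; exact: ltW. Qed.

Lemma locally_integrable_itv (f : R -> R) : measurable_fun I f ->
  (forall p : R, 0 < p < rho -> leb.-integrable `]p, rho[ (EFin \o f)) -> locally_integrable I f.
Proof.
move=> mf hf; split => //.
move=> K KI cK; have [p [q [p0 pq qr Kpq]]] := compact_sub_itv rho0 cK KI.
have p2 : 0 < p / 2 < rho.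
  by rewrite divr_gt0//=; apply: lt_trans (lt_trans pq qr); rewrite ltr_pdivrMr// ltr_pMr// ltr1n.
have /integrableP[_] := hf _ p2; apply: le_lt_trans.
apply: ge0_subset_integral_nomeas => // x /Kpq; rewrite /= !in_itv/= => /andP[px xq].
rewrite (le_lt_trans xq)// andbT; apply: lt_le_trans px.
by rewrite ltr_pdivrMr ?ltr_pMr ?ltr1n// (lt_trans p0).
Qed.

Lemma weak_der1_ae_id (u v : R -> R) : measurable_fun I u -> locally_integrable I v ->
  {ae leb, forall r, I r -> u r = v r} -> weak_der1 I 0 u v.
Proof.
move=> mu lv uv; have [mv oI hv] := lv; split => //.
  split => // K KI cK; have := hv K KI cK; apply: le_lt_trans.
  have mK : measurable K by apply: compact_measurable.
  apply: ae_le_integral_nomeas => //.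
    by apply/measurable_EFinP; apply: (measurableT_comp (@normr_measurable R _)); exact: measurable_funS KI mv.
  by apply: ae_imp uv => r h Kr; rewrite h//; exact: KI.
move=> phi sphi _; rewrite expr0 mul1r; apply: lRint1_ae_eq => //.
- apply: measurable_funM => //; apply: measurable_funTS; apply: continuous_measurable_fun; exact: smooth1_continuous.
- apply: measurable_funM => //; apply: measurable_funTS; apply: continuous_measurable_fun; exact: smooth1_continuous.
- by apply: ae_imp uv => r h Ir; rewrite h.
Qed.

(** Integration by parts against [phi], whose support keeps away from both ends; absolute continuity
    is asked for away from the axis only, because the higher derivatives of the flux are singular
    there. *)
Lemma weak_der1_AC i (u g g' : R -> R) : measurable_fun I g' ->
  (forall p : R, 0 < p < rho -> abs_cont p rho g g') -> weak_der1 I i u g -> weak_der1 I i.+1 u g'.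
Proof.
move=> mg' ac [lu lg h]; split => //; first by apply: locally_integrable_itv => // p /ac[].
move=> phi sphi [K [cK KI vK]].
have [p [q [p0 pq qr Kpq]]] := compact_sub_itv rho0 cK KI.
have vphi r : ~ (p <= r <= q) -> phi r = 0 by move=> nr; apply: vK => /Kpq; rewrite /= in_itv.
have vphi' := derive1_vanish vphi.
have sphi' := smooth1_derive sphi.
have supp' : supported_in I phi^`()%classic.
  exists `[p, q]%classic; split; [exact: segment_compact| |].
    by move=> r; rewrite /= !in_itv/= => /andP[pr rq]; rewrite (lt_le_trans p0 pr) (le_lt_trans rq qr).
  by move=> r; rewrite /= in_itv/=; exact: vphi'.
rewrite derive1Sn h// exprS mulN1r mulNr -mulrN; congr (_ * _).
have p2 : 0 < p / 2 < rho.
  by rewrite divr_gt0//=; apply: lt_trans (lt_trans pq qr); rewrite ltr_pdivrMr// ltr_pMr// ltr1n.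
have p2p : p / 2 < p by rewrite ltr_pdivrMr// ltr_pMr// ltr1n.
have /andP[p20 p2r] := p2.
have acg := ac _ p2.
have acphi : abs_cont (p / 2) rho phi phi^`()%classic.
  apply: AC_C1 => [r _|]; first exact: smooth1_is_derive.
  by apply: continuous_subspaceT; exact: smooth1_continuous.
have [i12 e12] := AC_M (ltW p2r) acg acphi.
have cphi : {within `[p / 2, rho], continuous phi} by apply: continuous_subspaceT; exact: smooth1_continuous.
have cphi' : {within `[p / 2, rho], continuous phi^`()%classic} by apply: continuous_subspaceT; exact: smooth1_continuous.
have mE : measurable (`]p / 2, rho[%classic : set R) by [].
have i1 : leb.-integrable `]p / 2, rho[ (EFin \o (fun r => g' r * phi r)).
  by apply: lint1_eq (integrable_continuousM cphi acg.1) mE => r _; rewrite mulrC.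
have i2 : leb.-integrable `]p / 2, rho[ (EFin \o (fun r => g r * phi^`()%classic r)).
  have ig := integrable_continuous (AC_continuous (ltW p2r) acg).
  by apply: lint1_eq (integrable_continuousM cphi' ig) mE => r _; rewrite mulrC.
have wid (f k : R -> R) : (forall r, ~ (p <= r <= q) -> k r = 0) ->
    \int[leb]_(r in I) (f r * k r) = \int[leb]_(r in `]p / 2, rho[) (f r * k r).
  move=> vk; apply: lRint1_widen; first exact: subI.
  move=> r; rewrite /= !in_itv/= => /andP[r0 rr] nr; rewrite vk ?mulr0// => /andP[pr rq].
  by apply: nr; rewrite rr andbT (lt_le_trans p2p).
rewrite !wid//; apply/eqP; rewrite -addr_eq0 addrC -(lRint1D i1 i2 mE) -(e12 (p / 2) rho)//; last exact: ltW.
by rewrite !vphi ?mulr0 ?subrr//; apply/negP; rewrite negb_and -!ltNge ?p2p// qr orbT.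
Qed.

Lemma der1_norm2_le nu be i (u g : R -> R) : be = 2 * nu + 1 -> weak_der1 I i u g ->
  (der1_norm2 I nu i u <= wsqr rho be g)%E.
Proof.
move=> -> w; rewrite /der1_norm2; apply: ereal_inf_lbound; exists g => //.
apply: eq_integral => r; rewrite inE/= in_itv/= => /andP[r0 _].
by rewrite -mulrA -[in RHS](addrK 1 (2 * nu)) addrK -(powRpred (2 * nu + 1) r0) addrK.
Qed.

Lemma integrable_of_wsqr be C (c g : R -> R) : measurable_fun I c -> measurable_fun I g ->
  (wsqr rho be g < +oo)%E -> (forall r, 0 < r < rho -> (c r) ^+ 2 <= C * r `^ be) ->
  leb.-integrable I (EFin \o (fun r => c r * g r)).
Proof.
move=> mc mg fg hc.
have iw : leb.-integrable I (EFin \o (fun r => (g r) ^+ 2 * r `^ be)).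
  apply/integrableP; split; first exact: measurable_wsqr.
  apply: le_lt_trans fg; apply: le_integral_nomeas => x _.
  by rewrite abse_ge0/= ger0_norm// mulr_ge0 ?sqr_ge0 ?powR_ge0.
have ic : leb.-integrable I (EFin \o (fun _ : R => C)).
  by apply: integrable_continuous; exact: cst_continuous.
apply: (lint1_le (lint1D iw ic mI) mI); first exact: measurable_funM.
move=> r; rewrite /= in_itv/= => rr; have /andP[r0 _] := rr.
have w0 : 0 < r `^ be by rewrite powR_gt0.
exact: norm_mul_le_weighted w0 (hc r rr).
Qed.

Lemma wsqr_powM be c (g : R -> R) : wsqr rho be (fun r => r `^ c * g r) = wsqr rho (be + 2 * c) g.
Proof.
apply: eq_integral => r; rewrite inE/= in_itv/= => /andP[r0 _]; congr EFin.
rewrite exprMn mulrAC [RHS]mulrC; congr (_ * _).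
rewrite expr2 -powRD; last by apply/implyP => _; rewrite gt_eqF.
rewrite -powRD; last by apply/implyP => _; rewrite gt_eqF.
by congr (_ `^ _); ring.
Qed.

(** Hardy's inequality with its constant (q - 2)^-1 replaced by 1. *)
Lemma primitive_hardy (q : R) (g : R -> R) : 3 <= q -> leb.-integrable I (EFin \o g) ->
  (wsqr rho (- q) (fun r => \int[leb]_(s in `]0, r[) g s)%R <= wsqr rho (2 - q) g)%E.
Proof.
move=> q3 ig; have mg := lint1_measurable ig.
have q2 : 2 < q by apply: lt_le_trans q3; rewrite ltr_nat.
apply: (@le_trans _ _ ((q - 2)^-1%:E * wsqr rho (2 - q) g)%E); last first.
  rewrite -[leRHS]mul1e; apply: lee_wpmul2r; first exact: wsqr_ge0.
  by rewrite lee_fin invf_le1 ?lerBrDr ?subr_gt0.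
apply: le_trans (hardy_left q2 mg).
apply: le_integral_nomeas => r; rewrite /= in_itv/= => /andP[r0 rr].
rewrite lee_fin mulr_ge0 ?sqr_ge0 ?powR_ge0//= EFinM; apply: lee_wpmul2r; first by rewrite lee_fin powR_ge0.
have mIr : measurable (`]0, r[%classic : set R) by [].
have igr : leb.-integrable `]0, r[ (EFin \o g) by apply: integrable_sub_itv ig => //; exact: ltW.
have fin : (\int[leb]_(s in `]0%R, r[) `|g s|%:E)%E \is a fin_num by apply: integrable_fin_num => //; exact: (lint1_norm igr).
rewrite -(fineK fin) -EFinM lee_fin -expr2 -(real_normK (num_real (\int[leb]_(s in _) _))) ler_sqr ?nnegrE//.
  exact: (lRint1_norm igr mIr).
by apply: fine_ge0; exact: integral_ge0.
Qed.

Section slice_estimate.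
Variables (mu : R) (h h' : R -> R).
Hypotheses (mu0 : 0 < mu) (mu1 : mu < 1).
Hypotheses (mh : measurable_fun I h) (mh' : measurable_fun I h').
Hypothesis ach : forall p : R, 0 < p < rho -> abs_cont p rho h h'.
Hypothesis fh : (wsqr rho (2 * mu - 1) h < +oo)%E.

(** The solution of (r^3 U)' = - r^3 h without the singular part r^-3; it represents psi_r on a line
    z = const. [U1] and [U2] are its first two derivatives, read off from U' = - h - 3 U / r. *)
Definition slice_flux r : R := - (r `^ (- 3) * \int[leb]_(s in `]0, r[) (s ^+ 3 * h s)).
Notation U := slice_flux.
Let U1 r : R := - h r - 3 * (r `^ (- 1) * U r).
Let U2 r : R := - h' r + 3 * (r `^ (- 2) * U r - r `^ (- 1) * U1 r).

Let is3h : leb.-integrable I (EFin \o (fun s => s ^+ 3 * h s)).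
Proof.
have m3 : measurable_fun I (fun s : R => s ^+ 3) by exact: measurable_funX.
apply: (integrable_of_wsqr m3 mh fh (C := rho `^ (7 - 2 * mu))) => s /andP[s0 sr].
rewrite -exprM; have -> : s ^+ (3 * 2) = s `^ (7 - 2 * mu) * s `^ (2 * mu - 1).
  rewrite -powRD; last by apply/implyP => _; rewrite gt_eqF.
  by rewrite (_ : 7 - 2 * mu + (2 * mu - 1) = 6) ?powR_mulrn//; [exact: ltW|ring].
apply: ler_wpM2r; first exact: powR_ge0.
have b7 : 0 <= 7 - 2 * mu by have ? := mu1; lra.
by apply: ge0_ler_powR; rewrite ?nnegrE//; exact: ltW.
Qed.

Let acV := AC_Rintegral is3h.

Let acU p : 0 < p < rho -> abs_cont p rho U U1.
Proof.
move=> /andP[p0 pr]; have acp := @abs_cont_powR R p rho (- 3) p0.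
have := AC_Z (-1) (AC_M (ltW pr) acp (AC_sub (ltW p0) (lexx _) acV)).
apply: AC_ext => r; rewrite in_itv/= => /andP[p1 _].
  by rewrite mulN1r.
have r0 : 0 < r by exact: lt_trans p1.
rewrite /U1 /U.
have e4 : r `^ (- 3 - 1) = r `^ (- 1) * r `^ (- 3).
  by rewrite -powRD; [congr (_ `^ _); ring|apply/implyP => _; rewrite gt_eqF].
have e0 : r `^ (- 3) * r ^+ 3 = 1 by rewrite powRN powR_mulrn ?(ltW r0)// mulVf// expf_neq0// gt_eqF.
have e5 : r `^ (- 3) * (r ^+ 3 * h r) = h r by rewrite mulrA e0 mul1r.
rewrite e4 e5; ring.
Qed.

Let mU : measurable_fun I U.
Proof.
have cV := AC_continuous (ltW rho0) acV.
have mV : measurable_fun I (fun r => \int[leb]_(s in `]0, r[) (s ^+ 3 * h s)).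
  apply: (@measurable_funS _ _ _ _ `[0, rho]%classic) => //; first exact: subset_itv_oo_cc.
  exact: subspace_continuous_measurable_fun.
apply: (measurableT_comp (@oppr_measurable R _)); apply: measurable_funM => //.
exact: measurable_powR_on.
Qed.

Let mU1 : measurable_fun I U1.
Proof.
apply: measurable_funB; first exact: (measurableT_comp (@oppr_measurable R _)).
by apply: measurable_funM => //; apply: measurable_funM => //; exact: measurable_powR_on.
Qed.

Let mU2 : measurable_fun I U2.
Proof.
apply: measurable_funD; first exact: (measurableT_comp (@oppr_measurable R _)).
by apply: measurable_funM => //; apply: measurable_funB; apply: measurable_funM => //; exact: measurable_powR_on.
Qed.

Let acU1 p : 0 < p < rho -> abs_cont p rho U1 U2.
Proof.
move=> pp; have /andP[p0 pr] := pp; have acp := @abs_cont_powR R p rho (- 1) p0.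
have := AC_D (AC_Z (-1) (ach pp)) (AC_Z (- 3) (AC_M (ltW pr) acp (acU pp))).
apply: AC_ext => r; rewrite in_itv/= => /andP[p1 _].
  by rewrite /U1; ring.
rewrite /U2 (_ : - 1 - 1 = - 2 :> R); [ring|by ring].
Qed.

Let bU : (wsqr rho (2 * mu - 3) U <= wsqr rho (2 * mu - 1) h)%E.
Proof.
(* The factor r^-3, squared, lowers the exponent by 6, so Hardy's inequality is applied with q = 9 -
   2 mu; the exponent 2 mu - 7 that it gives for s^3 h is 2 mu - 1 for [h]. *)
have -> : wsqr rho (2 * mu - 3) U = wsqr rho (- (9 - 2 * mu)) (fun r => \int[leb]_(s in `]0, r[) (s ^+ 3 * h s)).
  transitivity (wsqr rho (2 * mu - 3) (fun r => r `^ (- 3) * \int[leb]_(s in `]0, r[) (s ^+ 3 * h s))).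
    by apply: eq_integral => r _; rewrite /U sqrrN.
  by rewrite wsqr_powM (_ : 2 * mu - 3 + 2 * - 3 = - (9 - 2 * mu)) //; ring.
apply: le_trans (primitive_hardy _ is3h) _; first by have ? := mu1; lra.
have -> : wsqr rho (2 - (9 - 2 * mu)) (fun s => s ^+ 3 * h s) = wsqr rho (2 - (9 - 2 * mu)) (fun s => s `^ 3 * h s).
  by apply: eq_integral => r; rewrite inE/= in_itv/= => /andP[r0 _]; rewrite powR_mulrn// ltW.
by rewrite wsqr_powM (_ : 2 - (9 - 2 * mu) + 2 * 3 = 2 * mu - 1) //; ring.
Qed.

(** The exponent 2 mu - 3 is negative, so the weight is bounded below up to the axis and a finite
    weighted norm implies integrability. *)
Lemma integrable_slice_flux : leb.-integrable I (EFin \o U).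
Proof.
have fU : (wsqr rho (2 * mu - 3) U < +oo)%E by apply: le_lt_trans bU fh.
have m1 : measurable_fun I (fun _ : R => 1 : R) by exact: measurable_cst.
have := integrable_of_wsqr m1 mU fU (C := rho `^ (3 - 2 * mu)).
move=> hh; apply: lint1_eq (hh _) mI => [r _|r /andP[r0 rr]]; first by rewrite mul1r.
rewrite expr1n; have e1 : r `^ (3 - 2 * mu) * r `^ (2 * mu - 3) = 1.
  rewrite -powRD; last by apply/implyP => _; rewrite gt_eqF.
  by rewrite (_ : 3 - 2 * mu + (2 * mu - 3) = 0) ?powRr0//; ring.
rewrite -[leLHS]e1; apply: ler_wpM2r; first exact: powR_ge0.
by apply: ge0_ler_powR; rewrite ?nnegrE; [have ? := mu1; lra|exact: ltW|exact: ltW|exact: ltW].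
Qed.

Definition slice_profile r : R := \int[leb]_(s in `]0, r[) U s.

Let acv : abs_cont 0 rho slice_profile U := AC_Rintegral integrable_slice_flux.

Lemma slice_profile_continuous : {within `[0, rho], continuous slice_profile}.
Proof. exact: AC_continuous (ltW rho0) acv. Qed.

(** The flux is bounded by Hardy's inequality with q = 9 - 2 mu and its primitive with q = 5 - 2 mu,
    which is at least 3 because mu < 1; the next two derivatives are expressed through U, h and h'.
    The orders 0 to 3 contribute 1, 1, 2 + 18 = 20 and 18 (2 + 40) = 756 times the squared norm of
    [h], in all 778. *)
Lemma slice_estimate (u : R -> R) : measurable_fun I u ->
  {ae leb, forall r, I r -> u r = slice_profile r} ->
  (Hmu1_norm2 rho mu 3 u <= 778%:E * wsqr rho (2 * mu - 1) h + 2%:E * wsqr rho (2 * mu + 1) h')%E.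
Proof.
move=> mu_ uv; set v := slice_profile.
have mv : measurable_fun I v.
  apply: (@measurable_funS _ _ _ _ `[0, rho]%classic) => //; first exact: subset_itv_oo_cc.
  by apply: subspace_continuous_measurable_fun => //; exact: slice_profile_continuous.
have iv : leb.-integrable I (EFin \o v) by apply: integrable_continuous; exact: slice_profile_continuous.
have lv : locally_integrable I v.
  apply: locally_integrable_itv => // p /andP[p0 pr].
  by apply: integrable_sub_itv iv => //; exact: ltW.
have w0 : weak_der1 I 0 u v by exact: weak_der1_ae_id.
have w1 : weak_der1 I 1 u U.
  apply: weak_der1_AC w0 => // p /andP[p0 pr]; apply: AC_sub acv => //; exact: ltW.
have w2 : weak_der1 I 2 u U1 by apply: weak_der1_AC w1.
have w3 : weak_der1 I 3 u U2 by apply: weak_der1_AC w2.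
set H := wsqr rho (2 * mu - 1) h; set H' := wsqr rho (2 * mu + 1) h'.
have H0 : (0 <= H)%E by exact: wsqr_ge0.
have H'0 : (0 <= H')%E by exact: wsqr_ge0.
have E0 : (wsqr rho (2 * mu - 5) v <= H)%E.
  apply: le_trans bU.
  have := @primitive_hardy (5 - 2 * mu) _ _ integrable_slice_flux.
  rewrite opprB (_ : 2 + (2 * mu - 5) = 2 * mu - 3); [apply; have ? := mu1; lra|ring].
have mUp c : measurable_fun I (fun r => r `^ c * U r) by apply: measurable_funM => //; exact: measurable_powR_on.
have mU1p c : measurable_fun I (fun r => r `^ c * U1 r) by apply: measurable_funM => //; exact: measurable_powR_on.
have E2 : (wsqr rho (2 * mu - 1) U1 <= 2%:E * H + 18%:E * H)%E.
  apply: (@le_trans _ _ (2%:E * H + 18%:E * wsqr rho (2 * mu - 1) (fun r => r `^ (- 1) * U r)%R)%E).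
    apply: wsqr_comb => //; apply: aeW => r _; rewrite /U1; move: (h r) (r `^ (- 1) * U r) => x y.
    have := sqr_ge0 (x - 3 * y) => hh.
    by rewrite (_ : 2 * x ^+ 2 + 18 * y ^+ 2 = (- x - 3 * y) ^+ 2 + (x - 3 * y) ^+ 2) ?lerDl//; ring.
  apply: leeD; first exact: lexx.
  apply: lee_wpmul2l; first by rewrite lee_fin.
  rewrite wsqr_powM.
  by rewrite (_ : 2 * mu - 1 + 2 * - 1 = 2 * mu - 3); [exact: bU|ring].
have E3 : (wsqr rho (2 * mu + 1) U2 <= 2%:E * H' + 18%:E * (2%:E * H + 2%:E * (2%:E * H + 18%:E * H)))%E.
  pose G r := r `^ (- 2) * U r - r `^ (- 1) * U1 r.
  have mG : measurable_fun I G by exact: measurable_funB.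
  apply: (@le_trans _ _ (2%:E * H' + 18%:E * wsqr rho (2 * mu + 1) G)%E).
    apply: wsqr_comb => //; apply: aeW => r _; rewrite /U2 -/(G r); move: (h' r) (G r) => x y.
    have := sqr_ge0 (x + 3 * y) => hh.
    by rewrite (_ : 2 * x ^+ 2 + 18 * y ^+ 2 = (- x + 3 * y) ^+ 2 + (x + 3 * y) ^+ 2) ?lerDl//; ring.
  apply: leeD; first exact: lexx.
  apply: lee_wpmul2l; first by rewrite lee_fin.
  apply: (@le_trans _ _ (2%:E * wsqr rho (2 * mu + 1) (fun r => r `^ (- 2) * U r)%R
      + 2%:E * wsqr rho (2 * mu + 1) (fun r => r `^ (- 1) * U1 r)%R)%E).
    apply: wsqr_comb => //; apply: aeW => r _; rewrite /G; move: (r `^ (- 2) * U r) (r `^ (- 1) * U1 r) => x y.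
    have := sqr_ge0 (x + y) => hh.
    by rewrite (_ : 2 * x ^+ 2 + 2 * y ^+ 2 = (x - y) ^+ 2 + (x + y) ^+ 2) ?lerDl//; ring.
  apply: leeD; (apply: lee_wpmul2l; first by rewrite lee_fin); rewrite wsqr_powM.
    by rewrite (_ : 2 * mu + 1 + 2 * - 2 = 2 * mu - 3); [exact: bU|ring].
  by rewrite (_ : 2 * mu + 1 + 2 * - 1 = 2 * mu - 1); [exact: E2|ring].
rewrite /Hmu1_norm2 !big_ord_recr big_ord0/= add0e.
have le4 (x1 x2 x3 x4 y1 y2 y3 y4 : \bar R) : (x1 <= y1)%E -> (x2 <= y2)%E -> (x3 <= y3)%E -> (x4 <= y4)%E ->
    (x1 + x2 + x3 + x4 <= y1 + y2 + y3 + y4)%E by move=> *; do 3 apply: leeD => //.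
apply: (@le_trans _ _ (H + H + (2%:E * H + 18%:E * H) + (2%:E * H' + 18%:E * (2%:E * H + 2%:E * (2%:E * H + 18%:E * H))))%E).
  apply: le4.
  - by apply: le_trans E0; apply: der1_norm2_le w0; ring.
  - by apply: le_trans bU; apply: der1_norm2_le w1; ring.
  - by apply: le_trans E2; apply: der1_norm2_le w2; ring.
  - by apply: le_trans E3; apply: der1_norm2_le w3; ring.
have finH : H \is a fin_num by rewrite (ge0_fin_numE H0); exact: fh.
rewrite -(fineK finH); move: (fine H) (fine_ge0 H0) H' {H'0 E3} => x x0 y.
rewrite -!(EFinM, EFinD) [(2%:E * y + _)%E]addeC addeA -EFinD.
by apply: leeD; [rewrite lee_fin; lra|exact: lexx].
Qed.

End slice_estimate.

End radial_slice.

(** * Proof of the estimate *)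

Section boundary_values.
Context {R : realType}.
Notation leb := (@lebesgue_measure R).
Variables (rho a : R).
Hypotheses (rho0 : 0 < rho) (a0 : 0 < a).
Notation I := (`]0%R, rho[%classic : set R).
Notation J := (`](- a), a[%classic : set R).
Notation D := (cyl 0 rho a).

Let mI : measurable I. Proof. by []. Qed.
Let mJ : measurable J. Proof. by []. Qed.
Let mD : measurable D. Proof. exact: measurable_cyl. Qed.

Lemma measurable_smooth_fst (X : set R) z (f : R * R -> R) : smooth f -> measurable_fun X (fun r => f (r, z)).
Proof.
move=> sf; have cf : continuous f := @continuous_pder R 0 0 f sf.
by apply: measurable_funTS; apply: continuous_measurable_fun; exact: (@continuous_slice2 _ f z cf).
Qed.

Lemma measurable_smooth_snd (X : set R) r (f : R * R -> R) : smooth f -> measurable_fun X (fun z => f (r, z)).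
Proof.
move=> sf; have cf : continuous f := @continuous_pder R 0 0 f sf.
by apply: measurable_funTS; apply: continuous_measurable_fun; exact: (@continuous_slice1 _ f r cf).
Qed.

Lemma S1_small (e : R) : 0 < e -> exists2 e' : R, 0 < e' & forall f : R * R -> R, smooth f ->
  (S1_norm2 rho a f <= e'%:E)%E -> (\int[leb]_(z in J) `|f (rho, z)|%:E <= e%:E)%E.
Proof.
move=> e0; have mw : measurable_fun J (fun _ : R => rho) by exact: measurable_cst.
have na : - a <= a by have ? := a0; lra.
have fJ : (leb J <= (a - - a)%:E)%E by rewrite (leb_itvoo na).
have [e' e'0 h] := @small_L1 _ (measurableTypeR R) R leb J (fun=> rho) rho (a - - a) e mJ mw rho0 (fun _ _ => lexx _) fJ e0.
by exists e' => // f sf hf; apply: h => //; exact: measurable_smooth_snd.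
Qed.

Lemma S2_small (d e : R) : 0 < d < rho -> 0 < e -> exists2 e' : R, 0 < e' & forall f : R * R -> R, smooth f ->
  (S2_norm2 d rho a f <= e'%:E)%E ->
  (\int[leb]_(r in `]d, rho[) (`|f (r, - a)| + `|f (r, a)|)%:E <= e%:E)%E.
Proof.
move=> /andP[d0 dr] e0; have mE : measurable (`]d, rho[%classic : set R) by [].
have mw : measurable_fun (`]d, rho[%classic : set R) (fun r : R => r) by [].
have fE : (leb `]d, rho[%classic <= (rho - d)%:E)%E by rewrite (leb_itvoo (ltW dr)).
have dw (r : R) : `]d, rho[%classic r -> d <= r by rewrite /= in_itv/= => /andP[/ltW].
have [e' e'0 h] := @small_L1 _ (measurableTypeR R) R leb `]d, rho[%classic (fun r => r) d (rho - d) e mE mw d0 dw fE e0.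
(* The halving compensates the factor 2 in (s + t)^2 <= 2 (s^2 + t^2), used to join the two
   bases. *)
exists (e' / 2); first by rewrite divr_gt0.
move=> f sf hf.
have m1 z : measurable_fun (`]d, rho[%classic : set R) (fun r => f (r, z)) by exact: measurable_smooth_fst.
have mn z : measurable_fun (`]d, rho[%classic : set R) (fun r => `|f (r, z)|).
  by apply: (measurableT_comp (@normr_measurable R _)).
have -> : (\int[leb]_(r in `]d, rho[) (`|f (r, (- a)%R)| + `|f (r, a)|)%:E =
    \int[leb]_(r in `]d, rho[) `|(`|f (r, (- a)%R)| + `|f (r, a)|)%R|%:E)%E.
  by apply: eq_integral => r _; congr EFin; apply/esym; apply: ger0_norm; exact: addr_ge0.
have mg : measurable_fun (`]d, rho[%classic : set R) (fun r : R => `|f (r, - a)| + `|f (r, a)|).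
  by apply: measurable_funD; exact: mn.
apply: (h _ mg).
have w0 (r : R) : `]d, rho[%classic r -> 0 <= r by move=> /dw; apply: le_trans; exact: ltW.
apply: (@le_trans _ _ (2%:E * S2_norm2 d rho a f)%E); last first.
  have -> : e' = 2 * (e' / 2) by field.
  by rewrite EFinM; apply: lee_wpmul2l => //; rewrite lee_fin.
rewrite /S2_norm2.
have <- : (\int[leb]_(r in `]d, rho[) (2%:E * (((f (r, - a)) ^+ 2 + (f (r, a)) ^+ 2) * r)%:E) =
   2%:E * \int[leb]_(r in `]d, rho[) (((f (r, - a)) ^+ 2 + (f (r, a)) ^+ 2) * r)%:E)%E.
  apply: ge0_integralZl => //.
    by apply/measurable_EFinP; apply: measurable_funM => //; apply: measurable_funD; apply: measurable_funX; exact: m1.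
  by move=> r Er; rewrite lee_fin mulr_ge0 ?addr_ge0 ?sqr_ge0//; exact: w0.
apply: le_integral_nomeas => r Er; rewrite lee_fin mulr_ge0 ?sqr_ge0 ?w0//= -EFinM lee_fin mulrA.
apply: ler_wpM2r; first exact: w0.
move: (f (r, - a)) (f (r, a)) => x y.
rewrite -(real_normK (num_real x)) -(real_normK (num_real y)); move: (`|x|) (`|y|) => s t.
by rewrite (_ : 2 * (s ^+ 2 + t ^+ 2) = (s + t) ^+ 2 + (s - t) ^+ 2) ?lerDl ?sqr_ge0//; ring.
Qed.

Section weak_solution_traces.
Variables (psi psir psiz : R * R -> R).
Hypotheses (wr : weak_der D 1 0 psi psir) (wz : weak_der D 0 1 psi psiz).
Hypothesis ip : forall d : R, 0 < d < rho -> leb2.-integrable (cyl d rho a) (EFin \o psi).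
Hypothesis ir : forall d : R, 0 < d < rho -> leb2.-integrable (cyl d rho a) (EFin \o psir).
Hypothesis iz : forall d : R, 0 < d < rho -> leb2.-integrable (cyl d rho a) (EFin \o psiz).
Hypothesis tr : zero_on_S rho a psi.

Let approx d e : 0 < d < rho -> 0 < e -> exists f, [/\ smooth f,
    (\int[leb2]_(x in cyl d rho a) `|f x - psi x|%:E <= e%:E)%E,
    (\int[leb2]_(x in cyl d rho a) `|pder 1 0 f x - psir x|%:E <= e%:E)%E,
    (\int[leb2]_(x in cyl d rho a) `|pder 0 1 f x - psiz x|%:E <= e%:E)%E &
    (S1_norm2 rho a f <= e%:E)%E /\ (S2_norm2 d rho a f <= e%:E)%E].
Proof.
move=> /andP[d0 dr] e0; have [lp _ _] := wr.
have [f [sf h1 h2 h3 h4]] := smooth_approximation (lexx 0) (ltW d0) d0 dr a0 tr lp wr wz e0.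
have S10 : (0 <= S1_norm2 rho a f)%E.
  by apply: integral_ge0 => z _; rewrite lee_fin mulr_ge0 ?sqr_ge0// ltW.
have S20 : (0 <= S2_norm2 0 rho a f)%E.
  apply: integral_ge0 => r; rewrite /= in_itv/= => /andP[r0 _].
  by rewrite lee_fin mulr_ge0 ?addr_ge0 ?sqr_ge0// ltW.
exists f; split => //; split.
  by apply: le_trans h4; rewrite -[leLHS]adde0; apply: leeD.
apply: (@le_trans _ _ (S2_norm2 0 rho a f)); last by apply: le_trans h4; rewrite -[leLHS]add0e; apply: leeD.
apply: ge0_subset_integral_nomeas; first by apply: itvoo_subset => //; exact: ltW.
move=> r; rewrite /= in_itv/= => /andP[r0 _].
by rewrite lee_fin mulr_ge0 ?addr_ge0 ?sqr_ge0// ltW.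
Qed.

Lemma solution_lateral :
  {ae leb2, forall x, D x -> psi x + \int[leb]_(s in `]x.1, rho[) psir (s, x.2) = 0}.
Proof.
apply: (ae_of_subcyl rho0) => d dd; have /andP[d0 dr] := dd.
apply: (trace_lateral dr) (ip dd) (ir dd) => e e0.
have [e' e'0 small] := S1_small e0.
pose m := Num.min e e'; have m0 : 0 < m by rewrite lt_min e0.
have me : (m%:E <= e%:E)%E by rewrite lee_fin ge_min lexx.
have me' : (m%:E <= e'%:E)%E by rewrite lee_fin ge_min lexx orbT.
have [f [sf h1 h2 h3 [h4 h5]]] := approx dd m0.
exists f; split => //; [exact: le_trans h1 me|exact: le_trans h2 me|].
by apply: small => //; exact: le_trans h4 me'.
Qed.

Lemma solution_coef n :
  {ae leb, forall r, 0 < r < rho -> coef a (cn a n) psiz r = freq a n * coef a (sn a n) psi r}.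
Proof.
apply: (ae_of_subitv rho0) => d dd; have /andP[d0 dr] := dd.
have h : {ae leb, forall r, `]d, rho[%classic r ->
    coef a (cn a n) psiz r = freq a n * coef a (sn a n) psi r}; last first.
  by apply: ae_imp h => r h rr; apply: h; rewrite /= in_itv.
apply: (trace_coefficients a0) (ip dd) (iz dd) => e e0.
have [e' e'0 small] := S2_small dd e0.
pose m := Num.min e e'; have m0 : 0 < m by rewrite lt_min e0.
have me : (m%:E <= e%:E)%E by rewrite lee_fin ge_min lexx.
have me' : (m%:E <= e'%:E)%E by rewrite lee_fin ge_min lexx orbT.
have [f [sf h1 h2 h3 [h4 h5]]] := approx dd m0.
exists f; split => //; [exact: le_trans h1 me|exact: le_trans h3 me|].
by apply: small => //; exact: le_trans h5 me'.
Qed.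

End weak_solution_traces.

Section source_traces.
Variables (omega omegar omegaz : R * R -> R).
Hypotheses (wr : weak_der D 1 0 omega omegar) (wz : weak_der D 0 1 omega omegaz).
Hypothesis ip : forall d : R, 0 < d < rho -> leb2.-integrable (cyl d rho a) (EFin \o omega).
Hypothesis ir : forall d : R, 0 < d < rho -> leb2.-integrable (cyl d rho a) (EFin \o omegar).
Hypothesis iz : forall d : R, 0 < d < rho -> leb2.-integrable (cyl d rho a) (EFin \o omegaz).
Hypothesis tr : zero_on_S2 rho a omega.

Let approx d e : 0 < d < rho -> 0 < e -> exists f, [/\ smooth f,
    (\int[leb2]_(x in cyl d rho a) `|f x - omega x|%:E <= e%:E)%E,
    (\int[leb2]_(x in cyl d rho a) `|pder 1 0 f x - omegar x|%:E <= e%:E)%E,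
    (\int[leb2]_(x in cyl d rho a) `|pder 0 1 f x - omegaz x|%:E <= e%:E)%E &
    (S2_norm2 d rho a f <= e%:E)%E].
Proof.
move=> dd e0; have /andP[d0 dr] := dd.
have wr' := weak_der_sub a0 (ltW d0) dr wr; have wz' := weak_der_sub a0 (ltW d0) dr wz.
have [lp _ _] := wr'.
exact: (smooth_approximation (ltW d0) (lexx d) d0 dr a0 (tr dd) lp wr' wz' e0).
Qed.

Lemma source_coef n :
  {ae leb, forall r, 0 < r < rho -> coef a (cn a n) omegaz r = freq a n * coef a (sn a n) omega r}.
Proof.
apply: (ae_of_subitv rho0) => d dd; have /andP[d0 dr] := dd.
have h : {ae leb, forall r, `]d, rho[%classic r ->
    coef a (cn a n) omegaz r = freq a n * coef a (sn a n) omega r}; last first.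
  by apply: ae_imp h => r h rr; apply: h; rewrite /= in_itv.
apply: (trace_coefficients a0) (ip dd) (iz dd) => e e0.
have [e' e'0 small] := S2_small dd e0.
pose m := Num.min e e'; have m0 : 0 < m by rewrite lt_min e0.
have me : (m%:E <= e%:E)%E by rewrite lee_fin ge_min lexx.
have me' : (m%:E <= e'%:E)%E by rewrite lee_fin ge_min lexx orbT.
have [f [sf h1 h2 h3 h5]] := approx dd m0.
exists f; split => //; [exact: le_trans h1 me|exact: le_trans h3 me|].
by apply: small => //; exact: le_trans h5 me'.
Qed.

Lemma source_constant : exists c : R -> R,
  {ae leb2, forall x, D x -> omega x + \int[leb]_(s in `]x.1, rho[) omegar (s, x.2) = c x.2}.
Proof.
(* A fixed radius: the mean over []rho / 2, rho[] defines the function of z independently of the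
   part r > d under consideration, and d is lowered to [d'] when it exceeds [sig]. *)
pose sig := rho / 2; have sr : sig < rho by rewrite ltr_pdivrMr// ltr_pMr// ltr1n.
have s0 : 0 < sig by rewrite divr_gt0.
exists (fun z => (rho - sig)^-1 * \int[leb]_(s in `]sig, rho[) (omega (s, z) + \int[leb]_(t in `]s, rho[) omegar (t, z))).
apply: (ae_of_subcyl rho0) => d /andP[d0 dr].
pose d' := Num.min d sig.
have d'd : 0 < d' < rho by rewrite lt_min d0 s0/= gt_min dr.
have /andP[d'0 d'r] := d'd.
have d's : d' <= sig by rewrite ge_min lexx orbT.
have h := trace_constant d'r d's sr _ (ip d'd) (ir d'd).
apply: ae_imp (h _) => [x hx [x1 x2]|e e0].
  by apply: hx; split => //; apply: itvoo_subset x1 => //; rewrite ge_min lexx.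
by have [f [sf h1 h2 _ _]] := approx d'd e0; exists f.
Qed.

End source_traces.
End boundary_values.

(** * The solution on a line parallel to the radius *)

Section slices_of_the_solution.
Context {R : realType}.
Notation leb := (@lebesgue_measure R).
Variables (rho mu : R).
Hypotheses (rho0 : 0 < rho) (mu0 : 0 < mu) (mu1 : mu < 1).
Notation I := (`]0%R, rho[%classic : set R).

Let mI : measurable I. Proof. by []. Qed.

Lemma integrable_subitv_of_wsqr be (g : R -> R) p : measurable_fun I g -> (wsqr rho be g < +oo)%E ->
  0 < p < rho -> leb.-integrable `]p, rho[ (EFin \o g).
Proof.
move=> mg fg /andP[p0 pr]; have [C C0 hC] := powR_bounded_below rho be p0.
have subp : `]p, rho[%classic `<=` I by apply: itvoo_subset => //; exact: ltW.
have mp : measurable (`]p, rho[%classic : set R) by [].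
pose c r : R := if p < r then 1 else 0.
have mc : measurable_fun I c.
  by apply: measurable_fun_if => //; apply: measurable_funTS; apply: measurable_fun_ltr.
have hc (r : R) : 0 < r < rho -> (c r) ^+ 2 <= C * r `^ be.
  move=> /andP[r0 rr]; rewrite /c; case: ifPn => pr'; first by rewrite expr1n; apply: hC; rewrite pr'.
  by rewrite expr0n/= mulr_ge0 ?powR_ge0// ltW.
have := lint1_sub (integrable_of_wsqr mc mg fg hc) mI mp subp.
move=> h; apply: lint1_eq h mp => r; rewrite /= in_itv/= => /andP[pr' _].
by rewrite /c pr' mul1r.
Qed.

(** The dual Hardy inequality with m = [mu], the source of mu^-2 in the final constant. *)
Lemma hardy_right_primitive (A B : R -> R) : measurable_fun I A -> measurable_fun I B ->
  (wsqr rho (2 * mu + 1) B < +oo)%E ->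
  {ae leb, forall r, I r -> A r = - \int[leb]_(s in `]r, rho[) B s} ->
  (wsqr rho (2 * mu - 1) A <= (mu ^- 2)%:E * wsqr rho (2 * mu + 1) B)%E.
Proof.
move=> mA mB fB AB; apply: le_trans (hardy_right mu0 mB).
have mprim : measurable_fun I (fun r => (\int[leb]_(s in `]r, rho[) `|B s|%:E)%E).
  have mF : measurable_fun (cyl 0 rho 1) (fun x : R * R => `|B x.1|).
    apply: (measurableT_comp (@normr_measurable R _)).
    apply: (@measurable_comp _ _ _ _ _ _ I B _ fst) => //; first by move=> _ [[r z] [/= Ar _] <-].
    by apply: measurable_funTS; exact: measurable_fst.
  have mJ : measurable (`](- 1), 1[%classic : set R) by [].
  have J0 : (`](- 1), 1[%classic : set R) 0 by rewrite /= in_itv/=; lra.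
  have m1 := measurable_fun_slice2 (T1 := measurableTypeR R) (T2 := measurableTypeR R) mI mJ J0
    (measurable_primitive_right (lexx 0) mF).1.
  apply: (@eq_measurable_fun _ _ _ _ _ (fun r => (\int[leb]_(s in `]r, rho[) `|B s|)%:E)); last exact/measurable_EFinP.
  move=> r; rewrite inE/= in_itv/= => rr; rewrite /Rintegral fineK//.
  have mIr : measurable (`]r, rho[%classic : set R) by [].
  by apply: integrable_fin_num => //; exact: (lint1_norm (integrable_subitv_of_wsqr mB fB rr)).
apply: ae_le_integral_nomeas => //.
- apply: emeasurable_funM; first exact: emeasurable_funM.
  by apply/measurable_EFinP; exact: measurable_powR_on.
- by move=> r _; rewrite lee_fin mulr_ge0 ?sqr_ge0 ?powR_ge0.
- by move=> r _; apply: mule_ge0; [apply: sqre_ge0|rewrite lee_fin powR_ge0].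
apply: ae_imp AB => r hr Ir; have rr : 0 < r < rho by move: Ir; rewrite /= in_itv.
rewrite hr// EFinM; apply: lee_wpmul2r; first by rewrite lee_fin powR_ge0.
have mIr : measurable (`]r, rho[%classic : set R) by [].
have iB := integrable_subitv_of_wsqr mB fB rr.
have fin : (\int[leb]_(s in `]r, rho[) `|B s|%:E)%E \is a fin_num by apply: integrable_fin_num => //; exact: (lint1_norm iB).
rewrite sqrrN -(fineK fin) -EFin_expe lee_fin -(real_normK (num_real (\int[leb]_(s in _) _))) ler_sqr ?nnegrE//.
  exact: (lRint1_norm iB mIr).
by apply: fine_ge0; exact: integral_ge0.
Qed.

(** On the line, [w + A] agrees almost everywhere with an absolutely continuous [h] whose derivative
    is [wr + B]. The integrated equation makes [pr] the [slice_flux] of [h], and the condition at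
    [rho] makes [p - p0] its [slice_profile]. Continuity of the latter at 0 gives the value on the
    axis. *)
Lemma slice_solution (p pr w wr A B : R -> R) (cz : R) :
  measurable_fun I p -> measurable_fun I pr -> measurable_fun I w -> measurable_fun I wr ->
  measurable_fun I A -> measurable_fun I B ->
  measurable_fun I (fun r => \int[leb]_(s in `]r, rho[) wr s) ->
  measurable_fun I (fun r => \int[leb]_(s in `]r, rho[) B s) ->
  (wsqr rho (2 * mu + 1) wr < +oo)%E -> (wsqr rho (2 * mu + 1) B < +oo)%E ->
  (wsqr rho (2 * mu - 1) (fun r => w r + A r)%R < +oo)%E ->
  {ae leb, forall r, I r -> p r + \int[leb]_(s in `]r, rho[) pr s = 0} ->
  {ae leb, forall r, I r -> A r = - \int[leb]_(s in `]r, rho[) B s} ->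
  {ae leb, forall r, I r -> r ^+ 3 * pr r = - \int[leb]_(s in `]0, r[) (s ^+ 3 * (w s + A s))} ->
  {ae leb, forall r, I r -> w r + \int[leb]_(s in `]r, rho[) wr s = cz} ->
  let p0 := - \int[leb]_(s in I) pr s in
  (Hmu1_norm2 rho mu 3 (fun r => p r - p0)%R <=
     778%:E * wsqr rho (2 * mu - 1) (fun r => w r + A r)%R
     + 2%:E * wsqr rho (2 * mu + 1) (fun r => wr r + B r)%R)%E /\
  forall e : R, 0 < e -> exists2 d : R, 0 < d & {ae leb, forall r, 0 < r < d -> `|p r - p0| <= e}.
Proof.
move=> mp mpr mw mwr mA mB mIwr mIB fwr fB fh e1 e2 e3 e4 p0.
(* [cz] is the boundary value of [w] at [rho], about which nothing is known; the representative of
   [A] vanishes there. *)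
pose h r := cz - \int[leb]_(s in `]r, rho[) wr s - \int[leb]_(s in `]r, rho[) B s.
pose h' r := wr r + B r.
have mh : measurable_fun I h by apply: measurable_funB => //; apply: measurable_funB.
have mh' : measurable_fun I h' by exact: measurable_funD.
have mwA : measurable_fun I (fun r => w r + A r) by exact: measurable_funD.
have hE : {ae leb, forall r, I r -> w r + A r = h r}.
  by apply: ae_imp2 e2 e4 => r k2 k4 Ir; rewrite /h -(k4 Ir) (k2 Ir); ring.
have hN : wsqr rho (2 * mu - 1) (fun r => w r + A r) = wsqr rho (2 * mu - 1) h by exact: wsqr_ae_eq.
have fh' : (wsqr rho (2 * mu - 1) h < +oo)%E by rewrite -hN.
have ach q : 0 < q < rho -> abs_cont q rho h h'.
  move=> qq; have iw := integrable_subitv_of_wsqr mwr fwr qq; have iB := integrable_subitv_of_wsqr mB fB qq.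
  apply: AC_ext (AC_D (AC_D (AC_cst q rho cz) (AC_Rintegral_right iw)) (AC_Rintegral_right iB)) => r _ //=.
  by rewrite /h' add0r.
have iU := integrable_slice_flux rho0 mu1 mh fh'.
have mU := lint1_measurable iU.
set U := slice_flux h in iU mU.
have prU : {ae leb, forall r, I r -> pr r = U r}.
  apply: ae_imp e3 => r k3 Ir; have := Ir; rewrite /= in_itv/= => /andP[r0 rr].
  have subr : `]0, r[%classic `<=` I by apply: itvoo_subset => //; exact: ltW.
  have mIr : measurable (`]0, r[%classic : set R) by [].
  have r3 : r ^+ 3 != 0 by rewrite expf_neq0// gt_eqF.
  apply: (mulfI r3); rewrite (k3 Ir) /U /slice_flux powRN powR_mulrn ?(ltW r0)// mulrN mulVKf//; congr (- _).
  apply: lRint1_ae_eq => //.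
  - by apply: measurable_funM; [exact: measurable_funX|exact: measurable_funS subr mwA].
  - by apply: measurable_funM; [exact: measurable_funX|exact: measurable_funS subr mh].
  - by apply: ae_imp hE => s ks Is; rewrite ks//; exact: subr.
have uv : {ae leb, forall r, I r -> p r - p0 = slice_profile h r}.
  apply: ae_imp e1 => r k1 Ir; have := Ir; rewrite /= in_itv/= => /andP[r0 rr].
  have subr : `]r, rho[%classic `<=` I by apply: itvoo_subset => //; exact: ltW.
  have mIr : measurable (`]r, rho[%classic : set R) by [].
  have q1 : \int[leb]_(s in `]r, rho[) pr s = \int[leb]_(s in `]r, rho[) U s.
    apply: lRint1_ae_eq => //; [exact: measurable_funS subr mpr|exact: measurable_funS subr mU|].
    by apply: ae_imp prU => s ks Is; apply: ks; exact: subr.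
  have q2 : \int[leb]_(s in I) pr s = \int[leb]_(s in I) U s by exact: lRint1_ae_eq.
  have := Rintegral_itv_cat (ltW r0) (ltW rr) iU; rewrite -q2 -q1 => q3.
  have := k1 Ir => /eqP; rewrite addr_eq0 => /eqP ->.
  by rewrite /p0 opprK q3 /slice_profile -/U; ring.
have mu_ : measurable_fun I (fun r => p r - p0) by exact: measurable_funB.
split.
  by rewrite hN; exact: (slice_estimate rho0 mu1 mh mh' ach fh' mu_ uv).
move=> e e0; have cv := slice_profile_continuous rho0 mu1 mh fh'.
have ac := AC_Rintegral iU.
have v0 : slice_profile h 0 = 0 by rewrite /slice_profile set_itvoo0 Rintegral_set0.
have /(continuous_within_itvP _ rho0)[_ + _] := cv.
rewrite v0 => /cvgr0Pnorm_le/(_ e e0) [d /= d0 hd].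
pose d' := Num.min d rho; exists d'; first by rewrite lt_min d0.
apply: ae_imp uv => r hr /andP[r0]; rewrite lt_min => /andP[rd rr].
rewrite hr; last by rewrite /= in_itv/= r0.
by apply: hd => //=; rewrite sub0r normrN gtr0_norm.
Qed.

End slices_of_the_solution.

(** * Integration over the lines and collection of the constants *)

Section weighted_regularity.
Context {R : realType}.
Notation leb := (@lebesgue_measure R).
Lemma Hmu_norm2_1E (D : set (R * R)) mu (u : R * R -> R) : (Hmu_norm2 D mu 1 u =
  der_norm2 D (mu - 1)%R 0 0 u + der_norm2 D mu 0 1 u + der_norm2 D mu 1 0 u)%E.
Proof.
have gen (F : nat -> nat -> \bar R) :
    (\sum_(i < 2) \sum_(j < 2 | (i + j <= 1)%N) F i j = F 0%N 0%N + F 0%N 1%N + F 1%N 0%N)%E.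
  under eq_bigr do rewrite big_mkcond /=.
  have s2 (f : 'I_2 -> \bar R) : (\sum_(i < 2) f i = f ord0 + f (lift ord0 ord0))%E.
    by rewrite big_ord_recl big_ord1.
  by rewrite !s2 /= adde0.
have e1 : mu + (0 + 0)%:R - 1%:R = mu - 1 by rewrite addr0.
have e2 : mu + (0 + 1)%:R - 1%:R = mu by rewrite addrK.
have e3 : mu + (1 + 0)%:R - 1%:R = mu by rewrite addrK.
have := gen (fun i j => der_norm2 D (mu + (i + j)%:R - 1%:R)%R i j u).
by rewrite e1 !e2 ?e3.
Qed.

Variables (rho a : R).
Hypotheses (rho0 : 0 < rho) (a0 : 0 < a).
Notation I := (`]0%R, rho[%classic : set R).
Notation J := (`](- a), a[%classic : set R).
Notation D := (cyl 0 rho a).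

Let mI : measurable I. Proof. by []. Qed.
Let mJ : measurable J. Proof. by []. Qed.
Let mD : measurable D. Proof. exact: measurable_cyl. Qed.

Lemma der_norm2E nu be i j (u g : R * R -> R) : be = 2 * nu + 1 -> weak_der D i j u g ->
  der_norm2 D nu i j u = wsqr2 a rho be g.
Proof.
move=> -> w; rewrite (der_norm2_eq nu rho0 a0 w); apply: eq_integral => -[r z].
rewrite inE => -[/= + _]; rewrite in_itv/= => /andP[r0 _].
by rewrite -mulrA -(powRpred (2 * nu + 1) r0) addrK.
Qed.

Lemma wsqr2E2 be (F : R * R -> R) : measurable_fun D F ->
  wsqr2 a rho be F = (\int[leb]_(z in J) wsqr rho be (fun r => F (r, z)))%E /\
  measurable_fun J (fun z => wsqr rho be (fun r => F (r, z))).
Proof.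
move=> mF; have mw := @measurable_wsqr2 R a rho be F mF.
have w0 x : (I `*` J) x -> (0 <= ((F x) ^+ 2 * x.1 `^ be)%:E)%E.
  by move=> _; rewrite lee_fin mulr_ge0 ?sqr_ge0 ?powR_ge0.
split; last exact: (leb_measurable_tonelli2 mI mJ mw w0).
by rewrite /wsqr2 (leb_tonelli2 mI mJ mw w0).
Qed.

Lemma add3_lty (x y z : \bar R) : (0 <= x)%E -> (0 <= y)%E -> (0 <= z)%E -> (x + y + z < +oo)%E ->
  [/\ (x < +oo)%E, (y < +oo)%E & (z < +oo)%E].
Proof.
move=> x0 y0 z0 h; split; apply: le_lt_trans h.
- by rewrite -addeA -[leLHS]adde0; apply: leeD => //; exact: adde_ge0.
- by rewrite [(x + y)%E]addeC -addeA -[leLHS]adde0; apply: leeD => //; exact: adde_ge0.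
- by rewrite -[leLHS]add0e; apply: leeD => //; exact: adde_ge0.
Qed.

(** In the bound of [L] the norm [A] carries 2 times 778 = 1556, and [k * A] adds at most 4 more;
    1560 A <= 1560 m B <= 780 m Nz. What remains is 1556 N0, 4 Nr and, from 5 B + C, at most 7/2
    Nz. *)
Lemma collect_constants (m k : R) (L A B C N0 Nz Nr : \bar R) : 0 <= m -> 0 <= k <= 4 ->
  (0 <= A)%E -> (0 <= B)%E -> (0 <= C)%E -> (0 <= N0)%E -> (0 <= Nz)%E -> (0 <= Nr)%E ->
  N0 \is a fin_num -> Nz \is a fin_num -> Nr \is a fin_num ->
  (A <= m%:E * B)%E -> (B <= (2^-1)%:E * Nz)%E -> (C <= Nz)%E ->
  (L <= 778%:E * (2%:E * N0 + 2%:E * A) + 2%:E * (2%:E * Nr + 2%:E * B))%E ->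
  (L + C + B + k%:E * A <= (1556 + 780 * m)%:E * (N0 + Nz + Nr))%E.
Proof.
move=> m0 /andP[k0 k4] A0 B0 C0 N00 Nz0 Nr0 fN0 fNz fNr.
rewrite -(fineK fN0) -(fineK fNz) -(fineK fNr).
move: (fine N0) (fine Nz) (fine Nr) (fine_ge0 N00) (fine_ge0 Nz0) (fine_ge0 Nr0) => n0 nz nr n00 nz0 nr0.
move=> hA hB hC hL.
have fB : B \is a fin_num by rewrite (ge0_fin_numE B0); apply: le_lt_trans hB _; rewrite -EFinM ltry.
have fC : C \is a fin_num by rewrite (ge0_fin_numE C0); apply: le_lt_trans hC _; rewrite ltry.
have fA : A \is a fin_num.
  by rewrite (ge0_fin_numE A0); apply: le_lt_trans hA _; rewrite -(fineK fB) -EFinM ltry.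
move: hL hA hB hC; rewrite -(fineK fA) -(fineK fB) -(fineK fC).
move: (fine A) (fine B) (fine C) (fine_ge0 A0) (fine_ge0 B0) (fine_ge0 C0) => x b c x0 b0 c0.
rewrite -!(EFinM, EFinD) !lee_fin => hL hA hB hC.
apply: (@le_trans _ _ ((778 * (2 * n0 + 2 * x) + 2 * (2 * nr + 2 * b))%:E + c%:E + b%:E + (k * x)%:E)%E).
  by apply: leeD; [apply: leeD; [apply: leeD|]|].
rewrite -!EFinD lee_fin.
have h1 : k * x <= 4 * x by apply: ler_wpM2r.
have h2 : m * b <= m * (2^-1 * nz) by apply: ler_wpM2l.
have h3 : 0 <= m * n0 by exact: mulr_ge0.
have h4 : 0 <= m * nr by exact: mulr_ge0.
have e4 : m * (2^-1 * nz) = 2^-1 * (m * nz) by ring.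
have -> : (1556 + 780 * m) * (n0 + nz + nr) =
  1556 * n0 + 1556 * nz + 1556 * nr + 780 * (m * n0) + 780 * (m * nz) + 780 * (m * nr) by ring.
rewrite e4 in h2.
move: (m * n0) (m * nr) (m * nz) (m * b) (k * x) h1 h2 h3 h4 hA => t1 t2 t3 t4 t5 *; lra.
Qed.

Lemma Hmu1_norm2_ge0 mu k (v : R -> R) : (0 <= Hmu1_norm2 rho mu k v)%E.
Proof.
apply: sume_ge0 => i _; apply: le_ereal_inf_tmp => _ [g _ <-]; apply: integral_ge0 => r.
by rewrite /= in_itv/= => /andP[r0 _]; rewrite lee_fin mulr_ge0 ?(ltW r0)// mulr_ge0 ?sqr_ge0 ?powR_ge0.
Qed.

(** The boundary conditions are turned into identities, the modes are summed, and every identity and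
    finiteness statement is restricted to almost every line z = const, where [slice_solution] and
    the dual Hardy inequality apply. Integration over z returns the norms on the cylinder. *)
Lemma regularity (mu : R) (psi psir psiz omega omegar omegaz : R * R -> R) : 0 < mu -> mu < 1 ->
  weak_der D 1 0 psi psir -> weak_der D 0 1 psi psiz ->
  weak_der D 1 0 omega omegar -> weak_der D 0 1 omega omegaz ->
  (forall phi, smooth phi -> supported_in D phi ->
     - (\int[leb2]_(x in D) (psi x * pder 2 0 phi x))
     - (\int[leb2]_(x in D) (x.1^-1 * psir x * phi x))
     - (\int[leb2]_(x in D) (psi x * pder 0 2 phi x))
     - (\int[leb2]_(x in D) (2 / x.1 * psir x * phi x))
     = \int[leb2]_(x in D) (omega x * phi x)) ->
  (wsqr2 a rho 1 psi < +oo)%E -> (wsqr2 a rho 1 psir < +oo)%E -> (wsqr2 a rho 1 psiz < +oo)%E ->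
  (wsqr2 a rho (2 * mu - 1) omega < +oo)%E -> (wsqr2 a rho (2 * mu + 1) omegar < +oo)%E ->
  (wsqr2 a rho (2 * mu + 1) omegaz < +oo)%E ->
  zero_on_S2 rho a omega -> zero_on_S rho a psi ->
  exists A B C : R * R -> R, exists psi0 : R -> R,
    [/\ [/\ weak_der D 0 2 psi A, weak_der D 1 2 psi B & weak_der D 0 3 psi C],
        [/\ (wsqr2 a rho (2 * mu - 1) A <= (mu ^- 2)%:E * wsqr2 a rho (2 * mu + 1) B)%E,
            (wsqr2 a rho (2 * mu + 1) B <= (2^-1)%:E * wsqr2 a rho (2 * mu + 1) omegaz)%E &
            (wsqr2 a rho (2 * mu + 1) C <= wsqr2 a rho (2 * mu + 1) omegaz)%E],
        axis_value a psi psi0 &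
        (L2Hmu1_norm2 rho a mu 3 (fun x => psi x - psi0 x.2)%R <=
          778%:E * (2%:E * wsqr2 a rho (2 * mu - 1) omega + 2%:E * wsqr2 a rho (2 * mu - 1) A)
          + 2%:E * (2%:E * wsqr2 a rho (2 * mu + 1) omegar + 2%:E * wsqr2 a rho (2 * mu + 1) B))%E].
Proof.
move=> mu0 mu1 wr wz owr owz deq fp fr fz fo fwr fwz tro trp.
have [lp lr _] := wr; have [_ lz _] := wz; have [lo lor _] := owr; have [_ loz _] := owz.
have mp := lp.1; have mr := lr.1; have mz := lz.1; have mo := lo.1; have mor := lor.1; have moz := loz.1.
have isub be F : measurable_fun D F -> (wsqr2 a rho be F < +oo)%E -> forall d : R, 0 < d < rho ->
    leb2.-integrable (cyl d rho a) (EFin \o F).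
  by move=> mF fF d /andP[d0 _]; exact: integrable_subcyl_of_wsqr2 d0 mF fF.
have lat := solution_lateral rho0 a0 wr wz (isub _ _ mp fp) (isub _ _ mr fr) trp.
have coefz := solution_coef rho0 a0 wr wz (isub _ _ mp fp) (isub _ _ mz fz) trp.
have coefoz := source_coef rho0 a0 owr owz (isub _ _ mo fo) (isub _ _ moz fwz) tro.
have [c hc] := source_constant rho0 a0 owr owz (isub _ _ mo fo) (isub _ _ mor fwr) tro.
have [A [B [C [[mA mB mC] [w02 w12 w03] [_ hB hC] AB eqn]]]] :=
  second_derivatives rho0 a0 mu0 mu1 wr wz deq mo moz fp fr fz fo fwz lat coefz coefoz.
(* By the condition on S_1 the value on the axis is minus the integral of psi_r over the whole
   radius. *)
pose psi0 z := - \int[leb]_(s in I) psir (s, z).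
have fin be F (k : R) : (wsqr2 a rho be F <= k%:E * wsqr2 a rho (2 * mu + 1) omegaz)%E -> (wsqr2 a rho be F < +oo)%E.
  move=> h; apply: (le_lt_trans h); rewrite -(@fineK _ (wsqr2 a rho (2 * mu + 1) omegaz)); last by rewrite ge0_fin_numE ?wsqr2_ge0.
  by rewrite -EFinM ltry.
have fB := fin _ _ _ hB.
have slice (F : R * R -> R) z : J z -> measurable_fun D F -> measurable_fun I (fun r => F (r, z)).
  move=> Jz mF; exact: (measurable_fun_slice2 (T1 := measurableTypeR R) (T2 := measurableTypeR R) mI mJ Jz mF).
have [SA mSA] := wsqr2E2 (2 * mu - 1) mA.
have [SB mSB] := wsqr2E2 (2 * mu + 1) mB.
have AB' := leb_ae_slices2 AB.
have fBz := ae_wsqr_slices2 mB fB.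
have hA : (wsqr2 a rho (2 * mu - 1) A <= (mu ^- 2)%:E * wsqr2 a rho (2 * mu + 1) B)%E.
  have m20 : 0 <= mu ^- 2 by rewrite invr_ge0 sqr_ge0.
  rewrite SA SB.
  have <- : (\int[leb]_(z in J) ((mu ^- 2)%:E * wsqr rho (2 * mu + 1) (fun r => B (r, z))) =
     (mu ^- 2)%:E * \int[leb]_(z in J) wsqr rho (2 * mu + 1) (fun r => B (r, z)))%E.
    by apply: ge0_integralZl => //; move=> z _; exact: wsqr_ge0.
  apply: ae_le_integral_nomeas => //.
  - exact: emeasurable_funM.
  - by move=> z _; exact: wsqr_ge0.
  - by move=> z _; apply: mule_ge0; [rewrite lee_fin|exact: wsqr_ge0].
  apply: ae_imp2 AB' fBz => z h1 h2 Jz.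
  exact: (hardy_right_primitive mu0 (slice _ _ Jz mA) (slice _ _ Jz mB) (h2 Jz) (h1 Jz)).
have comb be (F G : R * R -> R) : measurable_fun D F -> measurable_fun D G ->
    (wsqr2 a rho be (fun x => F x + G x)%R <= 2%:E * wsqr2 a rho be F + 2%:E * wsqr2 a rho be G)%E.
  move=> mF mG; apply: wsqr2_comb => //; apply: aeW => x _; move: (F x) (G x) => p q.
  by rewrite (_ : 2 * p ^+ 2 + 2 * q ^+ 2 = (p + q) ^+ 2 + (p - q) ^+ 2) ?lerDl ?sqr_ge0//; ring.
pose H x := omega x + A x; pose H' x := omegar x + B x.
have mH : measurable_fun D H by exact: measurable_funD.
have mH' : measurable_fun D H' by exact: measurable_funD.
have fA : (wsqr2 a rho (2 * mu - 1) A < +oo)%E.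
  by apply: le_lt_trans hA _; apply: mule_lty; [by rewrite invr_ge0 sqr_ge0|exact: wsqr2_ge0|exact: fB].
have fH : (wsqr2 a rho (2 * mu - 1) H < +oo)%E.
  apply: le_lt_trans (comb _ _ _ mo mA) _; apply: lte_add_pinfty.
      by apply: mule_lty; [by []|exact: wsqr2_ge0|exact: fo].
    by apply: mule_lty; [by []|exact: wsqr2_ge0|exact: fA].
have [SH mSH] := wsqr2E2 (2 * mu - 1) mH; have [SH' mSH'] := wsqr2E2 (2 * mu + 1) mH'.
have fwrz := ae_wsqr_slices2 mor fwr; have fHz := ae_wsqr_slices2 mH fH.
have key : {ae leb, forall z, J z ->
  (Hmu1_norm2 rho mu 3 (fun r => psi (r, z) - psi0 z)%R <=
     778%:E * wsqr rho (2 * mu - 1) (fun r => H (r, z)) + 2%:E * wsqr rho (2 * mu + 1) (fun r => H' (r, z)))%E /\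
  forall e : R, 0 < e -> exists2 d : R, 0 < d & {ae leb, forall r, 0 < r < d -> `|psi (r, z) - psi0 z| <= e}}.
  have l1 := ae_imp3 (fun z p q r => conj p (conj q r)) fBz fwrz fHz.
  have l2 := ae_imp3 (fun z p q r => conj p (conj q r)) (leb_ae_slices2 lat) (leb_ae_slices2 eqn) (leb_ae_slices2 hc).
  apply: ae_imp3 l1 l2 AB' => z [p1 [p2 p3]] [p4 [p5 p6]] p7 Jz.
  have res := @slice_solution R rho mu rho0 mu1 (fun r => psi (r, z)) (fun r => psir (r, z)) (fun r => omega (r, z))
    (fun r => omegar (r, z)) (fun r => A (r, z)) (fun r => B (r, z)) (c z).
  exact: (res (slice _ _ Jz mp) (slice _ _ Jz mr) (slice _ _ Jz mo) (slice _ _ Jz mor)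
    (slice _ _ Jz mA) (slice _ _ Jz mB) (slice _ _ Jz (measurable_primitive_right (lexx 0) mor).1)
    (slice _ _ Jz (measurable_primitive_right (lexx 0) mB).1) (p2 Jz) (p1 Jz) (p3 Jz) (p4 Jz) (p7 Jz) (p5 Jz) (p6 Jz)).
exists A, B, C, psi0; split => //.
- split.
    have J2 : I (rho / 2) by rewrite /= in_itv/= divr_gt0//= ltr_pdivrMr// ltr_pMr// ltr1n.
    have m1 := measurable_fun_slice1 (T1 := measurableTypeR R) (T2 := measurableTypeR R) mI mJ J2
      (measurable_primitive_right (lexx 0) mr).2.
    exact: (measurableT_comp (@oppr_measurable R _) m1).
  apply: ae_imp key => z h zJ; have Jz : J z by rewrite /= in_itv.
  by have [_] := h Jz.
- apply: (@le_trans _ _ (778%:E * wsqr2 a rho (2 * mu - 1) H + 2%:E * wsqr2 a rho (2 * mu + 1) H')%E); last first.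
    have n1 : (0 <= 778%:E :> \bar R)%E by rewrite lee_fin ler0n.
    have n2 : (0 <= 2%:E :> \bar R)%E by rewrite lee_fin ler0n.
    exact: (leeD (lee_wpmul2l n1 (comb _ _ _ mo mA)) (lee_wpmul2l n2 (comb _ _ _ mor mB))).
  rewrite SH SH' /L2Hmu1_norm2.
  have Z k be F : 0 <= k -> measurable_fun J (fun z => wsqr rho be (fun r => F (r, z))) ->
      (k%:E * \int[leb]_(z in J) wsqr rho be (fun r => F (r, z)) = \int[leb]_(z in J) (k%:E * wsqr rho be (fun r => F (r, z))))%E.
    by move=> k0 mf; apply/esym; apply: ge0_integralZl => // z _; exact: wsqr_ge0.
  have k1 : 0 <= 778 :> R by rewrite ler0n.
  have k2 : 0 <= 2 :> R by rewrite ler0n.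
  rewrite (Z _ _ _ k1 mSH) (Z _ _ _ k2 mSH').
  have mk k (f : R -> \bar R) : measurable_fun J f -> measurable_fun J (fun z => k%:E * f z)%E.
    by move=> mf; exact: emeasurable_funM.
  have k0f k be F z : 0 <= k -> (0 <= k%:E * wsqr rho be (fun r => F (r, z)))%E.
    by move=> k0; apply: mule_ge0; [rewrite lee_fin|exact: wsqr_ge0].
  have addI (f g : R -> \bar R) : measurable_fun J f -> measurable_fun J g -> (forall z, 0 <= f z)%E ->
      (forall z, 0 <= g z)%E -> (\int[leb]_(z in J) f z + \int[leb]_(z in J) g z = \int[leb]_(z in J) (f z + g z))%E.
    by move=> mf mg f0 g0; apply/esym; exact: ge0_integralD.
  rewrite (addI _ _ (mk _ _ mSH) (mk _ _ mSH') (fun z => k0f _ _ _ _ z k1) (fun z => k0f _ _ _ _ z k2)).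
  apply: ae_le_integral_nomeas.
  - exact: mJ.
  - by apply: emeasurable_funD; exact: mk.
  - by move=> z _; exact: Hmu1_norm2_ge0.
  - by move=> z _; apply: adde_ge0; [exact: k0f _ _ _ _ z k1|exact: k0f _ _ _ _ z k2].
  by apply: ae_imp key => z h Jz; have [] := h Jz.
Qed.

End weighted_regularity.

Theorem theorem2 (R : realType) (a rho mu : R)
    (ha : 0 < a) (hrho : 0 < rho) (hmu : 0 < mu < 1) :
  exists c : R, forall omega psi : R * R -> R,
    (Hmu_norm2 (cyl 0%R rho a) mu 1 omega < +oo)%E ->
    zero_on_S2 rho a omega ->
    weak_solution rho a omega psi ->
    exists2 psi0 : R -> R, axis_value a psi psi0 &
      (L2Hmu1_norm2 rho a mu 3 (fun x => psi x - psi0 x.2)%R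
       + der_norm2 (cyl 0%R rho a) mu 0 3 psi
       + der_norm2 (cyl 0%R rho a) mu 1 2 psi
       + (2 * mu * (2 - 2 * mu))%:E * der_norm2 (cyl 0%R rho a) (mu - 1)%R 0 2 psi
       <= c%:E * Hmu_norm2 (cyl 0%R rho a) mu 1 omega)%E.
Proof.
have /andP[mu0 mu1] := hmu.
have m20 : 0 <= mu ^- 2 by rewrite invr_ge0 sqr_ge0.
exists (1556 + 780 * mu ^- 2) => omega psi fo tro [fpsi trp [psir wr deq]].
have d0 nu i j u : (0 <= der_norm2 (cyl 0 rho a) nu i j u)%E by exact: der_norm2_ge0.
move: fo; rewrite Hmu_norm2_1E => fo.
have [fo0 foz for_] := add3_lty (d0 _ _ _ _) (d0 _ _ _ _) (d0 _ _ _ _) fo.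
move: fpsi; rewrite H1_norm2E => fpsi.
have [fp fpz fpr] := add3_lty (d0 _ _ _ _) (d0 _ _ _ _) (d0 _ _ _ _) fpsi.
have [psiz wz] := der_norm2_fin fpz.
have [omegaz owz] := der_norm2_fin foz; have [omegar owr] := der_norm2_fin for_.
have wp : weak_der (cyl 0 rho a) 0 0 psi psi by apply: weak_der_id => //; have [] := wr.
have wo : weak_der (cyl 0 rho a) 0 0 omega omega by apply: weak_der_id => //; have [] := owr.
have b0 : 1 = 2 * 0 + 1 :> R by ring.
have b1 : 2 * mu - 1 = 2 * (mu - 1) + 1 by ring.
rewrite (der_norm2E hrho ha b0 wp) in fp; rewrite (der_norm2E hrho ha b0 wr) in fpr.
rewrite (der_norm2E hrho ha b0 wz) in fpz.
rewrite (der_norm2E hrho ha b1 wo) in fo0 *; rewrite (der_norm2E hrho ha erefl owz) in foz *.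
rewrite (der_norm2E hrho ha erefl owr) in for_ *.
have [A [B [C [psi0 [[wA wB wC] [hA hB hC] ax est]]]]] :=
  regularity hrho ha mu0 mu1 wr wz owr owz deq fp fpr fpz fo0 for_ foz tro trp.
exists psi0 => //.
rewrite (der_norm2E hrho ha erefl wC) (der_norm2E hrho ha erefl wB) (der_norm2E hrho ha b1 wA).
have k4 : 0 <= 2 * mu * (2 - 2 * mu) <= 4.
  apply/andP; split; first by apply: mulr_ge0; [apply: mulr_ge0 => //; exact: ltW|lra].
  have p2 : 2 * mu <= 2 by lra.
  have p0 : 0 <= 2 * mu by lra.
  have q2 : 2 - 2 * mu <= 2 by lra.
  have q0 : 0 <= 2 - 2 * mu by lra.
  by have -> : 4 = 2 * 2 :> R; [ring|exact: ler_pM].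
have g0 be F : (0 <= wsqr2 a rho be F)%E by exact: wsqr2_ge0.
have gf be F : (wsqr2 a rho be F < +oo)%E -> wsqr2 a rho be F \is a fin_num by rewrite (ge0_fin_numE (g0 _ _)).
exact: (collect_constants m20 k4 (g0 _ _) (g0 _ _) (g0 _ _) (g0 _ _) (g0 _ _) (g0 _ _) (gf _ _ fo0) (gf _ _ foz) (gf _ _ for_) hA hB hC est).
Qed.
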